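(* There exists a map $f_\infty: D^2\to \mathbb{E}^3$ such that: (a) $f_\infty$ is $\beta$-Hölder for any $0<\beta<1$; (b) the restriction of $f_\infty$ to $\mathrm{Int}\,D^2$ is a $C^1$-isometric embedding of the hyperbolic plane $\mathbb{H}^2=(\mathrm{Int}\,D^2,h)$ into $\mathbb{E}^3$; (c) the limit set of this embedding is a closed curve of Hausdorff dimension $1$; and (d) $f_\infty$ is $3$-corrugated, i.e. for some $\rho_0\in\,]0,1[$ its restriction to the annulus $C=\{\rho_0\le\rho\le 1\}$ is the limit of a sequence of maps obtained by a $3$-corrugated process.
   Context: $D^2$ is the closed unit disk of $\mathbb{E}^2$ and $h=4\frac{dx^2+dy^2}{(1-x^2-y^2)^2}$ is the hyperbolic metric on $\mathrm{Int}\,D^2$. The limit set of $f:\mathbb{H}^2\to\mathbb{E}^3$ is the set of limits in $\mathbb{E}^3$ of sequences $(f(p_n))_n$ with $p_n\to\infty$ in the one-point compactification of $\mathbb{H}^2$. Polar coordinates: $C=[\rho_0,1]\times\mathbb{R}/2\pi\mathbb{Z}$ with coordinates $(\rho,\varphi)$, $\widetilde C=[\rho_0,1]\times\mathbb{R}$, oriented so that $(\partial_\rho,\partial_\varphi)$ is direct; tangent spaces are identified with $\mathbb{R}^2$ via this basis. For a map $f$, $f^*\langle\cdot,\cdot\rangle$ is the pullback of the Euclidean inner product; $\wedge$ is the cross product in $\mathbb{E}^3$. $J_0$ is the Bessel function of the first kind of order $0$, $\kappa_0$ its first positive zero, and $J_0^{-1}:\,]0,1]\to[0,\kappa_0[$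 the inverse of $J_0|_{[0,\kappa_0[}$. Corrugation process. Let $f:C\to\mathbb{E}^3$ be a smooth immersion, $\eta:C\to\mathbb{R}_{>0}$ smooth, $N\ge 1$ an integer, $\varpi:\widetilde C\to\mathbb{R}$ a non-constant affine function with $\varpi(\rho,\varphi+2\pi)-\varpi(\rho,\varphi)\in\mathbb{Z}$. Let $(v,w)$ be a direct basis of $\mathbb{R}^2$ with $d\varpi(v)>0$, $w\in\ker d\varpi$, and put $\mathbf w=\frac{df(w)}{\|df(w)\|}$, $\mathbf n=\frac{df(v)\wedge df(w)}{\|df(v)\wedge df(w)\|}$, $\mathbf t=\mathbf w\wedge\mathbf n$. Let $u$ be the vector (depending on the point) such that $df(u)$ is collinear to $\mathbf t$ and $d\varpi(u)=1$. Put $r=\sqrt{\eta+\|df(u)\|^2}$, $\alpha=J_0^{-1}(\|df(u)\|/r)$, $\gamma(\cdot,s)=r(\cos\theta\,\mathbf t+\sin\theta\,\mathbf n)$ with $\theta=\alpha\cos(2\pi s)$, $\overline\gamma=\int_0^1\gamma(\cdot,s)\,ds$. Then $CP(f,\eta,\varpi,N)$ is the map $F(p)=f(p)+\frac1N\int_0^{N\varpi(p)}(\gamma(p,s)-\overline\gamma(p))\,ds$, which descends to $C$. 3-corrugated process. The data are: an initial smooth immersion $f_0:C\to\mathbb{E}^3$; an increasing sequence $(g_k)_{k\ge0}$ of metrics on $C$ with $g_0=f_0^*\langle\cdot,\cdot\rangle$, converging to $h$ on $C\cap\mathrm{Int}\,D^2$; three affine functions $\varpi_1,\varpi_2,\varpi_3:\widetilde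 C\to\mathbb{R}$ (independent of $k$) satisfying $\varpi_i(\rho,\varphi+2\pi)-\varpi_i(\rho,\varphi)\in\mathbb{Z}$ for all $(\rho,\varphi)\in\widetilde C$ and such that, with $\ell_i=d\varpi_i$, $(\ell_i\otimes\ell_i)_{i=1,2,3}$ is a basis of the space of symmetric bilinear forms on $\mathbb{R}^2$, with dual basis $(H_i)_{i=1,2,3}$; and positive integers $(N_{k,i})_{k\ge1,\,i\in\{1,2,3\}}$. The maps are $f_{1,0}=f_0$, $f_{k,i}=CP(f_{k,i-1},\eta_{k,i},\varpi_i,N_{k,i})$ with $\eta_{k,i}=H_i(g_k-f_{k,i-1}^*\langle\cdot,\cdot\rangle)$, $f_{k+1,0}=f_{k,3}=:f_k$; it is required that every $f_{k,i-1}$ is an immersion and every $\eta_{k,i}$ is positive. One says that $(f_k)_k$ is obtained by a 3-corrugated process and that its limit (if it exists) is 3-corrugated. *)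

(* Defs.v *)
From mathcomp Require Export all_boot all_order all_algebra.
From mathcomp Require Export all_classical all_reals all_analysis.
Import Order.TTheory GRing.Theory Num.Theory.
Import numFieldNormedType.Exports.

Set Implicit Arguments.
Unset Strict Implicit.
Unset Printing Implicit Defensive.

Local Open Scope classical_set_scope.
Local Open Scope ring_scope.

Section Euclidean.
Context {R : realType}.

Definition dot n (u v : 'rV[R]_n) : R := \sum_(i < n) u 0 i * v 0 i.

(* The library norm on 'rV[R]_n is the sup norm: it has the right topology but
   is not Euclidean. *)
Definition enorm n (u : 'rV[R]_n) : R := Num.sqrt (dot u u).

(* Indices are taken in 'I_3 = Z/3Z. *)
Definition cross (u v : 'rV[R]_3) : 'rV[R]_3 :=
  \row_k (u 0 (k + 1) * v 0 (k + 2%:R) - u 0 (k + 2%:R) * v 0 (k + 1)).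

Definition normalize n (u : 'rV[R]_n) : 'rV[R]_n := (enorm u)^-1 *: u.

Definition open_disk : set 'rV[R]_2 := [set p | enorm p < 1].
Definition closed_disk : set 'rV[R]_2 := [set p | enorm p <= 1].

(* Symmetric bilinear forms on R^2 are represented by their Gram matrices in
   the standard basis. *)
Definition posdef (S : 'M[R]_2) : Prop :=
  S^T = S /\ forall v : 'rV[R]_2, v != 0 -> 0 < (v *m S *m v^T) 0 0.

Definition hyperbolic_metric (p : 'rV[R]_2) : 'M[R]_2 :=
  (4 / (1 - dot p p) ^+ 2)%:M.

Definition holder_on n m (A : set 'rV[R]_n) (f : 'rV[R]_n -> 'rV[R]_m)
    (beta : R) : Prop :=
  exists K : R, forall x y, A x -> A y ->
    enorm (f x - f y) <= K * enorm (x - y) `^ beta.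

Definition C1_isometric_embedding (f : 'rV[R]_2 -> 'rV[R]_3) : Prop :=
  [/\ (forall p, open_disk p -> differentiable f p),
      {within open_disk, continuous (jacobian f)},
      (forall p, open_disk p ->
         jacobian f p *m (jacobian f p)^T = hyperbolic_metric p),
      {in open_disk &, injective f} &
      {within f @` open_disk, continuous ('pinv_(fun=> 0) open_disk f)}].

(* The second condition says that (p n) tends to the point at infinity of the
   one-point compactification of the open disk. *)
Definition limit_set (f : 'rV[R]_2 -> 'rV[R]_3) : set 'rV[R]_3 :=
  [set y | exists p : nat -> 'rV[R]_2,
     [/\ (forall n, open_disk (p n)),
         (forall K : set 'rV[R]_2, compact K -> K `<=` open_disk ->
            \forall n \near \oo, ~ K (p n)) &
         f (p n) @[n --> \oo] --> y]].

Definition closed_curve n (A : set 'rV[R]_n) : Prop :=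
  exists c : R -> 'rV[R]_n,
    [/\ {within `[0, 1], continuous c}, c 0 = c 1 & A = c @` `[0, 1]].

Section Hausdorff.
Local Open Scope ereal_scope.

(* Adding 0 gives the empty set diameter 0 instead of -oo. *)
Definition diameter n (A : set 'rV[R]_n) : \bar R :=
  ereal_sup ([set 0] `|` [set (enorm (x - y))%:E | x in A & y in A]).

Definition hausdorff_premeasure n (s delta : R) (A : set 'rV[R]_n) : \bar R :=
  ereal_inf [set \sum_(0 <= i <oo) poweR (diameter (U i)) s |
    U in [set U : nat -> set 'rV[R]_n |
      A `<=` \bigcup_i U i /\ forall i, diameter (U i) <= delta%:E]].

Definition hausdorff_measure n (s : R) (A : set 'rV[R]_n) : \bar R :=
  ereal_sup [set hausdorff_premeasure s delta A | delta in [set d | (0 < d)%R]].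

(* Exponents are restricted to s > 0, which does not change the infimum and
   avoids the convention 0 `^ 0 = 1. *)
Definition hausdorff_dim n (A : set 'rV[R]_n) : \bar R :=
  ereal_inf [set s%:E | s in [set s : R | (0 < s)%R /\ hausdorff_measure s A = 0]].

End Hausdorff.

End Euclidean.

Section Annulus.
Context {R : realType} (rho0 : R).

(* Maps on the annulus C are 2pi-periodic maps on its universal cover, the strip
   [rho0, 1] x R; the coordinates of p are rho = p 0 0 and phi = p 0 1. Only the
   values on the strip are relevant. *)
Definition strip : set 'rV[R]_2 := [set p | rho0 <= p 0 0 <= 1].

Definition polar (p : 'rV[R]_2) : 'rV[R]_2 :=
  \row_i (if i == 0 then p 0 0 * cos (p 0 1) else p 0 0 * sin (p 0 1)).

Section Differential.
Context {V : normedModType R}.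

(* Partial derivatives relative to the strip: they are one-sided in rho on the
   boundary. *)
Definition partial_quotient (f : 'rV[R]_2 -> V) (i : 'I_2) (p : 'rV[R]_2) :=
  (h^-1 *: (f (p + h *: delta_mx 0 i) - f p))
    @[h --> within [set h : R | strip (p + h *: delta_mx 0 i)] (0 : R)^'].

Definition partial (f : 'rV[R]_2 -> V) (i : 'I_2) (p : 'rV[R]_2) : V :=
  lim (partial_quotient f i p).

Fixpoint Ck_strip (k : nat) (f : 'rV[R]_2 -> V) : Prop :=
  {within strip, continuous f} /\
  if k is k'.+1 then
    forall i, (forall p, strip p -> cvg (partial_quotient f i p)) /\
              Ck_strip k' (partial f i)
  else True.

Definition smooth_on_annulus (f : 'rV[R]_2 -> V) : Prop :=
  (forall p, strip p -> f (p + (2 * pi) *: delta_mx 0 1) = f p) /\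
  forall k, Ck_strip k f.

End Differential.

(* Row i is the i-th partial derivative, so that df_p(v) = v *m jac f p, as for
   the library's jacobian. *)
Definition jac n (f : 'rV[R]_2 -> 'rV[R]_n) (p : 'rV[R]_2) : 'M[R]_(2, n) :=
  \matrix_(i < 2) partial f i p.

Definition df n (f : 'rV[R]_2 -> 'rV[R]_n) (p v : 'rV[R]_2) : 'rV[R]_n :=
  v *m jac f p.

Definition immersion n (f : 'rV[R]_2 -> 'rV[R]_n) : Prop :=
  forall p, strip p -> forall v, df f p v = 0 -> v = 0.

Definition pullback (f : 'rV[R]_2 -> 'rV[R]_3) (p : 'rV[R]_2) : 'M[R]_2 :=
  jac f p *m (jac f p)^T.

Definition hyperbolic_polar (p : 'rV[R]_2) : 'M[R]_2 :=
  jacobian polar p *m hyperbolic_metric (polar p) *m (jacobian polar p)^T.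

Definition bessel_J0 (x : R) : R :=
  limn (series (fun k : nat => (-1) ^+ k / (k`!%:R) ^+ 2 * (x / 2) ^+ (2 * k))).

(* The set of positive zeros is closed in R, does not accumulate at 0 and is
   nonempty, so that its infimum is its least element. *)
Definition kappa0 : R := inf [set x : R | 0 < x /\ bessel_J0 x = 0].

Definition bessel_J0_inv : R -> R := 'pinv_(fun=> 0) `[0, kappa0[ bessel_J0.

Definition oriented_integral (a b : R) (g : R -> R) : R :=
  if a <= b then \int[lebesgue_measure]_(s in `[a, b]) g s
  else - \int[lebesgue_measure]_(s in `[b, a]) g s.

Definition vector_integral n (a b : R) (g : R -> 'rV[R]_n) : 'rV[R]_n :=
  \row_j oriented_integral a b (fun s => g s 0 j).

Section Corrugation.
Variables (f : 'rV[R]_2 -> 'rV[R]_3) (eta : 'rV[R]_2 -> R).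

(* v, w and u are the tangent vectors of the corrugation process. *)
Definition frame_w (w p : 'rV[R]_2) : 'rV[R]_3 := normalize (df f p w).

Definition frame_n (v w p : 'rV[R]_2) : 'rV[R]_3 :=
  normalize (cross (df f p v) (df f p w)).

Definition frame_t (v w p : 'rV[R]_2) : 'rV[R]_3 :=
  cross (frame_w w p) (frame_n v w p).

Definition radius (u p : 'rV[R]_2) : R :=
  Num.sqrt (eta p + enorm (df f p u) ^+ 2).

Definition amplitude (u p : 'rV[R]_2) : R :=
  bessel_J0_inv (enorm (df f p u) / radius u p).

Definition loop (v w u p : 'rV[R]_2) (s : R) : 'rV[R]_3 :=
  let theta := amplitude u p * cos (2 * pi * s) in
  radius u p *: (cos theta *: frame_t v w p + sin theta *: frame_n v w p).

Definition loop_average (v w u p : 'rV[R]_2) : 'rV[R]_3 :=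
  vector_integral 0 1 (loop v w u p).

(* F = CP(f, eta, varpi, N) on the strip, for the affine map
   varpi(p) = l(p) + c, whose differential is l. The map F does not depend on
   the choice of (v, w). *)
Definition is_corrugation (l : {scalar 'rV[R]_2}) (c : R) (N : nat)
    (F : 'rV[R]_2 -> 'rV[R]_3) : Prop :=
  [/\ smooth_on_annulus f /\ immersion f,
      smooth_on_annulus (eta : _ -> R^o) /\ (forall p, strip p -> 0 < eta p),
      l ((2 * pi) *: delta_mx 0 1) \is a Num.int,
      (0 < N)%N &
      exists v w : 'rV[R]_2,
        [/\ 0 < \det (col_mx v w : 'M[R]_2), 0 < l v, l w = 0 &
          forall p, strip p -> exists u : 'rV[R]_2,
            [/\ exists a : R, df f p u = a *: frame_t v w p,
                l u = 1 &
                F p = f p + N%:R^-1 *: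
                  vector_integral 0 (N%:R * (l p + c))
                    (fun s => loop v w u p s - loop_average v w u p)]]].

End Corrugation.

Definition form_square (l : {scalar 'rV[R]_2}) : 'M[R]_2 :=
  \matrix_(i, j) (l (delta_mx 0 i) * l (delta_mx 0 j)).

Definition form_squares (l : 'I_3 -> {scalar 'rV[R]_2}) : 3.-tuple 'M[R]_2 :=
  [tuple form_square (l i) | i < 3].

Definition symmetric_basis (X : 3.-tuple 'M[R]_2) : Prop :=
  free X /\ forall S : 'M[R]_2, S \in <<X>>%VS <-> S^T = S.

(* The map f_{k,i} is f k i, for k >= 1 and 0 <= i <= 3. The three steps of a
   stage are indexed by 'I_3: the step i goes from f_{k,i} to f_{k,i+1}. The
   dual basis of X is (coord X i)_i. *)
Definition three_corrugated_process (f : nat -> nat -> 'rV[R]_2 -> 'rV[R]_3)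
  : Prop :=
  exists (g : nat -> 'rV[R]_2 -> 'M[R]_2)
         (l : 'I_3 -> {scalar 'rV[R]_2}) (c : 'I_3 -> R)
         (N : nat -> 'I_3 -> nat),
  let X := form_squares l in
  [/\ [/\ (forall k, smooth_on_annulus (g k)),
          (forall k p, strip p -> posdef (g k p)),
          (forall p, strip p -> g 0%N p = pullback (f 1%N 0%N) p),
          (forall k p, strip p -> posdef (g k.+1 p - g k p)) &
          (forall p, strip p -> p 0 0 < 1 ->
             g k p @[k --> \oo] --> hyperbolic_polar p)],
      symmetric_basis X,
      (forall k, (0 < k)%N -> f k.+1 0%N = f k 3%N) &
      (forall k (i : 'I_3), (0 < k)%N ->
         is_corrugation (f k i)
           (fun p => coord X i (g k p - pullback (f k i) p))
           (l i) (c i) (N k i) (f k i.+1))].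

(* finf is a map of the Cartesian coordinates; since f_k = f_{k+1,0}, the
   sequence below is (f_k)_{k >= 0}. *)
Definition three_corrugated (finf : 'rV[R]_2 -> 'rV[R]_3) : Prop :=
  exists f : nat -> nat -> 'rV[R]_2 -> 'rV[R]_3,
    three_corrugated_process f /\
    {uniform strip, (fun k => f k.+1 0%N) @ \oo --> finf \o polar}.

End Annulus.

(* Main.v *)
(* The planar map f_0 = 2 (x, y, 0) has the metric 4 (dx^2 + dy^2), and the
   conformal metrics of factor 4 / (1 - (1 - tau^k) |p|^2)^2 increase from it to h.
   For tau close to 1, each increment is small compared with the metric, and the
   three corrugations of a stage realize it up to O(1/N), N being the frequency of
   the oscillations. The C^1 size of a stage is O(tau^(k/2)) on every compact subset
   of the open disk, so that the limit is C^1 and isometric there. On the closed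
   disk the derivatives grow like tau^-k, but the C^0 size of each step can be taken
   as small as desired: interpolation yields every Hölder exponent below 1, and
   quantitative injectivity passes to the limit. Corrugations are cut off
   near the origin, where polar coordinates degenerate. The limit set is the image of
   the unit circle: its dimension is at most 1 by the Hölder estimates, and at least
   1 because one of its projections to the axes contains an interval. *)
From HB Require Import structures.
Require Import Defs.
From mathcomp Require Import zify ring lra.
Import Order.TTheory GRing.Theory Num.Theory.
Import numFieldNormedType.Exports.
Set Implicit Arguments.
Unset Strict Implicit.
Unset Printing Implicit Defensive.
Local Open Scope classical_set_scope.
Local Open Scope ring_scope.

(** * Smooth functions of two variables *)

Section PlaneSmooth.
Context {R : realType}.
Implicit Types (f g h a b : R -> R -> R) (I J : set R) (x y : R).

(** The phases are fixed once and for all, while every [eta] must be positive. In polar coordinates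
    [(x, y)] the target metrics are multiples of [dx^2 + x^2 dy^2], whose coordinates in the basis
    of squared forms are [1 - x^2 / 16], [2 pi^2 x^2], [2 pi^2 x^2]: all positive near the closed
    disk, the origin excepted. A deficit close to such a multiple is therefore positive in the three
    directions, and the O(1/N) errors of a stage are absorbed by the next increment. Small
    increments serve two more purposes. The amplitudes stay below 1, where J_0 is inverted from its
    Taylor polynomials. A step moves the derivatives by much less than the map stretches, because
    the squared excursion of the loop is at most [9 eta]; hence the new map is still injective. The
    price of the cutoff is that a partial correction may triple a deficit. It is paid by the bound
    [conformal k x - 4 <= 16 x^2], uniform in [k], which also makes the limit differentiable at the
    origin. Each step is chosen after the margin of injectivity of the current map, so that this
    margin survives in the limit. *)

Definition jcont f x y :=
  {for (x, y), continuous (fun z : R * R => f z.1 z.2)}.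

(** Only the abscissa is restricted: the second variable is an angle and ranges over the whole line.
    The partial derivatives are existential, so that closure properties are proved by exhibiting
    formulas; joint continuity is what the chain rule consumes. *)
Fixpoint sm I n f : Prop :=
  (forall x y, I x -> jcont f x y) /\
  if n is m.+1 then exists fx fy : R -> R -> R,
    [/\ forall x y, I x -> is_derive x (1 : R) (f ^~ y) (fx x y),
        forall x y, I x -> is_derive y (1 : R) (f x) (fy x y),
        sm I m fx & sm I m fy]
  else True.

Definition smooth I f := forall n, sm I n f.

Lemma sm_jcont I n f : sm I n f -> forall x y, I x -> jcont f x y.
Proof. by case: n => [|n] []. Qed.

Lemma sm_pred I n f : sm I n.+1 f -> sm I n f.
Proof.
elim: n f => [|n IH] f [fc [fx [fy [dx dy sx sy]]]]; first by split.
by split=> //; exists fx, fy; split=> //; apply: IH.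
Qed.

Lemma sm_sub I J n f : J `<=` I -> sm I n f -> sm J n f.
Proof.
move=> JI; elim: n f => [|n IH] f [fc fd]; split; do ?by move=> x y /JI; apply: fc.
  by [].
have [fx [fy [dx dy sx sy]]] := fd.
exists fx, fy; split; do ?exact: IH; move=> x y /JI Ix; [exact: dx|exact: dy].
Qed.

Lemma near_open_jcont I x y : open I -> I x -> \forall z \near ((x, y) : R * R), I z.1.
Proof.
move=> oI Ix; have : \forall u \near x, I u by exact: open_nbhs_nbhs.
move=> nI; apply: (@cvg_fst _ _ (nbhs x) (nbhs y)); first exact: nI.
Qed.

Lemma jcont_ext I f g : open I -> (forall x y, I x -> f x y = g x y) ->
  forall x y, I x -> jcont f x y -> jcont g x y.
Proof.
move=> oI fg x y Ix; rewrite /jcont /prop_for /continuous_at /= => fc; rewrite -(fg x y Ix).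
apply: cvg_trans fc; apply: near_eq_cvg; near=> z; apply: fg.
by near: z; apply: near_open_jcont.
Unshelve. all: by end_near. Qed.

Lemma is_derive_ext_near (u v : R -> R) x d :
  (\forall z \near x, u z = v z) -> is_derive x (1 : R) u d -> is_derive x (1 : R) v d.
Proof. by move=> uv; apply: near_eq_is_derive => //; rewrite oner_neq0. Qed.

Lemma is_derive_congr (u v : R -> R) x d d' : (forall z, u z = v z) -> d = d' ->
  is_derive x (1 : R) u d -> is_derive x (1 : R) v d'.
Proof. by move=> /funext -> ->. Qed.

Lemma sm_ext I n f g : open I -> (forall x y, I x -> f x y = g x y) ->
  sm I n f -> sm I n g.
Proof.
move=> oI fg; elim: n => [|n IH] [fc fd]; split => //;
  do ?by move=> x y Ix; apply: (jcont_ext oI fg) => //; apply: fc.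
have [fx [fy [dx dy sx sy]]] := fd.
exists fx, fy; split=> // x y Ix.
  apply: is_derive_ext_near (dx x y Ix).
  by near=> z; apply: fg; near: z; exact: open_nbhs_nbhs.
by apply: is_derive_ext_near (dy x y Ix); near=> z; apply: fg.
Unshelve. all: by end_near. Qed.

Lemma jcont_cst (c : R) x y : jcont (fun _ _ => c) x y.
Proof. exact: cvg_cst. Qed.

Lemma jcont_fst x y : jcont (fun x _ => x) x y.
Proof. exact: cvg_fst. Qed.

Lemma jcont_snd x y : jcont (fun _ y => y) x y.
Proof. exact: cvg_snd. Qed.

Lemma jcontD f g x y : jcont f x y -> jcont g x y ->
  jcont (fun x y => f x y + g x y) x y.
Proof. by move=> fc gc; apply: cvgD. Qed.

Lemma jcontM f g x y : jcont f x y -> jcont g x y ->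
  jcont (fun x y => f x y * g x y) x y.
Proof. by move=> fc gc; apply: cvgM. Qed.

Lemma jcont_comp h a b x y : jcont h (a x y) (b x y) -> jcont a x y ->
  jcont b x y -> jcont (fun x y => h (a x y) (b x y)) x y.
Proof.
move=> hc ac bc.
apply: (cvg_comp (fun z : R * R => (a z.1 z.2, b z.1 z.2)) (fun z => h z.1 z.2) _ hc).
exact: (cvg_pair ac bc).
Qed.

Lemma jcont_line2 f x y : jcont f x y -> {for y, continuous (f x)}.
Proof.
move=> fc; apply: (cvg_comp (fun z => (x, z)) (fun z : R * R => f z.1 z.2) _ fc).
exact: (@cvg_pair _ _ _ (nbhs y) (nbhs x) (nbhs y) _ _ _ (fun=> x) id (cvg_cst _) cvg_id).
Qed.

Lemma sm_cst I n (c : R) : sm I n (fun _ _ => c).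
Proof.
elim: n c => [|n IH] c; split=> //; do ?by move=> *; apply: jcont_cst.
exists (fun _ _ => 0), (fun _ _ => 0); split=> // x y _; exact: is_derive_cst.
Qed.

Lemma sm_fst I n : sm I n (fun x _ => x).
Proof.
case: n => [|n]; split=> //; do ?by move=> *; apply: jcont_fst.
exists (fun _ _ => 1), (fun _ _ => 0); split; do ?exact: sm_cst.
  by move=> x y _; exact: is_derive_id.
by move=> x y _; exact: is_derive_cst.
Qed.

Lemma sm_snd I n : sm I n (fun _ y => y).
Proof.
case: n => [|n]; split=> //; do ?by move=> *; apply: jcont_snd.
exists (fun _ _ => 0), (fun _ _ => 1); split; do ?exact: sm_cst.
  by move=> x y _; exact: is_derive_cst.
by move=> x y _; exact: is_derive_id.
Qed.

Lemma smD I n f g : sm I n f -> sm I n g -> sm I n (fun x y => f x y + g x y).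
Proof.
elim: n f g => [|n IH] f g [fc fd] [gc gd]; split=> //;
  do ?by move=> x y Ix; apply: jcontD; [apply: fc|apply: gc].
have [fx [fy [dfx dfy sfx sfy]]] := fd; have [gx [gy [dgx dgy sgx sgy]]] := gd.
exists (fun x y => fx x y + gx x y), (fun x y => fy x y + gy x y).
split; do ?exact: IH; move=> x y Ix.
  exact: (is_deriveD (dfx x y Ix) (dgx x y Ix)).
exact: (is_deriveD (dfy x y Ix) (dgy x y Ix)).
Qed.

Lemma is_derive_mul (u v : R -> R) x du dv :
  is_derive x (1 : R) u du -> is_derive x (1 : R) v dv ->
  is_derive x (1 : R) (fun z => u z * v z) (du * v x + u x * dv).
Proof.
move=> du' dv'; have := is_deriveM du' dv'.
by rewrite addrC (_ : v x *: du = du * v x)//; rewrite mulrC.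
Qed.

Lemma smM I n f g : sm I n f -> sm I n g -> sm I n (fun x y => f x y * g x y).
Proof.
elim: n f g => [|n IH] f g sf sigma.
  by split=> // x y Ix; apply: jcontM; [exact: (sf.1)|exact: (sigma.1)].
split; first by move=> x y Ix; apply: jcontM; [exact: (sf.1)|exact: (sigma.1)].
have [fx [fy [dfx dfy sfx sfy]]] := sf.2; have [gx [gy [dgx dgy sgx sgy]]] := sigma.2.
exists (fun x y => fx x y * g x y + f x y * gx x y),
       (fun x y => fy x y * g x y + f x y * gy x y).
split; do ?[by move=> x y Ix; apply: is_derive_mul; auto];
  by apply: smD; apply: IH => //; apply: sm_pred.
Qed.

(** Stated between [p] and [q] in either order, so that increments of unknown sign need no case
    analysis later. *)
Lemma mean_value (u du : R -> R) (p q : R) :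
  (forall z, Num.min p q <= z <= Num.max p q -> is_derive z (1 : R) u (du z)) ->
  exists2 c, Num.min p q <= c <= Num.max p q & u q - u p = du c * (q - p).
Proof.
have main (p' q' : R) : p' <= q' ->
    (forall z, p' <= z <= q' -> is_derive z (1 : R) u (du z)) ->
    exists2 c, p' <= c <= q' & u q' - u p' = du c * (q' - p').
  move=> pq du'; have [||c cs E] := @MVT_segment R u du p' q' pq.
  - by move=> z zs; apply: du'; move: zs; rewrite in_itv/=; lra.
  - apply: derivable_within_continuous => z; rewrite in_itv/= => zs.
    by have := du' z zs => ?; exact: ex_derive.
  - by exists c => //; rewrite in_itv/= in cs.
case: (leP p q) => pq du'; first exact: main.
have [c cs E] := main q p (ltW pq) du'.
by exists c => //; lra.
Qed.

(* Moving first along the abscissa and then along the ordinate reduces the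
   chain rule to the mean value theorem in one variable. *)
Lemma is_derive_comp2 h hx (hy : R) (a b : R -> R) t (a' b' : R) (J : set R) : open J ->
  J (a t) ->
  (forall x y, J x -> is_derive x (1 : R) (h ^~ y) (hx x y)) ->
  jcont hx (a t) (b t) -> is_derive (b t) (1 : R) (h (a t)) hy ->
  is_derive t (1 : R) a a' -> is_derive t (1 : R) b b' ->
  is_derive t (1 : R) (fun s => h (a s) (b s)) (hx (a t) (b t) * a' + hy * b').
Proof.
move=> oJ Jat dh chx dhy da db.
(* Difference quotient of [h] in its first argument, extended by continuity where [a s = a t]. It
   makes the increment of [h (a s) (b s)] split exactly, as in [hq]. *)
pose q s := if a s == a t then hx (a t) (b t)
            else (h (a s) (b s) - h (a t) (b s)) / (a s - a t).
have hq s : h (a s) (b s) = h (a t) (b s) + q s * (a s - a t).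
  rewrite /q; case: eqP => [->|/eqP ne]; first by rewrite subrr mulr0 addr0.
  by rewrite divfK ?subr_eq0//; lra.
have ca : {for t, continuous a} by apply: differentiable_continuous; apply/derivable1_diffP; apply: ex_derive.
have cb : {for t, continuous b} by apply: differentiable_continuous; apply/derivable1_diffP; apply: ex_derive.
have qc : q s @[s --> t] --> hx (a t) (b t).
  apply/cvgrPdist_le => e e0.
  move/cvgrPdist_le : chx => /(_ _ e0) [[A B] /= [nA nB] AB].
  have nA' : \forall z \near a t, A z /\ J z.
    by apply: filterI => //; exact: open_nbhs_nbhs.
  move/nbhs_ballP : nA' => [r r0 rA].
  have : \forall s \near t, ball (a t) r (a s).
    by apply: ca; apply/nbhs_ballP; exists r.
  move=> nas; have nbs : \forall s \near t, B (b s) by exact: cb.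
  near=> s; rewrite /q; case: eqP => [_|/eqP ne]; first by rewrite subrr normr0 ltW.
  have bs : B (b s) by near: s.
  have as_ : ball (a t) r (a s) by near: s.
  have seg z : Num.min (a s) (a t) <= z <= Num.max (a s) (a t) -> A z /\ J z.
    move=> zs; apply: rA; move: as_ zs; rewrite /ball/= !ltr_distlC.
    by rewrite ge_min le_max; case: (leP (a s) (a t)); lra.
  have [c cs E] : exists2 c, Num.min (a t) (a s) <= c <= Num.max (a t) (a s) &
      h (a s) (b s) - h (a t) (b s) = hx c (b s) * (a s - a t).
    apply: (@mean_value (h ^~ (b s)) (hx ^~ (b s))) => z zs; apply: dh.
    by apply: (seg z _).2; rewrite minC maxC.
  have [|Ac _] := seg c; first by rewrite minC maxC.
  rewrite E mulfK ?subr_eq0//; exact: (AB (c, b s) (conj Ac bs)).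
have qt : q t = hx (a t) (b t) by rewrite /q eqxx.
have d1 : is_derive t (1 : R) (fun s => q s * (a s - a t)) (hx (a t) (b t) * a').
  have [da0 da1] := da.
  have lim : (fun e : R => e^-1 *: ((fun s => q s * (a s - a t)) (e *: 1 + t) -
      (fun s => q s * (a s - a t)) t)) @ 0^' --> hx (a t) (b t) * a'.
    have -> : (fun e : R => e^-1 *: ((fun s => q s * (a s - a t)) (e *: 1 + t) -
      (fun s => q s * (a s - a t)) t)) =
      (fun e : R => q (e *: 1 + t) * (e^-1 *: (a (e *: 1 + t) - a t))).
      apply/funext => e /=; rewrite subrr mulr0 subr0 /GRing.scale/=.
      by rewrite mulrCA.
    apply: cvgM; last by rewrite -da1; exact: da0.
    apply: (cvg_comp (fun e : R => e *: 1 + t) q) qc.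
    have : (fun e : R => e *: (1 : R) + t) e @[e --> 0^'] --> (0 : R) *: (1 : R) + t.
      apply: cvgD; last exact: cvg_cst.
      apply: cvgZr_tmp; apply: cvg_within_filter; exact: cvg_id.
    by rewrite scale0r add0r.
  by split; [apply/cvg_ex; eexists; exact: lim|exact: cvg_lim lim].
have d2 : is_derive t (1 : R) (fun s => h (a t) (b s)) (hy * b').
  have := @is_derive1_comp R (h (a t)) b t hy b' dhy db.
  by [].
rewrite (_ : (fun s => _) = (fun s => h (a t) (b s)) + (fun s => q s * (a s - a t))).
  by rewrite addrC; exact: is_deriveD.
by apply/funext => s; rewrite hq.
Unshelve. all: by end_near. Qed.


Lemma sm_comp I J n h a b : open I -> open J -> (forall x y, I x -> J (a x y)) ->
  sm J n h -> sm I n a -> sm I n b -> sm I n (fun x y => h (a x y) (b x y)).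
Proof.
move=> oI oJ aJ; elim: n h a b aJ => [|n IH] h a b aJ sh sa sb;
  (split; first by move=> x y Ix; apply: jcont_comp;
    [exact: (sm_jcont sh (aJ _ _ Ix))|exact: (sm_jcont sa)|exact: (sm_jcont sb)]) => //.
have [hx [hy [dhx dhy shx shy]]] := sh.2.
have [ax [ay [dax day sax say]]] := sa.2.
have [bx [by_ [dbx dby sbx sby]]] := sb.2.
exists (fun x y => hx (a x y) (b x y) * ax x y + hy (a x y) (b x y) * bx x y),
       (fun x y => hx (a x y) (b x y) * ay x y + hy (a x y) (b x y) * by_ x y).
split.
- move=> x y Ix; apply: (@is_derive_comp2 h hx _ (a ^~ y) (b ^~ y) x _ _ J) => //.
  + exact: aJ.
  + by apply: (sm_jcont shx); exact: aJ.
  + by apply: dhy; exact: aJ.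
  + exact: dax.
  + exact: dbx.
- move=> x y Ix; apply: (@is_derive_comp2 h hx _ (a x) (b x) y _ _ J) => //.
  + exact: aJ.
  + by apply: (sm_jcont shx); exact: aJ.
  + by apply: dhy; exact: aJ.
  + exact: day.
  + exact: dby.
- apply: smD; (apply: smM; last by []); apply: IH => //; exact: sm_pred.
- apply: smD; (apply: smM; last by []); apply: IH => //; exact: sm_pred.
Qed.

Lemma smooth_cst I (c : R) : smooth I (fun _ _ => c).
Proof. by move=> n; exact: sm_cst. Qed.

Lemma smooth_fst I : smooth I (fun x _ => x).
Proof. by move=> n; exact: sm_fst. Qed.

Lemma smooth_snd I : smooth I (fun _ y => y).
Proof. by move=> n; exact: sm_snd. Qed.

Lemma smoothD I f g : smooth I f -> smooth I g -> smooth I (fun x y => f x y + g x y).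
Proof. by move=> sf sigma n; exact: smD. Qed.

Lemma smoothM I f g : smooth I f -> smooth I g -> smooth I (fun x y => f x y * g x y).
Proof. by move=> sf sigma n; exact: smM. Qed.

Lemma smoothN I f : smooth I f -> smooth I (fun x y => - f x y).
Proof.
move=> sf; have := smoothM (smooth_cst I (-1)) sf.
by under [X in smooth _ X]eq_fun => x do under eq_fun => y do rewrite mulN1r.
Qed.

Lemma smoothB I f g : smooth I f -> smooth I g -> smooth I (fun x y => f x y - g x y).
Proof. by move=> sf sigma; apply: smoothD => //; exact: smoothN. Qed.

Lemma smoothX I f k : smooth I f -> smooth I (fun x y => f x y ^+ k).
Proof.
move=> sf; elim: k => [|k IH].
  by under [X in smooth _ X]eq_fun => x do under eq_fun => y do rewrite expr0; exact: smooth_cst.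
under [X in smooth _ X]eq_fun => x do under eq_fun => y do rewrite exprS.
exact: smoothM.
Qed.

Lemma smooth_sub I J f : J `<=` I -> smooth I f -> smooth J f.
Proof. by move=> JI sf n; exact: sm_sub (sf n). Qed.

Lemma smooth_comp I J h a b : open I -> open J -> (forall x y, I x -> J (a x y)) ->
  smooth J h -> smooth I a -> smooth I b -> smooth I (fun x y => h (a x y) (b x y)).
Proof. by move=> oI oJ aJ sh sa sb n; exact: (@sm_comp I J). Qed.

(** Bootstrap: if the right-hand side of [u' = G] is as smooth as [u], each order of smoothness of
    [u] gives the next one. Inverses, square roots and the inverse of the Bessel function are
    obtained this way. *)
Lemma smooth_ode J (u G : R -> R) :
  (forall x, J x -> is_derive x (1 : R) u (G x)) ->
  (forall n, sm J n (fun x _ => u x) -> sm J n (fun x _ => G x)) ->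
  smooth J (fun x _ => u x).
Proof.
move=> du sG.
have cu x y : J x -> jcont (fun x _ => u x) x y.
  move=> Jx; apply: (@cvg_comp _ _ _ (fun z : R * R => z.1) u (nbhs (x, y)) (nbhs x)).
    exact: cvg_fst.
  have : {for x, continuous u}; last by [].
  apply: differentiable_continuous; apply/derivable1_diffP.
  by have := du _ Jx => ?; exact: ex_derive.
elim=> [|n IH]; split=> //.
exists (fun x _ => G x), (fun _ _ => 0); split; do ?exact: sm_cst; do ?exact: sG.
  by move=> x y; exact: du.
by move=> x y _; exact: is_derive_cst.
Qed.

Lemma smooth_inv1 : smooth [set x : R | 0 < x] (fun x _ => x^-1).
Proof.
apply: (@smooth_ode _ _ (fun x => - (x^-1 * x^-1))) => [x /= x0|n sn].
  have := is_deriveV (lt0r_neq0 x0 : id x != 0) (is_derive_id x 1).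
  by rewrite /GRing.scale/= mulr1 -expr2 exprVn.
have -> : (fun x (_ : R) => - (x^-1 * x^-1)) = (fun x (_ : R) => (-1) * (x^-1 * x^-1)).
  by apply/funext => x; apply/funext => y; rewrite mulN1r.
apply: smM; [exact: sm_cst|exact: smM].
Qed.

Lemma open_pos : open [set x : R | 0 < x].
Proof. exact: open_gt. Qed.

Lemma smoothV I f : open I -> (forall x y, I x -> 0 < f x y) -> smooth I f ->
  smooth I (fun x y => (f x y)^-1).
Proof.
move=> oI f0 sf; exact: (smooth_comp oI open_pos f0 smooth_inv1 sf (smooth_cst I 0)).
Qed.

Lemma smooth_sqrt I f : open I -> (forall x y, I x -> 0 < f x y) -> smooth I f ->
  smooth I (fun x y => Num.sqrt (f x y)).
Proof.
move=> oI f0 sf.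
apply: (@smooth_comp I _ (fun x _ => Num.sqrt x) f _ oI open_pos f0 _ sf (smooth_cst I 0)).
have sG := @smooth_ode [set x : R | 0 < x] Num.sqrt (fun x => (2 * Num.sqrt x)^-1).
apply: sG => n sn.
apply: (@sm_comp _ [set x | 0 < x] n (fun x _ => x^-1) (fun x _ => 2 * Num.sqrt x) (fun _ _ => 0)).
- exact: open_pos.
- exact: open_pos.
- by move=> x y /= x0; rewrite mulr_gt0// sqrtr_gt0.
- exact: smooth_inv1.
- apply: smM => //; exact: sm_cst.
- exact: sm_cst.
Qed.

Lemma smooth_cos I f : open I -> smooth I f -> smooth I (fun x y => cos (f x y)).
Proof.
move=> oI sf.
have sc : forall n, sm setT n (fun x _ => cos x) /\ sm setT n (fun x _ => sin x).
  elim=> [|n [IHc IHs]]; split; split=> //; try (move=> x y _;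
    apply: (@cvg_comp _ _ _ (fun z : R * R => z.1) _ (nbhs (x, y)) (nbhs x));
    [exact: cvg_fst|exact: continuous_cos || exact: continuous_sin]).
    exists (fun x _ => (-1) * sin x), (fun _ _ => 0); split; do ?exact: sm_cst.
    - by move=> x y _; apply: is_derive_eq (is_derive_cos x) _; rewrite mulN1r.
    - by move=> x y _; exact: is_derive_cst.
    - by apply: smM => //; exact: sm_cst.
  exists (fun x _ => cos x), (fun _ _ => 0); split; do ?exact: sm_cst; do ?by [].
    by move=> x y _; exact: is_derive_sin.
  by move=> x y _; exact: is_derive_cst.
apply: (@smooth_comp I setT (fun x _ => cos x) f _ oI openT _ _ sf (smooth_cst I 0)) => //.
by move=> n; have [] := sc n.
Qed.

Lemma smooth_sin I f : open I -> smooth I f -> smooth I (fun x y => sin (f x y)).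
Proof.
move=> oI sf; under [X in smooth _ X]eq_fun => x do under eq_fun => y do rewrite -cosBpihalf.
by apply: smooth_cos => //; apply: smoothB => //; exact: smooth_cst.
Qed.

(** The library derivative, a total function, replaces the existential witnesses of [sm] once these
    are known to exist. *)
Definition dx f x y : R := 'D_1 (f ^~ y) x.
Definition dy f x y : R := 'D_1 (f x) y.

Lemma smooth_dxP I f x y : smooth I f -> I x -> is_derive x (1 : R) (f ^~ y) (dx f x y).
Proof.
by move=> sf Ix; have [_ [fx [fy [+ _ _ _]]]] := sf 1%N => /(_ x y Ix) d; apply: DeriveDef.
Qed.

Lemma smooth_dyP I f x y : smooth I f -> I x -> is_derive y (1 : R) (f x) (dy f x y).
Proof.
by move=> sf Ix; have [_ [fx [fy [_ + _ _]]]] := sf 1%N => /(_ x y Ix) d; apply: DeriveDef.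
Qed.

Lemma smooth_dx I f : open I -> smooth I f -> smooth I (dx f).
Proof.
move=> oI sf n; have [_ [fx [fy [d _ s _]]]] := sf n.+1.
by apply: sm_ext s => // x y Ix; have := d x y Ix => ?; rewrite /dx derive_val.
Qed.

Lemma smooth_dy I f : open I -> smooth I f -> smooth I (dy f).
Proof.
move=> oI sf n; have [_ [fx [fy [_ d _ s]]]] := sf n.+1.
by apply: sm_ext s => // x y Ix; have := d x y Ix => ?; rewrite /dy derive_val.
Qed.

Lemma smooth_jcont I f x y : smooth I f -> I x -> jcont f x y.
Proof. by move=> sf Ix; exact: (sm_jcont (sf 0%N)). Qed.

End PlaneSmooth.

(** * Oscillatory integrals and the Bessel function *)

Section OscillatoryIntegrals.
Context {R : realType}.
Local Notation leb := (@lebesgue_measure R).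

Lemma is_derive_continuous (G : R -> R) x d : is_derive x (1 : R) G d -> {for x, continuous G}.
Proof.
by move=> dG; apply: differentiable_continuous; apply/derivable1_diffP; exact: ex_derive.
Qed.

Lemma oriented_integral_FTC (g G : R -> R) a b : continuous g ->
  (forall x, is_derive x (1 : R) G (g x)) -> oriented_integral a b g = G b - G a.
Proof.
move=> cg dG.
have main p q : p < q -> \int[leb]_(s in `[p, q]) g s = G q - G p.
  move=> pq; rewrite /Rintegral (@continuous_FTC2 _ g G p q)//.
  - exact: continuous_subspaceT.
  - split.
    + by move=> z _; have := dG z => ?; exact: ex_derive.
    + by apply: cvg_at_right_filter; exact: is_derive_continuous (dG p).
    + by apply: cvg_at_left_filter; exact: is_derive_continuous (dG q).
  - by move=> z _; rewrite derive1E; have := dG z => ?; rewrite derive_val.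
rewrite /oriented_integral; have [ab|ba|->] := ltgtP a b.
- exact: main.
- by rewrite main// opprB.
- by rewrite set_itv1 Rintegral_set1 subrr.
Qed.

Lemma integrable_continuous (g : R -> R) p q : continuous g ->
  leb.-integrable `[p, q] (EFin \o g).
Proof.
move=> cg; apply: continuous_compact_integrable; first exact: segment_compact.
exact: continuous_subspaceT.
Qed.

Lemma is_derive_oriented_integral (g : R -> R) x : continuous g ->
  is_derive x (1 : R) (fun x => oriented_integral 0 x g) (g x).
Proof.
(* The base point is moved from 0 to [- M], to the left of [x], so that the fundamental theorem
   applies whatever the sign of [x]. *)
move=> cg; pose M : R := `|x| + 1.
pose H z := \int[leb]_(s in `[- M, z]) g s.
have M0 : 0 < M by rewrite /M ltr_pwDr.
have dH : is_derive x (1 : R) H (g x).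
  have xM : x < M by rewrite /M; have := ler_norm x; lra.
  have Mx : - M < x by rewrite /M; have := ler_norm (- x); rewrite normrN; lra.
  have [d E] := @continuous_FTC1_closed R g (- M) x M xM (integrable_continuous (- M) M cg) Mx (cg x).
  by rewrite -E derive1E; exact: derivableP.
have split_ p q : - M < p -> p <= q -> \int[leb]_(s in `[p, q]) g s = H q - H p.
  move=> Mp pq; rewrite /H Rintegral_itvB; last 3 first.
  - exact: integrable_continuous.
  - by rewrite bnd_simp ltW.
  - by rewrite bnd_simp.
  rewrite Rintegral_itv_obnd_cbnd//; apply: integrableS (integrable_continuous p q cg) => //.
  by move=> z /=; rewrite !in_itv/= => /andP[/ltW -> ->].
apply: (@is_derive_ext_near _ (fun z => H z - H 0)); last first.
  rewrite -[X in is_derive _ _ _ X]subr0; apply: is_deriveB.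
have nM : \forall z \near x, - M < z.
  by apply: lt_nbhsr; rewrite /M; have := ler_norm (- x); rewrite normrN; lra.
near=> z; rewrite /oriented_integral; have Mz : - M < z by near: z.
case: (leP 0 z) => z0; first by rewrite split_// oppr_lt0.
by rewrite split_// ?ltW// opprB.
Unshelve. all: by end_near. Qed.

(* The power [m] and the shift [beta] make the family stable under
   differentiation in the amplitude [a]. *)
Definition osc m (beta a s : R) : R := cos (2 * pi * s) ^+ m * cos (a * cos (2 * pi * s) + beta).

Definition osc_integral m (beta a x : R) : R := oriented_integral 0 x (osc m beta a).

Lemma smooth_osc (I : set R) m beta : open I -> smooth I (osc m beta).
Proof.
move=> oI; have sc : smooth I (fun _ y : R => cos (2 * pi * y)).
  by apply: smooth_cos => //; apply: smoothM; [exact: smooth_cst|exact: smooth_snd].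
apply: smoothM; first exact: smoothX.
apply: smooth_cos => //; apply: smoothD; last exact: smooth_cst.
by apply: smoothM => //; exact: smooth_fst.
Qed.

Lemma continuous_osc m beta a : continuous (osc m beta a).
Proof.
move=> s; have := @smooth_jcont R setT _ a s (smooth_osc m beta openT) I.
exact: jcont_line2.
Qed.

Lemma osc_le1 m beta a s : `|osc m beta a s| <= 1.
Proof.
rewrite /osc normrM normrX mulr_ile1//; last exact: cos_max.
by rewrite exprn_ile1// cos_max.
Qed.

Lemma osc_integral0 m beta a : osc_integral m beta a 0 = 0.
Proof. by rewrite /osc_integral /oriented_integral lexx set_itv1 Rintegral_set1. Qed.

Lemma osc_integral_dx m beta a x : is_derive x (1 : R) (osc_integral m beta a) (osc m beta a x).
Proof. apply: is_derive_oriented_integral; exact: continuous_osc. Qed.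

Lemma lipschitz_of_derive (u du : R -> R) (c p q : R) :
  (forall z, is_derive z (1 : R) u (du z)) -> (forall z, `|du z| <= c) ->
  `|u q - u p| <= c * `|q - p|.
Proof.
move=> d le; have [z _ ->] := @mean_value _ u du p q (fun z _ => d z).
by rewrite normrM ler_wpM2r.
Qed.

Lemma osc_integral_le m beta a x : `|osc_integral m beta a x| <= `|x|.
Proof.
have := lipschitz_of_derive 0 x (osc_integral_dx m beta a) (osc_le1 m beta a).
by rewrite osc_integral0 !subr0 mul1r.
Qed.

(** The derivative of the cosine is written as the phase shift [cos (t + pi / 2)], the form in which
    the family [osc] is closed under differentiation. *)
Lemma cos_taylor2 (t d : R) : `|cos (t + d) - cos t - d * cos (t + pi / 2)| <= d ^+ 2.
Proof.
have [c cs E] := @mean_value _ cos (fun z => - sin z) t (t + d) (fun z _ => is_derive_cos z).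
rewrite E cosDpihalf.
have -> : - sin c * (t + d - t) - d * - sin t = - (d * (sin c - sin t)) by ring.
rewrite normrN normrM -(real_normK (num_real d)) expr2.
have : `|sin c - sin t| <= 1 * `|c - t|.
  by apply: (@lipschitz_of_derive sin cos) => z; exact: cos_max.
rewrite mul1r => h; have h2 : `|c - t| <= `|d|.
  move: cs; rewrite ge_min le_max; case: (leP 0 d) => d0.
    by rewrite [`|d|]ger0_norm// ler_norml; lra.
  by rewrite [`|d|]ltr0_norm// ler_norml; lra.
by rewrite ler_wpM2l// (le_trans h).
Qed.

(** Differentiation under the integral sign: the second-order error in [a] is, as a function of the
    upper endpoint, a primitive of a function bounded by [h ^+ 2], by [cos_taylor2]. *)
Lemma osc_integral_da m beta a x :
  is_derive a (1 : R) (fun a => osc_integral m beta a x) (osc_integral m.+1 (beta + pi / 2) a x).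
Proof.
have est h : `|osc_integral m beta (a + h) x - osc_integral m beta a x - h * osc_integral m.+1 (beta + pi / 2) a x| <=
    h ^+ 2 * `|x|.
  pose u y := osc_integral m beta (a + h) y - osc_integral m beta a y - h * osc_integral m.+1 (beta + pi / 2) a y.
  pose du y := osc m beta (a + h) y - osc m beta a y - h * osc m.+1 (beta + pi / 2) a y.
  have du_ z : is_derive z (1 : R) u (du z).
    apply: is_deriveB; first by apply: is_deriveB; exact: osc_integral_dx.
    by have := osc_integral_dx m.+1 (beta + pi / 2) a z => ?; exact: is_deriveZ.
  have := @lipschitz_of_derive u du (h ^+ 2) 0 x du_ _.
  rewrite /u !osc_integral0 !(subr0, mulr0); apply => z.
  rewrite /du /osc; set c := cos (2 * pi * z).
  have -> : c ^+ m * cos ((a + h) * c + beta) - c ^+ m * cos (a * c + beta) -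
    h * (c ^+ m.+1 * cos (a * c + (beta + pi / 2))) =
    c ^+ m * (cos ((a * c + beta) + h * c) - cos (a * c + beta) -
      (h * c) * cos ((a * c + beta) + pi / 2)).
    by rewrite exprS addrA (_ : (a + h) * c + beta = a * c + beta + h * c); ring.
  have c1 : `|c| <= 1 by exact: cos_max.
  rewrite normrM -[leRHS]mul1r ler_pM// ?normrX ?exprn_ile1//.
  apply: (le_trans (cos_taylor2 _ _)); rewrite exprMn ler_piMr ?sqr_ge0//.
  by rewrite -real_normK ?num_real// exprn_ile1.
have lim : (fun h : R => h^-1 *: (osc_integral m beta (h *: (1 : R) + a) x - osc_integral m beta a x)) @ 0^' -->
    osc_integral m.+1 (beta + pi / 2) a x.
  apply/cvgrPdist_le => e e0; near=> h.
  have h0 : h != 0 by near: h; exact: nbhs_dnbhs_neq.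
  have -> : osc_integral m.+1 (beta + pi / 2) a x - h^-1 *: (osc_integral m beta (h *: (1 : R) + a) x - osc_integral m beta a x) =
     - (h^-1 * (osc_integral m beta (a + h) x - osc_integral m beta a x - h * osc_integral m.+1 (beta + pi / 2) a x)).
    by rewrite /GRing.scale/= mulr1 [h + a]addrC; field.
  rewrite normrN normrM normfV ler_pdivrMl ?normr_gt0//.
  apply: (le_trans (est h)); rewrite -real_normK ?num_real// expr2 -mulrA ler_wpM2l//.
  have hx : `|h| <= e / (`|x| + 1).
    near: h; apply: dnbhs0_le; rewrite divr_gt0//; have := normr_ge0 x; lra.
  have x1 : 0 < `|x| + 1 by have := normr_ge0 x; lra.
  apply: (le_trans (ler_wpM2r (normr_ge0 x) hx)).
  by rewrite mulrAC ler_pdivrMr// ler_wpM2l ?ltW//; lra.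
by split; [apply/cvg_ex; eexists; exact: lim|exact: cvg_lim lim].
Unshelve. all: by end_near. Qed.

Lemma near_fst (P : R -> Prop) (x y : R) :
  (\forall u \near x, P u) -> \forall z \near ((x, y) : R * R), P z.1.
Proof. by move=> nP; exact: (@cvg_fst _ _ (nbhs x) (nbhs y) _ P nP). Qed.

Lemma near_snd (P : R -> Prop) (x y : R) :
  (\forall u \near y, P u) -> \forall z \near ((x, y) : R * R), P z.2.
Proof. by move=> nP; exact: (@cvg_snd _ _ (nbhs x) (nbhs y) _ P nP). Qed.

(** The hypothesis has the shape met by [osc_integral]: Lipschitz in the amplitude with constant the
    length of the interval of integration, and Lipschitz in the endpoint. *)
Lemma jcont_lipschitz (f : R -> R -> R) (x y c : R) : 
  (forall x' y', `|f x' y' - f x y| <= (`|y| + c) * `|x' - x| + (`|x' - x| + c) * `|y' - y|) -> jcont f x y.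
Proof.
move=> H; rewrite /jcont /prop_for /continuous_at /=.
apply/cvgrPdist_le => e e0.
pose C := `|y| + `|c| + 2.
have C0 : 0 < C by rewrite /C; have := normr_ge0 y; have := normr_ge0 c; lra.
have eC : 0 < Num.min 1 (e / (2 * C)) by rewrite lt_min ltr01 divr_gt0// mulr_gt0.
have near_le (w : R) : \forall u \near w, `|u - w| <= Num.min 1 (e / (2 * C)).
  near=> u; rewrite distrC; near: u; exact: (@cvgr_dist_le _ _ _ (nbhs w) _ id w cvg_id).
have nx := near_fst y (near_le x); have ny := near_snd x (near_le y).
near=> z.
have hx : `|z.1 - x| <= Num.min 1 (e / (2 * C)) by near: z.
have hy : `|z.2 - y| <= Num.min 1 (e / (2 * C)) by near: z.
rewrite distrC; apply: (le_trans (H z.1 z.2)).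
move: hx hy; rewrite !le_min => /andP[x1 xe] /andP[y1 ye].
have -> : e = C * (e / (2 * C)) + C * (e / (2 * C)) by field; lra.
have cn := ler_norm c.
apply: lerD; apply: le_trans (_ : C * _ <= _).
- by apply: ler_wpM2r => //; rewrite /C; lra.
- by rewrite ler_wpM2l// ltW.
- by apply: ler_wpM2r => //; rewrite /C; have := normr_ge0 y; lra.
- by rewrite ler_wpM2l// ltW.
Unshelve. all: by end_near. Qed.

Lemma jcont_osc_integral m beta a x : jcont (osc_integral m beta) a x.
Proof.
apply: (@jcont_lipschitz _ _ _ 1) => a' x'.
have -> : osc_integral m beta a' x' - osc_integral m beta a x =
  (osc_integral m beta a' x - osc_integral m beta a x) + (osc_integral m beta a' x' - osc_integral m beta a' x) by ring.
apply: (le_trans (ler_normD _ _)); apply: lerD.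
  apply: (@le_trans _ _ (`|x| * `|a' - a|)); last by rewrite ler_wpM2r//; lra.
  apply: (@lipschitz_of_derive (fun a => osc_integral m beta a x)) => z; first exact: osc_integral_da.
  exact: osc_integral_le.
apply: (@le_trans _ _ (1 * `|x' - x|)); last by rewrite ler_wpM2r//; have := normr_ge0 (a' - a); lra.
by apply: lipschitz_of_derive => z; [exact: osc_integral_dx|exact: osc_le1].
Qed.

Lemma smooth_osc_integral (I : set R) m beta : open I -> smooth I (osc_integral m beta).
Proof.
move=> oI n; elim: n m beta => [|n IH] m beta; split=> //; do ?by move=> *; exact: jcont_osc_integral.
exists (osc_integral m.+1 (beta + pi / 2)), (osc m beta); split.
- by move=> *; exact: osc_integral_da.
- by move=> *; exact: osc_integral_dx.
- exact: IH.
- exact: smooth_osc.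
Qed.

Lemma cos2piD1 (s : R) : cos (2 * pi * (s + 1)) = cos (2 * pi * s).
Proof. by rewrite mulrDr mulr1 (_ : 2 * pi = pi *+ 2) ?cosD2pi// mulr_natl. Qed.

Lemma derive_shift1 (u du : R -> R) c x :
  (forall z, is_derive z (1 : R) u (du z)) -> is_derive x (1 : R) (fun z => u (z + c)) (du (x + c)).
Proof.
move=> d; rewrite -[du _]mulr1; apply: is_derive1_comp.
by rewrite -[X in is_derive _ _ _ X]addr0; apply: is_deriveD.
Qed.

(** The increment over a period is constant, since the integrand has period 1. *)
Lemma osc_integral_D1 m beta a x : osc_integral m beta a (x + 1) = osc_integral m beta a x + osc_integral m beta a 1.
Proof.
pose u z := osc_integral m beta a (z + 1) - osc_integral m beta a z.
have du z : is_derive z (1 : R) u 0.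
  have -> : 0 = osc m beta a (z + 1) - osc m beta a z by rewrite /osc cos2piD1 subrr.
  apply: is_deriveB; last exact: osc_integral_dx.
  apply: derive_shift1; exact: osc_integral_dx.
have := is_derive_0_is_cst x 0 du; rewrite /u add0r osc_integral0; lra.
Qed.

(** Primitive of [osc] minus its mean over a period. Removing the mean makes it 1-periodic in [x],
    hence bounded independently of the frequency. *)
Definition osc_excursion m (beta a x : R) : R := osc_integral m beta a x - x * osc_integral m beta a 1.

Lemma osc_excursion_int m beta a x (k : int) : osc_excursion m beta a (x + k%:~R) = osc_excursion m beta a x.
Proof.
have nat_case y n : osc_excursion m beta a (y + n%:R) = osc_excursion m beta a y.
  elim: n y => [|n IH] y; first by rewrite addr0.
  by rewrite -natr1 addrA -(IH y) /osc_excursion osc_integral_D1; ring.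
case: k => n; first exact: nat_case.
by rewrite NegzE mulrNz -(nat_case (x - _) n.+1) subrK.
Qed.

Lemma osc_excursion_le2 m beta a x : `|osc_excursion m beta a x| <= 2.
Proof.
have -> : osc_excursion m beta a x = osc_excursion m beta a (x - (Num.floor x)%:~R).
  by rewrite -[RHS](osc_excursion_int m beta a _ (Num.floor x)) subrK.
set y := x - _; have y01 : 0 <= y <= 1.
  rewrite /y subr_ge0 floor_le_tmp lerBlDl /=; have := floorD1_gt x; rewrite intrD1; lra.
rewrite /osc_excursion; apply: (le_trans (ler_normB _ _)); rewrite -[leRHS](_ : 1 + 1 = 2); last by ring.
apply: lerD; first by apply: (le_trans (osc_integral_le _ _ _ _)); rewrite ger0_norm; lra.
rewrite normrM ger0_norm; last lra.
have := osc_integral_le m beta a 1; rewrite normr1 => k1.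
by rewrite mulr_ile1//; lra.
Qed.

(** The sine of [a cos (2 pi s)] changes sign under the half-period shift of [s]. Hence the average
    of the loop has no normal component. *)
Lemma osc_integral_sin a : osc_integral 0 (- (pi / 2)) a 1 = 0.
Proof.
pose K := osc_integral 0 (- (pi / 2)) a; pose u z := K (z + 1 / 2) + K z.
have du z : is_derive z (1 : R) u 0.
  have -> : 0 = osc 0 (- (pi / 2)) a (z + 1 / 2) + osc 0 (- (pi / 2)) a z.
    rewrite /osc !expr0 !mul1r !cosBpihalf mulrDr (_ : 2 * pi * 2^-1 = pi); last by field.
    by rewrite cosDpi mulrN sinN addNr.
  apply: is_deriveD; last exact: osc_integral_dx.
  apply: derive_shift1; exact: osc_integral_dx.
have := is_derive_0_is_cst (1/2) 0 du.
rewrite /u add0r (_ : 1 / 2 + 1 / 2 = 1 :> R); last by field.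
by rewrite [LHS]addrC => /addrI; rewrite /K osc_integral0.
Qed.

Lemma osc_excursion_dx m beta a x : is_derive x (1 : R) (osc_excursion m beta a) (osc m beta a x - osc_integral m beta a 1).
Proof.
apply: is_deriveB; first exact: osc_integral_dx.
have := @is_derive_mul R id (fun=> osc_integral m beta a 1) x 1 0 (is_derive_id x 1) (is_derive_cst _ x 1).
by rewrite mul1r mulr0 addr0.
Qed.

Lemma osc_excursion_da m beta a x :
  is_derive a (1 : R) (fun a => osc_excursion m beta a x) (osc_excursion m.+1 (beta + pi / 2) a x).
Proof.
apply: is_deriveB; first exact: osc_integral_da.
have := osc_integral_da m beta a 1 => ?; exact: is_deriveZ.
Qed.

Lemma smooth_osc_excursion (I : set R) m beta : open I -> smooth I (osc_excursion m beta).
Proof.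
move=> oI; apply: smoothB; first exact: smooth_osc_integral.
apply: smoothM; first exact: smooth_snd.
move=> n; apply: (@sm_comp _ I I n (osc_integral m beta) (fun x _ => x) (fun _ _ => 1)) => //.
- exact: smooth_osc_integral.
- exact: sm_fst.
- exact: sm_cst.
Qed.

End OscillatoryIntegrals.

(** * The Bessel function as an oscillatory integral, and its numerical estimates *)

Section Bessel.
Context {R : realType}.

Lemma is_derive_pow n (z : R) :
  is_derive z (1 : R) (fun z => z ^+ n.+1) (n.+1%:R * z ^+ n).
Proof.
elim: n => [|n IH]; first by rewrite mulr1; exact: is_derive_id.
apply: is_derive_congr (is_derive_mul (is_derive_id z (1 : R)) IH) => [w|].
  by rewrite [RHS]exprS.
by rewrite -[n.+2%:R]natr1 exprS; ring.
Qed.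

Lemma is_derive_bigsum n (u : nat -> R -> R) (d : nat -> R) z :
  (forall m, is_derive z (1 : R) (u m) (d m)) ->
  is_derive z (1 : R) (fun z => \sum_(m < n) u m z) (\sum_(m < n) d m).
Proof.
move=> du; elim: n => [|n IH].
  by apply: is_derive_congr (is_derive_cst (0 : R) z (1 : R)) => [w|]; rewrite big_ord0.
by apply: is_derive_congr (is_deriveD IH (du n)) => [w|]; rewrite big_ord_recr.
Qed.

(** Induction on [n]: the remainder at order [n + 1] has as derivative the remainder at order [n] of
    the shifted family, and is compared with the primitive [x^(n+1) / (n+1)!] of its bound. *)
Lemma taylor_bound (G : nat -> R -> R) :
  (forall m x, is_derive x (1 : R) (G m) (G m.+1 x)) -> (forall m x, `|G m x| <= 1) ->
  forall n x, 0 <= x ->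
    `|G 0%N x - \sum_(m < n) G m 0 * x ^+ m / m`!%:R| <= x ^+ n / n`!%:R.
Proof.
move=> dG G1 n; elim: n G dG G1 => [|n IH] G dG G1 x x0.
  by rewrite big_ord0 subr0 expr0 fact0 invr1 mulr1.
pose P (z : R) := G 0%N z - \sum_(m < n.+1) G m 0 * z ^+ m / m`!%:R.
pose dP (z : R) := G 1%N z - \sum_(m < n) G m.+1 0 * z ^+ m / m`!%:R.
have factS m : (m.+1`!%:R : R) = m.+1%:R * m`!%:R by rewrite factS natrM.
have fact0' m : (m`!%:R : R) != 0 by rewrite pnatr_eq0 -lt0n fact_gt0.
have dpow c m (z : R) : is_derive z (1 : R) (fun z => c * z ^+ m.+1 / m.+1`!%:R) (c * z ^+ m / m`!%:R).
  apply: is_derive_congr (is_derive_mul (is_derive_cst (c / m.+1`!%:R) z (1 : R)) (is_derive_pow m z)) => [w|].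
    by rewrite /= mulrAC.
  rewrite /cst factS; have k0 : (m.+1%:R : R) != 0 by rewrite pnatr_eq0.
  by move: (m.+1%:R) k0 => k k0; field; rewrite fact0' k0.
have dP_ z : is_derive z (1 : R) P (dP z).
  apply: is_deriveB.
  have -> : (fun z : R => \sum_(m < n.+1) G m 0 * z ^+ m / m`!%:R) =
      (fun z => G 0%N 0 + \sum_(m < n) G m.+1 0 * z ^+ m.+1 / m.+1`!%:R).
    apply/funext => w; rewrite big_ord_recl expr0 fact0 invr1 !mulr1.
    by congr (_ + _); apply: eq_bigr => i _.
  rewrite -[X in is_derive _ _ _ X]add0r; apply: is_deriveD.
  exact: (@is_derive_bigsum n (fun m z => G m.+1 0 * z ^+ m.+1 / m.+1`!%:R)
    (fun m => G m.+1 0 * z ^+ m / m`!%:R) z (fun m => dpow _ _ _)).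
have P0 : P 0 = 0.
  rewrite /P big_ord_recl expr0 fact0 invr1 !mulr1 big1 ?addr0 ?subrr// => i _.
  by rewrite exprS mul0r mulr0 mul0r.
have bdP z : 0 <= z -> `|dP z| <= z ^+ n / n`!%:R.
  by move=> z0; apply: (IH (fun m => G m.+1)).
have nonneg (u du : R -> R) : (forall z, is_derive z (1 : R) u (du z)) -> u 0 = 0 ->
    (forall z, 0 <= z -> 0 <= du z) -> 0 <= u x.
  move=> du_ u0 du0; have [c cx] := @mean_value _ u du 0 x (fun z _ => du_ z).
  rewrite u0 !subr0 => ->; rewrite mulr_ge0// du0//; move: cx.
  by rewrite min_l// => /andP[].
have q0 z : is_derive z (1 : R) (fun z => z ^+ n.+1 / n.+1`!%:R) (z ^+ n / n`!%:R).
  have := dpow 1 n z; rewrite mul1r.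
  by rewrite (_ : (fun z0 : R => 1 * z0 ^+ n.+1 / n.+1`!%:R) = (fun z => z ^+ n.+1 / n.+1`!%:R))//;
    apply/funext => w; rewrite mul1r.
rewrite -/(P x) ler_norml; apply/andP; split.
  have := @nonneg (fun z => z ^+ n.+1 / n.+1`!%:R + P z) (fun z => z ^+ n / n`!%:R + dP z).
  move=> H; rewrite -subr_ge0 opprK addrC; apply: (H (fun z => is_deriveD (q0 z) (dP_ z))).
  - by rewrite P0 expr0n mul0r addr0.
  - by move=> z z0; have := bdP z z0; rewrite ler_norml; lra.
have := @nonneg (fun z => z ^+ n.+1 / n.+1`!%:R - P z) (fun z => z ^+ n / n`!%:R - dP z).
move=> H; rewrite -subr_ge0; apply: (H (fun z => is_deriveB (q0 z) (dP_ z))).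
- by rewrite P0 expr0n mul0r subr0.
- by move=> z z0; have := bdP z z0; rewrite ler_norml; lra.
Qed.

(* [bessel_deriv 0] is [bessel_J0] and [bessel_deriv m] is its [m]-th derivative. *)
Definition bessel_deriv m (a : R) : R := osc_integral m (m%:R * (pi / 2)) a 1.

Lemma bessel_deriv_derive m a : is_derive a (1 : R) (bessel_deriv m) (bessel_deriv m.+1 a).
Proof.
rewrite /bessel_deriv (_ : m.+1%:R * (pi / 2) = m%:R * (pi / 2) + pi / 2); first exact: osc_integral_da.
by rewrite -natr1; ring.
Qed.

Lemma bessel_deriv_le1 m a : `|bessel_deriv m a| <= 1.
Proof. by have := osc_integral_le m (m%:R * (pi / 2)) a 1; rewrite normr1. Qed.

(** Mean of the [m]-th power of the cosine over a period, a Wallis integral; these give the Taylor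
    coefficients of J_0 at 0. *)
Definition wallis m : R := osc_integral m 0 0 1.

Lemma bessel_deriv0E m : bessel_deriv m 0 = cos (m%:R * (pi / 2)) * wallis m.
Proof.
have d x : is_derive x (1 : R) (fun x => cos (m%:R * (pi / 2)) * osc_integral m 0 0 x) (osc m (m%:R * (pi / 2)) 0 x).
  apply: is_derive_congr (is_derive_mul (is_derive_cst (cos (m%:R * (pi / 2))) x (1 : R)) (osc_integral_dx m 0 0 x)) => //.
  by rewrite /osc /cst !mul0r !add0r cos0 mulr1 mulrC.
have := oriented_integral_FTC 0 1 (@continuous_osc R m _ 0) d.
by rewrite -/(osc_integral _ _ _ _) -/(bessel_deriv _ _) osc_integral0 mulr0 subr0.
Qed.

Lemma wallis0 : wallis 0 = 1.
Proof.
have d x : is_derive x (1 : R) id (osc 0 0 0 x).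
  by rewrite /osc expr0 mul0r addr0 cos0 mulr1; exact: is_derive_id.
by have := oriented_integral_FTC 0 1 (@continuous_osc R 0 0 0) d; rewrite subr0.
Qed.

(** Integration by parts read backwards: [u] is the expected identity with upper endpoint [z], its
    derivative vanishes by [sin^2 = 1 - cos^2], and the boundary term vanishes at [z = 1]. *)
Lemma wallisSS m : wallis m.+2 = m.+1%:R / m.+2%:R * wallis m.
Proof.
pose c (s : R) := cos (2 * pi * s); pose s' (s : R) := sin (2 * pi * s).
have increment (z : R) : is_derive z (1 : R) (fun z => 2 * pi * z) (2 * pi).
  by have := @is_deriveZ _ _ _ id (2 * pi) z 1 _ (is_derive_id z (1 : R)); rewrite /GRing.scale/= mulr1.
have dc z : is_derive z (1 : R) c (- s' z * (2 * pi)).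
  exact: (@is_derive1_comp _ cos (fun z => 2 * pi * z)).
have ds z : is_derive z (1 : R) s' (c z * (2 * pi)).
  exact: (@is_derive1_comp _ sin (fun z => 2 * pi * z)).
have dcn z : is_derive z (1 : R) (fun z => c z ^+ m.+1) (m.+1%:R * c z ^+ m * (- s' z * (2 * pi))).
  exact: (@is_derive1_comp _ (fun x : R => x ^+ m.+1) c z _ _ (is_derive_pow m (c z)) (dc z)).
pose u z := m.+2%:R * osc_integral m.+2 0 0 z - m.+1%:R * osc_integral m 0 0 z - (2 * pi)^-1 * (s' z * c z ^+ m.+1).
have du z : is_derive z (1 : R) u 0.
  have E : osc m.+2 0 0 z = c z ^+ m.+2 by rewrite /osc mul0r addr0 cos0 mulr1.
  have E' : osc m 0 0 z = c z ^+ m by rewrite /osc mul0r addr0 cos0 mulr1.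
  have -> : 0 = m.+2%:R * c z ^+ m.+2 - m.+1%:R * c z ^+ m -
     (2 * pi)^-1 * (c z * (2 * pi) * c z ^+ m.+1 + s' z * (m.+1%:R * c z ^+ m * (- s' z * (2 * pi)))).
    have cs : s' z ^+ 2 = 1 - c z ^+ 2 by rewrite /s' sin2cos2.
    have p0 : pi != 0 :> R by rewrite gt_eqF// pi_gt0.
    have -> : (2 * pi)^-1 * (c z * (2 * pi) * c z ^+ m.+1 + s' z * (m.+1%:R * c z ^+ m * (- s' z * (2 * pi)))) =
      c z ^+ m.+2 - s' z ^+ 2 * (m.+1%:R * c z ^+ m).
      have v0 : (2 * pi)^-1 * (2 * pi) = 1 :> R by rewrite mulVf// mulf_neq0.
      transitivity ((2 * pi)^-1 * (2 * pi) * (c z ^+ m.+2 - s' z ^+ 2 * (m.+1%:R * c z ^+ m))).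
        by rewrite !exprS; ring.
      by rewrite v0 mul1r.
    by rewrite cs -[m.+2%:R]natr1 !exprS; ring.
  apply: is_deriveB; last exact: (is_deriveZ _ (is_derive_mul (ds z) (dcn z))).
  by apply: is_deriveB; rewrite -?E -?E'; exact: (is_deriveZ _ (osc_integral_dx _ _ _ _)).
have := is_derive_0_is_cst 1 0 du; rewrite /u !osc_integral0 !mulr0 /s' mulr0 mulr1 sin0.
rewrite (_ : 2 * pi = pi *+ 2); last by rewrite mulr_natl.
rewrite sin2pi !mul0r !mulr0 !subr0 => /eqP.
rewrite subr_eq0 => /eqP E.
by rewrite /wallis mulrAC -E mulrC mulKf// pnatr_eq0.
Qed.

Lemma cos_natpi2_even k : cos ((2 * k)%:R * (pi / 2)) = (-1) ^+ k :> R.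
Proof.
elim: k => [|k IH]; first by rewrite muln0 mul0r cos0 expr0.
rewrite mulnS natrD mulrDl addrC (_ : 2%:R * (pi / 2) = pi :> R); last by field.
by rewrite cosDpi IH exprS mulN1r.
Qed.

Lemma cos_natpi2_odd k : cos ((2 * k).+1%:R * (pi / 2)) = 0 :> R.
Proof.
elim: k => [|k IH]; first by rewrite muln0 mul1r cos_pihalf.
have -> : (2 * k.+1).+1%:R * (pi / 2) = (2 * k).+1%:R * (pi / 2) + pi :> R.
  by rewrite mulnS -!natr1 natrD; field.
by rewrite cosDpi IH oppr0.
Qed.

Lemma wallis_even k : wallis (2 * k) = (2 * k)`!%:R / (4 ^+ k * k`!%:R ^+ 2).
Proof.
elim: k => [|k IH]; first by rewrite muln0 wallis0 fact0 expr0 expr1n mulr1 divr1.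
rewrite mulnS !add2n wallisSS IH !factS !natrM !exprS -!natr1 natrM.
have f0 : (k`!%:R : R) != 0 by rewrite pnatr_eq0 -lt0n fact_gt0.
have k0 : (k%:R : R) >= 0 by rewrite ler0n.
by field; rewrite f0 expf_neq0 ?pnatr_eq0//= !lt0r_neq0//; lra.
Qed.

Definition bessel_term (x : R) (k : nat) : R := (-1) ^+ k / (k`!%:R) ^+ 2 * (x / 2) ^+ (2 * k).

Lemma bessel_deriv_partial_sum (x : R) n :
  \sum_(m < (2 * n)%N) bessel_deriv m 0 * x ^+ m / m`!%:R = \sum_(k < n) bessel_term x k.
Proof.
elim: n => [|n IH]; first by rewrite muln0 !big_ord0.
rewrite mulnS add2n !big_ord_recr /= IH !bessel_deriv0E cos_natpi2_odd cos_natpi2_even mul0r !mul0r addr0.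
congr (_ + _); rewrite wallis_even /bessel_term exprMn exprVn [2 ^+ _]exprM.
have f0 m : (m`!%:R : R) != 0 by rewrite pnatr_eq0 -lt0n fact_gt0.
rewrite (_ : 2 ^+ 2 = 4 :> R); last by ring.
by field; rewrite !f0 expf_neq0 ?pnatr_eq0.
Qed.

Lemma bessel_deriv_approx (x : R) n : 0 <= x ->
  `|bessel_deriv 0 x - \sum_(k < n) bessel_term x k| <= x ^+ (2 * n) / (2 * n)`!%:R.
Proof. by move=> x0; rewrite -bessel_deriv_partial_sum; exact: (taylor_bound bessel_deriv_derive bessel_deriv_le1). Qed.

(** Integral representation of J_0: the partial sums of its series are Taylor polynomials of the
    integral, and the remainders [x^n / n!] tend to 0. *)
Lemma bessel_J0E (x : R) : 0 <= x -> bessel_J0 x = bessel_deriv 0 x.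
Proof.
move=> x0; rewrite /bessel_J0; apply: cvg_lim => //.
have c0 : (fun n => x ^+ n / n`!%:R) @ \oo --> (0 : R).
  by have := cvg_series_cvg_0 (is_cvg_series_exp_coeff x).
apply/cvgrPdist_le => e e0.
move/cvgrPdist_le : c0 => /(_ _ e0) [N _ HN].
exists N => // n /= Nn; rewrite /series/= big_mkord.
apply: (le_trans (bessel_deriv_approx n x0)).
have := HN (2 * n)%N; rewrite /= sub0r normrN ger0_norm; last first.
  by rewrite divr_ge0// exprn_ge0.
by apply; apply: (leq_trans Nn); rewrite mul2n -addnn leq_addr.
Qed.


Lemma bessel_term_lt4 (x : R) : let z := (x / 2) ^+ 2 in
  [/\ bessel_term x 0 = 1, bessel_term x 1 = - z, bessel_term x 2 = z ^+ 2 / 4,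
      bessel_term x 3 = - (z ^+ 3 / 36) & bessel_term x 4 = z ^+ 4 / 576].
Proof.
by move=> z; rewrite /bessel_term /z /= !exprM !factS fact0; split; field.
Qed.

Lemma bessel_deriv_quadratic (x : R) : 0 <= x ->
  `|bessel_deriv 0 x - (1 - x ^+ 2 / 4)| <= x ^+ 4 / 24.
Proof.
move=> x0; have := bessel_deriv_approx 2 x0; rewrite !big_ord_recr big_ord0 /=.
have [-> -> _ _ _] := bessel_term_lt4 x.
rewrite add0r (_ : (x / 2) ^+ 2 = x ^+ 2 / 4); last by field.
by rewrite (_ : (2 * 2)`!%:R = 24 :> R).
Qed.

(** Places the first zero below [5 / 2]: the first five terms of the series add up to about -0.048
    there, while the remainder [(5/2)^10 / 10!] is below 0.003. *)
Lemma bessel_deriv_5_2_lt0 : bessel_deriv 0 (5 / 2 : R) < 0.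
Proof.
have x0 : 0 <= 5 / 2 :> R by lra.
have := bessel_deriv_approx 5 x0; rewrite !big_ord_recr big_ord0 /=.
have [-> -> -> -> ->] := bessel_term_lt4 (5 / 2).
have -> : (2 * 5)`!%:R = 72 * 70 * (80 * 9) :> R.
  by rewrite (_ : (2 * 5 = 10)%N)// !factS fact0 !natrM; ring.
have y2 : (25 / 4) ^+ 2 <= 40 :> R by rewrite expr2; lra.
have y4 : ((25 / 4) ^+ 2) ^+ 2 <= 40 * 40 :> R.
  by rewrite [X in X <= _]expr2 ler_pM// sqr_ge0.
have y5 : (5 / 2) ^+ (2 * 5) <= 40 * 40 * (25 / 4) :> R.
  rewrite (_ : (5 / 2) ^+ (2 * 5) = ((25 / 4) ^+ 2) ^+ 2 * (25 / 4) :> R); last by field.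
  by rewrite ler_wpM2r//; lra.
have -> : (5 / 2 / 2) ^+ 2 = 25 / 16 :> R by field.
move: ((5 / 2) ^+ (2 * 5)) y5 => u y5.
rewrite ler_norml => /andP[_]; rewrite !exprS expr0; lra.
Qed.

(** With [y = x^2], the Taylor polynomial is [x (-1/2 + y/16 - y^2/384)]. Its first two terms are
    negative together for [y <= 25/4], and the last one dominates the remainder [x y^3 / 7!]. *)
Lemma bessel_deriv1_lt0 (x : R) : 0 < x -> x <= 5 / 2 -> bessel_deriv 1 x < 0.
Proof.
move=> x0 x5.
have := @taylor_bound (fun m => bessel_deriv m.+1) (fun m => bessel_deriv_derive m.+1) (fun m => bessel_deriv_le1 m.+1) 7 x (ltW x0).
rewrite !big_ord_recr big_ord0 /= !bessel_deriv0E.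
have c1 : cos (1%:R * (pi / 2)) = 0 :> R by exact: (cos_natpi2_odd 0).
have c2 : cos (2%:R * (pi / 2)) = -1 :> R by rewrite (cos_natpi2_even 1) expr1.
have c3 : cos (3%:R * (pi / 2)) = 0 :> R by exact: (cos_natpi2_odd 1).
have c4 : cos (4%:R * (pi / 2)) = 1 :> R by rewrite (cos_natpi2_even 2); ring.
have c5 : cos (5%:R * (pi / 2)) = 0 :> R by exact: (cos_natpi2_odd 2).
have c6 : cos (6%:R * (pi / 2)) = -1 :> R by rewrite (cos_natpi2_even 3); ring.
have c7 : cos (7%:R * (pi / 2)) = 0 :> R by exact: (cos_natpi2_odd 3).
have w2 : wallis 2 = 1 / 2 :> R by rewrite wallisSS wallis0; field.
have w4 : wallis 4 = 3 / 8 :> R by rewrite wallisSS w2; field.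
have w6 : wallis 6 = 5 / 16 :> R by rewrite wallisSS w4; field.
rewrite c1 c2 c3 c4 c5 c6 c7 w2 w4 w6 !mul0r !add0r !addr0.
rewrite ler_norml => /andP[_ le7].
set y := x ^+ 2.
have y0 : 0 <= y by rewrite sqr_ge0.
have y5 : y <= 25 / 4 by rewrite /y expr2; nra.
have : bessel_deriv 1 x <= x * (- 1 / 2 + y / 16 - y ^+ 2 / 384 + y ^+ 3 / (72 * 70)).
  move: le7; rewrite (_ : 1`!%:R = 1 :> R)// (_ : 3`!%:R = 6 :> R)// (_ : 5`!%:R = 120 :> R)//.
  rewrite (_ : 7`!%:R = (72 * 70) :> R); last by rewrite !factS fact0 !natrM; ring.
  by rewrite /y !exprS expr0; lra.
move=> h; apply: le_lt_trans h _.
rewrite (pmulr_rlt0 _ x0).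
have : y ^+ 2 * (y / (72 * 70) - 1 / 384) <= 0.
  apply: mulr_ge0_le0; [exact: sqr_ge0|lra].
rewrite !exprS expr0; lra.
Qed.

End Bessel.

(** * The inverse of the Bessel function and the amplitude of the loop *)

Section Amplitude.
Context {R : realType}.

Lemma bessel_deriv_continuous m (a : R) : {for a, continuous (bessel_deriv m)}.
Proof. exact: is_derive_continuous (bessel_deriv_derive m a). Qed.

Lemma bessel_deriv0_decr (a b : R) : 0 <= a -> a < b -> b <= 5 / 2 -> bessel_deriv 0 b < bessel_deriv 0 a.
Proof.
move=> a0 ab b5.
have [c] := @MVT R (bessel_deriv 0) (bessel_deriv 1) a b ab (fun z _ => bessel_deriv_derive 0 z)
  (continuous_subspaceT (fun z => @bessel_deriv_continuous 0 z)).
rewrite in_itv/= => /andP[ac cb] E.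
have : bessel_deriv 1 c * (b - a) < 0 by rewrite nmulr_rlt0 ?subr_gt0// bessel_deriv1_lt0//; lra.
by rewrite -E subr_lt0.
Qed.

Lemma bessel_deriv00 : bessel_deriv 0 (0 : R) = 1.
Proof. by rewrite bessel_deriv0E mul0r cos0 wallis0 mulr1. Qed.

Lemma bessel_deriv0_1 : bessel_deriv 0 (1 : R) <= 4 / 5.
Proof.
have := @bessel_deriv_quadratic R 1 ler01; rewrite !expr1n ler_norml; lra.
Qed.

Lemma bessel_deriv0_pos (x : R) : 0 <= x -> x <= 3 / 2 -> 0 < bessel_deriv 0 x.
Proof.
move=> x0 x3; have := bessel_deriv_quadratic x0; rewrite ler_norml => /andP[+ _].
have x2 : x ^+ 2 <= 9 / 4 by rewrite expr2; nra.
have x2' : 0 <= x ^+ 2 by rewrite sqr_ge0.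
rewrite (_ : x ^+ 4 = x ^+ 2 * x ^+ 2); last by rewrite -exprD.
nra.
Qed.

(** The lower bound puts [[0, 1]], where the amplitudes live, inside the domain of the inverse; the
    upper bound keeps J_0 strictly decreasing on that domain. *)
Lemma kappa0_bounds : 3 / 2 <= (kappa0 : R) <= 5 / 2.
Proof.
have [z] : exists2 c : R, c \in `[0, 5 / 2] & bessel_deriv 0 c = 0.
  apply: IVT; first lra.
    by apply: continuous_subspaceT => z; exact: bessel_deriv_continuous.
  by rewrite bessel_deriv00 ge_min le_max ler01 (ltW bessel_deriv_5_2_lt0) orbT.
rewrite in_itv/= => /andP[z0 z5] Bz.
have zpos : 0 < z.
  by rewrite lt_neqAle z0 andbT; apply/eqP => zz; move: Bz; rewrite -zz bessel_deriv00 => /eqP; rewrite oner_eq0.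
have form_phi : lbound [set x : R | 0 < x /\ bessel_J0 x = 0] (3 / 2).
  move=> x /= [x0]; rewrite (bessel_J0E (ltW x0)) => Bx; rewrite leNgt; apply/negP => x3.
  by have := @bessel_deriv0_pos x (ltW x0) (ltW x3); rewrite Bx ltxx.
have inz : [set x : R | 0 < x /\ bessel_J0 x = 0] z by split=> //; rewrite bessel_J0E.
apply/andP; split; first by apply: lb_le_inf => //; exists z.
by apply: le_trans z5; apply: ge_inf => //; exists (3 / 2).
Qed.

Lemma bessel_J0_invK (a : R) : 0 <= a -> a <= 1 -> bessel_J0_inv (bessel_deriv 0 a) = a.
Proof.
move=> a0 a1; have /andP[k1 k2] := kappa0_bounds.
have ink : a \in [set` `[0, (kappa0 : R)[] by rewrite inE /= in_itv/= a0 /=; lra.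
have inj : {in [set` `[0, (kappa0 : R)[] &, injective (@bessel_J0 R)}; last first.
  rewrite -(bessel_J0E a0); exact: (pinvKV (fun=> 0) inj ink).
move=> x y; rewrite !inE /= !in_itv/= => /andP[x0 xk] /andP[y0 yk].
rewrite !bessel_J0E// => E; apply/eqP; rewrite eq_le !leNgt; apply/andP; split; apply/negP => lt.
  have x5 : x <= 5 / 2 by lra.
  by have := @bessel_deriv0_decr y x y0 lt x5; rewrite E ltxx.
have y5 : y <= 5 / 2 by lra.
by have := @bessel_deriv0_decr x y x0 lt y5; rewrite E ltxx.
Qed.

(** J_0 is at most [4 / 5] at 1, so that the values between [4 / 5] and 1 are taken with an
    amplitude at most 1. *)
Lemma bessel_J0_inv_spec (y : R) : 4 / 5 <= y -> y <= 1 ->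
  0 <= bessel_J0_inv y <= 1 /\ bessel_deriv 0 (bessel_J0_inv y) = y.
Proof.
move=> y4 y1; have [a] : exists2 c : R, c \in `[0, 1] & bessel_deriv 0 c = y.
  apply: IVT => //.
    by apply: continuous_subspaceT => z; exact: bessel_deriv_continuous.
  by have := bessel_deriv0_1; rewrite bessel_deriv00 ge_min le_max y1 orbC /= => ?; rewrite (le_trans _ y4).
by rewrite in_itv/= => /andP[a0 a1] <-; rewrite bessel_J0_invK// a0 a1.
Qed.

(** The endpoint 1 is excluded, since J_0' vanishes at 0 and the graph of the inverse becomes
    vertical there. Below 1 the inverse solves a differential equation to which [smooth_ode]
    applies. *)
Lemma smooth_bessel_J0_inv :
  smooth [set y : R | 4 / 5 < y < 1] (fun y _ => bessel_J0_inv y).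
Proof.
have oJ : open [set y : R | 4 / 5 < y < 1].
  by rewrite (_ : [set _ | _] = `](4 / 5), 1[%classic); [exact: interval_open|
    apply/seteqP; split => x /=; rewrite in_itv].
have range (y : R) : 4 / 5 < y < 1 -> 0 < bessel_J0_inv y < 1.
  move=> /andP[y4 y1]; have [/andP[b0 b1] E] := bessel_J0_inv_spec (ltW y4) (ltW y1).
  rewrite !lt_neqAle b0 b1 !andbT; apply/andP; split; apply/eqP => e.
    by move: E; rewrite -e bessel_deriv00 => E; rewrite -E ltxx in y1.
  by move: E; rewrite e => E; have := bessel_deriv0_1; rewrite E; lra.
apply: (@smooth_ode _ _ _ (fun y => (bessel_deriv 1 (bessel_J0_inv y))^-1)) => [y /= yI|n sn].
  have /andP[a0 a1] := range y yI.
  have /andP[y4 y1] := yI; have [_ E] := bessel_J0_inv_spec (ltW y4) (ltW y1).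
  rewrite -{1}E; apply: is_derive_inverse.
  - have : \forall z \near bessel_J0_inv y, 0 < z < 1.
      by near=> z; apply/andP; split; near: z; [exact: lt_nbhsr|exact: lt_nbhsl].
    by apply: filterS => z /andP[z0 z1]; rewrite bessel_J0_invK// ltW.
  - by near=> z; exact: bessel_deriv_continuous.
  - exact: bessel_deriv_derive.
  - by rewrite lt_eqF// bessel_deriv1_lt0//; lra.
(* [smooth_inv1] inverts positive quantities, whereas J_0' is negative here: two signs are
   inserted. *)
have -> : (fun x _ : R => (bessel_deriv 1 (bessel_J0_inv x))^-1) =
    (fun x _ : R => (-1) * ((-1) * bessel_deriv 1 (bessel_J0_inv x))^-1).
  by apply/funext => x; apply/funext => y; rewrite invfM invrN1 mulrA mulrNN !mul1r.
apply: smM; first exact: sm_cst.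
apply: (@sm_comp _ _ [set x | 0 < x] n (fun x _ => x^-1)
   (fun x _ => (-1) * bessel_deriv 1 (bessel_J0_inv x)) (fun _ _ => 0)) => //.
- move=> x _ /range /andP[a0 a1]; rewrite /= mulN1r oppr_gt0 bessel_deriv1_lt0//; lra.
- exact: smooth_inv1.
- apply: smM; first exact: sm_cst.
  apply: (@sm_comp _ _ setT n (osc_integral 1 (1%:R * (pi / 2))) (fun x _ => bessel_J0_inv x) (fun _ _ => 1)) => //.
  + exact: openT.
  + by apply: smooth_osc_integral; exact: openT.
  + exact: sm_cst.
- exact: sm_cst.
Unshelve. all: by end_near. Qed.

Lemma cos_ge (t : R) : 1 - t ^+ 2 <= cos t.
Proof.
have := cos_taylor2 0 t; rewrite !add0r cos0 cos_pihalf mulr0 subr0 ler_norml; lra.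
Qed.

(* [1 - bessel_J0 a >= 5 a^2 / 24] for [a <= 1], so the excursion of the loop
   direction is controlled by the increase of the squared length. *)
Lemma loop_excursion (y t : R) : 4 / 5 <= y -> y <= 1 -> `|t| <= bessel_J0_inv y ->
  1 - 2 * y * cos t + y ^+ 2 <= 9 * (1 - y ^+ 2).
Proof.
move=> y4 y1 ta; have [/andP[a0 a1] E] := bessel_J0_inv_spec y4 y1.
set a := bessel_J0_inv y in ta a0 a1 E.
have := bessel_deriv_quadratic a0; rewrite E ler_norml => /andP[_ q].
have t2 : t ^+ 2 <= a ^+ 2 by rewrite -(real_normK (num_real t)) ler_sqr ?nnegrE.
have c := cos_ge t.
have a2 : a ^+ 2 <= 1 by rewrite expr_le1.
have a4 : a ^+ 4 <= a ^+ 2 by rewrite (_ : a ^+ 4 = a ^+ 2 * a ^+ 2) ?ler_piMr ?sqr_ge0// -exprD.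
have k : a ^+ 2 <= 24 / 5 * (1 - y) by lra.
have : 2 * y * (1 - 24 / 5 * (1 - y)) <= 2 * y * cos t by rewrite ler_wpM2l//; lra.
nra.
Qed.

End Amplitude.

(** * A smooth cutoff function *)

Section Cutoff.
Context {R : realType}.

(** The functions [x^(-n) exp (-1/x)] extended by 0: letting [n] vary closes the family under
    differentiation. *)
Definition flat n (x : R) : R := if 0 < x then x^-1 ^+ n * expR (- x^-1) else 0.

(** [exp (1/x)] dominates the single term [x^(-n-1) / (n+1)!] of its series. At the next order this
    makes the difference quotient of [flat n] at 0 tend to 0. *)
Lemma flat_le n (x : R) : 0 < x -> flat n x <= n.+1`!%:R * x.
Proof.
move=> x0; rewrite /flat x0 expRN.
have := expR_ge1Dxn n (ltW (_ : 0 < x^-1)); rewrite invr_gt0 => /(_ x0) h.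
have f0 : (0 : R) < n.+1`!%:R by rewrite ltr0n fact_gt0.
rewrite ler_pdivrMr ?expR_gt0//.
apply: (@le_trans _ _ (n.+1`!%:R * x * (x^-1 ^+ n.+1 / n.+1`!%:R))).
  rewrite exprS le_eqVlt; apply/orP; left; apply/eqP; field.
  by rewrite !lt0r_neq0.
rewrite ler_wpM2l//; first by rewrite mulr_ge0 ?ltW.
lra.
Qed.

Lemma flat_ge0 n (x : R) : 0 <= flat n x.
Proof.
rewrite /flat; case: ifP => // x0; rewrite mulr_ge0 ?expR_ge0//.
by rewrite exprn_ge0// invr_ge0 ltW.
Qed.

Lemma flat_derive n (x : R) :
  is_derive x (1 : R) (flat n) (- n%:R * flat n.+1 x + flat n.+2 x).
Proof.
have [x0|x0|x0] := ltgtP 0 x.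
- apply: (@is_derive_ext_near R (fun x => x^-1 ^+ n * expR (- x^-1))).
    have : \forall z \near x, 0 < z by exact: lt_nbhsr.
    by apply: filterS => z z0; rewrite /flat z0.
  have xn0 : x != 0 by rewrite gt_eqF.
  have di : is_derive x (1 : R) (fun z => z^-1) (- x^-1 ^+ 2).
    have := is_deriveV (xn0 : id x != 0) (is_derive_id x (1 : R)).
    by apply: is_derive_congr => //; rewrite /GRing.scale/= mulr1 exprVn.
  have de : is_derive x (1 : R) (fun z => expR (- z^-1)) (expR (- x^-1) * x^-1 ^+ 2).
    have := @is_derive1_comp R expR (fun z => - z^-1) x _ _ (is_derive_expR _) (is_deriveN di).
    by apply: is_derive_congr => //; rewrite opprK.
  have dn : is_derive x (1 : R) (fun z => z^-1 ^+ n) (- n%:R * x^-1 ^+ n.+1).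
    case: n => [|n].
      apply: is_derive_congr (is_derive_cst (1 : R) x (1 : R)) => [w|]; first by rewrite expr0.
      by rewrite oppr0 mul0r.
    have := @is_derive1_comp R (fun z => z ^+ n.+1) (fun z => z^-1) x _ _ (is_derive_pow n _) di.
    by apply: is_derive_congr => //; rewrite !exprS; ring.
  apply: is_derive_congr (is_derive_mul dn de) => //.
  by rewrite /flat x0 !exprS; ring.
- apply: (@is_derive_ext_near R (fun=> 0)).
    have : \forall z \near x, z < 0 by exact: lt_nbhsl.
    by apply: filterS => z z0; rewrite /flat ltNge ltW.
  apply: is_derive_congr (is_derive_cst (0 : R) x (1 : R)) => //.
  by rewrite /flat ltNge ltW// mulr0 addr0.
- rewrite -x0.
  have -> : - n%:R * flat n.+1 0 + flat n.+2 0 = 0 by rewrite /flat ltxx mulr0 addr0.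
  have lim : (fun h : R => h^-1 *: (flat n (h *: (1 : R) + 0) - flat n 0)) @ 0^' --> (0 : R).
    apply/cvgrPdist_le => e e0; near=> h.
    have h0 : h != 0 by near: h; exact: nbhs_dnbhs_neq.
    rewrite /GRing.scale/= mulr1 addr0 {2}/flat ltxx subr0 sub0r normrN.
    have f0 : (0 : R) < n.+2`!%:R by rewrite ltr0n fact_gt0.
    have hx : `|h| <= e / n.+2`!%:R.
      near: h; apply: dnbhs0_le; rewrite divr_gt0//.
    case: (ltP 0 h) => hp; last first.
      by rewrite /flat ltNge hp /= mulr0 normr0 ltW.
    have -> : h^-1 * flat n h = flat n.+1 h by rewrite /flat hp exprS mulrA.
    rewrite ger0_norm ?flat_ge0//; apply: (le_trans (flat_le _ hp)).
    by move: hx; rewrite gtr0_norm// ler_pdivlMr// mulrC.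
  by split; [apply/cvg_ex; eexists; exact: lim|exact: cvg_lim lim].
Unshelve. all: by end_near. Qed.

Lemma smooth_flat (I : set R) f : open I -> smooth I f -> smooth I (fun x y => flat 0 (f x y)).
Proof.
move=> oI sf.
have sfl : forall n k, sm setT n (fun x (_ : R) => flat k x).
  elim=> [|n IH] k; split=> //; try (move=> x y _;
    apply: (@cvg_comp _ _ _ (fun z : R * R => z.1) _ (nbhs (x, y)) (nbhs x));
    [exact: cvg_fst|exact: (is_derive_continuous (flat_derive k x))]).
  exists (fun x _ => - k%:R * flat k.+1 x + flat k.+2 x), (fun _ _ => 0); split; do ?exact: sm_cst.
  - by move=> x y _; exact: flat_derive.
  - by move=> x y _; exact: is_derive_cst.
  - by apply: smD => //; apply: smM => //; exact: sm_cst.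
apply: (@smooth_comp _ I setT (fun x _ => flat 0 x) f (fun _ _ => 0)) => //.
- exact: openT.
- exact: smooth_cst.
Qed.

Definition cutoff (x : R) : R := flat 0 (x - 1) / (flat 0 (x - 1) + flat 0 (2 - x)).

Lemma flat0_gt0 (x : R) : 0 < x -> 0 < flat 0 x.
Proof. by move=> x0; rewrite /flat x0 expr0 mul1r expR_gt0. Qed.

Lemma cutoff_den_gt0 (x : R) : 0 < flat 0 (x - 1) + flat 0 (2 - x).
Proof.
case: (ltP 1 x) => x1.
  by rewrite ltr_pwDl ?flat_ge0// flat0_gt0// subr_gt0.
by rewrite ltr_wpDl ?flat_ge0// flat0_gt0//; lra.
Qed.

Lemma cutoff01 x : 0 <= cutoff x <= 1.
Proof.
have d := cutoff_den_gt0 x; rewrite /cutoff divr_ge0 ?flat_ge0 ?(ltW d)//=.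
by rewrite ler_pdivrMr // mul1r lerDl flat_ge0.
Qed.

Lemma cutoff0 x : x <= 1 -> cutoff x = 0.
Proof. by move=> x1; rewrite /cutoff {1}/flat subr_gt0 ltNge x1 /= mul0r. Qed.

Lemma cutoff1 x : 2 <= x -> cutoff x = 1.
Proof.
move=> x2; have d := cutoff_den_gt0 x.
have E : flat 0 (2 - x) = 0 by rewrite {1}/flat subr_gt0 ltNge x2.
by move: d; rewrite /cutoff E addr0 => d; rewrite divff// gt_eqF.
Qed.

Lemma smooth_cutoff (I : set R) (f : R -> R -> R) : open I -> smooth I f ->
  smooth I (fun x y => cutoff (f x y)).
Proof.
move=> oI sf.
have s1 : smooth I (fun x y => flat 0 (f x y - 1)).
  by apply: smooth_flat => //; apply: smoothB => //; exact: smooth_cst.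
have s2 : smooth I (fun x y => flat 0 (2 - f x y)).
  by apply: smooth_flat => //; apply: smoothB => //; exact: smooth_cst.
apply: smoothM => //; apply: smoothV => //; last exact: smoothD.
by move=> *; exact: cutoff_den_gt0.
Qed.

End Cutoff.

(** * Corrugation of a map of the annulus *)

Section Vectors.
Context {R : realType}.
Implicit Types u v w : 'rV[R]_3.

Lemma dot3E u v : dot u v = u 0 0 * v 0 0 + u 0 1 * v 0 1 + u 0 2%:R * v 0 2%:R.
Proof.
rewrite /dot !big_ord_recl big_ord0 addr0 addrA.
by congr (_ * _ + u _ _ * v _ _ + u _ _ * v _ _); apply/val_inj.
Qed.

Lemma rV3P u v : u 0 0 = v 0 0 -> u 0 1 = v 0 1 -> u 0 2%:R = v 0 2%:R -> u = v.
Proof.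
move=> h0 h1 h2; apply/rowP => -[[|[|[|//]]] ltj].
- by rewrite (_ : Ordinal ltj = 0)//; apply/val_inj.
- by rewrite (_ : Ordinal ltj = 1)//; apply/val_inj.
- by rewrite (_ : Ordinal ltj = 2%:R)//; apply/val_inj.
Qed.

Lemma cross3E u v : [/\ cross u v 0 0 = u 0 1 * v 0 2%:R - u 0 2%:R * v 0 1,
  cross u v 0 1 = u 0 2%:R * v 0 0 - u 0 0 * v 0 2%:R &
  cross u v 0 2%:R = u 0 0 * v 0 1 - u 0 1 * v 0 0].
Proof.
have e11 : 1 + 1 = 2%:R :> 'I_3 by apply/val_inj.
have e12 : 1 + 2%:R = 0 :> 'I_3 by apply/val_inj.
have e21 : 2%:R + 1 = 0 :> 'I_3 by apply/val_inj.
have e22 : 2%:R + 2%:R = 1 :> 'I_3 by apply/val_inj.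
by rewrite /cross !mxE !add0r e11 e12 e21 e22.
Qed.

Lemma dotC n (u v : 'rV[R]_n) : dot u v = dot v u.
Proof. by apply: eq_bigr => i _; rewrite mulrC. Qed.

Lemma dotDl n (u v w : 'rV[R]_n) : dot (u + v) w = dot u w + dot v w.
Proof. by rewrite /dot -big_split; apply: eq_bigr => i _; rewrite mxE mulrDl. Qed.

Lemma dotZl n (k : R) (u v : 'rV[R]_n) : dot (k *: u) v = k * dot u v.
Proof. by rewrite /dot mulr_sumr; apply: eq_bigr => i _; rewrite mxE mulrA. Qed.

Lemma dotDr n (u v w : 'rV[R]_n) : dot u (v + w) = dot u v + dot u w.
Proof. by rewrite dotC dotDl !(dotC _ u). Qed.

Lemma dotZr n (k : R) (u v : 'rV[R]_n) : dot u (k *: v) = k * dot u v.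
Proof. by rewrite dotC dotZl dotC. Qed.

Lemma dotNl n (u v : 'rV[R]_n) : dot (- u) v = - dot u v.
Proof. by rewrite -scaleN1r dotZl mulN1r. Qed.

Lemma dotNr n (u v : 'rV[R]_n) : dot u (- v) = - dot u v.
Proof. by rewrite dotC dotNl dotC. Qed.

Definition dotE n := (@dotDl n, @dotDr n, @dotZl n, @dotZr n, @dotNl n, @dotNr n).

Lemma dot_ge0 n (u : 'rV[R]_n) : 0 <= dot u u.
Proof. by apply: sumr_ge0 => i _; rewrite -expr2 sqr_ge0. Qed.

Lemma dot_eq0 n (u : 'rV[R]_n) : dot u u = 0 -> u = 0.
Proof.
move/psumr_eq0P => H; apply/rowP => i; rewrite mxE; apply/eqP.
by rewrite -[_ == 0]orbb -mulf_eq0 H// => j _; rewrite -expr2 sqr_ge0.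
Qed.

Lemma enorm_ge0 n (u : 'rV[R]_n) : 0 <= enorm u.
Proof. exact: sqrtr_ge0. Qed.

Lemma enorm_sqr n (u : 'rV[R]_n) : enorm u ^+ 2 = dot u u.
Proof. by rewrite sqr_sqrtr// dot_ge0. Qed.

Lemma enorm0 n : enorm (0 : 'rV[R]_n) = 0.
Proof. by apply/eqP; rewrite -sqrf_eq0 enorm_sqr /dot big1// => i _; rewrite mxE mul0r. Qed.

Lemma enormZ n (k : R) (u : 'rV[R]_n) : enorm (k *: u) = `|k| * enorm u.
Proof. by rewrite /enorm dotZl dotZr mulrA -expr2 sqrtrM ?sqr_ge0// sqrtr_sqr. Qed.

Lemma enormN n (u : 'rV[R]_n) : enorm (- u) = enorm u.
Proof. by rewrite -scaleN1r enormZ normrN1 mul1r. Qed.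

Lemma cauchy_schwarz n (u v : 'rV[R]_n) : `|dot u v| <= enorm u * enorm v.
Proof.
rewrite -ler_sqr ?nnegrE ?mulr_ge0 ?enorm_ge0// real_normK ?num_real// exprMn !enorm_sqr.
have [/dot_eq0 ->|u0] := eqVneq (dot u u) 0.
  have d0 (w : 'rV[R]_n) : dot (0 : 'rV[R]_n) w = 0 by rewrite /dot big1// => i _; rewrite mxE mul0r.
  by rewrite !d0 expr0n mul0r.
have du : 0 < dot u u by rewrite lt_neqAle eq_sym u0 dot_ge0.
have := dot_ge0 (v - (dot u v / dot u u) *: u).
rewrite !dotE (dotC v u) => h.
have : dot v v - dot u v ^+ 2 / dot u u >= 0.
  by apply: le_trans h _; rewrite le_eqVlt; apply/orP; left; apply/eqP; field.
by rewrite subr_ge0 ler_pdivrMr// mulrC.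
Qed.

Lemma enormD n (u v : 'rV[R]_n) : enorm (u + v) <= enorm u + enorm v.
Proof.
rewrite -ler_sqr ?nnegrE ?addr_ge0 ?enorm_ge0// sqrrD !enorm_sqr !dotE (dotC v u).
have := le_trans (ler_norm _) (cauchy_schwarz u v); lra.
Qed.

Lemma enormB n (u v : 'rV[R]_n) : enorm (u - v) <= enorm u + enorm v.
Proof. by rewrite -(enormN v); exact: enormD. Qed.

Lemma enorm_distC n (u v : 'rV[R]_n) : enorm (u - v) = enorm (v - u).
Proof. by rewrite -enormN opprB. Qed.

Lemma enorm_eq0 n (u : 'rV[R]_n) : enorm u = 0 -> u = 0.
Proof. by move=> h; apply: dot_eq0; rewrite -enorm_sqr h expr0n. Qed.

Lemma enorm_coord n (u : 'rV[R]_n) i : `|u 0 i| <= enorm u.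
Proof.
rewrite -ler_sqr ?nnegrE ?enorm_ge0// real_normK ?num_real// enorm_sqr /dot (bigD1 i)//= -expr2.
by rewrite lerDl sumr_ge0// => j _; rewrite -expr2 sqr_ge0.
Qed.

(** The factor 2, an upper bound of [sqrt 3], is paid each time a vector estimate is obtained
    coordinate by coordinate from the mean value theorem. *)
Lemma enorm3_le u (K : R) : (forall i, `|u 0 i| <= K) -> enorm u <= 2 * K.
Proof.
move=> uK; have K0 : 0 <= K by apply: le_trans (uK 0).
rewrite -ler_sqr ?nnegrE ?enorm_ge0 ?mulr_ge0// enorm_sqr dot3E -!expr2.
have sq i : u 0 i ^+ 2 <= K ^+ 2.
  by rewrite -(real_normK (num_real (u 0 i))) ler_sqr ?nnegrE// uK.
have := sq 0; have := sq 1; have := sq 2%:R; rewrite exprMn; have := sqr_ge0 K; lra.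
Qed.

Lemma cross_dotl u v : dot (cross u v) u = 0.
Proof. by rewrite dot3E; have [-> -> ->] := cross3E u v; ring. Qed.

Lemma cross_dotr u v : dot (cross u v) v = 0.
Proof. by rewrite dot3E; have [-> -> ->] := cross3E u v; ring. Qed.

Lemma dot_cross u v : dot (cross u v) (cross u v) = dot u u * dot v v - dot u v ^+ 2.
Proof. by rewrite !dot3E; have [-> -> ->] := cross3E u v; ring. Qed.

End Vectors.

(** * Smooth and periodic maps to three-space *)

Section VectorSmooth.
Context {R : realType}.
Implicit Types (f g : R -> R -> 'rV[R]_3) (I : set R).

Definition vsmooth I f := forall j, smooth I (fun x y => f x y 0 j).

Lemma vsmoothD I f g : vsmooth I f -> vsmooth I g -> vsmooth I (fun x y => f x y + g x y).
Proof.
move=> sf sigma j.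
rewrite (_ : (fun x y => _) = (fun x y => f x y 0 j + g x y 0 j)); first exact: smoothD.
by apply/funext => x; apply/funext => y; rewrite mxE.
Qed.

Lemma vsmoothZ I (k : R -> R -> R) f : smooth I k -> vsmooth I f ->
  vsmooth I (fun x y => k x y *: f x y).
Proof.
move=> sk sf j.
rewrite (_ : (fun x y => _) = (fun x y => k x y * f x y 0 j)); first exact: smoothM.
by apply/funext => x; apply/funext => y; rewrite mxE.
Qed.

Lemma smooth_dot I f g : vsmooth I f -> vsmooth I g -> smooth I (fun x y => dot (f x y) (g x y)).
Proof.
move=> sf sigma.
rewrite (_ : (fun x y => _) = (fun x y => f x y 0 0 * g x y 0 0 + f x y 0 1 * g x y 0 1 +
   f x y 0 2%:R * g x y 0 2%:R)).
  by apply: smoothD; [apply: smoothD|]; apply: smoothM.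
by apply/funext => x; apply/funext => y; rewrite dot3E.
Qed.

Lemma vsmooth_cross I f g : vsmooth I f -> vsmooth I g -> vsmooth I (fun x y => cross (f x y) (g x y)).
Proof.
move=> sf sigma j.
rewrite (_ : (fun x y => _) = (fun x y => f x y 0 (j + 1) * g x y 0 (j + 2%:R) -
   f x y 0 (j + 2%:R) * g x y 0 (j + 1))); first by apply: smoothB; apply: smoothM.
by apply/funext => x; apply/funext => y; rewrite mxE.
Qed.

Definition vdx f x y : 'rV[R]_3 := \row_j dx (fun x y => f x y 0 j) x y.
Definition vdy f x y : 'rV[R]_3 := \row_j dy (fun x y => f x y 0 j) x y.

Lemma vsmooth_dx I f : open I -> vsmooth I f -> vsmooth I (vdx f).
Proof.
move=> oI sf j; rewrite (_ : (fun x y => _) = dx (fun x y => f x y 0 j)); first exact: smooth_dx.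
by apply/funext => x; apply/funext => y; rewrite mxE.
Qed.

Lemma vsmooth_dy I f : open I -> vsmooth I f -> vsmooth I (vdy f).
Proof.
move=> oI sf j; rewrite (_ : (fun x y => _) = dy (fun x y => f x y 0 j)); first exact: smooth_dy.
by apply/funext => x; apply/funext => y; rewrite mxE.
Qed.

Lemma smooth_enorm I f : open I -> (forall x y, I x -> 0 < dot (f x y) (f x y)) -> vsmooth I f ->
  smooth I (fun x y => enorm (f x y)).
Proof. by move=> oI f0 sf; apply: smooth_sqrt => //; exact: smooth_dot. Qed.

Definition per {V : Type} (g : R -> R -> V) := forall x y, g x (y + 2 * pi) = g x y.

Lemma per_dx (g : R -> R -> R) : per g -> per (dx g).
Proof.
by move=> pg x y; rewrite /dx (_ : (g ^~ (y + 2 * pi)) = (g ^~ y))//; apply/funext => z.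
Qed.

Lemma per_dy (g : R -> R -> R) : per g -> per (dy g).
Proof.
move=> pg x y; rewrite /dy /derive.
rewrite (_ : (fun h : R => h^-1 *: ((g x \o shift (y + 2 * pi)) (h *: (1 : R)) - g x (y + 2 * pi))) =
  (fun h : R => h^-1 *: ((g x \o shift y) (h *: (1 : R)) - g x y)))//.
by apply/funext => h /=; rewrite pg addrA pg.
Qed.

Lemma per_vdx f : per f -> per (vdx f).
Proof.
by move=> pf x y; apply/rowP => j; rewrite !mxE; apply: (per_dx (g := fun x y => f x y 0 j)) => x' y'; rewrite pf.
Qed.

Lemma per_vdy f : per f -> per (vdy f).
Proof.
by move=> pf x y; apply/rowP => j; rewrite !mxE; apply: (per_dy (g := fun x y => f x y 0 j)) => x' y'; rewrite pf.
Qed.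

Lemma per_int {V : Type} (g : R -> R -> V) (k : int) x y : per g -> g x (y + k%:~R * (2 * pi)) = g x y.
Proof.
move=> pg.
have nat_case z n : g x (z + n%:R * (2 * pi)) = g x z.
  elim: n z => [|n IH] z; first by rewrite mul0r addr0.
  by rewrite -natr1 mulrDl mul1r addrA pg.
case: k => n; first exact: nat_case.
by rewrite NegzE mulrNz -(nat_case (y + _) n.+1) mulNr subrK.
Qed.

Lemma angle_reduce (y : R) : exists k : int, 0 <= y + k%:~R * (2 * pi) <= 2 * pi.
Proof.
have p0 : 0 < 2 * pi :> R by rewrite mulr_gt0// pi_gt0.
exists (- Num.floor (y / (2 * pi))).
have f1 := floor_le_tmp (y / (2 * pi)); have f2 := floorD1_gt (y / (2 * pi)).
move: f1 f2; rewrite intrD1 mulrNz mulNr; set q := _%:~R => f1 f2.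
have ye : y = y / (2 * pi) * (2 * pi) by rewrite divfK// gt_eqF.
rewrite {1 2}ye -mulrBl; apply/andP; split.
  by apply: mulr_ge0; [lra|exact: ltW].
rewrite -[leRHS]mul1r; apply: ler_wpM2r; [exact: ltW|lra].
Qed.

(** By periodicity, the supremum over a strip is a maximum over the compact rectangle with angles in
    [[0, 2 pi]]. *)
Lemma bounded_periodic I (g : R -> R -> R) (r1 r2 : R) :
  (forall x, r1 <= x <= r2 -> I x) -> (forall x y, I x -> jcont g x y) -> per g ->
  exists K : R, forall x y, r1 <= x <= r2 -> `|g x y| <= K.
Proof.
move=> rI cg pg.
have [r12|r21] := leP r1 r2; last by exists 0 => x y; lra.
pose A := (`[r1, r2]%classic : set R) `*` (`[0, 2 * pi]%classic : set R).
have cA : compact A by apply: compact_setX; exact: segment_compact.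
have A0 : A !=set0.
  exists (r1, 0); split => /=; rewrite in_itv/= lexx//=.
  by rewrite mulr_ge0// pi_ge0.
have cn : {within A, continuous (fun z : R * R => `|g z.1 z.2|)}.
  apply: continuous_in_subspaceT => -[x y]; rewrite inE => -[/= + _]; rewrite in_itv/= => xr.
  apply: (@cvg_comp _ _ _ (fun z : R * R => g z.1 z.2) (fun u : R => `|u|)); first exact: cg (rI _ xr).
  exact: norm_continuous.
have [c cA' cmax] := @compact_EVT_max _ R (fun z : R * R => `|g z.1 z.2|) A A0 cA cn.
exists `|g c.1 c.2| => x y xr; have [k kb] := angle_reduce y.
rewrite -(per_int k x y pg); apply: (cmax (x, y + k%:~R * (2 * pi))).
by rewrite inE; split => /=; rewrite in_itv.
Qed.

End VectorSmooth.

(** * Coordinatewise differentiation *)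

Section Coordinates.
Context {R : realType}.

Lemma rV3D (u v : 'rV[R]_3) j : (u + v) 0 j = u 0 j + v 0 j.
Proof. by rewrite mxE. Qed.

Lemma rV3Z k (u : 'rV[R]_3) j : (k *: u) 0 j = k * u 0 j.
Proof. by rewrite mxE. Qed.

(** Algebra common to the two partial derivatives of [corrug], with variables for the analytic
    quantities. The factor [n] produced by differentiating the phase cancels [n^-1], and this term
    becomes the excursion of the loop. *)
Lemma step_algebra (n a d0 d0' c1 y0 s1 p r t m A B P1 P2 Q1 Q2 d4 dA dA' dB dB' o1 o2 k1 k2 : R) :
  n != 0 -> d0 = d0' -> dA = dA' -> dB = dB' -> A = p * r * t -> B = p * r * m ->
  o1 = c1 -> k1 = y0 -> o2 = s1 -> k2 = 0 ->
  d0 + p * a * (r * (c1 - y0) * t + r * s1 * m) +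
    n^-1 * (Q1 * d4 * A + P1 * dA + (Q2 * d4 * B + P2 * dB)) =
  d0' + n^-1 * (n * a * (o1 - k1) * A + (Q1 * d4 * A + P1 * dA') +
    (n * a * (o2 - k2) * B + (Q2 * d4 * B + P2 * dB'))).
Proof. by move=> n0 -> -> -> -> -> -> -> -> ->; field. Qed.

Lemma rV3_lin (u v w : 'rV[R]_3) k l j : (u + k *: v + l *: w) 0 j = u 0 j + k * v 0 j + l * w 0 j.
Proof. by rewrite !mxE. Qed.

Lemma vdx_coord (F : R -> R -> 'rV[R]_3) x y j : vdx F x y 0 j = dx (fun x y => F x y 0 j) x y.
Proof. by rewrite mxE. Qed.

Lemma vdy_coord (F : R -> R -> 'rV[R]_3) x y j : vdy F x y 0 j = dy (fun x y => F x y 0 j) x y.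
Proof. by rewrite mxE. Qed.

Lemma vdx_val (F : R -> R -> 'rV[R]_3) x y j d :
  is_derive x (1 : R) (fun x => F x y 0 j) d -> vdx F x y 0 j = d.
Proof. by move=> dF; rewrite mxE /dx derive_val. Qed.

Lemma vdy_val (F : R -> R -> 'rV[R]_3) x y j d :
  is_derive y (1 : R) (fun y => F x y 0 j) d -> vdy F x y 0 j = d.
Proof. by move=> dF; rewrite mxE /dy derive_val. Qed.

Lemma is_derive_affine2 (c : R) (u p q : R -> R) x du dp dq :
  is_derive x (1 : R) u du -> is_derive x (1 : R) p dp -> is_derive x (1 : R) q dq ->
  is_derive x (1 : R) (fun z => u z + c * (p z + q z)) (du + c * (dp + dq)).
Proof.
move=> hu hp hq.
have h := is_deriveD hu (is_derive_mul (is_derive_cst c x (1 : R)) (is_deriveD hp hq)).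
by apply: is_derive_congr h => //; rewrite /cst mul0r add0r.
Qed.

End Coordinates.

(** * The corrugated map and its derivatives *)

Section Step.
Context {R : realType}.
Variables (I : set R) (f : R -> R -> 'rV[R]_3) (eta psi : R -> R -> R) (a b : R).

(* [sV], [sW], [sU] are the images under [df] of the vectors v, w, u of the
   corrugation process of phase [a x + b y], for v = (a, b) and w = (-b, a);
   [st], [sn], [sr], [sal] are t, n, r, alpha. *)
Definition sV x y := a *: vdx f x y + b *: vdy f x y.
Definition sW x y := - b *: vdx f x y + a *: vdy f x y.
Definition sS x y := - (dot (sV x y) (sW x y) / dot (sW x y) (sW x y)).
Definition sU x y := (a ^+ 2 + b ^+ 2)^-1 *: (sV x y + sS x y *: sW x y).
Definition sr x y := Num.sqrt (eta x y + dot (sU x y) (sU x y)).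
Definition sy x y := enorm (sU x y) / sr x y.
Definition sal x y := bessel_J0_inv (sy x y).
Definition st x y := (enorm (sU x y))^-1 *: sU x y.
Definition sn x y := (enorm (sU x y) * enorm (sW x y))^-1 *: cross (sU x y) (sW x y).
Definition sA x y := (psi x y * sr x y) *: st x y.
Definition sB x y := (psi x y * sr x y) *: sn x y.
Definition sphase (N : nat) x y : R := N%:R * (a * x + b * y).
(* The cutoff [psi] has no counterpart in the corrugation process: it protects the
   origin, where polar coordinates degenerate, and is 1 near the annulus. *)
Definition corrug (N : nat) x y := f x y + N%:R^-1 *:
  (osc_excursion 0 0 (sal x y) (sphase N x y) *: sA x y +
   osc_excursion 0 (- (pi / 2)) (sal x y) (sphase N x y) *: sB x y).

Definition gram x y := dot (vdx f x y) (vdx f x y) * dot (vdy f x y) (vdy f x y) -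
  dot (vdx f x y) (vdy f x y) ^+ 2.

Lemma frame_W_gt0 x y : 0 < a ^+ 2 + b ^+ 2 -> 0 < gram x y -> 0 < dot (sW x y) (sW x y).
Proof.
move=> ab; rewrite /gram /sW.
move: (vdx f x y) (vdy f x y) => X Y; rewrite !dotE (dotC Y X).
have := dot_ge0 X; have := dot_ge0 Y.
move: (dot X X) (dot X Y) (dot Y Y) => E F G G0 E0 g.
have E1 : 0 < E by nra.
rewrite -(pmulr_rgt0 _ E1).
set Q := (X in 0 < E * X).
(* Completing the square: the Gram determinant appears with the factor [a^2], so that the case
   [a = 0] is treated apart. *)
have -> : E * Q = (b * E - a * F) ^+ 2 + a ^+ 2 * (E * G - F ^+ 2) by rewrite /Q; ring.
have [a0|an] := eqVneq a 0.
  have b0 : 0 < b ^+ 2 by have := ab; rewrite a0 expr0n add0r.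
  rewrite a0 !mul0r expr0n mul0r addr0 subr0 exprMn mulr_gt0// exprn_gt0//.
have := sqr_ge0 (b * E - a * F).
have : 0 < a ^+ 2 * (E * G - F ^+ 2) by rewrite mulr_gt0// lt_neqAle sqr_ge0 eq_sym sqrf_eq0 an.
lra.
Qed.

Lemma frame_UW x y : 0 < a ^+ 2 + b ^+ 2 -> 0 < gram x y -> dot (sU x y) (sW x y) = 0.
Proof.
move=> ab g0; have w0 := frame_W_gt0 ab g0.
rewrite /sU dotZl dotDl dotZl /sS; set V := dot (sV _ _) _.
by rewrite mulNr divfK ?gt_eqF// subrr mulr0.
Qed.

(** The vectors u and w span a parallelogram of area 1 in the plane of parameters; their images are
    orthogonal and span one of squared area [gram]. *)
Lemma frame_U_sqr x y : 0 < a ^+ 2 + b ^+ 2 -> 0 < gram x y -> dot (sU x y) (sU x y) = gram x y / dot (sW x y) (sW x y).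
Proof.
move=> ab g0; have w0 := frame_W_gt0 ab g0.
have -> : dot (sU x y) (sU x y) = (a ^+ 2 + b ^+ 2)^-1 * dot (sV x y) (sU x y).
  by rewrite {1}/sU dotZl dotDl dotZl [dot (sW _ _) _]dotC (frame_UW ab g0) mulr0 addr0.
have c0 : a ^+ 2 + b ^+ 2 != 0 by rewrite gt_eqF.
rewrite /sU dotZr dotDr dotZr /sS.
have g : dot (sV x y) (sV x y) * dot (sW x y) (sW x y) - dot (sV x y) (sW x y) ^+ 2 =
    (a ^+ 2 + b ^+ 2) ^+ 2 * gram x y.
  rewrite /gram /sV /sW; move: (vdx f x y) (vdy f x y) => X Y; rewrite !dotE (dotC Y X).
  by move: (dot X X) (dot X Y) (dot Y Y) => E F G; ring.
have g' : gram x y = (dot (sV x y) (sV x y) * dot (sW x y) (sW x y) - dot (sV x y) (sW x y) ^+ 2) /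
   (a ^+ 2 + b ^+ 2) ^+ 2 by rewrite g mulrC mulKf// expf_neq0.
rewrite g'; move: (dot (sW x y) (sW x y)) (dot (sV x y) (sV x y)) (dot (sV x y) (sW x y)) w0 => w v m w0.
by field; rewrite c0 gt_eqF.
Qed.

(** Standing hypotheses of a step. The factor 64 puts the ratio [sy] above [4 / 5], where the
    inverse of the Bessel function is controlled. The last condition makes the phase change by an
    integer along one turn. *)
Definition step_ok := [/\ open I, vsmooth I f, smooth I eta & smooth I psi] /\
  [/\ 0 < a ^+ 2 + b ^+ 2, (forall x y, I x -> 0 < eta x y),
      (forall x y, I x -> 0 < gram x y),
      (forall x y, I x -> 64 * eta x y <= dot (sU x y) (sU x y)) &
      (forall x y, 0 <= psi x y <= 1)] /\
  [/\ per f, per eta, per psi & exists k : int, b * (2 * pi) = k%:~R].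

Hypothesis ok : step_ok.

Let oI : open I. Proof. by case: ok => -[]. Qed.
Let sf : vsmooth I f. Proof. by case: ok => -[]. Qed.
Let seta : smooth I eta. Proof. by case: ok => -[]. Qed.
Let spsi : smooth I psi. Proof. by case: ok => -[]. Qed.
Let ab : 0 < a ^+ 2 + b ^+ 2. Proof. by case: ok => _ [[]]. Qed.
Let eta0 x y : I x -> 0 < eta x y. Proof. by case: ok => _ [[_ + _ _ _] _]; exact. Qed.
Let gram0 x y : I x -> 0 < gram x y. Proof. by case: ok => _ [[_ _ + _ _] _]; exact. Qed.
Let small x y : I x -> 64 * eta x y <= dot (sU x y) (sU x y).
Proof. by case: ok => _ [[_ _ _ + _] _]; exact. Qed.
Let psi01 x y : 0 <= psi x y <= 1. Proof. by case: ok => _ [[_ _ _ _ +] _]; exact. Qed.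

Lemma sW_gt0 x y : I x -> 0 < dot (sW x y) (sW x y).
Proof. by move=> Ix; exact: frame_W_gt0 ab (gram0 y Ix). Qed.

Lemma sUW x y : I x -> dot (sU x y) (sW x y) = 0.
Proof. by move=> Ix; exact: frame_UW ab (gram0 y Ix). Qed.

Lemma sU_sqr x y : I x -> dot (sU x y) (sU x y) = gram x y / dot (sW x y) (sW x y).
Proof. by move=> Ix; exact: frame_U_sqr ab (gram0 y Ix). Qed.

Lemma sU_gt0 x y : I x -> 0 < dot (sU x y) (sU x y).
Proof. by move=> Ix; rewrite sU_sqr// divr_gt0 ?gram0// sW_gt0. Qed.

(** The coefficient of [sU] is the value of the phase form on the coordinate vector, since that form
    is 1 on u and 0 on w. *)
Lemma sX_decomp x y : vdx f x y = a *: sU x y - ((a * sS x y + b) / (a ^+ 2 + b ^+ 2)) *: sW x y.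
Proof.
have c0 : a ^+ 2 + b ^+ 2 != 0 by rewrite gt_eqF.
rewrite /sU; move: (sS x y) => s; rewrite /sV /sW; move: (vdx f x y) (vdy f x y) => X Y.
apply/rowP => j; rewrite !mxE; field; exact: c0.
Qed.

Lemma sY_decomp x y : vdy f x y = b *: sU x y + ((a - b * sS x y) / (a ^+ 2 + b ^+ 2)) *: sW x y.
Proof.
have c0 : a ^+ 2 + b ^+ 2 != 0 by rewrite gt_eqF.
rewrite /sU; move: (sS x y) => s; rewrite /sV /sW; move: (vdx f x y) (vdy f x y) => X Y.
apply/rowP => j; rewrite !mxE; field; exact: c0.
Qed.

Lemma sr_sqr x y : I x -> sr x y ^+ 2 = eta x y + dot (sU x y) (sU x y).
Proof. by move=> Ix; rewrite sqr_sqrtr// addr_ge0 ?dot_ge0// ltW// eta0. Qed.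

Lemma sr_gt0 x y : I x -> 0 < sr x y.
Proof. by move=> Ix; rewrite sqrtr_gt0 addr_gt0 ?eta0// sU_gt0. Qed.

Lemma senorm_gt0 x y : I x -> 0 < enorm (sU x y).
Proof. by move=> Ix; rewrite sqrtr_gt0 sU_gt0. Qed.

Lemma sy_bounds x y : I x -> 4 / 5 < sy x y < 1.
Proof.
move=> Ix; have r0 := sr_gt0 y Ix; have U0 := senorm_gt0 y Ix.
have e0 := eta0 y Ix; have rs := sr_sqr y Ix; have sm := small y Ix.
rewrite -enorm_sqr in rs sm.
rewrite /sy; apply/andP; split.
  rewrite ltr_pdivlMr// -ltr_sqr ?nnegrE ?mulr_ge0 ?ltW// exprMn rs.
  by rewrite expr2; lra.
by rewrite ltr_pdivrMr// mul1r -ltr_sqr ?nnegrE ?ltW// rs; lra.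
Qed.

Lemma sal_spec x y : I x -> 0 <= sal x y <= 1 /\ bessel_deriv 0 (sal x y) = sy x y.
Proof. by move=> Ix; have /andP[y4 y1] := sy_bounds y Ix; apply: bessel_J0_inv_spec; exact: ltW. Qed.

Lemma vsmooth_sV : vsmooth I sV.
Proof.
by apply: vsmoothD; apply: vsmoothZ; try exact: smooth_cst; [exact: vsmooth_dx|exact: vsmooth_dy].
Qed.

Lemma vsmooth_sW : vsmooth I sW.
Proof.
by apply: vsmoothD; apply: vsmoothZ; try exact: smooth_cst; [exact: vsmooth_dx|exact: vsmooth_dy].
Qed.

Lemma vsmooth_sU : vsmooth I sU.
Proof.
apply: vsmoothZ; first exact: smooth_cst.
apply: vsmoothD; first exact: vsmooth_sV.
apply: vsmoothZ; last exact: vsmooth_sW.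
apply: smoothN; apply: smoothM; first by apply: smooth_dot; [exact: vsmooth_sV|exact: vsmooth_sW].
by apply: smoothV => //; [move=> x y Ix; exact: sW_gt0|apply: smooth_dot; exact: vsmooth_sW].
Qed.

Lemma smooth_eU : smooth I (fun x y => enorm (sU x y)).
Proof. by apply: smooth_enorm => //; [move=> x y Ix; exact: sU_gt0|exact: vsmooth_sU]. Qed.

Lemma smooth_sr : smooth I sr.
Proof.
apply: smooth_sqrt => //; first by move=> x y Ix; rewrite addr_gt0 ?eta0// sU_gt0.
by apply: smoothD => //; apply: smooth_dot; exact: vsmooth_sU.
Qed.

Lemma smooth_sal : smooth I sal.
Proof.
apply: (@smooth_comp _ I [set y : R | 4 / 5 < y < 1] (fun y _ => bessel_J0_inv y) sy (fun _ _ => 0)) => //.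
- rewrite (_ : [set _ | _] = `](4 / 5), 1[%classic); first exact: interval_open.
  by apply/seteqP; split => x /=; rewrite in_itv.
- by move=> x y Ix; exact: sy_bounds.
- exact: smooth_bessel_J0_inv.
- apply: smoothM; first exact: smooth_eU.
  by apply: smoothV => //; [move=> x y Ix; exact: sr_gt0|exact: smooth_sr].
- exact: smooth_cst.
Qed.

Lemma vsmooth_sA : vsmooth I sA.
Proof.
apply: vsmoothZ; first by apply: smoothM => //; exact: smooth_sr.
apply: vsmoothZ; last exact: vsmooth_sU.
by apply: smoothV => //; [move=> x y Ix; exact: senorm_gt0|exact: smooth_eU].
Qed.

Lemma vsmooth_sB : vsmooth I sB.
Proof.
apply: vsmoothZ; first by apply: smoothM => //; exact: smooth_sr.
apply: vsmoothZ; last by apply: vsmooth_cross; [exact: vsmooth_sU|exact: vsmooth_sW].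
apply: smoothV => //.
  by move=> x y Ix; rewrite mulr_gt0 ?senorm_gt0// sqrtr_gt0 sW_gt0.
apply: smoothM; first exact: smooth_eU.
by apply: smooth_enorm => //; [move=> x y Ix; exact: sW_gt0|exact: vsmooth_sW].
Qed.

Lemma smooth_sphase N : smooth I (sphase N).
Proof.
apply: smoothM; first exact: smooth_cst.
apply: smoothD; apply: smoothM; try exact: smooth_cst; [exact: smooth_fst|exact: smooth_snd].
Qed.

Lemma smooth_PPterm m beta N : smooth I (fun x y => osc_excursion m beta (sal x y) (sphase N x y)).
Proof.
apply: (@smooth_comp _ I setT (osc_excursion m beta) sal (sphase N)) => //.
- exact: openT.
- by apply: smooth_osc_excursion; exact: openT.
- exact: smooth_sal.
- exact: smooth_sphase.
Qed.

Lemma vsmooth_corrug N : vsmooth I (corrug N).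
Proof.
apply: vsmoothD => //; apply: vsmoothZ; first exact: smooth_cst.
by apply: vsmoothD; apply: vsmoothZ; try exact: smooth_PPterm; [exact: vsmooth_sA|exact: vsmooth_sB].
Qed.

Lemma per_sU : per sU /\ per sW.
Proof.
have [pf _ _ _] := ok.2.2; have px := per_vdx pf; have py := per_vdy pf.
by split=> x y; rewrite /sU /sS /sV /sW px py.
Qed.

Lemma per_sr : per sr.
Proof. by have [_ pe _ _] := ok.2.2; have [pU pW] := per_sU => x y; rewrite /sr pe pU. Qed.

Lemma per_sal : per sal.
Proof. by have pr := per_sr; have [pU pW] := per_sU => x y; rewrite /sal /sy pr pU. Qed.

Lemma per_sA : per sA.
Proof.
have [_ _ pp _] := ok.2.2; have pr := per_sr; have [pU pW] := per_sU => x y.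
by rewrite /sA /st pr pp pU.
Qed.

Lemma per_sB : per sB.
Proof.
have [_ _ pp _] := ok.2.2; have pr := per_sr; have [pU pW] := per_sU => x y.
by rewrite /sB /sn pr pp pU pW.
Qed.

Lemma per_corrug N : per (corrug N).
Proof.
have [pf _ _ [k bk]] := ok.2.2 => x y.
rewrite /corrug pf per_sal per_sA per_sB.
(* One turn adds the integer [N k] to the phase, which the 1-periodic [osc_excursion] does not
   see. *)
have -> : sphase N x (y + 2 * pi) = sphase N x y + (Posz N * k)%:~R.
  by rewrite /sphase intrM -bk pmulrn; ring.
by rewrite !osc_excursion_int.
Qed.

Lemma corrug_id N x y : psi x y = 0 -> corrug N x y = f x y.
Proof. by move=> p0; rewrite /corrug /sA /sB p0 !mul0r !scale0r !scaler0 addr0 scaler0 addr0. Qed.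

(* [G] is the excursion of the loop from its average. *)
Definition sG (s : R) x y := (sr x y * (cos (sal x y * cos (2 * pi * s)) - sy x y)) *: st x y +
  (sr x y * sin (sal x y * cos (2 * pi * s))) *: sn x y.

Lemma st_sqr x y : I x -> dot (st x y) (st x y) = 1.
Proof.
move=> Ix; have U0 := senorm_gt0 y Ix.
by move: U0; rewrite /st; move: (sU x y) => U U0; rewrite !dotE -enorm_sqr; field; rewrite gt_eqF.
Qed.

Lemma sn_sqr x y : I x -> dot (sn x y) (sn x y) = 1.
Proof.
move=> Ix; have U0 := senorm_gt0 y Ix; have W0 : 0 < enorm (sW x y) by rewrite sqrtr_gt0 sW_gt0.
have UW := sUW y Ix; rewrite /sn; move: (sU x y) (sW x y) UW U0 W0 => U W UW U0 W0.
rewrite !dotE dot_cross UW expr0n subr0 -!enorm_sqr.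
by field; rewrite !gt_eqF.
Qed.

Lemma st_sn x y : dot (st x y) (sn x y) = 0.
Proof. by rewrite /st /sn; move: (sU x y) (sW x y) => U W; rewrite !dotE dotC cross_dotl !mulr0. Qed.

Lemma st_sW x y : I x -> dot (st x y) (sW x y) = 0.
Proof. by move=> Ix; rewrite /st dotZl sUW// mulr0. Qed.

Lemma sn_sW x y : dot (sn x y) (sW x y) = 0.
Proof. by rewrite /sn dotZl cross_dotr mulr0. Qed.

Lemma sU_st x y : I x -> sU x y = (sr x y * sy x y) *: st x y.
Proof.
move=> Ix; have U0 := senorm_gt0 y Ix; have r0 := sr_gt0 y Ix.
by rewrite /st scalerA /sy mulrCA divff ?mulr1 ?gt_eqF// divff ?scale1r// gt_eqF.
Qed.

(** The loop runs on a circle of radius [sr] in the plane orthogonal to [W], and its average is [U];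
    hence the first two properties. The last one is [loop_excursion] multiplied by [sr ^+ 2], since
    [eta = sr^2 (1 - sy^2)]. *)
Lemma sG_spec s x y : I x ->
  [/\ dot (sG s x y) (sW x y) = 0,
      dot (sU x y + sG s x y) (sU x y + sG s x y) = eta x y + dot (sU x y) (sU x y) &
      dot (sG s x y) (sG s x y) <= 9 * eta x y].
Proof.
move=> Ix; have r0 := sr_gt0 y Ix; have rs := sr_sqr y Ix.
have tt := st_sqr y Ix; have nn := sn_sqr y Ix; have tn := st_sn x y.
have nt : dot (sn x y) (st x y) = 0 by rewrite dotC.
set th := sal x y * cos (2 * pi * s).
have cs := cos2Dsin2 th.
split.
- have tW := st_sW y Ix; have nW := sn_sW x y; rewrite /sG.
  move: (st x y) (sn x y) (sW x y) tW nW => t n W tW nW.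
  by rewrite !dotE tW nW !mulr0 addr0.
- have -> : sU x y + sG s x y = (sr x y * cos th) *: st x y + (sr x y * sin th) *: sn x y.
    rewrite {1}sU_st// /sG -!/th; move: (st x y) (sn x y) => t n.
    by apply/rowP => j; rewrite !mxE; ring.
  rewrite -rs; move: (st x y) (sn x y) tt nn tn nt => t n tt nn tn nt.
  rewrite !dotE tt nn tn nt.
  transitivity (sr x y ^+ 2 * (cos th ^+ 2 + sin th ^+ 2)); first ring.
  by rewrite cs mulr1.
- have -> : dot (sG s x y) (sG s x y) = sr x y ^+ 2 * (1 - 2 * sy x y * cos th + sy x y ^+ 2).
    rewrite /sG -!/th; move: (st x y) (sn x y) tt nn tn nt => t n tt nn tn nt.
    rewrite !dotE tt nn tn nt.
    transitivity (sr x y ^+ 2 * ((cos th ^+ 2 + sin th ^+ 2) - 2 * sy x y * cos th + sy x y ^+ 2)); first ring.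
    by rewrite cs.
  have /andP[y4 y1] := sy_bounds y Ix.
  have [/andP[al0 al1] _] := sal_spec y Ix.
  have tha : `|th| <= bessel_J0_inv (sy x y).
    by rewrite /th normrM ger0_norm// ler_piMr// cos_max.
  have := loop_excursion (ltW y4) (ltW y1) tha.
  have -> : eta x y = sr x y ^+ 2 * (1 - sy x y ^+ 2).
    rewrite mulrBr mulr1 -exprMn rs.
    have -> : sr x y * sy x y = enorm (sU x y) by rewrite /sy mulrCA divff ?mulr1// gt_eqF.
    by rewrite enorm_sqr addrK.
  move=> h; rewrite -subr_ge0 in h; have h' := mulr_ge0 (sqr_ge0 (sr x y)) h.
  rewrite -subr_ge0; apply: le_trans h' _; rewrite le_eqVlt; apply/orP; left; apply/eqP; ring.
Qed.

(** Product and chain rules for one of the two terms of [corrug]; the frequency appears as a factor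
    in the first summand only. *)
Lemma PPterm_dx (A : R -> R -> R) beta N x y : I x -> smooth I A ->
  is_derive x (1 : R) (fun x => osc_excursion 0 beta (sal x y) (sphase N x y) * A x y)
   (N%:R * a * (osc 0 beta (sal x y) (sphase N x y) - osc_integral 0 beta (sal x y) 1) * A x y +
    (osc_excursion 1 (beta + pi / 2) (sal x y) (sphase N x y) * dx sal x y * A x y +
     osc_excursion 0 beta (sal x y) (sphase N x y) * dx A x y)).
Proof.
move=> Ix sA_.
have dp : is_derive x (1 : R) (sphase N ^~ y) (N%:R * a).
  have da := is_derive_mul (is_derive_cst a x (1 : R)) (is_derive_id x (1 : R)).
  have ds := is_deriveD da (is_derive_cst (b * y) x (1 : R)).
  have := is_derive_mul (is_derive_cst (N%:R : R) x (1 : R)) ds.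
  by apply: is_derive_congr => // ; rewrite /cst; ring.
have dc := @is_derive_comp2 R (osc_excursion 0 beta) (osc_excursion 1 (beta + pi / 2)) _ (sal ^~ y) (sphase N ^~ y) x _ _ setT openT Logic.I
  (fun a' b' _ => osc_excursion_da 0 beta a' b') (smooth_jcont (smooth_osc_excursion 1 (beta + pi / 2) openT) Logic.I)
  (osc_excursion_dx 0 beta (sal x y) (sphase N x y)) (smooth_dxP y smooth_sal Ix) dp.
apply: is_derive_congr (is_derive_mul dc (smooth_dxP y sA_ Ix)) => //=.
by ring.
Qed.

Lemma PPterm_dy (A : R -> R -> R) beta N x y : I x -> smooth I A ->
  is_derive y (1 : R) (fun y => osc_excursion 0 beta (sal x y) (sphase N x y) * A x y)
   (N%:R * b * (osc 0 beta (sal x y) (sphase N x y) - osc_integral 0 beta (sal x y) 1) * A x y +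
    (osc_excursion 1 (beta + pi / 2) (sal x y) (sphase N x y) * dy sal x y * A x y +
     osc_excursion 0 beta (sal x y) (sphase N x y) * dy A x y)).
Proof.
move=> Ix sA_.
have dp : is_derive y (1 : R) (sphase N x) (N%:R * b).
  have da := is_derive_mul (is_derive_cst b y (1 : R)) (is_derive_id y (1 : R)).
  have ds := is_deriveD (is_derive_cst (a * x) y (1 : R)) da.
  have := is_derive_mul (is_derive_cst (N%:R : R) y (1 : R)) ds.
  by apply: is_derive_congr => // ; rewrite /cst; ring.
have dc := @is_derive_comp2 R (osc_excursion 0 beta) (osc_excursion 1 (beta + pi / 2)) _ (sal x) (sphase N x) y _ _ setT openT Logic.I
  (fun a' b' _ => osc_excursion_da 0 beta a' b') (smooth_jcont (smooth_osc_excursion 1 (beta + pi / 2) openT) Logic.I)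
  (osc_excursion_dx 0 beta (sal x y) (sphase N x y)) (smooth_dyP y smooth_sal Ix) dp.
apply: is_derive_congr (is_derive_mul dc (smooth_dyP y sA_ Ix)) => //=.
by ring.
Qed.

(** The part of the derivative without the factor [N], where amplitude and frame are differentiated
    and the phase is not. The operators [d] and [vd] are arguments, to serve for both variables. *)
Definition sE (d : (R -> R -> R) -> R -> R -> R) (vd : (R -> R -> 'rV[R]_3) -> R -> R -> 'rV[R]_3) N x y :=
  (osc_excursion 1 (0 + pi / 2) (sal x y) (sphase N x y) * d sal x y) *: sA x y +
  osc_excursion 0 0 (sal x y) (sphase N x y) *: vd sA x y +
  ((osc_excursion 1 (- (pi / 2) + pi / 2) (sal x y) (sphase N x y) * d sal x y) *: sB x y +
  osc_excursion 0 (- (pi / 2)) (sal x y) (sphase N x y) *: vd sB x y).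

Lemma osc_integral_sy x y : I x -> osc_integral 0 0 (sal x y) 1 = sy x y.
Proof. by move=> Ix; have [_ <-] := sal_spec y Ix; rewrite /bessel_deriv mul0r. Qed.

Lemma corrugE N x y j : corrug N x y 0 j = f x y 0 j + N%:R^-1 *
  (osc_excursion 0 0 (sal x y) (sphase N x y) * sA x y 0 j + osc_excursion 0 (- (pi / 2)) (sal x y) (sphase N x y) * sB x y 0 j).
Proof. by rewrite /corrug rV3D rV3Z rV3D !rV3Z. Qed.

Lemma sA_coord x y j : sA x y 0 j = psi x y * sr x y * st x y 0 j.
Proof. by rewrite /sA rV3Z. Qed.

Lemma sB_coord x y j : sB x y 0 j = psi x y * sr x y * sn x y 0 j.
Proof. by rewrite /sB rV3Z. Qed.

Lemma sG_coord s x y j : sG s x y 0 j =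
  (sr x y * (cos (sal x y * cos (2 * pi * s)) - sy x y)) * st x y 0 j +
  (sr x y * sin (sal x y * cos (2 * pi * s))) * sn x y 0 j.
Proof. by rewrite /sG rV3D !rV3Z. Qed.

Lemma sE_coord d vd N x y j : sE d vd N x y 0 j =
  (osc_excursion 1 (0 + pi / 2) (sal x y) (sphase N x y) * d sal x y) * sA x y 0 j +
  osc_excursion 0 0 (sal x y) (sphase N x y) * vd sA x y 0 j +
  ((osc_excursion 1 (- (pi / 2) + pi / 2) (sal x y) (sphase N x y) * d sal x y) * sB x y 0 j +
  osc_excursion 0 (- (pi / 2)) (sal x y) (sphase N x y) * vd sB x y 0 j).
Proof. by rewrite /sE !rV3D !rV3Z. Qed.

Opaque sU sW sV sS sA sB st sn sG sE sr sy sal sphase corrug vdx vdy.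

(** The average of the cosine term over a period is J_0 of the amplitude, that is [sy], and that of
    the sine term is 0: the leading term is exactly the excursion [sG]. *)
Lemma vdx_corrug N x y : (0 < N)%N -> I x ->
  vdx (corrug N) x y = vdx f x y + (psi x y * a) *: sG (sphase N x y) x y + N%:R^-1 *: sE dx vdx N x y.
Proof.
move=> N0 Ix; apply/rowP => j.
have Nn : (N%:R : R) != 0 by rewrite pnatr_eq0 -lt0n.
have fe : (fun x => corrug N x y 0 j) = (fun z => f z y 0 j + N%:R^-1 * (osc_excursion 0 0 (sal z y) (sphase N z y) * sA z y 0 j + osc_excursion 0 (- (pi / 2)) (sal z y) (sphase N z y) * sB z y 0 j)).
  by apply/funext => z; rewrite corrugE.
have dC := is_derive_affine2 N%:R^-1 (smooth_dxP y (sf j) Ix)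
  (PPterm_dx 0 N y Ix (vsmooth_sA j)) (PPterm_dx (- (pi / 2)) N y Ix (vsmooth_sB j)).
have dC' := eq_ind_r (fun g : R -> R => is_derive x (1 : R) g _) dC fe.
apply: (etrans (vdx_val dC')); apply/esym; apply: (etrans (rV3_lin _ _ _ _ _ _)).
rewrite sE_coord sG_coord.
apply: step_algebra.
- exact: Nn.
- exact: vdx_coord.
- exact: vdx_coord.
- exact: vdx_coord.
- exact: sA_coord.
- exact: sB_coord.
- by rewrite /osc expr0 mul1r  addr0.
- exact: osc_integral_sy.
- by rewrite /osc expr0 mul1r cosBpihalf.
- exact: osc_integral_sin.
Qed.

Lemma vdy_corrug N x y : (0 < N)%N -> I x ->
  vdy (corrug N) x y = vdy f x y + (psi x y * b) *: sG (sphase N x y) x y + N%:R^-1 *: sE dy vdy N x y.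
Proof.
move=> N0 Ix; apply/rowP => j.
have Nn : (N%:R : R) != 0 by rewrite pnatr_eq0 -lt0n.
have fe : (fun y => corrug N x y 0 j) = (fun z => f x z 0 j + N%:R^-1 * (osc_excursion 0 0 (sal x z) (sphase N x z) * sA x z 0 j + osc_excursion 0 (- (pi / 2)) (sal x z) (sphase N x z) * sB x z 0 j)).
  by apply/funext => z; rewrite corrugE.
have dC := is_derive_affine2 N%:R^-1 (smooth_dyP y (sf j) Ix)
  (PPterm_dy 0 N y Ix (vsmooth_sA j)) (PPterm_dy (- (pi / 2)) N y Ix (vsmooth_sB j)).
have dC' := eq_ind_r (fun g : R -> R => is_derive y (1 : R) g _) dC fe.
apply: (etrans (vdy_val dC')); apply/esym; apply: (etrans (rV3_lin _ _ _ _ _ _)).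
rewrite sE_coord sG_coord.
apply: step_algebra.
- exact: Nn.
- exact: vdy_coord.
- exact: vdy_coord.
- exact: vdy_coord.
- exact: sA_coord.
- exact: sB_coord.
- by rewrite /osc expr0 mul1r  addr0.
- exact: osc_integral_sy.
- by rewrite /osc expr0 mul1r cosBpihalf.
- exact: osc_integral_sin.
Qed.

Transparent sU sW sV sS sA sB st sn sG sE sr sy sal sphase corrug vdx vdy.

Lemma vbounded (A : R -> R -> 'rV[R]_3) (r1 r2 : R) : (forall x, r1 <= x <= r2 -> I x) ->
  vsmooth I A -> per A -> exists K : R, forall x y, r1 <= x <= r2 -> enorm (A x y) <= K.
Proof.
move=> rI sA_ pA.
have pd : per (fun x y => dot (A x y) (A x y)) by move=> x y; rewrite pA.
have [K HK] := bounded_periodic rI (fun x y => @smooth_jcont _ _ _ x y (smooth_dot sA_ sA_)) pd.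
exists (K + 1) => x y xr; have := HK x y xr; rewrite ger0_norm ?dot_ge0// -enorm_sqr => h.
have e0 := enorm_ge0 (A x y); nra.
Qed.

(** The bound is uniform in [N], because the frequency enters only through [osc_excursion], bounded
    by 2. *)
Lemma sE_bound (r1 r2 : R) : (forall x, r1 <= x <= r2 -> I x) ->
  exists K : R, forall N x y, r1 <= x <= r2 ->
   [/\ enorm (osc_excursion 0 0 (sal x y) (sphase N x y) *: sA x y +
         osc_excursion 0 (- (pi / 2)) (sal x y) (sphase N x y) *: sB x y) <= K,
       enorm (sE dx vdx N x y) <= K & enorm (sE dy vdy N x y) <= K].
Proof.
move=> rI.
have [kA HA] := vbounded rI vsmooth_sA per_sA.
have [kB HB] := vbounded rI vsmooth_sB per_sB.
have [kAx HAx] := vbounded rI (vsmooth_dx oI vsmooth_sA) (per_vdx per_sA).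
have [kBx HBx] := vbounded rI (vsmooth_dx oI vsmooth_sB) (per_vdx per_sB).
have [kAy HAy] := vbounded rI (vsmooth_dy oI vsmooth_sA) (per_vdy per_sA).
have [kBy HBy] := vbounded rI (vsmooth_dy oI vsmooth_sB) (per_vdy per_sB).
have [kx Hx] := bounded_periodic rI (fun x y => @smooth_jcont _ _ _ x y (smooth_dx oI smooth_sal)) (per_dx per_sal).
have [ky Hy] := bounded_periodic rI (fun x y => @smooth_jcont _ _ _ x y (smooth_dy oI smooth_sal)) (per_dy per_sal).
have b1 (p q kA' kB' : R) (A B : 'rV[R]_3) : `|p| <= 2 -> `|q| <= 2 -> enorm A <= kA' -> enorm B <= kB' ->
    enorm (p *: A + q *: B) <= 2 * kA' + 2 * kB'.
  move=> p2 q2 Ak Bk; apply: le_trans (enormD _ _) _.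
  by rewrite !enormZ; apply: lerD; rewrite ler_pM// enorm_ge0.
have b2 (p d q kd kA' kB' : R) (A B : 'rV[R]_3) : `|p| <= 2 -> `|d| <= kd -> `|q| <= 2 ->
    enorm A <= kA' -> enorm B <= kB' -> enorm ((p * d) *: A + q *: B) <= 2 * kd * kA' + 2 * kB'.
  move=> p2 dk q2 Ak Bk; apply: le_trans (enormD _ _) _.
  by rewrite !enormZ normrM; apply: lerD; rewrite ler_pM ?mulr_ge0 ?enorm_ge0// ler_pM.
pose K1 := 2 * kA + 2 * kB.
pose K2 := (2 * kx * kA + 2 * kAx) + (2 * kx * kB + 2 * kBx).
pose K3 := (2 * ky * kA + 2 * kAy) + (2 * ky * kB + 2 * kBy).
exists (`|K1| + `|K2| + `|K3|) => N x y xr.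
have n1 := ler_norm K1; have n2 := ler_norm K2; have n3 := ler_norm K3.
have n1' := normr_ge0 K1; have n2' := normr_ge0 K2; have n3' := normr_ge0 K3.
split.
- apply: (@le_trans _ _ K1); last lra.
  exact: b1 (osc_excursion_le2 _ _ _ _) (osc_excursion_le2 _ _ _ _) (HA x y xr) (HB x y xr).
- apply: (@le_trans _ _ K2); last lra.
  apply: le_trans (enormD _ _) (lerD _ _).
    exact: b2 (osc_excursion_le2 _ _ _ _) (Hx x y xr) (osc_excursion_le2 _ _ _ _) (HA x y xr) (HAx x y xr).
  exact: b2 (osc_excursion_le2 _ _ _ _) (Hx x y xr) (osc_excursion_le2 _ _ _ _) (HB x y xr) (HBx x y xr).
- apply: (@le_trans _ _ K3); last lra.
  apply: le_trans (enormD _ _) (lerD _ _).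
    exact: b2 (osc_excursion_le2 _ _ _ _) (Hy x y xr) (osc_excursion_le2 _ _ _ _) (HA x y xr) (HAy x y xr).
  exact: b2 (osc_excursion_le2 _ _ _ _) (Hy x y xr) (osc_excursion_le2 _ _ _ _) (HB x y xr) (HBy x y xr).
Qed.

End Step.

(** * Effect of a step on the map, its derivatives and its metric *)

Section StepEstimate.
Context {R : realType}.
Implicit Types (f : R -> R -> 'rV[R]_3).

Definition coef_E f x y : R := dot (vdx f x y) (vdx f x y).
Definition coef_F f x y : R := dot (vdx f x y) (vdy f x y).
Definition coef_G f x y : R := dot (vdy f x y) (vdy f x y).

(** The condition [d <= 1] absorbs the quadratic error into the linear one. *)
Lemma dot_perturb (X Y e1 e2 : 'rV[R]_3) (M d : R) : enorm X <= M -> enorm Y <= M ->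
  enorm e1 <= d -> enorm e2 <= d -> d <= 1 ->
  `|dot (X + e1) (Y + e2) - dot X Y| <= (2 * M + 1) * d.
Proof.
move=> XM YM e1d e2d d1.
have d0 : 0 <= d by apply: le_trans (enorm_ge0 _) e1d.
have -> : dot (X + e1) (Y + e2) - dot X Y = dot X e2 + dot e1 Y + dot e1 e2.
  by rewrite !dotE; ring.
have h (A B : 'rV[R]_3) a b : enorm A <= a -> enorm B <= b -> `|dot A B| <= a * b.
  move=> Aa Bb; apply: le_trans (cauchy_schwarz _ _) _.
  by rewrite ler_pM ?enorm_ge0.
have h1 := h _ _ _ _ XM e2d; have h2 := h _ _ _ _ e1d YM; have h3 := h _ _ _ _ e1d e2d.
apply: le_trans (ler_normD _ _) _; apply: le_trans (lerD (ler_normD _ _) (lexx _)) _.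
have : d * d <= d by rewrite ler_piMl.
lra.
Qed.

Lemma le_sqr1D (q : R) : 0 <= q -> q <= (1 + q) ^+ 2.
Proof. by move=> q0; rewrite expr2; nra. Qed.

Lemma step_bound_aux (k kx ky s t na nb q : R) : 0 <= na -> 0 <= nb -> 0 <= t -> k <= kx ->
  0 <= ky -> s <= t -> q <= k + 3 * s * na -> q <= kx + ky + (3 * t) * (na + nb).
Proof.
move=> na0 nb0 t0 kk ky0 st; have h : s * na <= t * na by rewrite ler_wpM2r.
have : 0 <= t * nb by rewrite mulr_ge0.
lra.
Qed.

Lemma enorm_contract (p l s : R) (G : 'rV[R]_3) : 0 <= p <= 1 -> enorm G <= 3 * s ->
  enorm ((p * l) *: G) <= 3 * s * `|l|.
Proof.
move=> p01 Gs; rewrite enormZ normrM mulrAC; apply: ler_wpM2r => //.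
apply: le_trans Gs; apply: ler_piMl; first exact: enorm_ge0.
by rewrite ger0_norm; lra.
Qed.

Lemma add3K (u v w : 'rV[R]_3) : u + v + w - u = v + w.
Proof. by apply/rowP => j; rewrite !mxE; ring. Qed.

Lemma small_quotient (K e : R) : 0 < e -> exists N0 : nat, forall N : nat, (N0 <= N)%N -> (0 < N)%N ->
  forall u : 'rV[R]_3, enorm u <= K -> enorm (N%:R^-1 *: u) <= e.
Proof.
move=> e0; exists (Num.bound (K / e)) => N NN N0 u uK.
have Np : (0 : R) < N%:R by rewrite ltr0n.
rewrite enormZ gtr0_norm ?invr_gt0// mulrC ler_pdivrMr//.
apply: le_trans uK _; rewrite mulrC -ler_pdivrMr//.
apply: le_trans (ler_norm _) _; apply: le_trans (ltW (archi_boundP (normr_ge0 _))) _.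
rewrite ler_nat; apply: leq_trans NN.
by rewrite /Num.bound normr_id.
Qed.

Variables (I : set R) (f : R -> R -> 'rV[R]_3) (eta psi : R -> R -> R) (a b : R).
Hypothesis ok : step_ok I f eta psi a b.

(** Since [2 <U, G> = eta - |G|^2], the metric gains [c] times the square of the phase form, with
    [c = psi eta - psi (1 - psi) |G|^2]. The bound [|G|^2 <= 9 eta] then gives [c >= - 2 eta],
    because [9 p^2 - 8 p + 2] is positive. *)
Lemma step_pointwise (G : 'rV[R]_3) x y : I x ->
  dot G (sW f a b x y) = 0 ->
  dot (sU f a b x y + G) (sU f a b x y + G) = eta x y + dot (sU f a b x y) (sU f a b x y) ->
  dot G G <= 9 * eta x y ->
  exists c, [/\ - (2 * eta x y) <= c <= eta x y, psi x y = 1 -> c = eta x y,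
    dot (vdx f x y + (psi x y * a) *: G) (vdx f x y + (psi x y * a) *: G) = coef_E f x y + c * a ^+ 2,
    dot (vdx f x y + (psi x y * a) *: G) (vdy f x y + (psi x y * b) *: G) = coef_F f x y + c * (a * b) &
    dot (vdy f x y + (psi x y * b) *: G) (vdy f x y + (psi x y * b) *: G) = coef_G f x y + c * b ^+ 2].
Proof.
move=> Ix GW UG GG.
have p01 : 0 <= psi x y <= 1 by case: ok => _ [[]].
have e0 : 0 < eta x y by case: ok => _ [[_ + _ _ _] _]; exact.
have ab : a ^+ 2 + b ^+ 2 != 0 by rewrite gt_eqF//; case: ok => _ [[]].
have XG : dot (vdx f x y) G = a * dot (sU f a b x y) G.
  rewrite (sX_decomp ok); move: (sU f a b x y) (sW f a b x y) (sS f a b x y) GW => U W s' GW.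
  by rewrite !dotE (dotC W) GW; ring.
have YG : dot (vdy f x y) G = b * dot (sU f a b x y) G.
  rewrite (sY_decomp ok); move: (sU f a b x y) (sW f a b x y) (sS f a b x y) GW => U W s' GW.
  by rewrite !dotE (dotC W) GW; ring.
have UG2 : 2 * dot (sU f a b x y) G = eta x y - dot G G.
  move: UG; move: (sU f a b x y) => U; rewrite !dotE (dotC G U) => h; lra.
exists (psi x y * eta x y - psi x y * (1 - psi x y) * dot G G).
have G0 := dot_ge0 G.
rewrite /coef_E /coef_F /coef_G; move: XG YG UG2; move: (vdx f x y) (vdy f x y) (sU f a b x y) => X Y U XG YG UG2.
split.
- move: (psi x y) p01 => p /andP[p0 p1]; apply/andP; split.
    have q0 : 0 <= p * (1 - p) by rewrite mulr_ge0//; lra.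
    have : p * (1 - p) * dot G G <= p * (1 - p) * (9 * eta x y) by rewrite ler_wpM2l.
    have : 0 <= eta x y * (9 * p ^+ 2 - 8 * p + 2).
      by rewrite mulr_ge0 ?(ltW e0)//; have := sqr_ge0 (9 * p - 4); nra.
    nra.
  have : 0 <= p * (1 - p) * dot G G by rewrite !mulr_ge0//; lra.
  nra.
- by move=> ->; rewrite subrr mulr0 mul0r subr0 mul1r.
- rewrite !dotE (dotC G X) XG; move: (dot G G) (dot X X) (dot U G) UG2 => g E u UG2.
  have -> : eta x y = 2 * u + g by lra.
  by ring.
- rewrite !dotE (dotC G Y) XG YG; move: (dot G G) (dot X Y) (dot U G) UG2 => g E u UG2.
  have -> : eta x y = 2 * u + g by lra.
  by ring.
- rewrite !dotE (dotC G Y) YG; move: (dot G G) (dot Y Y) (dot U G) UG2 => g E u UG2.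
  have -> : eta x y = 2 * u + g by lra.
  by ring.
Qed.

Lemma step_estimate (r1 r2 e : R) : (forall x, r1 <= x <= r2 -> I x) -> 0 < e ->
  exists N0 : nat, forall N : nat, (N0 <= N)%N -> (0 < N)%N -> forall x y, r1 <= x <= r2 ->
  let F := corrug f eta psi a b N in
  [/\ enorm (F x y - f x y) <= e,
      enorm (vdx F x y - vdx f x y) <= 3 * Num.sqrt (eta x y) * `|a| + e,
      enorm (vdy F x y - vdy f x y) <= 3 * Num.sqrt (eta x y) * `|b| + e &
      exists c, [/\ - (2 * eta x y) <= c <= eta x y, psi x y = 1 -> c = eta x y,
       `|coef_E F x y - coef_E f x y - c * a ^+ 2| <= e,
       `|coef_F F x y - coef_F f x y - c * (a * b)| <= e &
       `|coef_G F x y - coef_G f x y - c * b ^+ 2| <= e]].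
Proof.
move=> rI e0.
have [[oI sf seta spsi] [[ab0 eta0 gr0 sm psi01] [pf pe pp _]]] := ok.
have [K HK] := sE_bound ok rI.
have [kx Hx] := vbounded rI (vsmooth_dx oI sf) (per_vdx pf).
have [ky Hy] := vbounded rI (vsmooth_dy oI sf) (per_vdy pf).
have [ke He] := bounded_periodic rI (fun x y => @smooth_jcont _ _ _ x y seta) pe.
pose M : R := `|kx| + `|ky| + (3 * (1 + `|ke|)) * (`|a| + `|b|).
have M0 : 0 <= M by rewrite /M !addr_ge0// mulr_ge0 ?addr_ge0// mulr_ge0// addr_ge0.
(* Size allowed to the O(1/N) terms: [M] bounds the derivatives once the excursion is added, and
   [2 M + 1] is the constant of [dot_perturb]. *)
pose d : R := Num.min 1 (e / (2 * M + 1)).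
have M1 : 0 < 2 * M + 1 by lra.
have d0 : 0 < d by rewrite lt_min ltr01 divr_gt0.
have d1 : d <= 1 by rewrite ge_min lexx.
have de : (2 * M + 1) * d <= e by rewrite mulrC -ler_pdivlMr// ge_min lexx orbT.
have de' : d <= e by apply: le_trans de; rewrite ler_peMl ?(ltW d0)//; lra.
have [N0 HN0] := small_quotient K d0.
exists N0 => N NN Npos x y xr F.
have Ix := rI x xr; have [k1 k2 k3] := HK N x y xr.
have [GW UG GG] := sG_spec ok (sphase a b N x y) y Ix.
set G := sG f eta a b (sphase a b N x y) x y in GW UG GG.
have Gn : enorm G <= 3 * Num.sqrt (eta x y).
  rewrite -ler_sqr ?nnegrE ?mulr_ge0 ?enorm_ge0 ?sqrtr_ge0// enorm_sqr exprMn (sqr_sqrtr (ltW (eta0 x y Ix))).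
  by apply: le_trans GG _; rewrite (_ : 3 ^+ 2 = 9 :> R)//; ring.
have sq : Num.sqrt (eta x y) <= 1 + `|ke|.
  have := He x y xr; rewrite gtr0_norm ?eta0// => ek.
  have kk := ler_norm ke.
  rewrite -ler_sqr ?nnegrE ?sqrtr_ge0 ?addr_ge0// (sqr_sqrtr (ltW (eta0 x y Ix))).
  exact: le_trans ek (le_trans kk (le_sqr1D (normr_ge0 ke))).
have p01 := psi01 x y.
have pG (l : R) : enorm ((psi x y * l) *: G) <= 3 * Num.sqrt (eta x y) * `|l|.
  exact: enorm_contract.
have t0 : 0 <= 1 + `|ke| by rewrite addr_ge0.
have bX : enorm (vdx f x y + (psi x y * a) *: G) <= M.
  apply: (step_bound_aux (normr_ge0 a) (normr_ge0 b) t0 (ler_norm kx) (normr_ge0 ky) sq).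
  by apply: le_trans (enormD _ _) _; apply: lerD; [exact: Hx|exact: pG].
have bY : enorm (vdy f x y + (psi x y * b) *: G) <= M.
  rewrite /M [`|kx| + _]addrC [`|a| + _]addrC.
  apply: (step_bound_aux (normr_ge0 b) (normr_ge0 a) t0 (ler_norm ky) (normr_ge0 kx) sq).
  by apply: le_trans (enormD _ _) _; apply: lerD; [exact: Hy|exact: pG].
have [e1 EX ex] : exists2 e1 : 'rV[R]_3, vdx F x y = vdx f x y + (psi x y * a) *: G + e1 & enorm e1 <= d.
  by exists (N%:R^-1 *: sE f eta psi a b dx vdx N x y); [exact: (vdx_corrug ok y Npos Ix)|exact: HN0].
have [e2 EY ey] : exists2 e2 : 'rV[R]_3, vdy F x y = vdy f x y + (psi x y * b) *: G + e2 & enorm e2 <= d.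
  by exists (N%:R^-1 *: sE f eta psi a b dy vdy N x y); [exact: (vdy_corrug ok y Npos Ix)|exact: HN0].
split.
- rewrite /F /corrug addrC addKr; apply: le_trans de'; exact: HN0.
- rewrite EX add3K; apply: le_trans (enormD _ _) _.
  by apply: lerD; [exact: pG|exact: le_trans ex de'].
- rewrite EY add3K; apply: le_trans (enormD _ _) _.
  by apply: lerD; [exact: pG|exact: le_trans ey de'].
have [c [c1 c2 cE cF cG]] := step_pointwise Ix GW UG GG.
exists c; split => //.
- rewrite -addrA -opprD -cE {1}/coef_E EX; apply: le_trans de; exact: dot_perturb.
- rewrite -addrA -opprD -cF {1}/coef_F EX EY; apply: le_trans de; exact: dot_perturb.
- rewrite -addrA -opprD -cG {1}/coef_G EY; apply: le_trans de; exact: dot_perturb.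
Qed.

End StepEstimate.

(** * Injectivity of the corrugated map *)

Section Injectivity.
Context {R : realType}.

(** Compactness of the set of pairs of points of a rectangle: the thresholds valid near each pair
    combine into a single one. *)
Lemma uniform_near2 (a b c d : R) (P : nat -> R -> R -> R -> R -> Prop) :
  (forall x y x' y', a <= x <= b -> c <= y <= d -> a <= x' <= b -> c <= y' <= d ->
    exists2 r : R, 0 < r & exists N0, forall N, (N0 <= N)%N -> forall X Y X' Y',
      `|x - X| < r -> `|y - Y| < r -> `|x' - X'| < r -> `|y' - Y'| < r -> P N X Y X' Y') ->
  exists N0, forall N, (N0 <= N)%N -> forall x y x' y', a <= x <= b -> c <= y <= d ->
    a <= x' <= b -> c <= y' <= d -> P N x y x' y'.
Proof.
move=> H.
pose A : set (R * R) := (`[a, b]%classic : set R) `*` (`[c, d]%classic : set R).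
have cA : compact A by apply: compact_setX; exact: segment_compact.
have cAA : compact (A `*` A) by exact: compact_setX.
move/compact_near_coveringP : cAA => /(_ nat \oo (fun N z => P N z.1.1 z.1.2 z.2.1 z.2.2)) near.
have [|N0 _ HN0] := near _.
  move=> [[x y] [x' y']] [] /= [] /=; rewrite !in_itv/= => xr yr [] /=; rewrite !in_itv/= => xr' yr'.
  have [r r0 [N0 HN0]] := H x y x' y' xr yr xr' yr'.
  exists (ball ((x, y), (x', y')) r, [set N | (N0 <= N)%N]).
    split; last by exists N0.
    exact: nbhsx_ballx.
  by move=> [[[X Y] [X' Y']] N] [/= [[/= bx by_] [/= bx' by_']] NN]; apply: HN0.
exists N0 => N NN x y x' y' xr yr xr' yr'.
by apply: (HN0 N NN ((x, y), (x', y'))); split; split; rewrite /= in_itv.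
Qed.

Lemma jcont_ball (g : R -> R -> R) x y (e : R) : jcont g x y -> 0 < e ->
  exists2 r : R, 0 < r & forall X Y, `|x - X| < r -> `|y - Y| < r -> `|g x y - g X Y| < e.
Proof.
move=> gc e0; have /nbhs_ballP[r r0 Hr] : \forall z \near (x, y), `|g x y - g z.1 z.2| < e.
  by move/cvgr_dist_lt : gc; apply.
exists r => // X Y hX hY.
by apply: (Hr (X, Y)).
Qed.

Lemma vjcont_ball (g : R -> R -> 'rV[R]_3) x y (e : R) :
  (forall j, jcont (fun x y => g x y 0 j) x y) -> 0 < e ->
  exists2 r : R, 0 < r & forall X Y, `|x - X| < r -> `|y - Y| < r -> enorm (g x y - g X Y) <= e.
Proof.
move=> gc e0; have e2 : 0 < e / 2 by rewrite divr_gt0.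
have [r0 p0 H0] := jcont_ball (gc 0) e2.
have [r1 p1 H1] := jcont_ball (gc 1) e2.
have [r2 p2 H2] := jcont_ball (gc 2%:R) e2.
exists (Num.min r0 (Num.min r1 r2)); first by rewrite !lt_min p0 p1.
move=> X Y; rewrite !lt_min => /and3P[x0 x1 x2] /and3P[y0 y1 y2].
have -> : e = 2 * (e / 2) by field.
apply: enorm3_le => j.
have -> : (g x y - g X Y) 0 j = g x y 0 j - g X Y 0 j by rewrite !mxE.
suff : j = 0 \/ j = 1 \/ j = 2%:R.
  by case=> [->|[->|->]]; apply: ltW; [exact: H0|exact: H1|exact: H2].
by case: j => -[|[|[|//]]] lt; [left|right;left|right;right]; apply/val_inj.
Qed.

(** The three contributions are [l/5], [l/50] for the variation of the square root, and [l/100];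
    their sum is below [l/4]. *)
Lemma eta_near_num (a l s s0 e : R) : 0 <= a -> 0 < l -> e <= l / 100 ->
  3 * s0 * a <= l / 5 -> `|s0 - s| < l / 50 / (3 * (a + 1)) -> 3 * s * a + e <= l / 4.
Proof.
move=> a0 l0 ee h; have a1 : 0 < 3 * (a + 1) by lra.
rewrite ltr_pdivlMr// distrC => hs.
have := ler_norm (s - s0); move: (`|s - s0|) hs => t hs ts.
have : (s - s0) * (3 * (a + 1)) <= t * (3 * (a + 1)) by rewrite ler_wpM2r// ltW.
have [ss|ss] := leP s s0.
  by have := ler_wpM2r a0 ss; lra.
have : 0 <= (s - s0) * 3 by rewrite mulr_ge0// subr_ge0 ltW.
lra.
Qed.

(** [7/10] exceeds [2 (1/50 + 1/4) = 27/50]. *)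
Lemma perturb_inj_num (l S : R) : 7 / 10 * l * S <= 2 * (l / 50 * S) + 2 * (l / 4 * S) -> l * S <= 0.
Proof. lra. Qed.

Lemma dxB (I : set R) (g h : R -> R -> R) x y : smooth I g -> smooth I h -> I x ->
  dx (fun x y => g x y - h x y) x y = dx g x y - dx h x y.
Proof.
by move=> sigma sh Ix; rewrite {1}/dx; have := is_deriveB (smooth_dxP y sigma Ix) (smooth_dxP y sh Ix) => ?; rewrite derive_val.
Qed.

Lemma dyB (I : set R) (g h : R -> R -> R) x y : smooth I g -> smooth I h -> I x ->
  dy (fun x y => g x y - h x y) x y = dy g x y - dy h x y.
Proof.
by move=> sigma sh Ix; rewrite {1}/dy; have := is_deriveB (smooth_dyP y sigma Ix) (smooth_dyP y sh Ix) => ?; rewrite derive_val.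
Qed.

Lemma rV3B (u v : 'rV[R]_3) j : (u - v) 0 j = u 0 j - v 0 j.
Proof. by rewrite !mxE. Qed.

Lemma enorm_sub_gt0 (u v : 'rV[R]_3) : u <> v -> 0 < enorm (u - v).
Proof.
move=> uv; rewrite lt_neqAle enorm_ge0 andbT eq_sym; apply/eqP => /enorm_eq0 /eqP.
by rewrite subr_eq0 => /eqP.
Qed.

Lemma dot_lin2 (u v : R) (X Y : 'rV[R]_3) : dot (u *: X + v *: Y) (u *: X + v *: Y) =
  dot X X * u ^+ 2 + 2 * dot X Y * u * v + dot Y Y * v ^+ 2.
Proof. by rewrite dotDl !dotDr !dotZl !dotZr (dotC Y X); ring. Qed.

Lemma vsmoothB (I : set R) (F f : R -> R -> 'rV[R]_3) : vsmooth I F -> vsmooth I f ->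
  vsmooth I (fun x y => F x y - f x y).
Proof.
move=> sF sf j; rewrite (_ : (fun x y => (F x y - f x y) 0 j) = fun x y => F x y 0 j - f x y 0 j).
  exact: smoothB.
by apply/funext => x; apply/funext => y; rewrite rV3B.
Qed.

Lemma vdxB (I : set R) (F f : R -> R -> 'rV[R]_3) x y : vsmooth I F -> vsmooth I f -> I x ->
  vdx (fun x y => F x y - f x y) x y = vdx F x y - vdx f x y.
Proof.
move=> sF sf Ix; apply/rowP => j; rewrite rV3B !vdx_coord -(dxB y (sF j) (sf j) Ix).
by congr (dx _ x y); apply/funext => u; apply/funext => v; rewrite rV3B.
Qed.

Lemma vdyB (I : set R) (F f : R -> R -> 'rV[R]_3) x y : vsmooth I F -> vsmooth I f -> I x ->
  vdy (fun x y => F x y - f x y) x y = vdy F x y - vdy f x y.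
Proof.
move=> sF sf Ix; apply/rowP => j; rewrite rV3B !vdy_coord -(dyB y (sF j) (sf j) Ix).
by congr (dy _ x y); apply/funext => u; apply/funext => v; rewrite rV3B.
Qed.

(** The two partial derivatives are taken at different points, one on each side of a path parallel
    to the axes. *)
Lemma mean_value2 (I : set R) (g : R -> R -> R) x y x' y' : smooth I g ->
  (forall z, Num.min x x' <= z <= Num.max x x' -> I z) -> I x ->
  exists X Y, [/\ Num.min x x' <= X <= Num.max x x', Num.min y y' <= Y <= Num.max y y' &
    g x' y' - g x y = dx g X y' * (x' - x) + dy g x Y * (y' - y)].
Proof.
move=> sigma xI Ix.
have [X Xr EX] := @mean_value R (g ^~ y') (dx g ^~ y') x x' (fun z zr => smooth_dxP y' sigma (xI z zr)).
have [Y Yr EY] := @mean_value R (g x) (dy g x) y y' (fun z _ => smooth_dyP z sigma Ix).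
by exists X, Y; split => //; rewrite -EX -EY; ring.
Qed.

Lemma between_dist (x x' z p r : R) : `|p - x| < r -> `|p - x'| < r ->
  Num.min x x' <= z <= Num.max x x' -> `|p - z| < r.
Proof.
rewrite !ltr_norml ge_min le_max => h h'.
by case: (leP x z) => xz; case: (leP x' z) => xz' /=; case: (leP z x) => zx /=; case: (leP z x') => zx' /=; lra.
Qed.

(** Equality of the points with these polar coordinates. Injectivity has to be stated modulo this
    relation, as angles are defined modulo [2 pi] and the line [x = 0] is collapsed. *)
Definition polar_eq (x y x' y' : R) := x * cos y = x' * cos y' /\ x * sin y = x' * sin y'.

Definition polar_inj (f : R -> R -> 'rV[R]_3) := forall x y x' y', 0 <= x <= 1 -> 0 <= x' <= 1 ->
  f x y = f x' y' -> polar_eq x y x' y'.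

Lemma cos_eq1 (t : R) : cos t = 1 -> exists k : int, t = k%:~R * (2 * pi).
Proof.
move=> ct; have [k /andP[t0 t2]] := angle_reduce t.
have ck : cos (t + k%:~R * (2 * pi)) = 1.
  have pc : per (fun _ y : R => cos y).
    by move=> u v; rewrite (_ : 2 * pi = pi *+ 2) ?cosD2pi// mulr_natl.
  by rewrite (per_int k 0 t pc).
have pp := pi_gt0 R.
suff [e|e] : t + k%:~R * (2 * pi) = 0 \/ t + k%:~R * (2 * pi) = 2 * pi.
- by exists (- k); rewrite mulrNz mulNr; lra.
- by exists (1 - k); rewrite intrB mulrBl; lra.
case: (leP (t + k%:~R * (2 * pi)) pi) => tp; [left|right].
  by apply: cos_inj; rewrite ?in_itv/= ?t0 ?tp ?lexx ?ltW// ck cos0.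
have : 2 * pi - (t + k%:~R * (2 * pi)) = 0; last lra.
apply: cos_inj; rewrite ?in_itv/= ?lexx ?(ltW pp)//; first by apply/andP; split; lra.
rewrite cos0 -cosN opprB -[RHS]ck.
rewrite -(@cosD2pi R (t + k%:~R * (2 * pi) - 2 * pi)).
by rewrite (_ : pi *+ 2 = 2 * pi) ?subrK// mulr_natl.
Qed.

Lemma polar_eq_angle x y x' y' : 0 < x -> 0 <= x' -> polar_eq x y x' y' ->
  x = x' /\ exists k : int, y' = y + k%:~R * (2 * pi).
Proof.
move=> x0 x0' [ec es].
have sq : x ^+ 2 = x' ^+ 2.
  have h1 := cos2Dsin2 y; have h2 := cos2Dsin2 y'.
  have -> : x ^+ 2 = (x * cos y) ^+ 2 + (x * sin y) ^+ 2 by rewrite !exprMn -mulrDr h1 mulr1.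
  by rewrite ec es !exprMn -mulrDr h2 mulr1.
have xx : x = x' by apply/eqP; rewrite -(@eqrXn2 _ 2)// ?(ltW x0)// sq.
split=> //; rewrite -xx in ec es.
have xn : x != 0 by rewrite gt_eqF.
have ec' := mulfI xn ec; have es' := mulfI xn es.
have [k kE] : exists k : int, y' - y = k%:~R * (2 * pi).
  by apply: cos_eq1; rewrite cosB ec' es' -!expr2 cos2Dsin2.
by exists k; rewrite -kE; ring.
Qed.

(** [7 / 10] is below [1 / sqrt 2], the best constant between the Euclidean norm and the sum of two
    coordinates. *)
Lemma quadratic_lower (l x u v q : R) : 0 <= l -> 0 <= x ->
  l ^+ 2 * (u ^+ 2 + x ^+ 2 * v ^+ 2) <= q ^+ 2 -> 0 <= q -> 7 / 10 * l * (`|u| + x * `|v|) <= q.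
Proof.
move=> l0 x0 h q0.
have S0 : 0 <= `|u| + x * `|v| by rewrite addr_ge0// mulr_ge0.
have L0 : 0 <= 7 / 10 * l * (`|u| + x * `|v|) by rewrite !mulr_ge0// ?divr_ge0.
rewrite -ler_sqr ?nnegrE//.
apply: le_trans h; rewrite -mulrA exprMn [(l * _) ^+ 2]exprMn mulrCA ler_wpM2l ?sqr_ge0//.
rewrite -(real_normK (num_real u)) -(real_normK (num_real v)).
have := sqr_ge0 (`|u| - x * `|v|).
have := sqr_ge0 (`|u| + x * `|v|).
rewrite -[x ^+ 2 * _]exprMn; move: (`|u|) (x * `|v|) => a c; rewrite !expr2; nra.
Qed.

Lemma mean_value_bound (I : set R) (g : R -> R -> 'rV[R]_3) (A B : 'rV[R]_3) (d d' r x0 y0 : R) :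
  vsmooth I g -> (forall x, `|x0 - x| < r -> I x) ->
  (forall x y, `|x0 - x| < r -> `|y0 - y| < r -> enorm (vdx g x y - A) <= d /\ enorm (vdy g x y - B) <= d') ->
  forall X Y X' Y', `|x0 - X| < r -> `|y0 - Y| < r -> `|x0 - X'| < r -> `|y0 - Y'| < r ->
  enorm (g X' Y' - g X Y - ((X' - X) *: A + (Y' - Y) *: B)) <= 2 * (d * `|X' - X| + d' * `|Y' - Y|).
Proof.
move=> sigma rI Hg X Y X' Y' hX hY hX' hY'.
have XI z : Num.min X X' <= z <= Num.max X X' -> `|x0 - z| < r by exact: between_dist.
have YI z : Num.min Y Y' <= z <= Num.max Y Y' -> `|y0 - z| < r by exact: between_dist.
have XII z : Num.min X X' <= z <= Num.max X X' -> I z by move=> /XI /rI.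
have IX := rI _ hX.
apply: enorm3_le => j.
have [x1 [y1 [x1r y1r E]]] := mean_value2 Y Y' (sigma j) XII IX.
have [+ _] := Hg x1 Y' (XI _ x1r) hY'; have [_] := Hg X y1 hX (YI _ y1r).
have -> : (g X' Y' - g X Y - ((X' - X) *: A + (Y' - Y) *: B)) 0 j =
   (vdx g x1 Y' - A) 0 j * (X' - X) + (vdy g X y1 - B) 0 j * (Y' - Y).
  move: E; rewrite -!vdx_coord -!vdy_coord.
  move: (vdx g x1 Y') (vdy g X y1) (g X' Y') (g X Y) => p q s t; rewrite !mxE => ->; ring.
move=> hy hx; apply: le_trans (ler_normD _ _) _; rewrite !normrM.
by apply: lerD; apply: ler_wpM2r => //; apply: le_trans (enorm_coord _ _) _.
Qed.

Lemma le_distC (u v : 'rV[R]_3) e : enorm (u - v) <= e -> enorm (v - u) <= e.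
Proof. by rewrite enorm_distC. Qed.

(* An injective linear map plus a perturbation that is small in [C^1]. *)
Lemma perturb_inj (I : set R) (f F : R -> R -> 'rV[R]_3) (l r x0 y0 : R) : vsmooth I f -> vsmooth I F ->
  (forall x, `|x0 - x| < r -> I x) -> 0 < x0 -> 0 < l ->
  (forall u v, l ^+ 2 * (u ^+ 2 + x0 ^+ 2 * v ^+ 2) <=
     coef_E f x0 y0 * u ^+ 2 + 2 * coef_F f x0 y0 * u * v + coef_G f x0 y0 * v ^+ 2) ->
  (forall x y, `|x0 - x| < r -> `|y0 - y| < r ->
    [/\ enorm (vdx f x0 y0 - vdx f x y) <= l / 50, enorm (vdy f x0 y0 - vdy f x y) <= l / 50 * x0,
        enorm (vdx F x y - vdx f x y) <= l / 4 & enorm (vdy F x y - vdy f x y) <= l / 4 * x0]) ->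
  forall X Y X' Y', `|x0 - X| < r -> `|y0 - Y| < r -> `|x0 - X'| < r -> `|y0 - Y'| < r ->
    F X Y = F X' Y' -> X = X' /\ Y = Y'.
Proof.
move=> sf sF rI x00 l0 Q H X Y X' Y' hX hY hX' hY' FE.
pose u : R := X' - X; pose v : R := Y' - Y.
pose S : R := `|u| + x0 * `|v|.
have vS0 : 0 <= x0 * `|v| := mulr_ge0 (ltW x00) (normr_ge0 v).
have S0 : 0 <= S := addr_ge0 (normr_ge0 u) vS0.
have key (d : R) (g : R -> R -> 'rV[R]_3) (A B : 'rV[R]_3) : vsmooth I g ->
    (forall x y, `|x0 - x| < r -> `|y0 - y| < r -> enorm (vdx g x y - A) <= d /\ enorm (vdy g x y - B) <= d * x0) ->
    enorm (g X' Y' - g X Y - (u *: A + v *: B)) <= 2 * (d * S).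
  move=> sigma Hg; have := mean_value_bound sigma rI Hg hX hY hX' hY'.
  by have -> : d * S = d * `|X' - X| + d * x0 * `|Y' - Y| by rewrite /S mulrDr mulrA.
have D1 : enorm (f X' Y' - f X Y - (u *: vdx f x0 y0 + v *: vdy f x0 y0)) <= 2 * (l / 50 * S).
  by apply: key => // x y hx hy; have [h1 h2 _ _] := H x y hx hy; split; [exact: le_distC h1|exact: le_distC h2].
have sigma : vsmooth I (fun x y => F x y - f x y).
  exact: vsmoothB.
have D2 : enorm (F X' Y' - f X' Y' - (F X Y - f X Y) - (u *: 0 + v *: 0)) <= 2 * (l / 4 * S).
  apply: (key _ (fun x y => F x y - f x y)) => // x y hx hy; rewrite !subr0.
  by rewrite (vdxB y sF sf (rI _ hx)) (vdyB y sF sf (rI _ hx)); have [] := H x y hx hy.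
have D3 : 7 / 10 * l * S <= enorm (u *: vdx f x0 y0 + v *: vdy f x0 y0).
  apply: quadratic_lower; rewrite ?enorm_ge0 ?(ltW l0) ?(ltW x00)//.
  by apply: le_trans (Q u v) _; rewrite enorm_sqr dot_lin2 lexx.
have D4 : enorm (u *: vdx f x0 y0 + v *: vdy f x0 y0) <= 2 * (l / 50 * S) + 2 * (l / 4 * S).
  have -> : u *: vdx f x0 y0 + v *: vdy f x0 y0 =
     - (f X' Y' - f X Y - (u *: vdx f x0 y0 + v *: vdy f x0 y0)) +
     - (F X' Y' - f X' Y' - (F X Y - f X Y) - (u *: 0 + v *: 0)).
    rewrite FE !scaler0 !addr0 subr0; move: (_ *: _ + _ *: _) (F X' Y') (f X' Y') (f X Y) => p q s t.
    by apply/rowP => j; rewrite !mxE; ring.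
  by apply: le_trans (enormD _ _) _; rewrite !enormN; apply: lerD.
have Sz : S = 0.
  have : l * S <= 0 := perturb_inj_num (le_trans D3 D4).
  by rewrite pmulr_rle0// => S0'; apply/eqP; rewrite eq_le S0 S0'.
have uS : `|u| <= 0 by rewrite -Sz lerDl.
have vS : x0 * `|v| <= 0 by rewrite -Sz lerDr.
move: uS vS; rewrite pmulr_rle0// !normr_le0 /u /v !subr_eq0 => /eqP -> /eqP ->.
by [].
Qed.

Variables (I : set R) (f : R -> R -> 'rV[R]_3) (eta psi : R -> R -> R) (a b : R).
Hypothesis ok : step_ok I f eta psi a b.

(** The derivatives move by at most [3 sqrt eta] times the coefficient of the phase, up to a small
    error. This is less than the expansion [l] of [f], so that [perturb_inj] applies on a ball
    independent of [N]. *)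
Lemma corrug_local_inj (l x0 y0 : R) : I x0 -> 0 < x0 -> 0 < l ->
  (forall u v, l ^+ 2 * (u ^+ 2 + x0 ^+ 2 * v ^+ 2) <=
     coef_E f x0 y0 * u ^+ 2 + 2 * coef_F f x0 y0 * u * v + coef_G f x0 y0 * v ^+ 2) ->
  3 * Num.sqrt (eta x0 y0) * `|a| <= l / 5 -> 3 * Num.sqrt (eta x0 y0) * `|b| <= l / 5 * x0 ->
  exists2 r : R, 0 < r & exists N0, forall N, (N0 <= N)%N -> forall X Y X' Y',
    `|x0 - X| < r -> `|y0 - Y| < r -> `|x0 - X'| < r -> `|y0 - Y'| < r ->
    corrug f eta psi a b N X Y = corrug f eta psi a b N X' Y' -> X = X' /\ Y = Y'.
Proof.
move=> I0 x00 l0 Q ha hb.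
have [[oI sf seta spsi] [[ab0 eta0 gr0 sm psi01] [pf pe pp _]]] := ok.
have [rI rI0 HI] : exists2 r : R, 0 < r & forall x, `|x0 - x| < r -> I x.
  have : nbhs x0 I by exact: open_nbhs_nbhs.
  by move=> /nbhs_ballP[r r0 Hr]; exists r.
have sse : smooth I (fun x y => Num.sqrt (eta x y)) by exact: smooth_sqrt.
have bg0 : 0 < l / 50 / (3 * (`|a| + 1)) by rewrite !divr_gt0// mulr_gt0// ltr_wpDl.
have be0 : 0 < l / 50 * x0 / (3 * (`|b| + 1)) by rewrite divr_gt0// ?mulr_gt0// ?divr_gt0// ltr_wpDl.
have lx0 : 0 < l / 50 * x0 by rewrite mulr_gt0// divr_gt0.
have l50 : 0 < l / 50 by rewrite divr_gt0.
have ep0 : 0 < Num.min (l / 100) (l / 100 * x0) by rewrite lt_min !divr_gt0//= mulr_gt0// divr_gt0.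
have [r1 r10 H1] := jcont_ball (smooth_jcont (y := y0) sse I0) bg0.
have [r2 r20 H2] := vjcont_ball (fun j => smooth_jcont (y := y0) (vsmooth_dx oI sf j) I0) l50.
have [r3 r30 H3] := vjcont_ball (fun j => smooth_jcont (y := y0) (vsmooth_dy oI sf j) I0) lx0.
have [r4 r40 H4] := jcont_ball (smooth_jcont (y := y0) sse I0) be0.
pose r : R := Num.min (rI / 2) (Num.min r1 (Num.min r2 (Num.min r3 r4))).
have r0 : 0 < r by rewrite !lt_min r10 r20 r30 r40 !andbT divr_gt0.
have rrI : r <= rI / 2 by rewrite ge_min lexx.
have rr1 : r <= r1 by rewrite !ge_min lexx !orbT.
have rr2 : r <= r2 by rewrite !ge_min lexx !orbT.
have rr3 : r <= r3 by rewrite !ge_min lexx !orbT.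
have rr4 : r <= r4 by rewrite !ge_min lexx !orbT.
have seg x : x0 - r <= x <= x0 + r -> I x.
  by move=> xr; apply: HI; rewrite ltr_norml; lra.
have [N0 HN0] := step_estimate ok seg ep0.
exists r => //; exists (N0 + 1)%N => N NN.
have Npos : (0 < N)%N by apply: leq_trans NN; rewrite addn1.
have NN0 : (N0 <= N)%N by apply: leq_trans NN; rewrite leq_addr.
have HI' x : `|x0 - x| < r -> I x by rewrite ltr_norml => h; apply: seg; lra.
apply: (perturb_inj sf (vsmooth_corrug ok N) HI' x00 l0 Q) => x y hx hy.
have xr : x0 - r <= x <= x0 + r by move: hx; rewrite ltr_norml; lra.
have [_ e1 e2 _] := HN0 N NN0 Npos x y xr.
have b1 := H1 x y (lt_le_trans hx rr1) (lt_le_trans hy rr1).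
have b4 := H4 x y (lt_le_trans hx rr4) (lt_le_trans hy rr4).
split; [exact: H2 (lt_le_trans hx rr2) (lt_le_trans hy rr2)|exact: H3 (lt_le_trans hx rr3) (lt_le_trans hy rr3)| |].
- apply: le_trans e1 _; apply: eta_near_num (normr_ge0 a) l0 _ ha b1.
  by rewrite ge_min lexx.
- apply: le_trans e2 _; have lx : 0 < l * x0 by rewrite mulr_gt0.
  rewrite [l / 4 * x0]mulrAC; apply: eta_near_num (normr_ge0 b) lx _ _ _;
    [|rewrite [l * x0 / 5]mulrAC; exact: hb|rewrite [l * x0 / 50]mulrAC; exact: b4].
  by rewrite ge_min [l * x0 / 100]mulrAC lexx orbT.
Qed.

Lemma polar_eq_int x y x' y' (k k' : int) :
  polar_eq x (y + k%:~R * (2 * pi)) x' (y' + k'%:~R * (2 * pi)) -> polar_eq x y x' y'.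
Proof.
have pc : per (fun _ y : R => cos y).
  by move=> u v; rewrite (_ : 2 * pi = pi *+ 2) ?cosD2pi// mulr_natl.
have ps : per (fun _ y : R => sin y).
  by move=> u v; rewrite (_ : 2 * pi = pi *+ 2) ?sinD2pi// mulr_natl.
move=> [ec es]; split.
- by rewrite -(per_int k x y pc) -(per_int k' x' y' pc).
- by rewrite -(per_int k x y ps) -(per_int k' x' y' ps).
Qed.

Lemma polar_eq_shift x y (k : int) : polar_eq x (y + k%:~R * (2 * pi)) x y.
Proof. by apply: (@polar_eq_int _ _ _ _ 0 k); rewrite mulr0z mul0r addr0. Qed.

Definition polar_dist (x y x' y' : R) := `|x * cos y - x' * cos y'| + `|x * sin y - x' * sin y'|.

Lemma polar_dist_int x y x' y' (k k' : int) :
  polar_dist x (y + k%:~R * (2 * pi)) x' (y' + k'%:~R * (2 * pi)) = polar_dist x y x' y'.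
Proof.
have pc : per (fun _ y : R => cos y).
  by move=> u v; rewrite (_ : 2 * pi = pi *+ 2) ?cosD2pi// mulr_natl.
have ps : per (fun _ y : R => sin y).
  by move=> u v; rewrite (_ : 2 * pi = pi *+ 2) ?sinD2pi// mulr_natl.
by rewrite /polar_dist (per_int k x y pc) (per_int k' x' y' pc) (per_int k x y ps) (per_int k' x' y' ps).
Qed.

Lemma jcont_polar x y : jcont (fun x y : R => x * cos y) x y /\ jcont (fun x y : R => x * sin y) x y.
Proof.
split; apply: (@smooth_jcont _ setT) => //; apply: smoothM; try exact: smooth_fst.
  by apply: smooth_cos; [exact: openT|exact: smooth_snd].
by apply: smooth_sin; [exact: openT|exact: smooth_snd].
Qed.

Lemma polar_dist_ball x y x' y' e : 0 < e -> exists2 r : R, 0 < r & forall X Y X' Y',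
  `|x - X| < r -> `|y - Y| < r -> `|x' - X'| < r -> `|y' - Y'| < r -> polar_dist X Y X' Y' < polar_dist x y x' y' + e.
Proof.
move=> e0; have e4 : 0 < e / 4 by rewrite divr_gt0.
have [c1 s1] := jcont_polar x y; have [c2 s2] := jcont_polar x' y'.
have [r1 r10 H1] := jcont_ball c1 e4; have [r2 r20 H2] := jcont_ball s1 e4.
have [r3 r30 H3] := jcont_ball c2 e4; have [r4 r40 H4] := jcont_ball s2 e4.
exists (Num.min (Num.min r1 r2) (Num.min r3 r4)); first by rewrite !lt_min r10 r20 r30.
move=> X Y X' Y'; rewrite !lt_min => /andP[/andP[x1 x2] _] /andP[/andP[y1 y2] _].
move=> /andP[_ /andP[x3 x4]] /andP[_ /andP[y3 y4]].
have := H1 _ _ x1 y1; have := H2 _ _ x2 y2; have := H3 _ _ x3 y3; have := H4 _ _ x4 y4; rewrite /polar_dist.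
move: (x * cos y) (x * sin y) (x' * cos y') (x' * sin y') (X * cos Y) (X * sin Y) (X' * cos Y') (X' * sin Y').
move=> p q p' q' P Q P' Q' h4 h3 h2 h1.
have a1 : `|P - P'| <= `|p - p'| + `|p - P| + `|p' - P'|.
  have -> : P - P' = (p - p') - (p - P) + (p' - P') by ring.
  by apply: le_trans (ler_normD _ _) _; rewrite lerD2r; exact: ler_normB.
have a2 : `|Q - Q'| <= `|q - q'| + `|q - Q| + `|q' - Q'|.
  have -> : Q - Q' = (q - q') - (q - Q) + (q' - Q') by ring.
  by apply: le_trans (ler_normD _ _) _; rewrite lerD2r; exact: ler_normB.
lra.
Qed.

Lemma vdist_ball (g : R -> R -> 'rV[R]_3) x y x' y' (e : R) :
  (forall j, jcont (fun x y => g x y 0 j) x y) -> (forall j, jcont (fun x y => g x y 0 j) x' y') -> 0 < e ->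
  exists2 r : R, 0 < r & forall X Y X' Y', `|x - X| < r -> `|y - Y| < r -> `|x' - X'| < r -> `|y' - Y'| < r ->
  enorm (g x y - g x' y') <= enorm (g X Y - g X' Y') + e.
Proof.
move=> c1 c2 e0; have e2 : 0 < e / 2 by rewrite divr_gt0.
have [r1 r10 H1] := vjcont_ball c1 e2; have [r2 r20 H2] := vjcont_ball c2 e2.
exists (Num.min r1 r2); first by rewrite lt_min r10 r20.
move=> X Y X' Y'; rewrite !lt_min => /andP[x1 _] /andP[y1 _] /andP[_ x2] /andP[_ y2].
have h1 := H1 _ _ x1 y1; have := H2 _ _ x2 y2; rewrite enorm_distC => h2.
have -> : g x y - g x' y' = (g X Y - g X' Y') + ((g x y - g X Y) + (g X' Y' - g x' y')).
  by move: (g x y) (g x' y') (g X Y) (g X' Y') => p q s t; apply/rowP => j; rewrite !mxE; ring.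
apply: le_trans (enormD _ _) _; rewrite lerD2l; apply: le_trans (enormD _ _) _.
by rewrite [leRHS](splitr e); apply: lerD.
Qed.

(** Three kinds of pairs: distinct points, whose images stay apart by C^0-closeness; the origin
    twice, near which the cutoff leaves the map unchanged; one point off the origin, where local
    injectivity applies after shifting an angle by whole turns. *)
Lemma corrug_inj (s R1 : R) : 0 < s -> 1 < R1 -> (forall x, 0 < x < R1 -> I x) ->
  (forall x y j, x < R1 -> jcont (fun x y => f x y 0 j) x y) ->
  (forall x y, x <= s -> psi x y = 0) ->
  (forall x0 y0, 0 < x0 <= 1 -> exists l, [/\ 0 < l,
    (forall u v, l ^+ 2 * (u ^+ 2 + x0 ^+ 2 * v ^+ 2) <=
     coef_E f x0 y0 * u ^+ 2 + 2 * coef_F f x0 y0 * u * v + coef_G f x0 y0 * v ^+ 2),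
    3 * Num.sqrt (eta x0 y0) * `|a| <= l / 5 & 3 * Num.sqrt (eta x0 y0) * `|b| <= l / 5 * x0]) ->
  polar_inj f -> exists N0, forall N, (N0 <= N)%N -> polar_inj (corrug f eta psi a b N).
Proof.
move=> s0 R11 HI fc ps Hl fi.
have p2 : 0 < 2 * pi :> R by rewrite mulr_gt0// pi_gt0.
have pf : per f by have [_ [_ []]] := ok.
have pF N : per (corrug f eta psi a b N) by exact: per_corrug ok N.
suff [N0 HN0] : exists N0, forall N, (N0 <= N)%N -> forall x y x' y', 0 <= x <= 1 -> 0 <= y <= 2 * pi ->
    0 <= x' <= 1 -> 0 <= y' <= 2 * pi -> 0 <= x <= 1 -> 0 <= x' <= 1 ->
    corrug f eta psi a b N x y = corrug f eta psi a b N x' y' -> polar_eq x y x' y'.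
  exists N0 => N NN x y x' y' xr xr' FE.
  have [k kr] := angle_reduce y; have [k' kr'] := angle_reduce y'.
  apply: (@polar_eq_int _ _ _ _ k k'); apply: (HN0 N NN _ _ _ _ xr kr xr' kr' xr xr').
  by rewrite !(per_int _ _ _ (pF N)).
apply: (uniform_near2 (P := fun N x y x' y' => 0 <= x <= 1 -> 0 <= x' <= 1 ->
    corrug f eta psi a b N x y = corrug f eta psi a b N x' y' -> polar_eq x y x' y')).
move=> x y x' y' xr yr xr' yr'.
have xR z : 0 <= z <= 1 -> z < R1 by lra.
have [E|nE] := pselect (polar_eq x y x' y'); last first.
  have d0 : 0 < enorm (f x y - f x' y').
    by apply: enorm_sub_gt0 => E; apply: nE; exact: fi E.
  set d := enorm _ in d0; have d4 : 0 < d / 4 by rewrite divr_gt0.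
  have [r r0 Hr] := vdist_ball (fun j => fc x y j (xR _ xr)) (fun j => fc x' y' j (xR _ xr')) d4.
  have seg z : s <= z <= 1 -> I z by move=> zr; apply: HI; lra.
  have [N0 HN0] := step_estimate ok seg d4.
  exists r => //; exists N0.+1 => N NN X Y X' Y' hX hY hX' hY' Xr Xr' FE.
  have close z w : 0 <= z <= 1 -> enorm (corrug f eta psi a b N z w - f z w) <= d / 4.
    move=> zr; case: (leP z s) => zs.
      have -> : corrug f eta psi a b N z w = f z w by apply: corrug_id; exact: ps.
      by rewrite subrr enorm0; exact: (ltW d4).
    have zr' : s <= z <= 1 by lra.
    by have [] := HN0 N (ltnW NN) (leq_ltn_trans (leq0n _) NN) z w zr'.
  have := Hr _ _ _ _ hX hY hX' hY'; rewrite -/d.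
  have -> : f X Y - f X' Y' = - (corrug f eta psi a b N X Y - f X Y) + (corrug f eta psi a b N X' Y' - f X' Y').
    by rewrite FE; move: (corrug _ _ _ _ _ _ _ _) (f X Y) (f X' Y') => p q t; apply/rowP => j; rewrite !mxE; ring.
  have := enormD (- (corrug f eta psi a b N X Y - f X Y)) (corrug f eta psi a b N X' Y' - f X' Y').
  rewrite enormN; have := close X Y Xr; have := close X' Y' Xr'.
  move: (enorm _) (enorm _) (enorm _) => p q t h1 h2 h3 h4; exfalso; move: d0 h1 h2 h3 h4.
  by clear; move: d => d; lra.
have [x0|xn0] := eqVneq x 0.
  have x'0 : x' = 0.
    apply/eqP; apply: contraT => x'n; have x'p : 0 < x' by rewrite lt_neqAle eq_sym x'n; lra.
    have E' : polar_eq x' y' x y by case: E.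
    have x00 : 0 <= x by rewrite x0.
    have [xx _] := polar_eq_angle x'p x00 E'; by rewrite xx x0 eqxx in x'n.
  exists s => //; exists 0%N => N _ X Y X' Y' hX hY hX' hY' Xr Xr'.
  rewrite !corrug_id; first exact: fi.
  - by apply: ps; move: hX'; rewrite x'0 sub0r normrN => /(le_lt_trans (ler_norm _))/ltW.
  - by apply: ps; move: hX; rewrite x0 sub0r normrN => /(le_lt_trans (ler_norm _))/ltW.
have xp : 0 < x by rewrite lt_neqAle eq_sym xn0; lra.
have x'0 : 0 <= x' by lra.
have [xx [k ky]] := polar_eq_angle xp x'0 E.
have xr1 : 0 < x <= 1 by lra.
have xI : 0 < x < R1 by lra.
have [l [l0 Q ha hb]] := Hl x y xr1.
have [r r0 [N0 HN0]] := corrug_local_inj (HI _ xI) xp l0 Q ha hb.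
exists r => //; exists N0 => N NN X Y X' Y' hX hY hX' hY' _ _ FE.
have [] := HN0 N NN X Y X' (Y' + (- k)%:~R * (2 * pi)) hX hY.
- by rewrite xx.
- by move: hY'; rewrite ky mulrNz; congr (`|_| < _); ring.
- by rewrite per_int.
by move=> -> ->; exact: polar_eq_shift.
Qed.

(** The lower bound is sought in the form [N.+1%:R^-1], so that compactness, through
    [uniform_near2], produces it as a threshold on [N]. *)
Lemma margin (g : R -> R -> 'rV[R]_3) (e : R) : 0 < e -> per g -> polar_inj g ->
  (forall x y j, 0 <= x <= 1 -> jcont (fun x y => g x y 0 j) x y) ->
  exists2 d : R, 0 < d & forall x y x' y', 0 <= x <= 1 -> 0 <= x' <= 1 -> e <= polar_dist x y x' y' ->
    d <= enorm (g x y - g x' y').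
Proof.
move=> e0 pg gi gc.
have [|N0 HN0] := @uniform_near2 0 1 0 (2 * pi) (fun N x y x' y' => 
    e <= polar_dist x y x' y' -> N.+1%:R^-1 <= enorm (g x y - g x' y')); last first.
- exists N0.+1%:R^-1; first by rewrite invr_gt0.
  move=> x y x' y' xr xr' h.
  have [k kr] := angle_reduce y; have [k' kr'] := angle_reduce y'.
  rewrite -(per_int k x y pg) -(per_int k' x' y' pg); apply: HN0 => //.
  by rewrite polar_dist_int.
move=> x y x' y' xr yr xr' yr'.
have [pe|pe] := ltP (polar_dist x y x' y') e.
  have ep0 : 0 < e - polar_dist x y x' y' by rewrite subr_gt0.
  have [r r0 Hr] := polar_dist_ball x y x' y' ep0.
  exists r => //; exists 0%N => N _ X Y X' Y' hX hY hX' hY' h.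
  by have := Hr _ _ _ _ hX hY hX' hY'; rewrite subrKC ltNge h.
have d0 : 0 < enorm (g x y - g x' y').
  apply: enorm_sub_gt0 => E.
  have [e1 e2] := gi _ _ _ _ xr xr' E.
  by move: pe; rewrite /polar_dist e1 e2 !subrr normr0 addr0 leNgt e0.
set d := enorm _ in d0; have d2 : 0 < d / 2 by rewrite divr_gt0.
have [r r0 Hr] := vdist_ball (fun j => gc x y j xr) (fun j => gc x' y' j xr') d2.
pose N0 := Num.bound (d / 2)^-1.
exists r => //; exists N0 => N NN X Y X' Y' hX hY hX' hY' _.
have := Hr _ _ _ _ hX hY hX' hY'; rewrite -/d -lerBlDr.
have NI : N.+1%:R^-1 <= d / 2.
  rewrite invf_ple ?posrE//; apply: le_trans (ltW (archi_boundP _)) _; first by rewrite ltW// invr_gt0.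
  by rewrite ler_nat leqW.
move: (enorm _) => E h; apply: le_trans NI _; apply: le_trans h; lra.
Qed.

End Injectivity.

(** * The metrics and the invariants of the construction *)

Section Metrics.
Context {R : realType}.

(* [tau] is close enough to 1 for the increments of the metrics to be small
   compared with the metrics, and [sigma] bounds the square roots of the ratios. *)
Definition sigma : R := 1 - 1 / (80 * 80).
Definition tau : R := sigma ^+ 2.

Lemma sigma_bounds : 9 / 10 <= sigma < 1.
Proof. by rewrite /sigma; apply/andP; split; lra. Qed.

Lemma sigma_gt0 : 0 < sigma.
Proof. by have := sigma_bounds; lra. Qed.

(** Origin of [80 * 80]: it makes [1 - tau] about [1 / 3200], which leaves room below the [1 / 2500]
    used in [increment_le_conformal]. *)
Lemma tau_gap : 1 - tau <= tau / (50 * 50).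
Proof. by rewrite /tau /sigma expr2; lra. Qed.

Lemma tau_bounds : 9 / 10 <= tau < 1.
Proof. by rewrite /tau /sigma expr2; apply/andP; split; lra. Qed.

Lemma tauX_gt0 k : 0 < tau ^+ k.
Proof. by rewrite exprn_gt0//; have := tau_bounds; lra. Qed.

Lemma tauX_le1 k : tau ^+ k <= 1.
Proof. by rewrite exprn_ile1//; have := tau_bounds; lra. Qed.

Lemma tauX_anti k j : (k <= j)%N -> tau ^+ j <= tau ^+ k.
Proof.
move=> kj; rewrite -(subnK kj) exprD ler_piMl ?tauX_le1//.
by rewrite ltW// tauX_gt0.
Qed.

Lemma tauX_S k : tau ^+ k.+1 < tau ^+ k.
Proof. by rewrite exprS gtr_pMl ?tauX_gt0//; have := tau_bounds; lra. Qed.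

(* [conformal k] is the conformal factor of the [k]-th metric; it increases from 4 to
   the factor of the hyperbolic metric. *)
Definition conformal_den k x : R := 1 - (1 - tau ^+ k) * x ^+ 2.
Definition conformal k x : R := 4 / conformal_den k x ^+ 2.
Definition increment k x : R := conformal k.+1 x - conformal k x.
(* A neighbourhood of the closed disk minus the origin, shrinking with [j], on
   which [conformal j] is finite. *)
Definition near_disk j (x : R) := 0 < x /\ x ^+ 2 <= 1 + 3 / 10 * tau ^+ j.

Lemma near_disk_unit j (x : R) : 0 < x -> x <= 1 -> near_disk j x.
Proof. by move=> x0 x1; split => //; have := tauX_gt0 j; rewrite expr2; nra. Qed.

Lemma near_disk_le j j' (x : R) : (j' <= j)%N -> near_disk j x -> near_disk j' x.
Proof. by move=> jj [x0 x1]; split => //; have := tauX_anti jj; lra. Qed.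

(** With [t = tau^k] and [x^2 <= 1 + 3 t / 10], the denominator is at least
    [1 - (1 - t) (1 + 3 t / 10) >= 7 t / 10]. *)
Lemma conformal_den_ge k x : near_disk k x -> 7 / 10 * tau ^+ k <= conformal_den k x.
Proof.
move=> [x0]; rewrite /conformal_den; have := tauX_gt0 k; have := tauX_le1 k.
move: (tau ^+ k) => t t1 t0; have : 0 < x ^+ 2 by rewrite exprn_gt0.
move: (x ^+ 2) => z z0 h.
have [z1|z1] := leP z 1; nra.
Qed.

Lemma conformal_den_gt0 k x : near_disk k x -> 0 < conformal_den k x.
Proof. by move=> /conformal_den_ge; apply: lt_le_trans; rewrite mulr_gt0 ?tauX_gt0// divr_gt0. Qed.

Lemma conformal_den_le1 k x : conformal_den k x <= 1.
Proof. by rewrite /conformal_den lerBlDr lerDl mulr_ge0 ?sqr_ge0// subr_ge0 tauX_le1. Qed.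

Lemma conformal_den_ge_sqr k x : 1 - x ^+ 2 <= conformal_den k x.
Proof.
rewrite /conformal_den lerD2l lerN2 ler_piMl ?sqr_ge0//.
by have := tauX_gt0 k; lra.
Qed.

Lemma conformal_den_step k (x : R) : conformal_den k x - conformal_den k.+1 x = tau ^+ k * (1 - tau) * x ^+ 2.
Proof. by rewrite /conformal_den (exprS tau k); ring. Qed.

Lemma conformal0 x : conformal 0 x = 4.
Proof. by rewrite /conformal /conformal_den expr0 subrr mul0r subr0 expr1n divr1. Qed.

Lemma inv_sqr_gap (p q : R) : 0 < q -> q <= p ->
  4 / q ^+ 2 - 4 / p ^+ 2 = 4 * (p - q) * (p + q) / (p ^+ 2 * q ^+ 2).
Proof. by move=> q0 qp; field; rewrite !gt_eqF//; lra. Qed.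

Lemma conformal_den_S k x : near_disk k.+1 x -> 0 < conformal_den k.+1 x /\ conformal_den k.+1 x < conformal_den k x.
Proof.
move=> d; split; first exact: conformal_den_gt0.
rewrite -subr_gt0 conformal_den_step; apply: mulr_gt0; last by rewrite exprn_gt0//; case: d.
by apply: mulr_gt0; rewrite ?tauX_gt0//; have := tau_bounds; lra.
Qed.

Lemma increment_gt0 k x : near_disk k.+1 x -> 0 < increment k x.
Proof.
move=> d; have [d0 d1] := conformal_den_S d.
rewrite /increment /conformal (inv_sqr_gap d0 (ltW d1)) divr_gt0 ?mulr_gt0 ?exprn_gt0//; lra.
Qed.

Lemma conformal_ge4 k x : near_disk k x -> 4 <= conformal k x.
Proof.
elim: k => [|k IH] d; first by rewrite conformal0.
have := increment_gt0 d; have := IH (near_disk_le (leqnSn k) d); rewrite /increment; lra.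
Qed.

(** The relative gap between consecutive denominators is at most [(13/10) / (7/10) / 2500 < 1/1200],
    and squaring doubles it. The 500 becomes 250 for the deficits, which has to exceed 65 for the
    condition of [step_ok] and [15^2 + 1] for injectivity. *)
Lemma increment_le_conformal k x : near_disk k.+1 x -> 500 * increment k x <= conformal k.+1 x.
Proof.
move=> d; have [d0 d1] := conformal_den_S d.
have dd := near_disk_le (leqnSn k) d.
have gap : conformal_den k x - conformal_den k.+1 x <= conformal_den k x / (40 * 30).
  rewrite conformal_den_step; have := conformal_den_ge dd; have := tauX_gt0 k; have := tauX_le1 k.
  have := tau_gap; have := tau_bounds; case: dd => _.
  move: (conformal_den k x) (tau ^+ k) (x ^+ 2) (sqr_ge0 x) => q t z z0 h1 h2 h3 h4 h5 h6.
  have t1 : t * (1 - tau) <= t / (50 * 50) by rewrite ler_pM2l//; lra.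
  have z1 : z <= 13 / 10 by lra.
  have := ler_wpM2r z0 t1; nra.
rewrite /increment {1}/conformal {1}/conformal /conformal.
move: (conformal_den k x) (conformal_den k.+1 x) d0 d1 gap => p q q0 qp gap.
have p0 : 0 < p by lra.
have h : (p ^+ 2 - q ^+ 2) * 500 <= p ^+ 2 by rewrite !expr2; nra.
have -> : 4 / q ^+ 2 - 4 / p ^+ 2 = 4 / q ^+ 2 * ((p ^+ 2 - q ^+ 2) / p ^+ 2).
  by field; rewrite !gt_eqF.
rewrite mulrCA; apply: ler_piMr; first by rewrite divr_ge0 ?sqr_ge0.
by rewrite mulrA ler_pdivrMr ?exprn_gt0// mul1r mulrC.
Qed.

(** On the disk of radius [r] all denominators are at least [1 - r^2], so that the increments
    inherit the factor [tau^k x^2] of [conformal_den_step]. *)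
Lemma increment_le_tau k (x r : R) : 0 < x -> x <= r -> r < 1 ->
  increment k x <= 8 / (1 - r ^+ 2) ^+ 4 * tau ^+ k * x ^+ 2.
Proof.
move=> x0 xr r1; have r0 : 0 < r by lra.
have d : near_disk k.+1 x by apply: near_disk_unit => //; lra.
have [d0 d1] := conformal_den_S d.
rewrite /increment /conformal (inv_sqr_gap d0 (ltW d1)) conformal_den_step.
have rr : 0 < 1 - r ^+ 2 by rewrite expr2; nra.
have g q : 1 - r ^+ 2 <= conformal_den q x.
  apply: le_trans (conformal_den_ge_sqr q x); rewrite lerD2l lerN2 ler_sqr ?nnegrE; lra.
have h1 := g k; have h2 := g k.+1; have h3 := conformal_den_le1 k x; have h4 := conformal_den_le1 k.+1 x.
move: (conformal_den k x) (conformal_den k.+1 x) (1 - r ^+ 2) rr h1 h2 h3 h4 d0 d1 => p q c c0 h1 h2 h3 h4 q0 qp.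
have t0 := tauX_gt0 k; have z0 : 0 < x ^+ 2 by rewrite exprn_gt0.
move: (tau ^+ k) (x ^+ 2) t0 z0 => t z t0 z0.
have pq : c ^+ 4 <= p ^+ 2 * q ^+ 2.
  rewrite (_ : c ^+ 4 = c ^+ 2 * c ^+ 2); last by ring.
  by apply: ler_pM; rewrite ?sqr_ge0// ler_sqr ?nnegrE; lra.
have c4 : 0 < c ^+ 4 by rewrite exprn_gt0.
have tb := tau_bounds.
rewrite ler_pdivrMr; last by rewrite mulr_gt0 ?exprn_gt0//; lra.
have -> : 8 / c ^+ 4 * t * z * (p ^+ 2 * q ^+ 2) = 8 * (t * z) * (p ^+ 2 * q ^+ 2 / c ^+ 4).
  by field; rewrite gt_eqF.
have one : 1 <= p ^+ 2 * q ^+ 2 / c ^+ 4 by rewrite ler_pdivlMr// mul1r.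
have tz : 0 < t * z by rewrite mulr_gt0.
apply: le_trans (_ : 8 * (t * z) * 1 <= _); last by rewrite ler_wpM2l// ltW// mulr_gt0.
have -> : 4 * (t * (1 - tau) * z) * (p + q) = 4 * (t * z) * ((1 - tau) * (p + q)) by ring.
have : (1 - tau) * (p + q) <= 1 * 2 by apply: ler_pM; lra.
move: (t * z) tz ((1 - tau) * _) => w w0 v; nra.
Qed.

(** Uniform in [k]: a point near the origin may keep the initial metric during many stages, and the
    deficit accumulated meanwhile is still O(x^2). *)
Lemma conformal_near0 k (x : R) : 0 < x -> x <= 1 / 4 -> conformal k x - 4 <= 16 * x ^+ 2.
Proof.
move=> x0 x1; have h := conformal_den_ge_sqr k x; have h1 := conformal_den_le1 k x.
have z1 : x ^+ 2 <= 1 / 16.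
  by rewrite (_ : 1 / 16 = (1 / 4) ^+ 2); [rewrite ler_sqr ?nnegrE; lra|field].
rewrite /conformal; move: (x ^+ 2) (conformal_den k x) (sqr_ge0 x) z1 h h1 => z q z0 z1 h h1.
have q0 : 0 < q ^+ 2 by rewrite exprn_gt0//; lra.
rewrite lerBlDr ler_pdivrMr//.
have : (1 - z) ^+ 2 <= q ^+ 2 by rewrite ler_sqr ?nnegrE; lra.
move: (q ^+ 2) q0 => w w0; rewrite expr2; nra.
Qed.

Lemma conformal_le k (x : R) : near_disk k x -> conformal k x <= 16 / (tau ^+ k) ^+ 2.
Proof.
move=> d; have := conformal_den_ge d; have t0 := tauX_gt0 k; have d0 := conformal_den_gt0 d; rewrite /conformal.
move: (conformal_den k x) (tau ^+ k) t0 d0 => q t t0 q0 h.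
rewrite ler_pdivrMr ?exprn_gt0// mulrAC ler_pdivlMr ?exprn_gt0// !expr2; nra.
Qed.

Lemma cvg_tauX : (tau ^+ k) @[k --> \oo] --> (0 : R).
Proof. by apply: cvg_expr; rewrite ger0_norm; have := tau_bounds; lra. Qed.

Lemma cvg_conformal (x : R) : 0 < x < 1 -> conformal k x @[k --> \oo] --> 4 / (1 - x ^+ 2) ^+ 2.
Proof.
move=> xr; have x1 : 0 < 1 - x ^+ 2 by rewrite expr2; nra.
apply: cvgM; first exact: cvg_cst.
apply: cvgV; first by rewrite expf_neq0// gt_eqF.
rewrite [X in _ --> X]expr2; under eq_fun do rewrite expr2.
have : conformal_den k x @[k --> \oo] --> 1 - x ^+ 2; last by move=> h; apply: cvgM.
apply: cvgB; first exact: cvg_cst.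
rewrite -[X in _ --> X]mul1r; apply: cvgM; last exact: cvg_cst.
by rewrite -[X in _ --> X]subr0; apply: cvgB; [exact: cvg_cst|exact: cvg_tauX].
Qed.

(* The steps of the stage [k] do not change the map on the disk of radius [core_radius k.+2]. *)
Definition core_radius k : R := 1 / (100 * 4 ^+ k).

Lemma core_radius_gt0 k : 0 < core_radius k.
Proof. by rewrite divr_gt0// mulr_gt0// exprn_gt0. Qed.

Lemma core_radius_S k : core_radius k = 4 * core_radius k.+1.
Proof. by rewrite /core_radius exprS; field; rewrite expf_neq0. Qed.

Lemma core_radius_le k : core_radius k <= 1 / 100.
Proof.
elim: k => [|k IH]; first by rewrite /core_radius expr0 mulr1.
by have := core_radius_S k; have := core_radius_gt0 k.+1; lra.
Qed.

Lemma core_radius_lt k : core_radius k.+1 < core_radius k.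
Proof. by have := core_radius_S k; have := core_radius_gt0 k.+1; lra. Qed.

(* Bound, relative to the flat metric, of the deficits corrected by the stage [k]. *)
Definition deficit_bound k x : R := if core_radius k <= x then 2 * increment k x else 5 * (conformal k.+1 x - 4).

Lemma mu4_gt0 k x : near_disk k.+1 x -> 0 < conformal k.+1 x - 4.
Proof.
by move=> d; have := increment_gt0 d; have := conformal_ge4 (near_disk_le (leqnSn k) d); rewrite /increment; lra.
Qed.

Lemma deficit_bound_ge0 k x : near_disk k.+1 x -> 0 <= deficit_bound k x.
Proof.
move=> d; rewrite /deficit_bound; case: ifP => _; rewrite mulr_ge0//.
  by rewrite ltW// increment_gt0.
by rewrite ltW// mu4_gt0.
Qed.

Lemma deficit_bound_le k x : near_disk k.+1 x -> 250 * deficit_bound k x <= conformal k.+1 x.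
Proof.
move=> d; rewrite /deficit_bound; case: ifP => [_|/negbT]; first by have := increment_le_conformal d; lra.
rewrite -ltNge => xS; have := core_radius_le k; case: (d) => x0 _ S1.
have x4 : x <= 1 / 4 by lra.
have := conformal_near0 k.+1 x0 x4; have := conformal_ge4 d.
have : x ^+ 2 <= (1 / 100) ^+ 2 by rewrite ler_sqr ?nnegrE; lra.
rewrite (_ : (1 / 100) ^+ 2 = 1 / 100 / 100); last by field.
move: (x ^+ 2) (conformal k.+1 x) => z m; lra.
Qed.

(** The derivatives move by the square root of the deficits. Outside the core this is
    [increment_le_tau]; inside, [x < core_radius k <= 4^-k <= tau^k] turns [x^2] into [x tau^k]. The
    factor [sqrt x] is kept for the differentiability at the origin. *)
Lemma sqrt_deficit_bound_le (r : R) : r < 1 -> exists2 C : R, 0 <= C & forall k x, 0 < x -> x <= r ->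
  Num.sqrt (deficit_bound k x) <= C * Num.sqrt x * sigma ^+ k.
Proof.
move=> r1; pose C : R := 16 / (1 - r ^+ 2) ^+ 4 + 80.
have rC : 0 <= 16 / (1 - r ^+ 2) ^+ 4 by rewrite divr_ge0// exprn_even_ge0.
have C0 : 0 <= C by rewrite addr_ge0.
exists (Num.sqrt C); first exact: sqrtr_ge0.
move=> k x x0 xr; have x1 : x <= 1 by lra.
have d : near_disk k.+1 x by apply: near_disk_unit => //; lra.
have s0 : 0 <= sigma ^+ k by rewrite exprn_ge0// ltW// sigma_gt0.
have -> : Num.sqrt C * Num.sqrt x * sigma ^+ k = Num.sqrt (C * x * tau ^+ k).
  rewrite !sqrtrM ?mulr_ge0 ?(ltW x0)//; congr (_ * _).
  by rewrite /tau -exprM mulnC exprM sqrtr_sqr ger0_norm.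
rewrite ler_wsqrtr// /deficit_bound; have t0 := tauX_gt0 k; have xx : x ^+ 2 <= x by rewrite expr2 ler_piMl// ltW.
case: ifP => [_|/negbT].
  have := increment_le_tau k x0 xr r1.
  have : 16 / (1 - r ^+ 2) ^+ 4 * tau ^+ k * x ^+ 2 <= C * x * tau ^+ k.
    rewrite mulrAC ler_wpM2r ?(ltW t0)//; apply: ler_pM => //; first exact: sqr_ge0.
    by rewrite lerDl.
  move: (_ ^+ 4) => c; lra.
rewrite -ltNge => xS; have S1 := core_radius_le k.
have x4 : x <= 1 / 4 by lra.
have := conformal_near0 k.+1 x0 x4.
suff : x ^+ 2 <= x * tau ^+ k.
  move=> h; have : 80 * (x * tau ^+ k) <= C * (x * tau ^+ k).
    by rewrite ler_wpM2r ?mulr_ge0 ?(ltW x0) ?(ltW t0)// lerDr.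
  lra.
rewrite expr2 ler_wpM2l ?(ltW x0)//; apply: le_trans (ltW xS) _.
apply: le_trans (_ : (4 ^+ k)^-1 <= _).
  rewrite /core_radius div1r lef_pV2 ?posrE ?mulr_gt0 ?exprn_gt0// ler_peMl// ?exprn_ge0//; lra.
rewrite -exprVn lerXn2r ?nnegrE ?invr_ge0//; have := tau_bounds; lra.
Qed.

End Metrics.

(** * The three phases, the deficits and the invariant of the stages *)

Section Invariant.
Context {R : realType}.
Implicit Types (f : R -> R -> 'rV[R]_3) (x y u v : R).

(** The forms of index 1 and 2 are mirror images, with winding numbers 1 and -1. The ratio 4 of
    their coefficients gives the polar metric the first dual coordinate [1 - x^2 / 16], well away
    from 0 on the disk. *)
Definition form_rho (i : nat) : R := if i is 0%N then 1 else (8 * pi)^-1.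
Definition form_phi (i : nat) : R := match i with 0%N => 0 | 1%N => (2 * pi)^-1 | _ => - (2 * pi)^-1 end.
Definition form_value i u v : R := form_rho i * u + form_phi i * v.
(* The basis of quadratic forms dual to the squares of the [form_value i]. *)
Definition dual_form (i : nat) (E F G : R) : R :=
  match i with 0%N => E - G / 16 | 1%N => 2 * pi ^+ 2 * (G + 4 * F) | _ => 2 * pi ^+ 2 * (G - 4 * F) end.
Definition dual_polar i x : R := dual_form i 1 0 (x ^+ 2).

Lemma pi_neq0 : pi != 0 :> R.
Proof. by rewrite gt_eqF// pi_gt0. Qed.

Lemma dual_form_sum E F G u v : dual_form 0 E F G * form_value 0 u v ^+ 2 + dual_form 1 E F G * form_value 1 u v ^+ 2 + dual_form 2 E F G * form_value 2 u v ^+ 2 =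
  E * u ^+ 2 + 2 * F * u * v + G * v ^+ 2.
Proof. by rewrite /form_value /dual_form /form_rho /form_phi; move: (pi : R) pi_neq0 => p p0; field. Qed.

Lemma dual_polar_sum x u v : dual_polar 0 x * form_value 0 u v ^+ 2 + dual_polar 1 x * form_value 1 u v ^+ 2 + dual_polar 2 x * form_value 2 u v ^+ 2 =
  u ^+ 2 + x ^+ 2 * v ^+ 2.
Proof. by rewrite dual_form_sum; ring. Qed.

Lemma dual_formD j E F G E' F' G' : dual_form j (E + E') (F + F') (G + G') = dual_form j E F G + dual_form j E' F' G'.
Proof. by case: j => [|[|j]] /=; ring. Qed.

Lemma dual_formZ j k E F G : dual_form j (k * E) (k * F) (k * G) = k * dual_form j E F G.
Proof. by case: j => [|[|j]] /=; ring. Qed.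

Lemma dual_form_form i j : (i < 3)%N -> (j < 3)%N -> dual_form j (form_rho i ^+ 2) (form_rho i * form_phi i) (form_phi i ^+ 2) = (i == j)%:R.
Proof.
case: i => [|[|[|//]]] _; case: j => [|[|[|//]]] _;
  rewrite /dual_form /form_rho /form_phi; move: (pi : R) pi_neq0 => p p0 /=; by field.
Qed.

Lemma pi_le4 : pi <= 4 :> R.
Proof. by have /andP[_] := @pihalf_02 R; lra. Qed.

Lemma dual_form_bound j E F G e : `|E| <= e -> `|F| <= e -> `|G| <= e -> `|dual_form j E F G| <= 200 * e.
Proof.
move=> hE hF hG; have e0 := le_trans (normr_ge0 E) hE.
have p2 : 0 <= (pi : R) ^+ 2 <= 16.
  rewrite sqr_ge0/= (_ : 16 = 4 ^+ 2); last by ring.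
  by rewrite ler_sqr ?nnegrE ?pi_le4// ltW// pi_gt0.
have pP (t : R) : `|t| <= 5 * e -> `|2 * pi ^+ 2 * t| <= 200 * e.
  move=> ht; rewrite normrM ger0_norm; last by lra.
  apply: le_trans (_ : 2 * 16 * (5 * e) <= _); last by lra.
  by apply: ler_pM => //; lra.
move: hE hF hG; rewrite !ler_norml => /andP[E1 E2] /andP[F1 F2] /andP[G1 G2].
case: j => [|[|j]] /=; last 2 first.
- by rewrite -ler_norml; apply: pP; rewrite ler_norml; apply/andP; split; lra.
- by rewrite -ler_norml; apply: pP; rewrite ler_norml; apply/andP; split; lra.
by apply/andP; split; lra.
Qed.

Lemma pi2_ge1 : 1 <= pi ^+ 2 :> R.
Proof. by have := @pi_ge2 R; move: (pi : R) => p h; rewrite expr2; nra. Qed.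

Lemma dual_polar_ge j x : 0 < x -> x ^+ 2 <= 13 / 10 -> x ^+ 2 / 2 <= dual_polar j x.
Proof.
move=> x0 x1; have := pi2_ge1; have z0 : 0 < x ^+ 2 by rewrite exprn_gt0.
rewrite /dual_polar; case: j => [|[|j]] /=; rewrite ?mulr0 ?addr0 ?subr0; move: (x ^+ 2) (pi ^+ 2) z0 x1 => z p z0 x1 p1; nra.
Qed.

Lemma dual_polar_gt0 j x : 0 < x -> x ^+ 2 <= 13 / 10 -> 0 < dual_polar j x.
Proof. by move=> x0 x1; apply: lt_le_trans (dual_polar_ge j x0 x1); rewrite divr_gt0// exprn_gt0. Qed.

Lemma dual_polar_form_value i x u v : (i < 3)%N -> 0 < x -> x ^+ 2 <= 13 / 10 ->
  dual_polar i x * form_value i u v ^+ 2 <= u ^+ 2 + x ^+ 2 * v ^+ 2.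
Proof.
move=> i3 x0 x1; rewrite -dual_polar_sum.
have h j : 0 <= dual_polar j x * form_value j u v ^+ 2 by rewrite mulr_ge0 ?sqr_ge0// ltW// dual_polar_gt0.
have := h 0%N; have := h 1%N; have := h 2%N.
by case: i i3 => [|[|[|//]]] _; lra.
Qed.

(** Each step gives up a part of the neighbourhood of the closed disk on which the maps are
    controlled. The [1 / 8] keeps the square of the radius below [1 + 3/10 tau^(m+3)]; the shift by
    3 makes the metrics of the current stage and of the next ones finite there. *)
Definition outer_radius (m : nat) : R := 1 + tau ^+ (m + 3) / 8.
Definition stage_domain m : set R := [set x | 0 < x < outer_radius m].

Lemma stage_domain_near_disk m x : stage_domain m x -> near_disk (m + 3) x.
Proof.
move=> /= /andP[x0]; rewrite /outer_radius => x1; split => //.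
have t0 := @tauX_gt0 R (m + 3); have t1 := @tauX_le1 R (m + 3).
move: (tau ^+ _) x1 t0 t1 => t x1 t0 t1.
have : x ^+ 2 <= (1 + t / 8) ^+ 2 by rewrite ler_sqr ?nnegrE; lra.
by rewrite !expr2; nra.
Qed.

Lemma stage_domain_sqr m x : stage_domain m x -> x ^+ 2 <= 13 / 10.
Proof. by move=> /stage_domain_near_disk[_]; have := @tauX_le1 R (m + 3); lra. Qed.

Lemma open_stage_domain m : open (stage_domain m).
Proof.
rewrite (_ : stage_domain m = `]0, (outer_radius m)[%classic); first exact: interval_open.
by apply/seteqP; split => x /=; rewrite in_itv.
Qed.

Lemma outer_radius_gt1 m : 1 < outer_radius m.
Proof. by rewrite /outer_radius ltrDl divr_gt0// tauX_gt0. Qed.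

Lemma outer_radius_S m : outer_radius m.+1 < outer_radius m.
Proof. by rewrite /outer_radius ltrD2l ltr_pM2r ?invr_gt0// addSn tauX_S. Qed.

Lemma stage_domain_S m : stage_domain m.+1 `<=` stage_domain m.
Proof. by move=> x /= /andP[x0 x1]; rewrite /stage_domain/= x0; exact: lt_trans x1 (outer_radius_S m). Qed.

(* The functions eta of the stage [k] are [deficit k f i]. *)
Definition deficit k f j x y : R :=
  dual_form j (conformal k.+1 x - coef_E f x y) (- coef_F f x y) (conformal k.+1 x * x ^+ 2 - coef_G f x y).

(* Before the step [i], the deficits of index [j >= i] are of the order of the
   increment of the metric, and those of index [j < i] are at most [i * slack] where
   the cutoff is 1. Each step changes the deficits by [slack] up to its intended
   effect, and [slack] is small enough for the next stage to start. *)
Definition deficit_todo k x : R := if core_radius k <= x then 3 / 2 * increment k x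
  else if core_radius k.+1 <= x then 4 * (conformal k.+1 x - 4) else conformal k.+1 x - 4.
Definition slack k x : R := Num.min (increment k x) (increment k.+1 x) / 32.
Definition deficit_done k x : R := if core_radius k.+1 <= x then 0 else 3 * (deficit_todo k x + 3 * slack k x).
Definition deficit_low k i j x : R := (if (i <= j)%N then increment k x / 2 else 0) - i%:R * slack k x.
Definition deficit_high k i j x : R := (if (i <= j)%N then deficit_todo k x else deficit_done k x) + i%:R * slack k x.
Definition f0 x y : 'rV[R]_3 := \row_j (if j == 0 then 2 * (x * cos y) else if j == 1 then 2 * (x * sin y) else 0).

(** The map is still [f0] on a core of radius [core_radius k.+1] when the stage [k] starts, and of
    radius [core_radius k.+2] after its first step. The latter is the initial radius of the stage
    [k.+1]. *)
Definition stage_inv k i f := [/\ vsmooth (stage_domain (3 * k + i)) f, per f, polar_inj f,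
  (forall x y, x <= core_radius (if i is 0%N then k.+1 else k.+2) -> f x y = f0 x y) &
  forall j x y, (j < 3)%N -> stage_domain (3 * k + i) x ->
    deficit_low k i j x * dual_polar j x <= deficit k f j x y <= deficit_high k i j x * dual_polar j x].

Lemma stage_domain_near_disk_succ k i x : stage_domain (3 * k + i) x -> near_disk k.+2 x.
Proof. by move=> /stage_domain_near_disk; apply: near_disk_le; lia. Qed.

Lemma slack_bounds k x : near_disk k.+2 x -> [/\ 0 < slack k x, 32 * slack k x <= increment k x & 32 * slack k x <= increment k.+1 x].
Proof.
move=> d; have d1 := increment_gt0 (near_disk_le (leqnSn k.+1) d); have d2 := increment_gt0 d.
have e : 32 * slack k x = Num.min (increment k x) (increment k.+1 x) by rewrite /slack; field.
split; last 2 first.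
- by rewrite e ge_min lexx.
- by rewrite e ge_min lexx orbT.
by rewrite divr_gt0// lt_min d1.
Qed.

(** Replaces the bounds of the individual steps by one bound for the stage: the slack is absorbed by
    passing from [3/2] to 2 increments outside the core, and from 4 to 5 times the gap inside. *)
Lemma deficit_high_bound k i j x : (i <= 3)%N -> near_disk k.+2 x -> 
  [/\ - (3 * slack k x) <= deficit_low k i j x, deficit_low k i j x <= increment k x & deficit_high k i j x <= deficit_bound k x].
Proof.
move=> i3 d; have [w0 w1 w2] := slack_bounds d.
have d1 := near_disk_le (leqnSn k.+1) d; have dl0 := increment_gt0 d1.
have m4 := conformal_ge4 (near_disk_le (leqnSn k) d1).
have i3' : 0 <= (i%:R : R) <= 3 by rewrite ler0n (ler_nat _ i 3).
have iw : 0 <= i%:R * slack k x <= 3 * slack k x.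
  by apply/andP; split; [rewrite mulr_ge0// ltW| rewrite ler_pM2r]; lra.
split; rewrite /deficit_low /deficit_high; first by case: ifP => _; lra.
  by case: ifP => _; lra.
have dE : increment k x = conformal k.+1 x - conformal k x by [].
rewrite /deficit_bound /deficit_done /deficit_todo; have Sl := @core_radius_lt R k.
case: (leP (core_radius k) x) => S1; case: (leP (core_radius k.+1) x) => S2; case: ifP => _; lra.
Qed.

Lemma low_gt0 k i x : (i < 3)%N -> near_disk k.+2 x -> 0 < deficit_low k i i x.
Proof.
move=> i3 d; have [w0 w1 w2] := slack_bounds d.
have dl0 := increment_gt0 (near_disk_le (leqnSn k.+1) d).
have iw : i%:R * slack k x <= 3 * slack k x by rewrite ler_pM2r// (ler_nat _ i 3) ltnW.
by rewrite /deficit_low leqnn; lra.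
Qed.

Definition first_form f x y u v : R := coef_E f x y * u ^+ 2 + 2 * coef_F f x y * u * v + coef_G f x y * v ^+ 2.

Lemma first_form_deficit k f x y u v : first_form f x y u v = conformal k.+1 x * (u ^+ 2 + x ^+ 2 * v ^+ 2) -
  (deficit k f 0 x y * form_value 0 u v ^+ 2 + deficit k f 1 x y * form_value 1 u v ^+ 2 + deficit k f 2 x y * form_value 2 u v ^+ 2).
Proof. by rewrite /deficit dual_form_sum /first_form; ring. Qed.

Section Bounds.
Variables (k i : nat) (f : R -> R -> 'rV[R]_3).
Hypotheses (i3 : (i <= 3)%N) (fi : stage_inv k i f).

Lemma deficit_bounds j x y : (j < 3)%N -> stage_domain (3 * k + i) x ->
  - (3 * slack k x) * dual_polar j x <= deficit k f j x y <= deficit_bound k x * dual_polar j x.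
Proof.
move=> j3 xI; have d := stage_domain_near_disk_succ xI; have [x0 _] := d.
have [l1 _ h1] := deficit_high_bound j i3 d; have h0 := dual_polar_gt0 j x0 (stage_domain_sqr xI).
have [_ _ _ _ /(_ j x y j3 xI)/andP[b1 b2]] := fi.
by apply/andP; split; [apply: le_trans b1|apply: le_trans b2 _]; rewrite ler_pM2r.
Qed.

Lemma first_form_lower x y u v : stage_domain (3 * k + i) x ->
  (conformal k.+1 x - deficit_bound k x) * (u ^+ 2 + x ^+ 2 * v ^+ 2) <= first_form f x y u v.
Proof.
move=> xI; rewrite (first_form_deficit k) -dual_polar_sum.
have h j : (j < 3)%N -> deficit k f j x y * form_value j u v ^+ 2 <= deficit_bound k x * dual_polar j x * form_value j u v ^+ 2.
  by move=> j3; rewrite ler_wpM2r ?sqr_ge0//; have /andP[] := deficit_bounds y j3 xI.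
by have := h 0%N isT; have := h 1%N isT; have := h 2%N isT; lra.
Qed.

Lemma first_form_upper x y u v : stage_domain (3 * k + i) x ->
  first_form f x y u v <= (conformal k.+1 x + 3 * slack k x) * (u ^+ 2 + x ^+ 2 * v ^+ 2).
Proof.
move=> xI; rewrite (first_form_deficit k) -dual_polar_sum.
have h j : (j < 3)%N -> - (3 * slack k x) * dual_polar j x * form_value j u v ^+ 2 <= deficit k f j x y * form_value j u v ^+ 2.
  by move=> j3; rewrite ler_wpM2r ?sqr_ge0//; have /andP[] := deficit_bounds y j3 xI.
by have := h 0%N isT; have := h 1%N isT; have := h 2%N isT; lra.
Qed.

Lemma conformal_deficit_bound x : stage_domain (3 * k + i) x -> [/\ 0 <= deficit_bound k x, 4 <= conformal k.+1 x & 250 * deficit_bound k x <= conformal k.+1 x].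
Proof.
move=> /stage_domain_near_disk_succ/(near_disk_le (leqnSn _)) d; split; [exact: deficit_bound_ge0|exact: conformal_ge4|exact: deficit_bound_le].
Qed.

End Bounds.

(** At the vector [(-F, E)] the form equals [E] times its determinant. *)
Lemma posform_gram (E F G l z : R) : 0 < l -> 0 < z ->
  (forall u v, l * (u ^+ 2 + z * v ^+ 2) <= E * u ^+ 2 + 2 * F * u * v + G * v ^+ 2) ->
  0 < E * G - F ^+ 2.
Proof.
move=> l0 z0 h; have E0 : 0 < E.
  by apply: lt_le_trans l0 _; have := h 1 0; rewrite !expr2; lra.
have := h (- F) E; have -> : E * (- F) ^+ 2 + 2 * F * - F * E + G * E ^+ 2 = E * (E * G - F ^+ 2) by ring.
move=> h2; rewrite -(pmulr_rgt0 _ E0); apply: lt_le_trans h2.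
by rewrite mulr_gt0// ltr_wpDl ?sqr_ge0// mulr_gt0// exprn_gt0.
Qed.

(* Apply the bound to the vector dual to the form [a u + b v]. *)
Lemma posform_dual (E F G a b n : R) : 0 < E * G - F ^+ 2 -> 0 < E * b ^+ 2 - 2 * F * a * b + G * a ^+ 2 ->
  (forall u v, n * (a * u + b * v) ^+ 2 <= E * u ^+ 2 + 2 * F * u * v + G * v ^+ 2) ->
  n * (E * b ^+ 2 - 2 * F * a * b + G * a ^+ 2) <= E * G - F ^+ 2.
Proof.
move=> g0 q0 h; have := h (a * G - b * F) (b * E - a * F).
have -> : a * (a * G - b * F) + b * (b * E - a * F) = E * b ^+ 2 - 2 * F * a * b + G * a ^+ 2 by ring.
have -> : E * (a * G - b * F) ^+ 2 + 2 * F * (a * G - b * F) * (b * E - a * F) + G * (b * E - a * F) ^+ 2 =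
  (E * G - F ^+ 2) * (E * b ^+ 2 - 2 * F * a * b + G * a ^+ 2) by ring.
by rewrite expr2 mulrA ler_pM2r.
Qed.

End Invariant.

(** * One step preserves the invariant *)

Section OneStep.
Context {R : realType}.
Implicit Types (f : R -> R -> 'rV[R]_3) (x y u v : R).

(** Vanishes up to [core_radius k.+2] and is 1 from twice that radius on, in particular from
    [core_radius k.+1], which is four times as large. *)
Definition stage_cutoff k x (y : R) : R := cutoff (x / core_radius k.+2).

Lemma smooth_conformal k m : (k <= m + 3)%N -> smooth (stage_domain m) (fun x (_ : R) => conformal k x).
Proof.
move=> km; apply: smoothM; first exact: smooth_cst.
have oI := @open_stage_domain R m.
have sd : smooth (stage_domain m) (fun x (_ : R) => conformal_den k x).
  by apply: smoothB; [exact: smooth_cst|apply: smoothM; [exact: smooth_cst|apply: smoothX; exact: smooth_fst]].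
apply: (smoothV oI _ (smoothX 2 sd)) => x _ /stage_domain_near_disk/(near_disk_le km)/conformal_den_gt0 d.
by rewrite exprn_gt0.
Qed.

Lemma smooth_first (I : set R) f : open I -> vsmooth I f -> [/\ smooth I (coef_E f), smooth I (coef_F f) & smooth I (coef_G f)].
Proof.
by move=> oI sf; have sx := vsmooth_dx oI sf; have sy := vsmooth_dy oI sf; split; exact: smooth_dot.
Qed.

Lemma per_first f : per f -> [/\ per (coef_E f), per (coef_F f) & per (coef_G f)].
Proof.
by move=> pf; have px := per_vdx pf; have py := per_vdy pf; split => x y; rewrite /coef_E /coef_F /coef_G ?px ?py.
Qed.

Lemma smooth_dual_form (I : set R) j (E F G : R -> R -> R) : smooth I E -> smooth I F -> smooth I G ->
  smooth I (fun x y => dual_form j (E x y) (F x y) (G x y)).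
Proof.
move=> sE sF sG; case: j => [|[|j]] /=.
- by apply: smoothB => //; apply: smoothM => //; exact: smooth_cst.
- by apply: smoothM; [exact: smooth_cst|apply: smoothD => //; apply: smoothM => //; exact: smooth_cst].
- by apply: smoothM; [exact: smooth_cst|apply: smoothB => //; apply: smoothM => //; exact: smooth_cst].
Qed.

Lemma smooth_deficit k m f j : (k < m + 3)%N -> vsmooth (stage_domain m) f -> smooth (stage_domain m) (deficit k f j).
Proof.
move=> km sf; have [sE sF sG] := smooth_first (@open_stage_domain R m) sf; have sm := smooth_conformal km.
apply: smooth_dual_form; [exact: smoothB|exact: smoothN|apply: smoothB => //].
by apply: smoothM => //; apply: smoothX; exact: smooth_fst.
Qed.

Lemma per_deficit k f j : per f -> per (deficit k f j).
Proof. by move=> /per_first[pE pF pG] x y; rewrite /deficit pE pF pG. Qed.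

Lemma smooth_f0 (I : set R) : open I -> vsmooth I f0.
Proof.
move=> oI j; have c := smooth_cos oI (@smooth_snd R I); have s := smooth_sin oI (@smooth_snd R I).
rewrite (_ : (fun x y => f0 x y 0 j) = fun x y => if j == 0 then 2 * (x * cos y) else if j == 1 then 2 * (x * sin y) else 0).
  case: (j == 0); last first.
    case: (j == 1); last exact: smooth_cst.
    by apply: smoothM; [exact: smooth_cst|apply: smoothM => //; exact: smooth_fst].
  by apply: smoothM; [exact: smooth_cst|apply: smoothM => //; exact: smooth_fst].
by apply/funext => x; apply/funext => y; rewrite mxE.
Qed.

(** The interest is at [x <= 0], outside [stage_domain]: the map coincides there with [f0], which is
    smooth everywhere. *)
Lemma vjcont_inv k i f x y j : stage_inv k i f -> x < outer_radius (3 * k + i) -> jcont (fun x y => f x y 0 j) x y.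
Proof.
move=> [sf _ _ f0E _] xR; set S := core_radius _ in f0E.
have S0 : 0 < S by exact: core_radius_gt0.
have [xS|xS] := ltP x S; last first.
  by apply: (smooth_jcont (sf j)); rewrite /stage_domain/= xR andbT; exact: lt_le_trans xS.
apply: (@jcont_ext _ [set z | z < S] (fun x y => f0 x y 0 j)) => //.
  by move=> a b ab; rewrite f0E// ltW.
exact: (smooth_jcont (smooth_f0 (@openT R) j)).
Qed.

Lemma near_vd f g s x y : (forall z w, z <= s -> g z w = f z w) -> x < s ->
  vdx g x y = vdx f x y /\ vdy g x y = vdy f x y.
Proof.
move=> gf xs; split; apply/rowP => j; rewrite !mxE.
  apply: near_eq_derive.
  have : \forall z \near x, z < s by exact: lt_nbhsl.
  by apply: filterS => z zs; rewrite gf// ltW.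
rewrite /dy (_ : (fun y0 => g x y0 0 j) = (fun y0 => f x y0 0 j))//; by apply/funext => w; rewrite gf// ltW.
Qed.

Lemma deficit_near k f g s j x y : (forall z w, z <= s -> g z w = f z w) -> x < s -> deficit k g j x y = deficit k f j x y.
Proof. by move=> gf xs; have [ex ey] := near_vd y gf xs; rewrite /deficit /coef_E /coef_F /coef_G ex ey. Qed.

(** By duality, adding [c] times the square of the form [i] to the metric changes the dual
    coordinate [i] alone; the errors are amplified by at most 200. *)
Lemma deficit_perturb k i j f g x y c e : (i < 3)%N -> (j < 3)%N ->
  `|coef_E g x y - coef_E f x y - c * form_rho i ^+ 2| <= e ->
  `|coef_F g x y - coef_F f x y - c * (form_rho i * form_phi i)| <= e ->
  `|coef_G g x y - coef_G f x y - c * form_phi i ^+ 2| <= e ->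
  `|deficit k g j x y - (deficit k f j x y - c * (i == j)%:R)| <= 200 * e.
Proof.
move=> i3 j3 hE hF hG; rewrite -(dual_form_form i3 j3) -dual_formZ /deficit.
set A := coef_E g x y - _ - _ in hE; set B := coef_F g x y - _ - _ in hF; set C := coef_G g x y - _ - _ in hG.
rewrite (_ : conformal k.+1 x - coef_E g x y = conformal k.+1 x - coef_E f x y + ((- c) * form_rho i ^+ 2 + - A)); last by rewrite /A; ring.
rewrite (_ : - coef_F g x y = - coef_F f x y + ((- c) * (form_rho i * form_phi i) + - B)); last by rewrite /B; ring.
rewrite (_ : conformal k.+1 x * x ^+ 2 - coef_G g x y = conformal k.+1 x * x ^+ 2 - coef_G f x y + ((- c) * form_phi i ^+ 2 + - C)); last by rewrite /C; ring.
rewrite 2!dual_formD !dual_formZ; set D := dual_form j _ _ _; set E := dual_form j _ _ _.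
rewrite (_ : D + _ - _ = dual_form j (- A) (- B) (- C)); last by ring.
by apply: dual_form_bound; rewrite normrN.
Qed.

Lemma increment_lower k s x : 0 < s -> s <= x -> near_disk k.+1 x -> 4 * (tau ^+ k * (1 - tau) * s ^+ 2) ^+ 2 <= increment k x.
Proof.
move=> s0 sx d; have [d0 d1] := conformal_den_S d.
rewrite /increment /conformal (inv_sqr_gap d0 (ltW d1)).
have g : tau ^+ k * (1 - tau) * s ^+ 2 <= conformal_den k x - conformal_den k.+1 x.
  rewrite conformal_den_step ler_wpM2l//; last by rewrite ler_sqr ?nnegrE; lra.
  by rewrite mulr_ge0 ?(ltW (tauX_gt0 k))//; have /andP[_] := @tau_bounds R; lra.
have g0 : 0 <= tau ^+ k * (1 - tau) * s ^+ 2 :> R.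
  by rewrite !mulr_ge0 ?sqr_ge0 ?(ltW (tauX_gt0 k))//; have /andP[_] := @tau_bounds R; lra.
have := conformal_den_le1 k x; move: (conformal_den k x) (conformal_den k.+1 x) (_ * s ^+ 2) d0 d1 g g0 => p q t q0 qp g g0 p1.
have pq : 0 < p ^+ 2 * q ^+ 2 by rewrite mulr_gt0 ?exprn_gt0//; lra.
have pq1 : p ^+ 2 * q ^+ 2 <= 1 by apply: mulr_ile1; rewrite ?sqr_ge0// exprn_ile1//; lra.
rewrite ler_pdivlMr//; apply: le_trans (_ : 4 * t ^+ 2 * 1 <= _).
  by rewrite ler_wpM2l// mulr_ge0// sqr_ge0.
by rewrite mulr1 expr2 -!mulrA ler_wpM2l//; apply: ler_pM => //; lra.
Qed.

(** Away from the origin the slack has a positive lower bound on the whole domain, so that one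
    frequency serves for all points. *)
Lemma slack_lower k s : 0 < s -> exists2 c : R, 0 < c & forall j x, s <= x -> near_disk k.+2 x -> c <= slack k x * dual_polar j x.
Proof.
move=> s0; pose b l : R := 4 * (tau ^+ l * (1 - tau) * s ^+ 2) ^+ 2.
have b0 l : 0 < b l.
  rewrite mulr_gt0// exprn_gt0// !mulr_gt0 ?tauX_gt0//; have /andP[_] := @tau_bounds R; lra.
exists (Num.min (b k) (b k.+1) / 32 * (s ^+ 2 / 2)).
  by rewrite mulr_gt0 ?divr_gt0 ?exprn_gt0// lt_min !b0.
move=> j x sx d; have x0 : 0 < x by lra.
have x2 : x ^+ 2 <= 13 / 10 by case: d => _; have := @tauX_le1 R k.+2; lra.
apply: ler_pM; rewrite ?divr_ge0 ?sqr_ge0//.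
- by rewrite le_min !ltW.
- rewrite /slack ler_pM2r ?invr_gt0// le_min !ge_min (increment_lower s0 sx d) orbT andbT.
  by rewrite (increment_lower s0 sx (near_disk_le (leqnSn _) d)).
- apply: le_trans (dual_polar_ge j x0 x2); rewrite ler_pM2r ?invr_gt0// ler_sqr ?nnegrE; lra.
Qed.

(** Numerical update of the bounds. Where the cutoff is 1 the deficit [i] is cancelled up to one
    slack. In the transition zone the correction [t] is only known to lie between [- 2 D] and [D],
    so that the deficit may triple: this is the 3 of [deficit_done]. *)
Lemma bounds_step k i j x (h D D' : R) : (i < 3)%N -> near_disk k.+2 x -> 0 < h ->
  deficit_low k i j x * h <= D <= deficit_high k i j x * h ->
  (x < core_radius k.+2 /\ D' = D) \/ (exists t, [/\ `|D' - (D - t * (i == j)%:R)| <= slack k x * h,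
     i = j -> - (2 * D) <= t <= D & i = j -> core_radius k.+1 <= x -> t = D]) ->
  deficit_low k i.+1 j x * h <= D' <= deficit_high k i.+1 j x * h.
Proof.
move=> i3 d h0 /andP[b1 b2] H.
have [w0 w1 w2] := slack_bounds d; have d1 := increment_gt0 (near_disk_le (leqnSn k.+1) d).
have iS : i.+1%:R = i%:R + 1 :> R by rewrite -natr1.
have i0 : 0 <= (i%:R : R) <= 2 by rewrite ler0n (ler_nat _ i 2).
have iw : 0 <= i%:R * slack k x <= 2 * slack k x.
  by apply/andP; split; [rewrite mulr_ge0// ltW| rewrite ler_pM2r]; lra.
have U0 : 0 <= deficit_todo k x.
  rewrite /deficit_todo; have := mu4_gt0 (near_disk_le (leqnSn k.+1) d); case: ifP => _; last case: ifP => _; lra.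
case: H => [[xs ->]|[t [p1 t1 t2]]].
  apply/andP; split; [apply: le_trans b1|apply: le_trans b2 _];
    rewrite ler_pM2r// /deficit_low /deficit_high iS.
    by case: (leqP i.+1 j) => ij; [rewrite ltnW//; lra|case: ifP => _; lra].
  have S1 : x < core_radius k.+1 by apply: lt_trans xs _; exact: core_radius_lt.
  have -> : deficit_done k x = 3 * (deficit_todo k x + 3 * slack k x) by rewrite /deficit_done leNgt S1.
  by case: (leqP i.+1 j) => ij; [rewrite ltnW//; lra|case: ifP => _; lra].
move: p1; rewrite ler_norml => /andP[p1 p2].
have {p1} p1 : D - t * (i == j)%:R - slack k x * h <= D' by lra.
have {p2} p2 : D' <= D - t * (i == j)%:R + slack k x * h by lra.
rewrite /deficit_low /deficit_high iS; have [ij|ij] := eqVneq i j; last first.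
  move: p1 p2; rewrite (negPf ij) mulr0 subr0 => p1 p2.
  have -> : (i.+1 <= j)%N = (i <= j)%N by rewrite ltn_neqAle ij.
  move: b1 b2; rewrite /deficit_low /deficit_high; case: ifP => _ b1 b2; apply/andP; split; lra.
subst j; move: p1 p2; rewrite eqxx mulr1 ltnn => p1 p2.
move: b1 b2; rewrite /deficit_low /deficit_high leqnn => b1 b2.
have iwh : 0 <= i%:R * slack k x * h <= 2 * slack k x * h.
  by case/andP: iw => iw1 iw2; rewrite mulr_ge0 ?(ltW h0)//= ler_wpM2r// ltW.
have wh : 0 < slack k x * h by rewrite mulr_gt0.
rewrite /deficit_done; have [S1|S1] := leP (core_radius k.+1) x.
  by have tD := t2 erefl S1; apply/andP; split; lra.
have /andP[t3 t4] := t1 erefl.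
by apply/andP; split; lra.
Qed.

Section Step.
Variables (k i : nat) (f : R -> R -> 'rV[R]_3).
Hypotheses (i3 : (i < 3)%N) (fi : stage_inv k i f).
Let m := (3 * k + i)%N.
Let eta := deficit k f i.

Lemma deficit_gt0 x y : stage_domain m x -> 0 < eta x y.
Proof.
move=> xI; have d := stage_domain_near_disk_succ xI; have [x0 _] := d.
have [_ _ _ _ /(_ i x y i3 xI)/andP[+ _]] := fi.
by apply: lt_le_trans; rewrite mulr_gt0 ?low_gt0 ?dual_polar_gt0// (stage_domain_sqr xI).
Qed.

Lemma deficit_form_value x y u v : stage_domain m x -> eta x y * form_value i u v ^+ 2 <= deficit_bound k x * (u ^+ 2 + x ^+ 2 * v ^+ 2).
Proof.
move=> xI; have d := stage_domain_near_disk_succ xI; have [x0 _] := d.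
have /andP[_ h] := deficit_bounds (ltnW i3) fi y i3 xI.
apply: le_trans (ler_wpM2r (sqr_ge0 _) h) _; rewrite -mulrA ler_wpM2l//.
  by apply: deficit_bound_ge0; exact: near_disk_le d.
exact: dual_polar_form_value (stage_domain_sqr xI).
Qed.

Lemma forms_gt0 : 0 < form_rho i ^+ 2 + form_phi i ^+ 2 :> R.
Proof.
have p0 := pi_gt0 R; rewrite /form_rho /form_phi; case: i => [|[|j]]; rewrite ?expr1n ?expr0n ?addr0//.
  by rewrite ltr_wpDl ?sqr_ge0// exprn_gt0// invr_gt0 mulr_gt0.
by rewrite ltr_wpDl ?sqr_ge0// sqrrN exprn_gt0// invr_gt0 mulr_gt0.
Qed.

Lemma forms_int : exists z : int, form_phi i * (2 * pi) = z%:~R :> R.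
Proof.
have p0 : (2 * pi) != 0 :> R by rewrite mulf_neq0// pi_neq0.
by case: i => [|[|j]] /=; [exists 0|exists 1|exists (- 1)]; rewrite ?mul0r ?mulNr ?mulVf.
Qed.

Lemma gram_gt0 x y : stage_domain m x -> 0 < gram f x y.
Proof.
move=> xI; have [b0 m4 bm] := conformal_deficit_bound xI; have [x0 _] := stage_domain_near_disk_succ xI.
have l0 : 0 < conformal k.+1 x - deficit_bound k x by lra.
exact: (posform_gram l0 (exprn_gt0 2 x0) (fun u v => first_form_lower (ltnW i3) fi y u v xI)).
Qed.

Lemma inv_step_ok : step_ok (stage_domain m) f eta (stage_cutoff k) (form_rho i) (form_phi i).
Proof.
have oI := @open_stage_domain R m; have [sf pf _ _ _] := fi.
have km : (k < m + 3)%N by rewrite /m; lia.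
split; [split => //|split; [split|split]] => //.
- exact: smooth_deficit.
- by apply: smooth_cutoff => //; apply: smoothM; [exact: smooth_fst|exact: smooth_cst].
- exact: forms_gt0.
- exact: deficit_gt0.
- exact: gram_gt0.
(* Condition [64 eta <= |U|^2]. Since [|U|^2 = gram / |W|^2] is the inverse of the squared dual norm
   of the phase form, [posform_dual] reduces it to a comparison of [64 eta] times the squared phase
   form with the metric. *)
- move=> x y xI; have g0 := gram_gt0 y xI.
  have W0 := frame_W_gt0 forms_gt0 g0.
  rewrite (frame_U_sqr forms_gt0 g0) ler_pdivlMr//.
  have We : dot (sW f (form_rho i) (form_phi i) x y) (sW f (form_rho i) (form_phi i) x y) =
     coef_E f x y * form_phi i ^+ 2 - 2 * coef_F f x y * form_rho i * form_phi i + coef_G f x y * form_rho i ^+ 2.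
    by rewrite /sW dot_lin2 /coef_E /coef_F /coef_G; move: (dot _ _) (dot _ _) (dot _ _) (form_rho i) (form_phi i) => *; ring.
  rewrite We in W0 *; apply: posform_dual => // u v.
  have [b0 m4 bm] := conformal_deficit_bound xI; have h := deficit_form_value y u v xI.
  apply: le_trans (first_form_lower (ltnW i3) fi y u v xI).
  have z0 : 0 <= u ^+ 2 + x ^+ 2 * v ^+ 2 by exact: addr_ge0 (sqr_ge0 _) (mulr_ge0 (sqr_ge0 _) (sqr_ge0 _)).
  rewrite -[form_rho i * u + _]/(form_value i u v) -mulrA.
  apply: le_trans (ler_wpM2l _ h) _ => //.
  rewrite mulrA ler_wpM2r//; lra.
- by move=> x y; exact: cutoff01.
- exact: per_deficit.
- exact: forms_int.
Qed.

Lemma step_exists e : 0 < e -> exists N, (0 < N)%N /\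
  let F := corrug f eta (stage_cutoff k) (form_rho i) (form_phi i) N in
  [/\ stage_inv k i.+1 F, (forall x y, x <= 1 -> enorm (F x y - f x y) <= e) &
    forall x y, 0 < x <= 1 -> enorm (vdx F x y - vdx f x y) <= 3 * Num.sqrt (deficit_bound k x) + e * x /\
      enorm (vdy F x y - vdy f x y) <= (3 * Num.sqrt (deficit_bound k x) + e * x) * x].
Proof.
move=> e0; have ok := inv_step_ok; have [sf pf injf f0E bd] := fi.
pose s : R := core_radius k.+2; have s0 : 0 < s by exact: core_radius_gt0.
have sl : s <= 1 / 100 by exact: core_radius_le.
have R1 := outer_radius_gt1 (R := R) m.+1; have RS := outer_radius_S (R := R) m.
have seg x : s <= x <= outer_radius m.+1 -> stage_domain m x.
  by move=> /andP[sx xR]; rewrite /stage_domain/=; apply/andP; split; [exact: lt_le_trans sx|exact: le_lt_trans RS].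
have [c c0 dual_form] := slack_lower k s0.
(* The step acts only where [x >= s], so that [d <= e s^2] is at most both [e x] and [e x^2] there.
   The bound [c / 200] keeps the change of the deficits within one slack. *)
pose d : R := Num.min (e * s * s) (c / 200).
have d0 : 0 < d by rewrite lt_min !mulr_gt0//= divr_gt0.
have dess : d <= e * s * s by rewrite ge_min lexx.
have des : d <= e * s by apply: le_trans dess _; rewrite ler_piMr ?mulr_ge0 ?(ltW e0) ?(ltW s0)//; lra.
have dc : 200 * d <= c by rewrite mulrC -ler_pdivlMr// ge_min lexx orbT.
have [N1 HN1] := step_estimate ok seg d0.
have psi0 x y : x <= s -> stage_cutoff k x y = 0.
  by move=> xs; apply: cutoff0; rewrite ler_pdivrMr// mul1r.
have [N2 HN2] : exists N0, forall N, (N0 <= N)%N -> polar_inj (corrug f eta (stage_cutoff k) (form_rho i) (form_phi i) N).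
  apply: (corrug_inj ok s0 (lt_trans R1 RS)) => //.
    by move=> x y j xR; exact: vjcont_inv fi xR.
  move=> x0 y0 /andP[x00 x01].
  have xI : stage_domain m x0 by rewrite /stage_domain/= x00; lra.
  have [b0 m4 bm] := conformal_deficit_bound xI; have hl := first_form_lower (ltnW i3) fi y0 _ _ xI.
  have l0 : 0 < conformal k.+1 x0 - deficit_bound k x0 by lra.
  have e0' := ltW (deficit_gt0 y0 xI).
  (* Squaring turns the condition of [corrug_inj] into [15^2 eta p^2 <= conformal - deficit_bound],
     which the factor 250 of [deficit_bound_le] provides. *)
  have hl' p : eta x0 y0 * p ^+ 2 <= deficit_bound k x0 * 1 -> 3 * Num.sqrt (eta x0 y0) * `|p| <= Num.sqrt (conformal k.+1 x0 - deficit_bound k x0) / 5.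
    move=> h; rewrite ler_pdivlMr// -sqrtr_sqr -mulrA -sqrtrM// mulrAC.
    have -> : 3 * 5 = Num.sqrt (15 ^+ 2) :> R by rewrite sqrtr_sqr ger0_norm//; ring.
    rewrite -sqrtrM ?sqr_ge0// ler_wsqrtr//; move: h; rewrite mulr1.
    have -> : 15 ^+ 2 * (eta x0 y0 * p ^+ 2) = 15 * (15 * (eta x0 y0 * p ^+ 2)) by ring.
    by move: (eta x0 y0 * p ^+ 2) => q h; lra.
  have ha := deficit_form_value y0 1 0 xI; have hb := deficit_form_value y0 0 1 xI.
  exists (Num.sqrt (conformal k.+1 x0 - deficit_bound k x0)); split.
  - by rewrite sqrtr_gt0.
  - by move=> u v; rewrite sqr_sqrtr ?(ltW l0)//; exact: hl.
  - apply: hl'; move: ha; rewrite /form_value mulr1 mulr0 addr0 expr1n expr0n mulr0 addr0.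
    by [].
  (* The angular coordinate vector has flat length [x0], whence the coefficient
     [form_phi i / x0]. *)
  - rewrite -ler_pdivrMr// -[_ / x0]mulrA.
    rewrite -[X in _ * (_ * X)](gtr0_norm (x := x0^-1)) ?invr_gt0// -normrM; apply: hl'.
    move: hb; rewrite /form_value mulr0 mulr1 add0r expr1n expr0n add0r mulr1 mulr1 exprMn exprVn => hb.
    by rewrite mulrA ler_pdivrMr// exprn_gt0.
pose N := (maxn N1 N2).+1; exists N; split; first by [].
move=> F.
have N1N : (N1 <= N)%N by rewrite leqW// leq_maxl.
have EST := HN1 N N1N isT.
have Ff x y : x <= s -> F x y = f x y by move=> xs; apply: corrug_id; exact: psi0.
have mS : (3 * k + i.+1 = m.+1)%N by rewrite addnS.
split; last 2 first.
- move=> x y x1; have [xs|xs] := leP x s; first by rewrite Ff// subrr enorm0 ltW.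
  have xr : s <= x <= outer_radius m.+1 by rewrite (ltW xs) (ltW (le_lt_trans x1 R1)).
  have [h _ _ _] := EST x y xr; apply: le_trans h _; apply: le_trans des _.
  by rewrite ler_piMr ?(ltW e0)//; lra.
- move=> x y /andP[x0 x1]; have [xs|xs] := ltP x s.
    have [-> ->] := near_vd y Ff xs; rewrite !subrr enorm0.
    by split; do ?[apply: addr_ge0|apply: mulr_ge0]; rewrite ?sqrtr_ge0 ?(ltW x0) ?(ltW e0).
  have xr : s <= x <= outer_radius m.+1 by rewrite xs (ltW (le_lt_trans x1 R1)).
  have xI := seg x xr; have e0' := ltW (deficit_gt0 y xI).
  have [_ h1 h2 _] := EST x y xr.
  have dx : d <= e * x by apply: le_trans des _; rewrite ler_pM2l.
  have dxx : d <= e * x * x.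
    apply: le_trans dess _; apply: ler_pM; rewrite ?mulr_ge0 ?(ltW e0) ?(ltW s0)//.
    by rewrite ler_pM2l.
  have ha := deficit_form_value y 1 0 xI; have hb := deficit_form_value y 0 1 xI.
  split; [apply: le_trans h1 _|apply: le_trans h2 _; rewrite [leRHS]mulrDl]; apply: lerD => //.
    rewrite -mulrA ler_wpM2l// -sqrtr_sqr -sqrtrM// ler_wsqrtr//.
    by move: ha; rewrite /form_value mulr1 mulr0 addr0 expr1n expr0n mulr0 addr0 mulr1.
  have B0 : 0 <= deficit_bound k x by apply: deficit_bound_ge0; exact: near_disk_le (stage_domain_near_disk_succ xI).
  have -> : 3 * Num.sqrt (deficit_bound k x) * x = 3 * Num.sqrt (deficit_bound k x * x ^+ 2).
    by rewrite sqrtrM// sqrtr_sqr gtr0_norm// mulrA.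
  rewrite -mulrA ler_wpM2l// -sqrtr_sqr -sqrtrM// ler_wsqrtr//.
  by move: hb; rewrite /form_value mulr1 mulr0 add0r expr1n expr0n add0r mulr1.
split.
- rewrite mS => j; apply: (smooth_sub (@stage_domain_S R m)); exact: (vsmooth_corrug ok N j).
- exact: per_corrug ok N.
- by apply: HN2; rewrite leqW// leq_maxr.
- move=> x y xs; rewrite Ff// f0E//; apply: le_trans xs _.
  by case: i; rewrite // ltW// core_radius_lt.
move=> j x y j3; rewrite mS => xI; have xI' := stage_domain_S xI.
have dd := stage_domain_near_disk_succ xI'; have [x0 _] := dd.
have h0 := dual_polar_gt0 j x0 (stage_domain_sqr xI').
apply: (bounds_step i3 dd h0 (bd j x y j3 xI')).
have [xs|xs] := ltP x s; [left|right]; first by rewrite (deficit_near _ _ _ Ff xs).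
have xr : s <= x <= outer_radius m.+1 by rewrite xs/=; case/andP: xI => _ /ltW.
have [_ _ _ [t [t1 t2 cE cF cG]]] := EST x y xr.
exists t; split.
- apply: le_trans (deficit_perturb k i3 j3 cE cF cG) _; exact: le_trans dc (dual_form j x xs dd).
- by move=> <-.
- move=> ij S1; rewrite -ij; apply: t2; apply: cutoff1; rewrite ler_pdivlMr//; apply: le_trans S1.
  by rewrite (core_radius_S k.+1) ler_pM2r// ler_nat.
Qed.

End Step.
End OneStep.

(** * The sequence of steps *)

Section Sequence.
Context {R : realType}.
Implicit Types (f : R -> R -> 'rV[R]_3) (x y u v : R).

Lemma vd_f0 x y : vdx f0 x y = \row_j (if j == 0 then 2 * cos y else if j == 1 then 2 * sin y else 0) /\
  vdy f0 x y = \row_j (if j == 0 then - (2 * (x * sin y)) else if j == 1 then 2 * (x * cos y) else 0).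
Proof.
split; apply/rowP => j; rewrite !mxE /dx /dy.
  rewrite (_ : (fun x0 => f0 x0 y 0 j) = fun x0 => x0 * (if j == 0 then 2 * cos y else if j == 1 then 2 * sin y else 0)); last first.
    by apply/funext => z; rewrite mxE; case: (j == 0); last case: (j == 1); ring.
  have := is_derive_mul (@is_derive_id R R x 1) (is_derive_cst (if j == 0 then 2 * cos y else if j == 1 then 2 * sin y else 0) x (1 : R)).
  by move=> h; rewrite derive_val /cst mul1r mulr0 addr0.
have hc := is_derive_mul (is_derive_cst (2 * x) y (1 : R)) (is_derive_cos y).
have hs := is_derive_mul (is_derive_cst (2 * x) y (1 : R)) (is_derive_sin y).
case: ifP => j0; last case: ifP => j1.
- rewrite (_ : (fun y0 => f0 x y0 0 j) = fun y0 => cst (2 * x) y0 * cos y0); last first.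
    by apply/funext => z; rewrite mxE j0 mulrA.
  by rewrite derive_val /cst; ring.
- rewrite (_ : (fun y0 => f0 x y0 0 j) = fun y0 => cst (2 * x) y0 * sin y0); last first.
    by apply/funext => z; rewrite mxE j0 j1 mulrA.
  by rewrite derive_val /cst; ring.
- rewrite (_ : (fun y0 => f0 x y0 0 j) = fun=> 0); last by apply/funext => z; rewrite mxE j0 j1.
  by rewrite derive_val.
Qed.

Lemma deficit_f0 k j x y : deficit k f0 j x y = (conformal k.+1 x - 4) * dual_polar j x.
Proof.
have [ex ey] := vd_f0 x y; have cs := cos2Dsin2 y.
have E : coef_E f0 x y = 4.
  rewrite /coef_E ex dot3E !mxE /=; rewrite (_ : 4 = 4 * (cos y ^+ 2 + sin y ^+ 2)); first by ring.
  by rewrite cs mulr1.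
have F : coef_F f0 x y = 0 by rewrite /coef_F ex ey dot3E !mxE /=; ring.
have G : coef_G f0 x y = 4 * x ^+ 2.
  rewrite /coef_G ey dot3E !mxE /=; rewrite (_ : 4 * x ^+ 2 = 4 * x ^+ 2 * (cos y ^+ 2 + sin y ^+ 2)); first by ring.
  by rewrite cs mulr1.
rewrite /deficit E F G /dual_polar -dual_formZ; congr (dual_form j _ _ _); ring.
Qed.

Lemma polar_inj_f0 : polar_inj (f0 (R := R)).
Proof.
move=> x y x' y' xr xr' /rowP E; have := E 0; have := E 1; rewrite !mxE /= => e1 e2.
by split; [move: e2|move: e1] => /(mulfI _); apply.
Qed.

Lemma inv0 : stage_inv 0 0 (f0 (R := R)).
Proof.
split=> //.
- exact: smooth_f0 (@open_stage_domain R 0).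
- by move=> x y; apply/rowP => j; rewrite !mxE (_ : 2 * pi = pi *+ 2) ?cosD2pi ?sinD2pi// mulr_natl.
- exact: polar_inj_f0.
move=> j x y j3 xI; have d := stage_domain_near_disk_succ xI; have [x0 _] := d.
have h0 := dual_polar_gt0 j x0 (stage_domain_sqr xI); have m4 := mu4_gt0 (near_disk_le (leqnSn _) d).
have e : increment 0 x = conformal 1 x - 4 by rewrite /increment conformal0.
rewrite deficit_f0 !ler_pM2r// /deficit_low /deficit_high leq0n mul0r subr0 addr0 /deficit_todo -e.
by rewrite -e in m4; apply/andP; split; [lra|case: ifP => _; last case: ifP => _; lra].
Qed.

(** The new deficits are the residues of the finished stage, at most 3 slacks, plus an increment
    worth at least 32 slacks: they lie between half and three halves of it. In the former transition
    zone, three times the old gap plus the increment stays below four times the new gap. *)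
Lemma inv_next k f : stage_inv k 3 f -> stage_inv k.+1 0 f.
Proof.
move=> [sf pf fi f0E bd]; have e3 : (3 * k.+1 + 0 = 3 * k + 3)%N by lia.
split=> //; rewrite e3// => j x y j3 xI; have d := stage_domain_near_disk_succ xI; have [x0 _] := d.
have h0 := dual_polar_gt0 j x0 (stage_domain_sqr xI).
have d3 : near_disk k.+3 x by have := stage_domain_near_disk xI; apply: near_disk_le; lia.
have m4 := mu4_gt0 (near_disk_le (leqnSn _) d); have m4' := mu4_gt0 d.
have dl0 := increment_gt0 (near_disk_le (leqnSn _) d); have dl1 := increment_gt0 d.
have [w0 w1 w2] := slack_bounds d.
have S1 := @core_radius_lt R k; have S2 := @core_radius_lt R k.+1.
have e : increment k.+1 x = conformal k.+2 x - conformal k.+1 x by [].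
rewrite {1}/deficit_low {1}/deficit_high leq0n mul0r subr0 addr0.
have [xs|xs] := ltP x (core_radius k.+2).
  rewrite (deficit_near k.+1 j y f0E xs) deficit_f0 !ler_pM2r// /deficit_todo.
  by case: (leP (core_radius k.+1) x) => hx; [lra|case: (leP (core_radius k.+2) x) => hx'; apply/andP; split; lra].
have -> : deficit k.+1 f j x y = deficit k f j x y + increment k.+1 x * dual_polar j x.
  by rewrite /deficit /dual_polar -dual_formZ -dual_formD; congr (dual_form j _ _ _); rewrite e; ring.
have /andP[b1 b2] := bd j x y j3 xI; move: b1 b2; rewrite /deficit_low /deficit_high.
rewrite leqNgt j3 /= => b1 b2; apply/andP; split.
  have := ler_wpM2r (ltW h0) w2; have := mulr_gt0 dl1 h0; lra.
suff : (deficit_done k x + 3 * slack k x + increment k.+1 x) * dual_polar j x <= deficit_todo k.+1 x * dual_polar j x by lra.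
rewrite ler_pM2r// /deficit_todo /deficit_done; have [hx|hx] := leP (core_radius k.+1) x; first by lra.
have -> : deficit_todo k x = conformal k.+1 x - 4 by rewrite /deficit_todo leNgt (lt_trans hx S1)/= leNgt hx.
rewrite xs; lra.
Qed.

(** The derivatives are bounded by [6 / tau^(m+1)]; coordinatewise mean values double this, and the
    polar path of [F_lip] costs a factor 9. The resulting 108 is rounded to 120. *)
Definition lip_bound m : R := 120 / tau ^+ m.+1.
(* [budget m ^ (1 - b) * lip_bound m.+1] is summable for every [b < 1]. *)
Definition budget m : R := ((2 ^+ m * lip_bound m.+1) ^+ m)^-1.

Lemma lip_bound_ge1 m : 1 <= lip_bound m.
Proof.
rewrite /lip_bound ler_pdivlMr ?tauX_gt0// mul1r; have := @tauX_le1 R m.+1; lra.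
Qed.

Lemma budget_gt0 m : 0 < budget m.
Proof.
rewrite invr_gt0 exprn_gt0// mulr_gt0 ?exprn_gt0//.
exact: lt_le_trans (lip_bound_ge1 _).
Qed.

(* [z.2] bounds the distance from [z.1] to the limit; the margin keeps points at
   distance at least [1 / (m + 1)] apart in the limit. *)
Definition stage_ok m (z : (R -> R -> 'rV[R]_3) * R) :=
  [/\ stage_inv (m %/ 3) (m %% 3) z.1, 0 < z.2, z.2 <= budget m &
   forall x y x' y', 0 <= x <= 1 -> 0 <= x' <= 1 -> m.+1%:R^-1 <= polar_dist x y x' y' ->
     4 * z.2 <= enorm (z.1 x y - z.1 x' y')].

(* The step [m] is the step [m %% 3] of the stage [m %/ 3], both counted from 0. *)
Definition next m (z z' : (R -> R -> 'rV[R]_3) * R) :=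
  [/\ exists2 N, (0 < N)%N & z'.1 = corrug z.1 (deficit (m %/ 3) z.1 (m %% 3)) (stage_cutoff (m %/ 3)) (form_rho (m %% 3)) (form_phi (m %% 3)) N,
    z'.2 <= z.2 / 2, (forall x y, x <= 1 -> enorm (z'.1 x y - z.1 x y) <= z.2 / 2) &
    forall x y, 0 < x <= 1 -> enorm (vdx z'.1 x y - vdx z.1 x y) <= 3 * Num.sqrt (deficit_bound (m %/ 3) x) + 2^-1 ^+ m * x /\
      enorm (vdy z'.1 x y - vdy z.1 x y) <= (3 * Num.sqrt (deficit_bound (m %/ 3) x) + 2^-1 ^+ m * x) * x].

Lemma inv_margin m f : stage_inv (m %/ 3) (m %% 3) f -> exists2 d : R, 0 < d & 
  forall x y x' y', 0 <= x <= 1 -> 0 <= x' <= 1 -> m.+1%:R^-1 <= polar_dist x y x' y' ->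
     4 * d <= enorm (f x y - f x' y').
Proof.
move=> fi; have [_ pf injf _ _] := fi.
have m0 : 0 < m.+1%:R^-1 :> R by rewrite invr_gt0.
have [x y j /andP[_ x1]|d d0 H] := margin m0 pf injf.
  by apply: vjcont_inv fi _; exact: le_lt_trans (outer_radius_gt1 _).
exists (d / 4); first by rewrite divr_gt0.
by move=> x y x' y' xr xr' h; rewrite mulrC divfK//; exact: H.
Qed.

Lemma stage_ok_next m z : stage_ok m z -> exists z', stage_ok m.+1 z' /\ next m z z'.
Proof.
case: z => f d [/= fi d0 de Hm].
have i3 : (m %% 3 < 3)%N by rewrite ltn_mod.
(* The step may spend half of the remaining distance to the limit, and moves the derivatives by at
   most [2^-m] besides the unavoidable term. *)
have e0 : 0 < Num.min (d / 2) (2^-1 ^+ m) by rewrite lt_min divr_gt0//= exprn_gt0.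
have [N [N0 [Finv F1 F2]]] := step_exists i3 fi e0.
set F := corrug _ _ _ _ _ N in Finv F1 F2.
have Finv' : stage_inv (m.+1 %/ 3) (m.+1 %% 3) F.
  have [i2|i2] := eqVneq (m %% 3)%N 2%N.
    have -> : (m.+1 %/ 3 = (m %/ 3).+1)%N by lia.
    have -> : (m.+1 %% 3 = 0)%N by lia.
    by apply: inv_next; rewrite i2 in Finv.
  have -> : (m.+1 %/ 3 = m %/ 3)%N by lia.
  by have -> : (m.+1 %% 3 = (m %% 3).+1)%N by lia.
have [d' d'0 Hd'] := inv_margin Finv'.
(* The new bound leaves the other half for the future, meets the Hölder budget, and is at most a
   quarter of the margin of the new map. *)
exists (F, Num.min d' (Num.min (d / 2) (budget m.+1))); split; split => //=.
- by rewrite !lt_min d'0 divr_gt0//= budget_gt0.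
- by rewrite !ge_min lexx !orbT.
- move=> x y x' y' xr xr' h; apply: le_trans (Hd' x y x' y' xr xr' h).
  by rewrite ler_pM2l// ge_min lexx.
- by exists N.
- by rewrite !ge_min lexx !orbT.
- by move=> x y x1; apply: le_trans (F1 x y x1) _; rewrite ge_min lexx.
have eh : Num.min (d / 2) (2^-1 ^+ m) <= 2^-1 ^+ m by rewrite ge_min lexx orbT.
move=> x y xr; have [h1 h2] := F2 x y xr; have x0 : 0 <= x by case/andP: xr => /ltW.
split; [apply: le_trans h1 _|apply: le_trans h2 _]; first by rewrite lerD2l ler_wpM2r.
by rewrite ler_wpM2r// lerD2l ler_wpM2r.
Qed.

(** Dependent choice: the tolerance of a step depends on the margin of the map produced by the
    previous one. *)
Lemma sequence_exists : exists Z : nat -> (R -> R -> 'rV[R]_3) * R, 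
  [/\ (Z 0%N).1 = f0, forall m, stage_ok m (Z m) & forall m, next m (Z m) (Z m.+1)].
Proof.
have [d d0 Hd] := inv_margin (m := 0) inv0.
have z0 : stage_ok 0 (f0, Num.min d (budget 0)).
  split => //=; first exact: inv0; first by rewrite lt_min d0 budget_gt0.
    by rewrite ge_min lexx orbT.
  move=> x y x' y' xr xr' h; apply: le_trans (Hd x y x' y' xr xr' h).
  by rewrite ler_pM2l// ge_min lexx.
pose nx m (z : {z | stage_ok m z}) : {z' | stage_ok m.+1 z' /\ next m (sval z) z'} := cid (stage_ok_next (svalP z)).
pose fix S m : {z | stage_ok m z} := if m is m'.+1 then exist _ _ (svalP (nx m' (S m'))).1 else exist _ _ z0.
exists (fun m => sval (S m)); split => // m; first exact: svalP (S m).
exact: (svalP (nx m (S m))).2.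
Qed.

End Sequence.

(** * The limit map *)

Section VectorLimits.
Context {R : realType}.

Definition vlim (u : nat -> 'rV[R]_3) : 'rV[R]_3 := \row_j limn (fun m => u m 0 j).

Lemma le_eps (a b : R) : (forall e, 0 < e -> a <= b + e) -> a <= b.
Proof. by move=> h; apply/ler_addgt0Pr. Qed.

Lemma cauchy_lim (u e : nat -> R) : e @ \oo --> (0 : R) ->
  (forall m n, (m <= n)%N -> `|u n - u m| <= e m) -> forall m, `|limn u - u m| <= e m.
Proof.
move=> e0 ue.
have cu : cvgn u.
  apply/cauchy_cvgP/cauchy_exP => eps eps0.
  have [m _ em] : \forall m \near \oo, e m < eps by move/cvgrPdist_lt : e0 => /(_ _ eps0); apply: filterS => m; rewrite sub0r normrN; apply: le_lt_trans; exact: ler_norm.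
  exists (u m); exists m => // n /= mn; rewrite /ball /= distrC.
  exact: le_lt_trans (ue m n mn) (em m (leqnn m)).
move=> m.
have h : `|u n - u m| @[n --> \oo] --> `|limn u - u m|.
  by apply: cvg_norm; apply: cvgB => //; exact: cvg_cst.
rewrite -(cvg_lim _ h)//; apply: limr_le; first by apply/cvg_ex; eexists; exact: h.
by exists m => // n /= mn; exact: ue.
Qed.

(** The factor 2 of [enorm3_le] is spent only on the tail beyond a large [n], which is arbitrarily
    small, so that the bound [e m] itself passes to the limit. *)
Lemma vcauchy_lim (u : nat -> 'rV[R]_3) (e : nat -> R) : e @ \oo --> (0 : R) ->
  (forall m n, (m <= n)%N -> enorm (u n - u m) <= e m) -> forall m, enorm (vlim u - u m) <= e m.
Proof.
move=> e0 ue m.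
have lim_coord j n : `|vlim u 0 j - u n 0 j| <= e n.
  rewrite mxE; apply: (cauchy_lim (u := fun m => u m 0 j) e0) => p q pq.
  by apply: le_trans (ue p q pq); rewrite -rV3B; exact: enorm_coord.
apply: le_eps => eps eps0.
have eps2 : 0 < eps / 2 by rewrite divr_gt0.
have [n0 _ en] : \forall m \near \oo, e m < eps / 2.
  move/cvgrPdist_lt : e0 => /(_ _ eps2); apply: filterS => p; rewrite sub0r normrN; apply: le_lt_trans; exact: ler_norm.
pose n := maxn m n0.
have -> : vlim u - u m = (u n - u m) + (vlim u - u n).
  by move: (vlim u) (u n) (u m) => a b c; apply/rowP => j; rewrite !mxE; ring.
apply: le_trans (enormD _ _) _; apply: lerD; first by apply: ue; exact: leq_maxl.
have -> : eps = 2 * (eps / 2) by field.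
apply: enorm3_le => j; rewrite rV3B; apply: le_trans (lim_coord j n) _.
by apply/ltW/en; rewrite /= leq_maxr.
Qed.

Lemma geom_cauchy (u : nat -> 'rV[R]_3) (A q : R) : 0 <= A -> 0 <= q < 1 ->
  (forall m, enorm (u m.+1 - u m) <= A * q ^+ m) ->
  forall m, enorm (vlim u - u m) <= A / (1 - q) * q ^+ m.
Proof.
move=> A0 /andP[q0 q1] h; have q1' : 0 < 1 - q by rewrite subr_gt0.
apply: vcauchy_lim.
  rewrite -[X in _ --> X](mulr0 (A / (1 - q))); apply: cvgM; first exact: cvg_cst.
  by apply: cvg_expr; rewrite ger0_norm.
move=> m n /subnK <-; move: (n - m)%N => {n} n.
suff H : enorm (u (n + m)%N - u m) <= A / (1 - q) * (q ^+ m - q ^+ (n + m)).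
  apply: le_trans H _; rewrite ler_wpM2l ?divr_ge0 ?(ltW q1')// gerBl exprn_ge0//.
elim: n => [|n IH]; first by rewrite add0n !subrr enorm0 mulr0.
have -> : u (n.+1 + m)%N - u m = (u (n + m).+1 - u (n + m)%N) + (u (n + m)%N - u m).
  by rewrite addSn; move: (u _) (u _) (u _) => a b c; apply/rowP => j; rewrite !mxE; ring.
apply: le_trans (enormD _ _) _; apply: le_trans (lerD (h _) IH) _.
rewrite addSn exprS le_eqVlt; apply/orP; left; apply/eqP; field.
by rewrite gt_eqF.
Qed.

Lemma vlim_bound (u : nat -> 'rV[R]_3) (l : 'rV[R]_3) (e : nat -> R) (m : nat) (c : R) : e @ \oo --> (0 : R) ->
  (forall n, (m <= n)%N -> enorm (l - u n) <= e n) -> (forall n, (m <= n)%N -> enorm (u n) <= c) -> enorm l <= c.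
Proof.
move=> e0 le uc; apply: le_eps => eps eps0.
have [n0 _ en] : \forall m \near \oo, e m < eps.
  move/cvgrPdist_lt : e0 => /(_ _ eps0); apply: filterS => p; rewrite sub0r normrN; apply: le_lt_trans; exact: ler_norm.
have mn : (m <= maxn m n0)%N by exact: leq_maxl.
rewrite -[l](subrK (u (maxn m n0))) addrC; apply: le_trans (enormD _ _) _; apply: lerD; first exact: uc.
by apply: le_trans (le _ mn) _; apply/ltW/en; rewrite /= leq_maxr.
Qed.

Lemma enorm_tri3 (V v w W : 'rV[R]_3) a b : enorm (V - v) <= a -> enorm (W - w) <= a -> enorm (v - w) <= b ->
  enorm (V - W) <= a + b + a.
Proof.
move=> h1 h2 h3; have -> : V - W = (V - v) + (v - w) - (W - w) by apply/rowP => j; rewrite !mxE; ring.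
by apply: le_trans (enormB _ _) _; apply: lerD => //; apply: le_trans (enormD _ _) _; exact: lerD.
Qed.

Lemma cvg_lin2 (a b : nat -> 'rV[R]_3) (A B : 'rV[R]_3) (u v : R) j :
  a k 0 j @[k --> \oo] --> A 0 j -> b k 0 j @[k --> \oo] --> B 0 j ->
  (u *: a k + v *: b k) 0 j @[k --> \oo] --> (u *: A + v *: B) 0 j.
Proof.
move=> ca cb; rewrite rV3D !rV3Z.
rewrite (_ : (fun k => (u *: a k + v *: b k) 0 j) = fun k => u * a k 0 j + v * b k 0 j).
  by apply: cvgD; apply: cvgM => //; exact: cvg_cst.
by apply/funext => k; rewrite rV3D !rV3Z.
Qed.

Lemma cvg_dot (a : nat -> 'rV[R]_3) (A : 'rV[R]_3) :
  (forall j, a k 0 j @[k --> \oo] --> A 0 j) -> dot (a k) (a k) @[k --> \oo] --> dot A A.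
Proof.
move=> ca; rewrite dot3E (_ : (fun k => dot (a k) (a k)) = fun k => a k 0 0 * a k 0 0 + a k 0 1 * a k 0 1 + a k 0 2%:R * a k 0 2%:R).
  by apply: cvgD; [apply: cvgD|]; apply: cvgM.
by apply/funext => k; rewrite dot3E.
Qed.

Lemma enorm_lin2 (u v e : R) (A B : 'rV[R]_3) : enorm A <= e -> enorm B <= e ->
  enorm (u *: A + v *: B) <= e * (`|u| + `|v|).
Proof.
move=> hA hB; apply: le_trans (enormD _ _) _; rewrite !enormZ [leRHS]mulrDr.
by apply: lerD; rewrite mulrC ler_wpM2r.
Qed.

Lemma le_quadruple (a : R) : 0 <= a -> a <= 4 * a.
Proof. lra. Qed.

End VectorLimits.

(** * Convergence of the maps and of their first derivatives *)

Section Limit.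
Context {R : realType}.
Variable Z : nat -> (R -> R -> 'rV[R]_3) * R.
Hypotheses (Z0 : (Z 0%N).1 = f0) (Zst : forall m, stage_ok m (Z m)) (Znext : forall m, next m (Z m) (Z m.+1)).
Let F m := (Z m).1.
Let d m := (Z m).2.

(** Geometric ratio per step instead of per stage: the tangent line of the cube root at 1, evaluated
    at [sigma], lies above the cube root. *)
Definition rho : R := (2 + sigma) / 3.

Lemma rho_bounds : 1 / 2 < rho < 1.
Proof. by have := @sigma_bounds R; rewrite /rho => ?; apply/andP; split; lra. Qed.

Lemma rho_gt0 : 0 < rho.
Proof. by have := rho_bounds; lra. Qed.

Lemma rhoX_le1 n : rho ^+ n <= 1.
Proof. by rewrite exprn_ile1 ?(ltW rho_gt0)//; have := rho_bounds; lra. Qed.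

Lemma sigma_le_rho : sigma <= rho ^+ 3.
Proof.
have := @sigma_bounds R; rewrite /rho; move: (sigma : R) => s /andP[s0 s1].
rewrite (_ : ((2 + s) / 3) ^+ 3 = s + (1 - s) ^+ 2 * (8 + s) / 27); last by field.
by rewrite lerDl divr_ge0// mulr_ge0 ?sqr_ge0//; lra.
Qed.

(** The remainder of [m] modulo 3 costs at most [rho^-2 <= 4]. *)
Lemma sigma_rho m : sigma ^+ (m %/ 3) <= 4 * rho ^+ m.
Proof.
have r := rho_bounds; have r0 := rho_gt0; have rm k : 0 <= rho ^+ k by rewrite exprn_ge0// ltW.
apply: le_trans (_ : (rho ^+ 3) ^+ (m %/ 3) <= _).
  by rewrite lerXn2r ?nnegrE ?exprn_ge0 ?(ltW r0) ?(ltW sigma_gt0) ?sigma_le_rho.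
rewrite -exprM [in leRHS](divn_eq m 3) exprD mulnC mulrCA -[leLHS]mulr1 ler_wpM2l//.
have : (m %% 3 < 3)%N by rewrite ltn_mod.
case: (m %% 3)%N => [|[|[|//]]] _; rewrite ?expr0 ?expr1 ?expr2; nra.
Qed.

Lemma half_rho m : 2^-1 ^+ m <= rho ^+ m.
Proof. by rewrite lerXn2r ?nnegrE ?invr_ge0 ?(ltW rho_gt0)//; have := rho_bounds; lra. Qed.

Lemma d_gt0 m : 0 < d m. Proof. by case: (Zst m). Qed.

Lemma dS m : d m.+1 <= d m / 2. Proof. by case: (Znext m). Qed.

Lemma F_inv m : stage_inv (m %/ 3) (m %% 3) (F m). Proof. by case: (Zst m). Qed.

Lemma F_per m : per (F m). Proof. by case: (F_inv m). Qed.

Lemma F_vsmooth m : vsmooth [set x | 0 < x < 1] (F m).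
Proof.
move=> j; have [sf _ _ _ _] := F_inv m; apply: smooth_sub (sf j).
by move=> x /= /andP[x0 x1]; rewrite /stage_domain/= x0/=; exact: lt_trans (outer_radius_gt1 _).
Qed.

Lemma d_geom m : d m <= d 0 * 2^-1 ^+ m.
Proof.
elim: m => [|m IH]; first by rewrite expr0 mulr1.
by apply: le_trans (dS m) _; rewrite exprSr mulrA ler_pM2r ?invr_gt0.
Qed.

Lemma cvg_d : d @ \oo --> (0 : R).
Proof.
apply: (@squeeze_cvgr _ _ _ _ (fun=> 0) (fun m => d 0 * 2^-1 ^+ m)).
- by apply: nearW => m; rewrite (ltW (d_gt0 m)) d_geom.
- exact: cvg_cst.
rewrite -[X in _ --> X](mulr0 (d 0)); apply: cvgM; first exact: cvg_cst.
by apply: cvg_expr; rewrite ger0_norm ?invr_ge0//; lra.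
Qed.

Definition limit_map x y : 'rV[R]_3 := vlim (fun m => F m x y).
Definition limit_dx x y : 'rV[R]_3 := vlim (fun m => vdx (F m) x y).
Definition limit_dy x y : 'rV[R]_3 := vlim (fun m => vdy (F m) x y).

Lemma per_lim : [/\ per limit_map, per limit_dx & per limit_dy].
Proof.
split=> x y; congr vlim; apply/funext => m; first exact: F_per.
  exact: (per_vdx (@F_per m)).
exact: (per_vdy (@F_per m)).
Qed.

(** A step moves the map by at most [d m / 2 <= d m - d m.+1], so that the moves telescope. *)
Lemma limit_map_F m x y : x <= 1 -> enorm (limit_map x y - F m x y) <= d m.
Proof.
move=> x1; apply: (vcauchy_lim (u := fun m => F m x y) cvg_d) => {}m n /subnK <-.
move: (n - m)%N => {n} n.
suff H : enorm (F (n + m)%N x y - F m x y) <= d m - d (n + m)%N.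
  by apply: le_trans H _; rewrite gerBl ltW// d_gt0.
elim: n => [|n IH]; first by rewrite add0n !subrr enorm0.
have -> : F (n.+1 + m)%N x y - F m x y = (F (n + m).+1 x y - F (n + m)%N x y) + (F (n + m)%N x y - F m x y).
  by rewrite addSn; move: (F _ x y) (F _ x y) (F _ x y) => a b c; apply/rowP => j; rewrite !mxE; ring.
have [_ _ h _] := Znext (n + m); have := h x y x1; have := dS (n + m).
have := enormD (F (n + m).+1 x y - F (n + m)%N x y) (F (n + m)%N x y - F m x y).
move: IH; rewrite addSn /F /d; move: (enorm _) (enorm _) (enorm _) (Z _).2 (Z _).2 (Z _).2 => a b c p q s; lra.
Qed.

(** Keeps the factors [sqrt x] and [x], which the study of the origin requires; [increments1]
    forgets them. *)
Lemma increments (r : R) : r < 1 -> exists2 A : R, 0 <= A & forall m x y, 0 < x -> x <= r ->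
  enorm (limit_dx x y - vdx (F m) x y) <= A * Num.sqrt x * rho ^+ m /\
  enorm (limit_dy x y - vdy (F m) x y) <= A * Num.sqrt x * x * rho ^+ m.
Proof.
move=> r1; have [C C0 HC] := sqrt_deficit_bound_le r1.
have r0 : 0 < 1 - rho by have := rho_bounds; lra.
have rr : 0 <= rho < 1 by have := rho_bounds; lra.
exists ((12 * C + 1) / (1 - rho)); first by rewrite divr_ge0 ?(ltW r0)//; lra.
move=> m x y x0 xr; have x1 : x <= 1 by lra.
have sx : x <= Num.sqrt x.
  by rewrite -{1}(sqr_sqrtr (ltW x0)) expr2 ler_piMr ?sqrtr_ge0// -sqrtr1 ler_wsqrtr.
have s0 := sqrtr_ge0 x.
have inc n : 3 * Num.sqrt (deficit_bound (n %/ 3) x) + 2^-1 ^+ n * x <= (12 * C + 1) * Num.sqrt x * rho ^+ n.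
  have h1 := HC (n %/ 3)%N x x0 xr; have h2 := sigma_rho n; have h3 := half_rho n.
  have h4 : C * Num.sqrt x * sigma ^+ (n %/ 3) <= C * Num.sqrt x * (4 * rho ^+ n).
    by rewrite ler_wpM2l// mulr_ge0.
  have h5 : 2^-1 ^+ n * x <= rho ^+ n * Num.sqrt x.
    by apply: ler_pM; rewrite ?exprn_ge0 ?invr_ge0 ?(ltW x0).
  lra.
have xr1 : 0 < x <= 1 by rewrite x0.
have -> : (12 * C + 1) / (1 - rho) * Num.sqrt x = (12 * C + 1) * Num.sqrt x / (1 - rho) by rewrite mulrAC.
split.
  apply: (geom_cauchy (u := fun m => vdx (F m) x y)) => // [|n]; first by rewrite mulr_ge0//; lra.
  have [_ _ _ h] := Znext n; have [h1 _] := h x y xr1; exact: le_trans h1 (inc n).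
have -> : (12 * C + 1) * Num.sqrt x / (1 - rho) * x * rho ^+ m = (12 * C + 1) * Num.sqrt x * x / (1 - rho) * rho ^+ m.
  by rewrite [_ / (1 - rho) * x]mulrAC.
apply: (geom_cauchy (u := fun m => vdy (F m) x y)) => // [|n].
  by rewrite !mulr_ge0 ?(ltW x0)//; lra.
have [_ _ _ h] := Znext n; have [_ h1] := h x y xr1; apply: le_trans h1 _.
by rewrite [leRHS]mulrAC ler_wpM2r ?(ltW x0).
Qed.

Lemma rho_small (c e : R) : 0 < e -> exists m, c * rho ^+ m <= e.
Proof.
move=> e0; have h : c * rho ^+ m @[m --> \oo] --> (0 : R).
  rewrite -[X in _ --> X](mulr0 c); apply: cvgM; first exact: cvg_cst.
  by apply: cvg_expr; rewrite ger0_norm; have := rho_bounds; lra.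
move/cvgrPdist_lt : h => /(_ _ e0)[m _ h]; exists m.
by have := h m (leqnn m); rewrite /= sub0r normrN => /ltW; apply: le_trans; exact: ler_norm.
Qed.

Definition I01 : set R := [set x | 0 < x < 1].

Lemma open_I01 : open I01.
Proof.
rewrite (_ : I01 = `]0, 1[%classic); first exact: interval_open.
by apply/seteqP; split => x /=; rewrite in_itv.
Qed.

Lemma sqrt_le1 (x : R) : x <= 1 -> Num.sqrt x <= 1.
Proof. by move=> x1; rewrite -sqrtr1 ler_wsqrtr. Qed.

Lemma increments1 (r : R) : r < 1 -> exists2 A : R, 0 <= A & forall m x y, 0 < x -> x <= r ->
  enorm (limit_dx x y - vdx (F m) x y) <= A * rho ^+ m /\ enorm (limit_dy x y - vdy (F m) x y) <= A * rho ^+ m.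
Proof.
move=> r1; have [A A0 H] := increments r1; exists A => // m x y x0 xr.
have x1 : x <= 1 := le_trans xr (ltW r1).
have [h1 h2] := H m x y x0 xr.
have s1 := sqrt_le1 x1; have s0 := sqrtr_ge0 x; have r0 := exprn_ge0 m (ltW rho_gt0).
split; [apply: le_trans h1 _|apply: le_trans h2 _]; rewrite ler_wpM2r//.
  by rewrite ler_piMr.
by rewrite -mulrA ler_piMr// mulr_ile1 ?(ltW x0).
Qed.

(** The difference of two terms of the sequence has derivatives at most [2 A rho^m]; the Lipschitz
    bound that follows survives in the limit. *)
Lemma limit_map_F_lip (A r r0 x0 y0 : R) m :
  (forall m x y, 0 < x -> x <= r -> enorm (limit_dx x y - vdx (F m) x y) <= A * rho ^+ m /\
     enorm (limit_dy x y - vdy (F m) x y) <= A * rho ^+ m) -> r < 1 -> 0 <= A ->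
  (forall x, `|x0 - x| < r0 -> 0 < x /\ x <= r) ->
  forall X Y X' Y', `|x0 - X| < r0 -> `|y0 - Y| < r0 -> `|x0 - X'| < r0 -> `|y0 - Y'| < r0 ->
  enorm (limit_map X' Y' - F m X' Y' - (limit_map X Y - F m X Y)) <= 4 * (A * rho ^+ m) * (`|X' - X| + `|Y' - Y|).
Proof.
move=> H r1 A0 rI X Y X' Y' hX hY hX' hY'.
have I01' x : `|x0 - x| < r0 -> I01 x by move=> /rI[? ?]; rewrite /I01/=; apply/andP; split => //; exact: le_lt_trans r1.
apply: (vlim_bound (u := fun n => F n X' Y' - F m X' Y' - (F n X Y - F m X Y)) (e := fun n => d n + d n) (m := m)).
- by rewrite -[X in _ --> X]addr0; apply: cvgD; exact: cvg_d.
- move=> n mn.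
  have -> : limit_map X' Y' - F m X' Y' - (limit_map X Y - F m X Y) - (F n X' Y' - F m X' Y' - (F n X Y - F m X Y)) =
     (limit_map X' Y' - F n X' Y') - (limit_map X Y - F n X Y).
    by move: (limit_map _ _) (limit_map _ _) (F _ _ _) (F _ _ _) (F _ _ _) (F _ _ _) => a b p q s t; apply/rowP => j; rewrite !mxE; ring.
  apply: le_trans (enormB _ _) _; have [_ h1] := rI _ hX; have [_ h2] := rI _ hX'.
  by apply: lerD; apply: limit_map_F; exact: ltW (le_lt_trans _ r1).
move=> n mn; have sigma := vsmoothB (@F_vsmooth n) (@F_vsmooth m).
have rmn : rho ^+ n <= rho ^+ m :> R.
  rewrite -(subnK mn) exprD ler_piMl ?exprn_ge0 ?(ltW rho_gt0)// exprn_ile1 ?(ltW rho_gt0)//.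
  by have := rho_bounds; lra.
have An : A * rho ^+ n <= A * rho ^+ m by rewrite ler_wpM2l.
have bd x y : `|x0 - x| < r0 -> `|y0 - y| < r0 ->
    enorm (vdx (fun x y => F n x y - F m x y) x y - 0) <= 2 * (A * rho ^+ m) /\
    enorm (vdy (fun x y => F n x y - F m x y) x y - 0) <= 2 * (A * rho ^+ m).
  move=> hx hy; have [x0' xr] := rI _ hx; rewrite !subr0.
  rewrite (vdxB y (@F_vsmooth n) (@F_vsmooth m) (I01' _ hx)) (vdyB y (@F_vsmooth n) (@F_vsmooth m) (I01' _ hx)).
  have [a1 a2] := H n x y x0' xr; have [b1 b2] := H m x y x0' xr.
  have aux (V v w : 'rV[R]_3) : enorm (V - v) <= A * rho ^+ n -> enorm (V - w) <= A * rho ^+ m -> enorm (v - w) <= 2 * (A * rho ^+ m).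
    move=> hv hw; have -> : v - w = - (V - v) + (V - w) by apply/rowP => j; rewrite !mxE; ring.
    apply: le_trans (enormD _ _) _; rewrite enormN mulr2n mulrDl mul1r.
    by apply: lerD => //; exact: le_trans hv An.
  by split; [exact: aux a1 b1|exact: aux a2 b2].
have := mean_value_bound sigma I01' bd hX hY hX' hY'.
rewrite !scaler0 addr0 subr0 => h; apply: le_trans h _.
by rewrite -mulrDr !mulrA (_ : 4 = 2 * 2 :> R)//; ring.
Qed.

Lemma local_radius x : 0 < x < 1 -> exists2 r0 : R, 0 < r0 & forall z, `|x - z| < r0 -> 0 < z /\ z <= (1 + x) / 2.
Proof.
move=> xr; exists (Num.min x ((1 - x) / 2)); first by rewrite lt_min; apply/andP; split; lra.
by move=> z; rewrite lt_min !ltr_norml => /andP[h1 h2]; split; lra.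
Qed.

(** Three errors: the tail [limit_map - F m], Lipschitz with a small constant; the first-order error
    of the C^1 map [F m]; the distance of its derivatives to their limits. The index [m] is fixed
    before the radius. *)
Lemma limit_map_diff x y e : 0 < x < 1 -> 0 < e -> exists2 r : R, 0 < r & forall X Y, `|x - X| < r -> `|y - Y| < r ->
  enorm (limit_map X Y - limit_map x y - ((X - x) *: limit_dx x y + (Y - y) *: limit_dy x y)) <= e * (`|X - x| + `|Y - y|).
Proof.
move=> xr e0; have [r0 r00 HI] := local_radius xr.
have r1 : (1 + x) / 2 < 1 by lra.
have [A A0 H] := increments1 r1; have e20 : 0 < e / 20 by rewrite divr_gt0.
have [m Hm] := rho_small A e20.
have Ix : I01 x by [].
have sx := vsmooth_dx open_I01 (@F_vsmooth m); have sy := vsmooth_dy open_I01 (@F_vsmooth m).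
have [r2 r20 H2] := vjcont_ball (fun j => smooth_jcont (y := y) (sx j) Ix) e20.
have [r3 r30 H3] := vjcont_ball (fun j => smooth_jcont (y := y) (sy j) Ix) e20.
pose r : R := Num.min r0 (Num.min r2 r3).
have rp : 0 < r by rewrite !lt_min r00 r20 r30.
exists r => // X Y hX hY.
have hI z : `|x - z| < r -> I01 z.
  by rewrite lt_min => /andP[/HI[z0 z1] _]; rewrite /I01/= z0; exact: le_lt_trans r1.
have hx : `|x - x| < r by rewrite subrr normr0.
have hy : `|y - y| < r by rewrite subrr normr0.
have w0 (z : R) : `|z| < r -> `|z| < r0 by rewrite lt_min => /andP[].
have w2 (z : R) : `|z| < r -> `|z| < r2 by rewrite !lt_min => /and3P[].
have w3 (z : R) : `|z| < r -> `|z| < r3 by rewrite !lt_min => /and3P[].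
have B1 := limit_map_F_lip m H r1 A0 HI (w0 _ hx) (w0 _ hy) (w0 _ hX) (w0 _ hY).
have B2 : enorm (F m X Y - F m x y - ((X - x) *: vdx (F m) x y + (Y - y) *: vdy (F m) x y)) <=
    2 * (e / 20 * `|X - x| + e / 20 * `|Y - y|).
  apply: (mean_value_bound (@F_vsmooth m) hI _ hx hy hX hY) => a b ha hb.
  by split; [exact: le_distC (H2 _ _ (w2 _ ha) (w2 _ hb))|exact: le_distC (H3 _ _ (w3 _ ha) (w3 _ hb))].
have [x0 xle] := HI x (w0 _ hx).
have [C1 C2] := H m x y x0 xle.
have B3 : enorm ((X - x) *: (vdx (F m) x y - limit_dx x y) + (Y - y) *: (vdy (F m) x y - limit_dy x y)) <=
    e / 20 * (`|X - x| + `|Y - y|).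
  by apply: enorm_lin2; rewrite enorm_distC; apply: le_trans Hm.
have -> : limit_map X Y - limit_map x y - ((X - x) *: limit_dx x y + (Y - y) *: limit_dy x y) =
   (limit_map X Y - F m X Y - (limit_map x y - F m x y)) +
   ((F m X Y - F m x y - ((X - x) *: vdx (F m) x y + (Y - y) *: vdy (F m) x y)) +
   ((X - x) *: (vdx (F m) x y - limit_dx x y) + (Y - y) *: (vdy (F m) x y - limit_dy x y))).
  move: (limit_map X Y) (limit_map x y) (F m X Y) (F m x y) (limit_dx x y) (limit_dy x y) (vdx (F m) x y) (vdy (F m) x y) => a1 a2 a3 a4 a5 a6 a7 a8.
  by apply/rowP => j; rewrite !mxE; ring.
apply: le_trans (enormD _ _) _; have := enormD (F m X Y - F m x y - ((X - x) *: vdx (F m) x y + (Y - y) *: vdy (F m) x y))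
   ((X - x) *: (vdx (F m) x y - limit_dx x y) + (Y - y) *: (vdy (F m) x y - limit_dy x y)).
have S0 : 0 <= `|X - x| + `|Y - y| by exact: addr_ge0.
have := ler_wpM2r S0 Hm; have := mulr_ge0 (ltW e0) S0; move: B1 B2 B3; move: (enorm _) (enorm _) (enorm _) (enorm _) (`|X - x|) (`|Y - y|) (A * _) S0.
by clear => a b c f p q s S0 h1 h2 h3 h4 h5 h6; lra.
Qed.

Lemma XY_cont x y e : 0 < x < 1 -> 0 < e -> exists2 r : R, 0 < r & forall X Y, `|x - X| < r -> `|y - Y| < r ->
  enorm (limit_dx x y - limit_dx X Y) <= e /\ enorm (limit_dy x y - limit_dy X Y) <= e.
Proof.
move=> xr e0; have [r0 r00 HI] := local_radius xr.
have r1 : (1 + x) / 2 < 1 by lra.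
have [A A0 H] := increments1 r1; have e20 : 0 < e / 3 by rewrite divr_gt0.
have [m Hm] := rho_small A e20.
have Ix : I01 x by [].
have sx := vsmooth_dx open_I01 (@F_vsmooth m); have sy := vsmooth_dy open_I01 (@F_vsmooth m).
have [r2 r20 H2] := vjcont_ball (fun j => smooth_jcont (y := y) (sx j) Ix) e20.
have [r3 r30 H3] := vjcont_ball (fun j => smooth_jcont (y := y) (sy j) Ix) e20.
exists (Num.min r0 (Num.min r2 r3)); first by rewrite !lt_min r00 r20 r30.
move=> X Y; rewrite !lt_min => /and3P[x0 x2 x3] /and3P[y0 y2 y3].
have [X0 X1] := HI X x0; have xle : x <= (1 + x) / 2 by lra.
have x00 : 0 < x by case/andP: xr.
have [C1 C2] := H m x y x00 xle; have [D1 D2] := H m X Y X0 X1.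
have := H2 X Y x2 y2; have := H3 X Y x3 y3.
have aux (V v w W : 'rV[R]_3) : enorm (V - v) <= A * rho ^+ m -> enorm (W - w) <= A * rho ^+ m ->
    enorm (v - w) <= e / 3 -> enorm (V - W) <= e.
  move=> h1 h2 h3; rewrite [leRHS](_ : e = e / 3 + e / 3 + e / 3); last by field.
  exact: enorm_tri3 (le_trans h1 Hm) (le_trans h2 Hm) h3.
by move=> h3 h2; split; [exact: aux C1 D1 h2|exact: aux C2 D2 h3].
Qed.

(** Taken along the beginnings of the stages, where [first_form_lower] and [first_form_upper] pinch
    the metric around [conformal k.+1] with an error O(tau^k) at fixed [x < 1]. *)
Lemma metric_lim x y u v : 0 < x < 1 ->
  dot (u *: limit_dx x y + v *: limit_dy x y) (u *: limit_dx x y + v *: limit_dy x y) = 4 / (1 - x ^+ 2) ^+ 2 * (u ^+ 2 + x ^+ 2 * v ^+ 2).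
Proof.
move=> xr; have x0 : 0 < x by case/andP: xr.
have x1 : x < 1 by case/andP: xr.
have [A A0 H] := increments1 x1.
pose G k := F (3 * k)%N.
have cvX j : vdx (G k) x y 0 j @[k --> \oo] --> limit_dx x y 0 j.
  apply/cvgrPdist_le => e e0; have [m Hm] := rho_small A e0.
  exists m => // k /= mk; have [h _] := H (3 * k)%N x y x0 (lexx _).
  rewrite -rV3B; apply: le_trans (enorm_coord _ _) _; apply: le_trans h _; apply: le_trans Hm.
  have m3k : (m <= 3 * k)%N by lia.
  rewrite ler_wpM2l// -(subnK m3k) exprD ler_piMl ?exprn_ge0 ?(ltW rho_gt0)// exprn_ile1 ?(ltW rho_gt0)//.
  by have := rho_bounds; lra.
have cvY j : vdy (G k) x y 0 j @[k --> \oo] --> limit_dy x y 0 j.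
  apply/cvgrPdist_le => e e0; have [m Hm] := rho_small A e0.
  exists m => // k /= mk; have [_ h] := H (3 * k)%N x y x0 (lexx _).
  rewrite -rV3B; apply: le_trans (enorm_coord _ _) _; apply: le_trans h _; apply: le_trans Hm.
  have m3k : (m <= 3 * k)%N by lia.
  rewrite ler_wpM2l// -(subnK m3k) exprD ler_piMl ?exprn_ge0 ?(ltW rho_gt0)// exprn_ile1 ?(ltW rho_gt0)//.
  by have := rho_bounds; lra.
have cvV j : (u *: vdx (G k) x y + v *: vdy (G k) x y) 0 j @[k --> \oo] --> (u *: limit_dx x y + v *: limit_dy x y) 0 j.
  exact: cvg_lin2.
have cvQ : first_form (G k) x y u v @[k --> \oo] --> dot (u *: limit_dx x y + v *: limit_dy x y) (u *: limit_dx x y + v *: limit_dy x y).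
  rewrite (_ : (fun k => first_form (G k) x y u v) = fun k =>
     dot (u *: vdx (G k) x y + v *: vdy (G k) x y) (u *: vdx (G k) x y + v *: vdy (G k) x y)).
    exact: cvg_dot.
  by apply/funext => k; rewrite dot_lin2.
have xI k : stage_domain (3 * k + 0) x by rewrite /stage_domain/= x0 (lt_trans x1 (outer_radius_gt1 _)).
have Ginv k : stage_inv k 0 (G k).
  have := F_inv (3 * k)%N; have -> : (3 * k %/ 3 = k)%N by lia.
  by have -> : (3 * k %% 3 = 0)%N by lia.
set z := u ^+ 2 + x ^+ 2 * v ^+ 2.
have z0 : 0 <= z by exact: addr_ge0 (sqr_ge0 _) (mulr_ge0 (sqr_ge0 _) (sqr_ge0 _)).
have [C C0 HC] := sqrt_deficit_bound_le x1.
have B0 k : deficit_bound k x <= C ^+ 2 * tau ^+ k.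
  have b0 : 0 <= deficit_bound k x by have [] := conformal_deficit_bound (xI k).
  rewrite -(sqr_sqrtr b0) -[tau ^+ k]exprM mulnC exprM -exprMn.
  have s0 : 0 <= sigma ^+ k :> R by rewrite exprn_ge0// ltW// sigma_gt0.
  rewrite ler_sqr ?nnegrE ?sqrtr_ge0 ?mulr_ge0//; apply: le_trans (HC k x x0 (lexx _)) _.
  by rewrite ler_wpM2r// ler_piMr// sqrt_le1// ltW.
have c1 : C ^+ 2 * tau ^+ k @[k --> \oo] --> (0 : R).
  by rewrite -[X in _ --> X](mulr0 (C ^+ 2)); apply: cvgM; [exact: cvg_cst|exact: cvg_tauX].
have c2 : conformal k.+1 x @[k --> \oo] --> 4 / (1 - x ^+ 2) ^+ 2 by rewrite (cvg_shiftS (fun k => conformal k x)); exact: cvg_conformal.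
apply: (cvg_unique _ cvQ) => //.
apply: (@squeeze_cvgr _ _ _ _ (fun k => (conformal k.+1 x - C ^+ 2 * tau ^+ k) * z) (fun k => (conformal k.+1 x + C ^+ 2 * tau ^+ k) * z)).
- apply: nearW => k; apply/andP; split.
    apply: le_trans (first_form_lower (leq0n _) (Ginv k) y u v (xI k)); rewrite ler_wpM2r// lerD2l lerN2.
    exact: B0.
  apply: le_trans (first_form_upper (leq0n _) (Ginv k) y u v (xI k)) _; rewrite ler_wpM2r// lerD2l.
  apply: le_trans (B0 k).
  have d2 := stage_domain_near_disk_succ (xI k); have [w0 w1 w2] := slack_bounds d2.
  have [l1 _ h1] := deficit_high_bound 0 (leq0n 3) d2; move: h1; rewrite /deficit_high leqnn mul0r addr0.
  have := increment_gt0 (near_disk_le (leqnSn _) d2); have := conformal_ge4 (near_disk_le (leqnSn k) (near_disk_le (leqnSn _) d2)).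
  by rewrite /deficit_todo => m4 dl0; case: ifP => _ ; last case: ifP => _; rewrite /increment in w1 dl0 *; lra.
- by rewrite -[X in X * _]subr0; apply: cvgM; [exact: cvgB|exact: cvg_cst].
- by rewrite -[X in X * _]addr0; apply: cvgM; [exact: cvgD|exact: cvg_cst].
Qed.

Lemma limit_map_origin x y : x <= 0 -> limit_map x y = f0 x y.
Proof.
move=> x0; apply/rowP => j; rewrite [LHS]mxE.
rewrite (_ : (fun m => F m x y 0 j) = fun=> f0 x y 0 j) ?lim_cst//.
by apply/funext => m; have [_ _ _ h _] := F_inv m; rewrite h// (le_trans x0)// ltW// core_radius_gt0.
Qed.

Lemma F_core_radius m x y : x <= core_radius (m %/ 3).+2 -> F m x y = f0 x y.
Proof.
move=> xs; have [_ _ _ h _] := F_inv m; apply: h; apply: le_trans xs _.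
by case: (m %% 3)%N => // ; rewrite ltW// core_radius_lt.
Qed.

(** For the map itself, the mean value theorem is applied between [x] and the edge of the core of
    [F n], where [F n = f0]; the derivatives of [F n - f0] are bounded uniformly in [n]. *)
Lemma near_origin : exists2 A : R, 0 <= A & forall x y, 0 < x -> x <= 1 / 2 ->
  [/\ enorm (limit_dx x y - vdx f0 x y) <= A * Num.sqrt x, enorm (limit_dy x y - vdy f0 x y) <= A * Num.sqrt x * x &
      enorm (limit_map x y - f0 x y) <= A * Num.sqrt x * x].
Proof.
have h12 : (1 / 2 : R) < 1 by lra.
have [A A0 H] := increments h12.
exists (4 * A); first by rewrite mulr_ge0.
move=> x y x0 x1; have s0 := sqrtr_ge0 x.
have [h1 h2] := H 0%N x y x0 x1; rewrite expr0 !mulr1 /F Z0 in h1 h2.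
have As := le_quadruple (mulr_ge0 A0 s0).
rewrite mulrA in As.
split; [exact: le_trans h1 As|by apply: le_trans h2 _; rewrite ler_wpM2r// ltW|].
apply: (vlim_bound (u := fun n => F n x y - f0 x y) (e := d) (m := 0%N) cvg_d) => n _.
  have -> : limit_map x y - f0 x y - (F n x y - f0 x y) = limit_map x y - F n x y.
    by move: (limit_map _ _) (f0 _ _) (F _ _ _) => a b c; apply/rowP => j; rewrite !mxE; ring.
  by apply: limit_map_F; apply: le_trans x1 _; exact: ltW h12.
move=> {h1 h2}; have [xs|xs] := leP x (core_radius (n %/ 3).+2).
  by rewrite F_core_radius// subrr enorm0 !mulr_ge0// ltW.
set s := core_radius _ in xs; have sp : 0 < s by exact: core_radius_gt0.
have -> : 4 * A * Num.sqrt x * x = 2 * (2 * A * Num.sqrt x * x) by ring.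
apply: enorm3_le => j.
have sf0 : vsmooth I01 f0 by exact: smooth_f0 open_I01.
have sgs := vsmoothB (@F_vsmooth n) sf0.
have minE : Num.min s x = s by apply/min_idPl; exact: ltW.
have maxE : Num.max s x = x by apply/max_idPr; exact: ltW.
have [|//|X [Y [Xr Yr E]]] := mean_value2 y y (sgs j) (_ : forall z, Num.min s x <= z <= Num.max s x -> I01 z).
- rewrite minE maxE => z /andP[z0 z1]; rewrite /I01/= (lt_le_trans sp z0)/=.
  exact: le_lt_trans (le_trans z1 x1) h12.
- by rewrite /I01/= sp/=; exact: lt_trans xs (le_lt_trans x1 h12).
move: E; rewrite subrr mulr0 addr0 -vdx_coord.
have -> : (F n s y - f0 s y) 0 j = 0 by rewrite F_core_radius ?lexx// subrr mxE.
rewrite subr0 => ->; rewrite minE maxE in Xr; case/andP: Xr => X0 X1.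
have Xp : 0 < X := lt_le_trans sp X0.
have Xh : X <= 1 / 2 := le_trans X1 x1.
have XI : I01 X by rewrite /I01/= Xp; exact: le_lt_trans h12.
rewrite normrM; apply: ler_pM => //; last first.
  by rewrite ger0_norm ?gerBl ?subr_ge0 ltW.
apply: le_trans (enorm_coord _ _) _; rewrite (vdxB y (@F_vsmooth n) sf0 XI).
have [a1 _] := H n X y Xp Xh; have [b1 _] := H 0%N X y Xp Xh; rewrite expr0 mulr1 /F Z0 in b1.
have -> : vdx (F n) X y - vdx f0 X y = - (limit_dx X y - vdx (F n) X y) + (limit_dx X y - vdx f0 X y).
  by move: (vdx (F n) X y) (vdx f0 X y) (limit_dx X y) => a b c; apply/rowP => k; rewrite !mxE; ring.
apply: le_trans (enormD _ _) _; rewrite enormN.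
have sX : Num.sqrt X <= Num.sqrt x by rewrite ler_wsqrtr.
have rn : rho ^+ n <= 1 :> R by apply: rhoX_le1.
have AX : A * Num.sqrt X <= A * Num.sqrt x by rewrite ler_wpM2l.
rewrite -mulrA mulr2n mulrDl mul1r.
apply: lerD; last exact: le_trans b1 AX.
by apply: le_trans a1 _; apply: le_trans AX; rewrite ler_piMr// mulr_ge0// sqrtr_ge0.
Qed.

End Limit.

(** * From polar to Cartesian coordinates *)

Section EuclideanTopology.
Context {R : realType}.

Lemma enorm_le_coord n (u : 'rV[R]_n) (K : R) : 0 <= K -> (forall i, `|u 0 i| <= K) -> enorm u <= n.+1%:R * K.
Proof.
move=> K0 h; rewrite -ler_sqr ?nnegrE ?enorm_ge0 ?mulr_ge0// enorm_sqr.
apply: le_trans (_ : \sum_(i < n) K ^+ 2 <= _).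
  apply: ler_sum => i _; rewrite -expr2 -(real_normK (num_real (u 0 i))).
  by rewrite ler_sqr ?nnegrE.
rewrite sumr_const card_ord exprMn -[X in X <= _]mulr_natl ler_wpM2r ?sqr_ge0// -natrX ler_nat.
by rewrite (leq_trans (leqnSn n))// expnS expn1 leq_pmulr.
Qed.

Lemma norm_le_enorm n (u : 'rV[R]_n) : `|u| <= enorm u.
Proof.
have [u0|/mx_norm_neq0[[i j] /= E]] := eqVneq (mx_norm u) 0.
  by rewrite -[`|u|]/(mx_norm u) u0 enorm_ge0.
by rewrite -[`|u|]/(mx_norm u) E ord1 enorm_coord.
Qed.

Lemma coord_le_norm n (u : 'rV[R]_n) i : `|u 0 i| <= `|u|.
Proof.
rewrite -[`|u|]/(mx_norm u) mx_normrE.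
exact: (le_bigmax 0 (fun ij : 'I_1 * 'I_n => `|u ij.1 ij.2|) (0, i)).
Qed.

Lemma enorm_le_norm n (u : 'rV[R]_n) : enorm u <= n.+1%:R * `|u|.
Proof. by apply: enorm_le_coord => // i; exact: coord_le_norm. Qed.

Lemma nbhs_enorm n (p : 'rV[R]_n) (P : set 'rV[R]_n) :
  nbhs p P <-> exists2 r : R, 0 < r & forall q, enorm (p - q) < r -> P q.
Proof.
split=> [/nbhs_ballP[r /= r0 h]|[r r0 h]].
  exists r => // q pq; apply: h; split => // i j; rewrite ord1.
  by apply: le_lt_trans pq; rewrite -[p 0 j - q 0 j](_ : (p - q) 0 j = _) ?enorm_coord ?mxE.
apply/nbhs_ballP; have n0 : 0 < n.+1%:R :> R by rewrite ltr0n.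
exists (r / (2 * n.+1%:R)) => /=; first by rewrite divr_gt0// mulr_gt0.
move=> q [_ pq]; apply: h.
apply: le_lt_trans (_ : n.+1%:R * (r / (2 * n.+1%:R)) < r).
  apply: enorm_le_coord => [|i]; first by rewrite ltW// divr_gt0// mulr_gt0.
  by have := pq 0 i; rewrite /ball /= !mxE => /ltW.
by rewrite (_ : _ * _ = r / 2); [lra|field; rewrite gt_eqF].
Qed.

Lemma cvg_enorm n T (F : set_system T) (FF : Filter F) (f : T -> 'rV[R]_n) (l : 'rV[R]_n) :
  f @ F --> l <-> forall e : R, 0 < e -> \forall x \near F, enorm (l - f x) < e.
Proof.
split=> [h e e0|h P /nbhs_enorm[r r0 hr]].
  have := h [set z | enorm (l - z) < e]; apply; apply/nbhs_enorm; by exists e.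
by apply: filterS (h r r0) => x; exact: hr.
Qed.

Lemma mulmxr_continuous n m (J : 'M[R]_(n, m)) : continuous (mulmxr J : 'rV[R]_n -> 'rV[R]_m).
Proof.
pose K : R := \sum_(i < n) \sum_(j < m) `|J i j| + 1.
have K0 : 0 < K by rewrite ltr_wpDl// sumr_ge0// => i _; rewrite sumr_ge0.
have bd (v : 'rV[R]_n) : enorm (v *m J) <= m.+1%:R * (enorm v * K).
  apply: enorm_le_coord => [|j]; first by rewrite mulr_ge0 ?enorm_ge0 ?(ltW K0).
  rewrite mxE; apply: le_trans (ler_norm_sum _ _ _) _.
  apply: le_trans (_ : \sum_(i < n) enorm v * `|J i j| <= _).
    by apply: ler_sum => i _; rewrite normrM ler_wpM2r// enorm_coord.
  rewrite -mulr_sumr ler_wpM2l ?enorm_ge0// ler_wpDr//.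
  by apply: ler_sum => i _; rewrite (bigD1 j)//= lerDl sumr_ge0.
move=> p; apply/(cvg_enorm (nbhs_filter p)) => e e0; apply/nbhs_enorm.
have mK : 0 < m.+1%:R * K by rewrite mulr_gt0.
exists (e / (m.+1%:R * K)); first by rewrite divr_gt0.
move=> q pq; rewrite /= -mulmxBl; apply: le_lt_trans (bd _) _.
by rewrite mulrCA -ltr_pdivlMr.
Qed.

Lemma diff_of_linear (V W : normedModType R) (f : V -> W) (L : {linear V -> W}) (x : V) : continuous L ->
  (forall e : R, 0 < e -> \forall h \near (0 : V), `|f (h + x) - f x - L h| <= e * `|h|) ->
  differentiable f x /\ 'd f x = L :> (V -> W).
Proof.
move=> cL H; have E : f \o shift x = cst (f x) + L +o_ (0 : V) id.
  apply/eqaddoP => e e0; apply: filterS (H e e0) => h /=.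
  by rewrite !fctE /= opprD addrA.
by have D := diff_unique cL E; split => //; apply/diff_locallyP; rewrite D.
Qed.

(** The estimate is made with Euclidean norms and a candidate matrix, which the uniqueness of the
    differential then identifies with the library's [jacobian]. *)
Lemma diff_of_estimate n m (f : 'rV[R]_n -> 'rV[R]_m) (p : 'rV[R]_n) (J : 'M[R]_(n, m)) :
  (forall e : R, 0 < e -> exists2 r : R, 0 < r & forall q, enorm (p - q) < r ->
     enorm (f q - f p - (q - p) *m J) <= e * enorm (q - p)) ->
  differentiable f p /\ jacobian f p = J.
Proof.
move=> H; pose L : {linear 'rV[R]_n -> 'rV[R]_m} := mulmxr J.
have [||dif D] := @diff_of_linear 'rV[R]_n 'rV[R]_m f L p; first exact: mulmxr_continuous.
  move=> e e0.
  have [r r0 h] := H (e / n.+1%:R) (divr_gt0 e0 (ltr0Sn _ _)).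
  have : nbhs (0 : 'rV[R]_n) [set x | enorm x < r].
    by apply/nbhs_enorm; exists r => // q; rewrite sub0r enormN.
  apply: filterS => x /= xr.
  apply: le_trans (norm_le_enorm _) _; rewrite -{2}(addrK p x); apply: le_trans (h _ _) _.
    by rewrite opprD addrCA subrr addr0 enormN.
  rewrite addrK; apply: le_trans (ler_wpM2l _ (enorm_le_norm _)) _; first by rewrite ltW// divr_gt0.
  by rewrite mulrA divfK// pnatr_eq0.
split => //.
rewrite /jacobian; apply/row_matrixP => i; rewrite !rowE.
rewrite -[RHS]/(L (delta_mx 0 i)) -D.
by apply/rowP => j; rewrite -rowE !mxE.
Qed.

End EuclideanTopology.

(** * Polar coordinates and distances in the plane *)

Section Polar.
Context {R : realType}.

Definition polar_point (x y : R) : 'rV[R]_2 := \row_i (if i == 0 then x * cos y else x * sin y).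

Lemma dot2E (u v : 'rV[R]_2) : dot u v = u 0 0 * v 0 0 + u 0 1 * v 0 1.
Proof.
rewrite /dot !big_ord_recl big_ord0 addr0.
by congr (_ * _ + u _ _ * v _ _); apply/val_inj.
Qed.

Lemma rV2P (u v : 'rV[R]_2) : u 0 0 = v 0 0 -> u 0 1 = v 0 1 -> u = v.
Proof.
move=> h0 h1; apply/rowP => -[[|[|//]] ltj].
- by rewrite (_ : Ordinal ltj = 0)//; apply/val_inj.
- by rewrite (_ : Ordinal ltj = 1)//; apply/val_inj.
Qed.

Lemma enorm_polar_point x y : enorm (polar_point x y) = `|x|.
Proof.
have e : dot (polar_point x y) (polar_point x y) = x ^+ 2.
  by rewrite dot2E !mxE /= -!expr2 !exprMn -mulrDr cos2Dsin2 mulr1.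
by rewrite /enorm e sqrtr_sqr.
Qed.

Lemma polar_point_surj (p : 'rV[R]_2) : exists y, p = polar_point (enorm p) y.
Proof.
have [p0|pn] := eqVneq (enorm p) 0.
  by exists 0; rewrite {1}(enorm_eq0 p0) p0; apply/rowP => i; rewrite !mxE !mul0r if_same.
have r0 : 0 < enorm p by rewrite lt_neqAle eq_sym pn enorm_ge0.
have sq : p 0 0 ^+ 2 + p 0 1 ^+ 2 = enorm p ^+ 2 by rewrite enorm_sqr dot2E !expr2.
have h : -1 <= p 0 0 / enorm p <= 1.
  rewrite -ler_norml normrM normfV (gtr0_norm r0) ler_pdivrMr// mul1r; exact: enorm_coord.
have s : Num.sqrt (1 - (p 0 0 / enorm p) ^+ 2) = `|p 0 1| / enorm p.
  have -> : 1 - (p 0 0 / enorm p) ^+ 2 = (p 0 1 / enorm p) ^+ 2.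
    apply/eqP; rewrite subr_eq -[eqbRHS]addrC !expr_div_n -mulrDl sq divff// expf_neq0//.
  by rewrite sqrtr_sqr normrM normfV (gtr0_norm r0).
have ca : cos (acos (p 0 0 / enorm p)) = p 0 0 / enorm p by apply: acosK; rewrite in_itv.
have sa : sin (acos (p 0 0 / enorm p)) = `|p 0 1| / enorm p by rewrite sin_acos.
case: (leP 0 (p 0 1)) => p1.
  exists (acos (p 0 0 / enorm p)); apply: rV2P; rewrite !mxE /= ?ca ?sa mulrC divfK//.
  by rewrite ger0_norm.
exists (- acos (p 0 0 / enorm p)); apply: rV2P; rewrite !mxE /= ?cosN ?sinN ?ca ?sa ?mulrN mulrC divfK//.
by rewrite ltr0_norm// opprK.
Qed.

Lemma polar_eqE x y x' y' : polar_eq x y x' y' <-> polar_point x y = polar_point x' y'.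
Proof.
split=> [[e1 e2]|/rowP E]; first by apply: rV2P; rewrite !mxE.
by split; [have := E 0|have := E 1]; rewrite !mxE.
Qed.

Lemma polar_dist_polar_point x y x' y' : enorm (polar_point x y - polar_point x' y') <= polar_dist x y x' y'.
Proof.
rewrite -ler_sqr ?nnegrE ?enorm_ge0 ?addr_ge0// enorm_sqr dot2E !mxE /= -!expr2 /polar_dist.
rewrite [leRHS]sqrrD !real_normK ?num_real//.
by rewrite addrAC lerDl mulrn_wge0// mulr_ge0.
Qed.

(** Law of cosines, arranged to separate the radial and the angular contributions. *)
Lemma polar_point_dist x y x' y' : enorm (polar_point x y - polar_point x' y') ^+ 2 = (x - x') ^+ 2 + 2 * x * x' * (1 - cos (y - y')).
Proof.
rewrite enorm_sqr dot2E !mxE /= cosB.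
have -> : (x - x') ^+ 2 = (x ^+ 2 * (cos y ^+ 2 + sin y ^+ 2) - 2 * x * x' + x' ^+ 2 * (cos y' ^+ 2 + sin y' ^+ 2)).
  by rewrite !cos2Dsin2; ring.
by ring.
Qed.

Lemma polar_point_dist_radius x y x' y' : 0 <= x -> 0 <= x' -> `|x - x'| <= enorm (polar_point x y - polar_point x' y').
Proof.
move=> x0 x'0; rewrite -ler_sqr ?nnegrE ?enorm_ge0// real_normK ?num_real// polar_point_dist lerDl.
by rewrite !mulr_ge0// subr_ge0 cos_le1.
Qed.

(** A crude Jordan inequality: on [[0, 7/10]] the cosine is at least [1/2], and beyond, the sine
    stays above [7/20] while [s / 8 <= 1/4]. *)
Lemma sin_ge (s : R) : 0 <= s <= pi / 2 -> s / 8 <= sin s.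
Proof.
move=> /andP[s0 s1].
have mv (u v : R) : exists2 c : R, Num.min u v <= c <= Num.max u v & sin v - sin u = cos c * (v - u).
  by have [c h E] := @mean_value R sin cos u v (fun z _ => is_derive_sin z); exists c.
have pb : pi / 2 <= 2 :> R by have := @pihalf_02 R; lra.
have pb' : 1 <= pi / 2 :> R by have := @pi_ge2 R; lra.
have small (t : R) : 0 <= t -> t <= 7 / 10 -> t / 2 <= sin t.
  move=> t0 t1; have [c] := mv 0 t; rewrite (min_idPl t0) (max_idPr t0) sin0 !subr0 => /andP[c0 c1] ->.
  by have := cos_ge c; rewrite expr2; nra.
case: (leP s (7 / 10)) => s7; first by have := small s s0 s7; lra.
have h7 := small (7 / 10) ltac:(lra) (lexx _).
have [c] := mv (7 / 10) s; rewrite (min_idPl (ltW s7)) (max_idPr (ltW s7)) => /andP[c0 c1] E.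
have : 0 <= cos c by apply: cos_ge0_pihalf; apply/andP; split; lra.
nra.
Qed.

(** [1 - cos t = 2 sin^2 (t / 2)] with [sin (t / 2) >= t / 16] for [t >= 0], whence
    [128 = 16^2 / 2]. *)
Lemma cos_gap (t : R) : `|t| <= pi -> t ^+ 2 / 128 <= 1 - cos t.
Proof.
move=> tp; have -> : cos t = cos `|t| by case: (leP 0 t) => t0; [rewrite ger0_norm|rewrite ltr0_norm// cosN].
rewrite -(real_normK (num_real t)); move: (`|t|) tp (normr_ge0 t) => {}t tp t0.
have -> : cos t = 1 - 2 * sin (t / 2) ^+ 2.
  rewrite {1}(splitr t) -mulr2n cos_mulr2n; have := cos2Dsin2 (t / 2); move: (cos _ ^+ 2) (sin _ ^+ 2) => a b; lra.
have := sin_ge (s := t / 2) ltac:(apply/andP; split; lra); move: (sin _) => s h.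
rewrite !expr2; nra.
Qed.

Lemma polar_point_dist_angle m x y x' y' : 0 <= m -> m <= x -> m <= x' -> `|y - y'| <= pi ->
  m * `|y - y'| <= 8 * enorm (polar_point x y - polar_point x' y').
Proof.
move=> m0 mx mx' yp; rewrite -ler_sqr ?nnegrE ?mulr_ge0 ?enorm_ge0//.
rewrite [leRHS]exprMn polar_point_dist exprMn real_normK ?num_real//.
have := cos_gap yp; move: (1 - cos (y - y')) ((y - y') ^+ 2) (sqr_ge0 (y - y')) (sqr_ge0 (x - x')) => c t t0 s0 h.
have xx : m ^+ 2 <= x * x' by rewrite expr2; apply: ler_pM.
have c0 : 0 <= c by lra.
have h1 : m ^+ 2 * (t / 128) <= x * x' * c by apply: ler_pM; rewrite ?sqr_ge0//; lra.
rewrite (_ : 8 ^+ 2 = 64) ; last by ring.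
have -> : 64 * ((x - x') ^+ 2 + 2 * x * x' * c) = 64 * (x - x') ^+ 2 + 128 * (x * x' * c) by ring.
lra.
Qed.

Lemma angle_near (y y' : R) : exists k : int, `|y - (y' + k%:~R * (2 * pi))| <= pi.
Proof.
have [k /andP[h0 h1]] := angle_reduce (y' - y); have pp := pi_gt0 R.
case: (leP (y' - y + k%:~R * (2 * pi)) pi) => h.
  by exists k; rewrite ler_norml; lra.
exists (k - 1); rewrite intrB mulrBl mul1r ler_norml; lra.
Qed.

End Polar.

(** * Choice of angles and local estimates in polar coordinates *)

Section Angles.
Context {R : realType}.

(** An arbitrary determination, without any continuity. It is harmless for periodic maps, and local
    arguments use the nearby determination given by [polar_near]. *)
Definition polar_angle (p : 'rV[R]_2) : R := projT1 (cid (polar_point_surj p)).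

Lemma polar_angleE (p : 'rV[R]_2) : p = polar_point (enorm p) (polar_angle p).
Proof. exact: projT2 (cid (polar_point_surj p)). Qed.

Lemma per_cossin : per (fun _ y : R => cos y) /\ per (fun _ y : R => sin y).
Proof.
by split=> u v; rewrite (_ : 2 * pi = pi *+ 2) ?cosD2pi ?sinD2pi// mulr_natl.
Qed.

(** Local inverse of polar coordinates with Lipschitz control; [16 / x] is the constant 8 of
    [polar_point_dist_angle] over the lower bound [x / 2] of both radii. *)
Lemma polar_near (x y : R) (q : 'rV[R]_2) : 0 < x -> enorm (polar_point x y - q) < x / 2 -> exists x' y', 
  [/\ q = polar_point x' y', 0 < x', `|x - x'| <= enorm (polar_point x y - q) & `|y - y'| <= 16 / x * enorm (polar_point x y - q)].
Proof.
move=> x0 h; have [k hk] := angle_near y (polar_angle q).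
have q' : q = polar_point (enorm q) (polar_angle q + k%:~R * (2 * pi)).
  rewrite {1}(polar_angleE q); apply/polar_eqE; have [pc ps] := per_cossin.
  by split; rewrite ?(per_int k 0 _ pc) ?(per_int k 0 _ ps).
exists (enorm q), (polar_angle q + k%:~R * (2 * pi)).
have d1 : `|x - enorm q| <= enorm (polar_point x y - q).
  by rewrite {2}q'; apply: polar_point_dist_radius; [exact: ltW|exact: enorm_ge0].
have xq : x / 2 <= enorm q.
  by have := le_lt_trans d1 h; rewrite ltr_norml => /andP[_]; lra.
have xh : x / 2 <= x by lra.
have x20 : 0 <= x / 2 by lra.
split => //; first by apply: lt_le_trans xq; rewrite divr_gt0.
have := polar_point_dist_angle x20 xh xq hk; rewrite -q' => d2.
rewrite -ler_pdivrMl ?divr_gt0// invf_div; lra.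
Qed.

Lemma sinx_le (t : R) : `|t| <= 1 -> `|t - sin t| <= t ^+ 2.
Proof.
move=> t1; have [c hc E] := @mean_value R sin cos 0 t (fun z _ => is_derive_sin z).
move: E; rewrite sin0 !subr0 => ->.
rewrite -{1}[t]mul1r -mulrBl normrM ger0_norm ?subr_ge0 ?cos_le1//.
rewrite -[leRHS]real_normK ?num_real// expr2 ler_wpM2r//.
have ct : `|c| <= `|t|.
  by move: hc; case: (leP 0 t) => t0; rewrite ?(ger0_norm t0) ?(ltr0_norm t0) ler_norml => /andP[]; lra.
have := cos_ge c; rewrite -(real_normK (num_real c)).
move: (`|c|) (`|t|) (normr_ge0 c) ct t1 => a b a0 ab b1; rewrite expr2; nra.
Qed.

(** The quantities [x' cos t - x] and [x' sin t / x] are the components of the Cartesian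
    displacement in the polar frame; they agree with the increments of the coordinates to second
    order. *)
Lemma polar_second_order (x x' t : R) : 0 < x -> 0 < x' -> `|t| <= 1 ->
  `|x' - x - (x' * cos t - x)| <= x' * t ^+ 2 /\
  `|t - x' * sin t / x| <= t ^+ 2 + `|x - x'| / x * `|t|.
Proof.
move=> x0 x'0 t1; split.
  rewrite (_ : _ - _ = x' * (1 - cos t)); last by ring.
  rewrite normrM gtr0_norm// ler_pM2l// ger0_norm ?subr_ge0 ?cos_le1//.
  by have := cos_ge t; lra.
have -> : t - x' * sin t / x = (t - sin t) + (x - x') / x * sin t by field; rewrite gt_eqF.
apply: le_trans (ler_normD _ _) _; apply: lerD; first exact: sinx_le.
rewrite !normrM normfV (gtr0_norm x0) ler_wpM2l ?divr_ge0 ?(ltW x0)//.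
by have := @mean_value R sin cos 0 t (fun z _ => is_derive_sin z) => -[c _]; rewrite sin0 !subr0 => ->;
  rewrite normrM ler_piMl// ler_norml cos_geN1 cos_le1.
Qed.

Lemma diff_num (e T D x x' t a b c1 c2 nX nY E : R) : 0 < x -> x < 1 -> 0 < x' -> 0 < e -> T = 16 / x -> 0 <= D ->
  D <= x / 2 -> 0 <= nX -> 0 <= nY -> a <= D -> b <= T * D -> `|x - x'| <= D -> `|t| <= T * D ->
  c1 <= x' * t ^+ 2 -> c2 <= t ^+ 2 + `|x - x'| / x * `|t| ->
  (2 * T ^+ 2 * (nX + nY) + 1) * D <= e / 2 ->
  E <= e / (2 * (1 + T)) * (a + b) + (c1 * nX + c2 * nY) -> E <= e * D.
Proof.
move=> x0 x1 x'0 e0 TE D0 Dx nX0 nY0 aD bD xD tD c1h c2h KD h.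
have T16 : 16 <= T by rewrite TE ler_pdivlMr//; lra.
have xT : x^-1 = T / 16 by rewrite TE; field; rewrite gt_eqF.
have t2 : t ^+ 2 <= T ^+ 2 * D ^+ 2.
  by rewrite -(real_normK (num_real t)) -exprMn ler_sqr ?nnegrE ?mulr_ge0//; lra.
have x'2 : x' <= 2 by have := le_trans (ler_norm _) (_ : `|x' - x| <= D); rewrite distrC => /(_ xD); lra.
have TD : 0 <= T ^+ 2 * D ^+ 2 by rewrite mulr_ge0 ?sqr_ge0.
have c1' : c1 <= 2 * (T ^+ 2 * D ^+ 2).
  by apply: le_trans c1h _; apply: ler_pM; rewrite ?sqr_ge0 ?(ltW x'0).
have c2' : c2 <= 2 * (T ^+ 2 * D ^+ 2).
  apply: le_trans c2h _; rewrite mulr2n mulrDl mul1r; apply: lerD => //.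
  have : `|x - x'| / x * `|t| <= D * x^-1 * (T * D).
    by apply: ler_pM; rewrite ?mulr_ge0 ?invr_ge0 ?(ltW x0) ?ler_wpM2r ?invr_ge0 ?(ltW x0).
  rewrite xT => h'; apply: le_trans h' _.
  have -> : D * (T / 16) * (T * D) = T ^+ 2 * D ^+ 2 / 16 by field.
  lra.
have ab : e / (2 * (1 + T)) * (a + b) <= e / 2 * D.
  rewrite (_ : e / 2 * D = e / (2 * (1 + T)) * (D + T * D)); last by field; lra.
  by rewrite ler_wpM2l ?lerD// ltW// divr_gt0//; lra.
have p1 := ler_wpM2r nX0 c1'; have p2 := ler_wpM2r nY0 c2'.
have p3 := ler_wpM2r D0 KD.
apply: le_trans h _; apply: le_trans (lerD ab (lerD p1 p2)) _.
have D2 : 0 <= D ^+ 2 by rewrite sqr_ge0.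
have -> : 2 * (T ^+ 2 * D ^+ 2) * nX + 2 * (T ^+ 2 * D ^+ 2) * nY = (2 * T ^+ 2 * (nX + nY) + 1) * D * D - D ^+ 2 by ring.
lra.
Qed.

Lemma jcont_of_ball (g : R -> R -> R) x y : (forall e, 0 < e -> exists2 r : R, 0 < r & forall x' y',
  `|x - x'| < r -> `|y - y'| < r -> `|g x y - g x' y'| <= e) -> jcont g x y.
Proof.
move=> H; apply/cvgrPdist_le => e e0; have [r r0 h] := H e e0.
have : \forall z \near (x, y), `|g x y - g z.1 z.2| <= e.
  by apply/nbhs_ballP; exists r => // -[x' y'] [/= hx hy]; apply: h.
exact.
Qed.

Lemma open_open_disk : open (open_disk : set 'rV[R]_2).
Proof.
rewrite openE => p p1; apply/nbhs_enorm; exists (1 - enorm p); first by rewrite subr_gt0.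
move=> q h; rewrite /open_disk/=; rewrite enorm_distC in h.
by have := enormD (q - p) p; rewrite subrK; move: h p1; rewrite /open_disk/=; lra.
Qed.

Lemma open_closed_disk : open_disk `<=` (closed_disk : set 'rV[R]_2).
Proof. by move=> p /ltW. Qed.

End Angles.

(** * The map in Cartesian coordinates is an isometric embedding *)

Section Cartesian.
Context {R : realType}.
Variables (G X Y : R -> R -> 'rV[R]_3).
Hypotheses (pG : per G) (pX : per X) (pY : per Y) (G0 : forall y, G 0 y = 0).
Hypothesis Gdiff : forall x y e : R, 0 < x < 1 -> 0 < e -> exists2 r : R, 0 < r & forall x' y',
  `|x - x'| < r -> `|y - y'| < r ->
  enorm (G x' y' - G x y - ((x' - x) *: X x y + (y' - y) *: Y x y)) <= e * (`|x' - x| + `|y' - y|).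
Hypothesis XYc : forall x y e : R, 0 < x < 1 -> 0 < e -> exists2 r : R, 0 < r & forall x' y',
  `|x - x'| < r -> `|y - y'| < r -> enorm (X x y - X x' y') <= e /\ enorm (Y x y - Y x' y') <= e.
Hypothesis met : forall x y u v : R, 0 < x < 1 -> dot (u *: X x y + v *: Y x y) (u *: X x y + v *: Y x y) =
  4 / (1 - x ^+ 2) ^+ 2 * (u ^+ 2 + x ^+ 2 * v ^+ 2).
Hypothesis orig : exists2 A : R, 0 <= A & forall x y : R, 0 < x -> x <= 1 / 2 ->
  [/\ enorm (X x y - vdx f0 x y) <= A * Num.sqrt x, enorm (Y x y - vdy f0 x y) <= A * Num.sqrt x * x &
      enorm (G x y - f0 x y) <= A * Num.sqrt x * x].
Hypothesis marg : forall m, exists2 d : R, 0 < d & forall x y x' y' : R, 0 <= x <= 1 -> 0 <= x' <= 1 ->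
  m.+1%:R^-1 <= polar_dist x y x' y' -> d <= enorm (G x y - G x' y').

Definition cartesian p : 'rV[R]_3 := G (enorm p) (polar_angle p).

Lemma polar_angle_polar_point (x y : R) : 0 < x -> exists k : int, polar_angle (polar_point x y) = y + k%:~R * (2 * pi).
Proof.
move=> x0; have := polar_angleE (polar_point x y); rewrite enorm_polar_point gtr0_norm// => /polar_eqE E.
by have [_] := polar_eq_angle x0 (ltW x0) E.
Qed.

Lemma cartesian_polar_point x y : 0 <= x -> cartesian (polar_point x y) = G x y.
Proof.
rewrite le_eqVlt /cartesian enorm_polar_point => /predU1P[<-|x0]; first by rewrite normr0 !G0.
by have [k ->] := polar_angle_polar_point y x0; rewrite gtr0_norm// per_int.
Qed.

(** The inverse of the Jacobian of polar coordinates applied to the polar derivatives [X] and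
    [Y]. *)
Definition Jpol x y : 'M[R]_(2, 3) := \matrix_(i, j) (if i == 0 then cos y * X x y 0 j - sin y / x * Y x y 0 j
  else sin y * X x y 0 j + cos y / x * Y x y 0 j).
Definition jac_origin : 'M[R]_(2, 3) := \matrix_(i, j) (if i == 0 then if j == 0 then 2 else 0 else if j == 1 then 2 else 0).
Definition Jcart p : 'M[R]_(2, 3) := if enorm p == 0 then jac_origin else Jpol (enorm p) (polar_angle p).

Lemma Jcart_polar_point x y : 0 < x -> Jcart (polar_point x y) = Jpol x y.
Proof.
move=> x0; rewrite /Jcart enorm_polar_point gtr0_norm// gt_eqF//.
have [k ->] := polar_angle_polar_point y x0; have [pc ps] := @per_cossin R.
by apply/matrixP => i j; rewrite !mxE (per_int k x y pX) (per_int k x y pY) (per_int k x y pc) (per_int k x y ps).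
Qed.

Lemma mul_Jpol (v : 'rV[R]_2) x y : v *m Jpol x y =
  (v 0 0 * cos y + v 0 1 * sin y) *: X x y + ((v 0 1 * cos y - v 0 0 * sin y) / x) *: Y x y.
Proof.
apply/rowP => j; rewrite rV3D !rV3Z mxE !big_ord_recl big_ord0 !mxE /= addr0.
rewrite (_ : lift ord0 ord0 = 1 :> 'I_2) /=; last exact/val_inj.
by ring.
Qed.

Lemma diff_polar_point (x y e : R) : 0 < x < 1 -> 0 < e -> exists2 r : R, 0 < r & forall q, enorm (polar_point x y - q) < r ->
  enorm (cartesian q - cartesian (polar_point x y) - (q - polar_point x y) *m Jpol x y) <= e * enorm (q - polar_point x y).
Proof.
move=> xr e0; have /andP[x0 x1] := xr.
pose T : R := 16 / x; have T0 : 0 < T by rewrite divr_gt0.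
have e1 : 0 < e / (2 * (1 + T)) by rewrite divr_gt0// mulr_gt0// addr_gt0.
have [r1 r10 H] := Gdiff y xr e1.
pose K : R := 2 * T ^+ 2 * (enorm (X x y) + enorm (Y x y)) + 1.
have K0 : 0 < K by rewrite ltr_wpDl//; apply: mulr_ge0; rewrite ?addr_ge0 ?enorm_ge0// mulr_ge0// sqr_ge0.
pose r : R := Num.min (Num.min (x / 2) (r1 / (1 + T))) (Num.min (1 / T) (e / (2 * K))).
have r0 : 0 < r by rewrite !lt_min !divr_gt0// ?addr_gt0// mulr_gt0.
exists r => // q; rewrite [enorm (q - _)]enorm_distC.
rewrite !lt_min => /andP[/andP[h1 h2] /andP[h3 h4]].
have [x' [y' [qE x'0 dx dy]]] := polar_near x0 h1; rewrite qE in h1 h2 h3 h4 dx dy *; rewrite !cartesian_polar_point ?(ltW x0) ?(ltW x'0)//.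
move: h1 h2 h3 h4 dx dy; set D := enorm (polar_point x y - polar_point x' y') => h1 h2 h3 h4 dx dy; rewrite -/T in dy.
have D0 : 0 <= D by exact: enorm_ge0.
have Dr : (1 + T) * D < r1 by rewrite mulrC -ltr_pdivlMr ?addr_gt0.
have dx1 : `|x - x'| < r1 by apply: le_lt_trans dx _; apply: le_lt_trans Dr; rewrite ler_peMl// lerDl ltW.
have dy1 : `|y - y'| < r1 by apply: le_lt_trans dy _; apply: le_lt_trans Dr; rewrite ler_wpM2r// lerDr.
have t1 : `|y' - y| <= 1.
  by rewrite distrC; apply: le_trans dy _; move: h3; rewrite ltr_pdivlMr// mulrC => /ltW.
have [s1 s2] := polar_second_order x0 x'0 t1.
have h4' : K * D <= e / 2.
  by move: h4; rewrite ltr_pdivlMr ?mulr_gt0// => /ltW; rewrite (_ : D * (2 * K) = 2 * (K * D)); [lra|ring].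
have dyt : `|y' - y| <= T * D by rewrite distrC.
apply: (diff_num x0 x1 x'0 e0 (erefl T) D0 (ltW h1) (enorm_ge0 (X x y)) (enorm_ge0 (Y x y)) _ _ dx dyt s1 s2 h4' (_ : _ <= e / (2 * (1 + T)) * (`|x' - x| + `|y' - y|) + _)) => //.
  by rewrite distrC.
have := H x' y' dx1 dy1; rewrite mul_Jpol.
have -> : (polar_point x' y' - polar_point x y) 0 0 * cos y + (polar_point x' y' - polar_point x y) 0 1 * sin y = x' * cos (y' - y) - x.
  rewrite !mxE /= cosB -[x in RHS]mulr1 -(cos2Dsin2 y); ring.
have -> : (polar_point x' y' - polar_point x y) 0 1 * cos y - (polar_point x' y' - polar_point x y) 0 0 * sin y = x' * sin (y' - y).
  rewrite !mxE /= sinB; ring.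
move=> hG.
have -> : G x' y' - G x y - ((x' * cos (y' - y) - x) *: X x y + (x' * sin (y' - y) / x) *: Y x y) =
  (G x' y' - G x y - ((x' - x) *: X x y + (y' - y) *: Y x y)) +
  ((x' - x - (x' * cos (y' - y) - x)) *: X x y + (y' - y - x' * sin (y' - y) / x) *: Y x y).
  move: (G x' y') (G x y) (X x y) (Y x y) => a b c f; apply/rowP => j; rewrite !mxE; ring.
apply: le_trans (enormD _ _) _; apply: lerD => //.
by apply: le_trans (enormD _ _) _; rewrite !enormZ.
Qed.

Lemma cartesian0 : cartesian 0 = 0.
Proof. by rewrite /cartesian enorm0 G0. Qed.

(** In Cartesian coordinates [f0] is the linear map of matrix [jac_origin], and the map differs from
    it by O(x^(3/2)). *)
Lemma diff_zero (e : R) : 0 < e -> exists2 r : R, 0 < r & forall q : 'rV[R]_2, enorm (0 - q) < r ->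
  enorm (cartesian q - cartesian 0 - (q - 0) *m jac_origin) <= e * enorm (q - 0).
Proof.
move=> e0; have [A A0 H] := orig.
pose b : R := e / (A + 1); have A1 : 0 < A + 1 by rewrite ltr_wpDl.
have b0 : 0 < b by rewrite divr_gt0.
exists (Num.min (1 / 2) (b ^+ 2)); first by rewrite lt_min divr_gt0//= exprn_gt0.
move=> q; rewrite sub0r enormN !subr0 cartesian0 subr0 lt_min => /andP[q1 q2].
have [q0|qn] := eqVneq (enorm q) 0; first by rewrite (enorm_eq0 q0) cartesian0 mul0mx subrr !enorm0 mulr0.
have qp : 0 < enorm q by rewrite lt_neqAle eq_sym qn enorm_ge0.
have [_ _ h] := H _ (polar_angle q) qp (ltW q1).
have -> : q *m jac_origin = f0 (enorm q) (polar_angle q).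
  rewrite {1}(polar_angleE q); apply/rowP => j; rewrite mxE !big_ord_recl big_ord0 !mxE /= addr0.
  by have [->|j0] := eqVneq j 0; [rewrite /=; ring|case: (j == 1); ring].
apply: le_trans h _; rewrite ler_pM2r//.
have sq : Num.sqrt (enorm q) <= b by rewrite -[leRHS]gtr0_norm// -sqrtr_sqr ler_wsqrtr// ltW.
apply: le_trans (ler_wpM2l A0 sq) _; rewrite /b mulrA ler_pdivrMr// mulrC ler_pM2l// lerDl//.
Qed.

Lemma cartesian_diff p : open_disk p -> differentiable cartesian p /\ jacobian cartesian p = Jcart p.
Proof.
move=> p1; have [p0|pn] := eqVneq (enorm p) 0.
  have -> : p = 0 by exact: enorm_eq0.
  have -> : Jcart 0 = jac_origin by rewrite /Jcart enorm0 eqxx.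
  apply: diff_of_estimate => e e0; exact: diff_zero.
have pp : 0 < enorm p < 1 by rewrite lt_neqAle eq_sym pn enorm_ge0.
have pp0 : 0 < enorm p by case/andP: pp.
rewrite (polar_angleE p) Jcart_polar_point//; apply: diff_of_estimate => e e0; exact: diff_polar_point.
Qed.

Lemma jcont_Jpol (x y : R) i j : 0 < x < 1 -> jcont (fun x y => Jpol x y i j) x y.
Proof.
move=> xr; have x0 : 0 < x by case/andP: xr.
have cX : jcont (fun x y => X x y 0 j) x y.
  apply: jcont_of_ball => e e0; have [r r0 h] := XYc y xr e0; exists r => // x' y' hx hy.
  by have [h1 _] := h x' y' hx hy; rewrite -rV3B; exact: le_trans (enorm_coord _ _) h1.
have cY : jcont (fun x y => Y x y 0 j) x y.
  apply: jcont_of_ball => e e0; have [r r0 h] := XYc y xr e0; exists r => // x' y' hx hy.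
  by have [_ h1] := h x' y' hx hy; rewrite -rV3B; exact: le_trans (enorm_coord _ _) h1.
have sc := smooth_cos (@open_pos R) (@smooth_snd R [set x | 0 < x]).
have ss := smooth_sin (@open_pos R) (@smooth_snd R [set x | 0 < x]).
have sv : smooth [set x : R | 0 < x] (fun x _ => x^-1) by apply: smoothV (@smooth_fst R _) => //; exact: open_pos.
have cc := smooth_jcont (y := y) sc x0; have cs := smooth_jcont (y := y) ss x0.
have ccv := smooth_jcont (y := y) (smoothM sc sv) x0.
have csv := smooth_jcont (y := y) (smoothN (smoothM ss sv)) x0.
rewrite (_ : (fun x y => Jpol x y i j) = fun x y => if i == 0 then cos y * X x y 0 j + - (sin y * x^-1) * Y x y 0 j
  else sin y * X x y 0 j + (cos y * x^-1) * Y x y 0 j).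
  by case: (i == 0); apply: jcontD; apply: jcontM.
by apply/funext => a; apply/funext => b; rewrite mxE mulNr.
Qed.

(** At the origin, the factor [1 / x] of [Jpol] is absorbed by the factor [x] in the bound on the
    angular derivative, and the rotations of the frame cancel by [cos^2 + sin^2 = 1]. *)
Lemma Jcart_near p i j (e : R) : open_disk p -> 0 < e -> exists2 r : R, 0 < r & forall q, enorm (p - q) < r ->
  `|Jcart p i j - Jcart q i j| < e.
Proof.
move=> p1 e0; have [p0|pn] := eqVneq (enorm p) 0.
  have [A A0 H] := orig.
  pose b : R := e / (2 * A + 1); have A1 : 0 < 2 * A + 1 by rewrite ltr_wpDl// mulr_ge0.
  have b0 : 0 < b by rewrite divr_gt0.
  exists (Num.min (1 / 2) (b ^+ 2)); first by rewrite lt_min divr_gt0//= exprn_gt0.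
  move=> q; rewrite {1 2}(enorm_eq0 p0) sub0r enormN /Jcart enorm0 eqxx lt_min => /andP[q1 q2].
  have [q0|qn] := eqVneq (enorm q) 0; first by rewrite subrr normr0.
  have qp : 0 < enorm q by rewrite lt_neqAle eq_sym qn enorm_ge0.
  have [h1 h2 _] := H _ (polar_angle q) qp (ltW q1).
  move: (enorm q) (polar_angle q) qp h1 h2 q2 => x y x0 h1 h2 q2.
  have sq : Num.sqrt x < b by rewrite -[ltRHS]gtr0_norm// -sqrtr_sqr ltr_sqrt// exprn_gt0.
  have [vx vy] := vd_f0 x y; rewrite vx in h1; rewrite vy in h2.
  have k1 := le_trans (enorm_coord _ j) h1; have k2 := le_trans (enorm_coord _ j) h2.
  have fin (u v : R) : `|u| <= 1 -> `|v| <= 1 -> `|- (u * (X x y - \row_j0 (if j0 == 0 then 2 * cos y else if j0 == 1 then 2 * sin y else 0)) 0 j +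
     v / x * (Y x y - \row_j0 (if j0 == 0 then - (2 * (x * sin y)) else if j0 == 1 then 2 * (x * cos y) else 0)) 0 j)| < e.
    move=> hu hv; rewrite normrN; apply: le_lt_trans (ler_normD _ _) _.
    apply: le_lt_trans (_ : 1 * (A * Num.sqrt x) + 1 / x * (A * Num.sqrt x * x) < _).
      rewrite !normrM normfV (gtr0_norm x0); apply: lerD; apply: ler_pM => //.
        by rewrite divr_ge0// ltW.
      by rewrite ler_pM2r// invr_gt0.
    rewrite (_ : 1 * (A * Num.sqrt x) + 1 / x * (A * Num.sqrt x * x) = 2 * A * Num.sqrt x); last by field; rewrite gt_eqF.
    apply: le_lt_trans (_ : (2 * A) * b < e); first by rewrite ler_wpM2l ?mulr_ge0// ltW.
    by rewrite /b mulrA ltr_pdivrMr// mulrC ltr_pM2l// ltrDl.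
  have c1 : `|cos y| <= 1 by rewrite ler_norml cos_geN1 cos_le1.
  have c2 : `|sin y| <= 1 by rewrite ler_norml sin_geN1 sin_le1.
  have c3 : `|- sin y| <= 1 by rewrite normrN.
  have cs := cos2Dsin2 y; have xn : x != 0 by rewrite gt_eqF.
  have e2 : (2 : R) = 2 * (cos y ^+ 2 + sin y ^+ 2) by rewrite cs mulr1.
  rewrite !mxE; case: (i == 0); [have := fin _ _ c1 c3|have := fin _ _ c2 c1]; congr (`|_| < e); rewrite !mxE.
    have [->|j0] := eqVneq j 0; last case: (j == 1).
    - by rewrite [X in _ = X - _]e2; field.
    - by field.
    - by field.
  have [->|j0] := eqVneq j 0; last case: (j == 1).
  - by rewrite /=; field.
  - by rewrite [X in _ = X - _]e2; field.
  - by field.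
have pp : 0 < enorm p < 1 by rewrite lt_neqAle eq_sym pn enorm_ge0.
have x0 : 0 < enorm p by case/andP: pp.
suff main (x y : R) : 0 < x < 1 -> exists2 r : R, 0 < r & forall q, enorm (polar_point x y - q) < r ->
    `|Jpol x y i j - Jcart q i j| < e.
  have [r r0 h] := main _ (polar_angle p) pp; rewrite -(polar_angleE p) in h; exists r => // q hq.
  by rewrite {1}/Jcart (negPf pn); exact: h.
move=> xr; have {}x0 : 0 < x by case/andP: xr.
have [r r0 h] := jcont_ball (@jcont_Jpol x y i j xr) e0.
have T0 : 0 < 1 + 16 / x by rewrite addr_gt0// divr_gt0.
exists (Num.min (x / 2) (r / (1 + 16 / x))); first by rewrite lt_min !divr_gt0.
move=> q; rewrite lt_min => /andP[h1 h2].
have [x' [y' [qE x'0 dx dy]]] := polar_near x0 h1; rewrite {1}qE Jcart_polar_point//.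
have D0 := enorm_ge0 (polar_point x y - q); rewrite ltr_pdivlMr// in h2.
have T0' : 0 <= 16 / x by rewrite divr_ge0// ltW.
apply: h.
  by apply: le_lt_trans dx _; apply: le_lt_trans h2; rewrite ler_peMr// lerDl.
by apply: le_lt_trans dy _; apply: le_lt_trans h2; rewrite mulrC ler_wpM2l// lerDr.
Qed.

Lemma Jcart_metric p : open_disk p -> Jcart p *m (Jcart p)^T = hyperbolic_metric p.
Proof.
move=> p1; have E (J : 'M[R]_(2, 3)) i k : (J *m J^T) i k = dot (row i J) (row k J).
  by rewrite mxE; apply: eq_bigr => j _; rewrite !mxE.
have rj (x y : R) : row 0 (Jpol x y) = cos y *: X x y + (- (sin y / x)) *: Y x y /\
    row 1 (Jpol x y) = sin y *: X x y + (cos y / x) *: Y x y.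
  by split; apply/rowP => j; rewrite rV3D !rV3Z !mxE /=; rewrite ?mulNr.
have [p0|pn] := eqVneq (enorm p) 0.
  rewrite /Jcart p0 eqxx (enorm_eq0 p0); apply/matrixP => i k.
  rewrite E dot3E !mxE /= (_ : dot (0 : 'rV[R]_2) 0 = 0); last by rewrite -enorm_sqr enorm0 expr0n.
  rewrite subr0 expr1n divr1.
  by case: i => [[|[|//]] hi]; case: k => [[|[|//]] hk]; rewrite /= ?mulr0 ?addr0 ?mulr1n ?mulr0n//; ring.
have pp : 0 < enorm p < 1 by rewrite lt_neqAle eq_sym pn enorm_ge0.
have x0 : 0 < enorm p by case/andP: pp.
rewrite /hyperbolic_metric -enorm_sqr /Jcart (negPf pn).
move: (enorm p) (polar_angle p) pp x0 => x y xr x0; have xn : x != 0 by rewrite gt_eqF.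
have m u v := met y u v xr; set l := 4 / _ in m *.
(* Polarization: the values of [met] at three vectors give the Gram matrix of [X] and [Y]. *)
have EE : dot (X x y) (X x y) = l by have := m 1 0; rewrite !dotE; move=> h; lra.
have GG : dot (Y x y) (Y x y) = l * x ^+ 2 by have := m 0 1; rewrite !dotE; move=> h; lra.
have FF : dot (X x y) (Y x y) = 0 by have := m 1 1; rewrite !dotE (dotC (Y x y)) EE GG; move=> h; lra.
have [r0 r1] := rj x y; have cs := cos2Dsin2 y.
have o2 (i : 'I_2) : i = 0 \/ i = 1 by case: i => [[|[|//]] hi]; [left|right]; apply/val_inj.
apply/matrixP => i k; rewrite E [RHS]mxE.
case: (o2 i) => ->; case: (o2 k) => ->; rewrite ?r0 ?r1 !dotE (dotC (Y x y)) EE FF GG ?eqxx /=.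
- by rewrite -[in RHS](mulr1 l) -cs mulr1n; field.
- by rewrite mulr0n; field.
- by rewrite mulr0n; field.
- by rewrite -[in RHS](mulr1 l) -cs mulr1n; field.
Qed.

(** Quantitative injectivity on the closed disk; it gives both injectivity and the continuity of the
    inverse that an embedding requires. *)
Lemma cartesian_modulus (e : R) : 0 < e -> exists2 d : R, 0 < d & forall p q, closed_disk p -> closed_disk q ->
  e <= enorm (p - q) -> d <= enorm (cartesian p - cartesian q).
Proof.
move=> e0; pose m := Num.bound e^-1.
have mp : m.+1%:R^-1 <= e.
  rewrite invf_ple ?posrE//; apply: le_trans (ltW (archi_boundP _)) _; first by rewrite ltW// invr_gt0.
  by rewrite ler_nat leqW.
have [d d0 H] := marg m; exists d => // p q p1 q1 h.
apply: H; rewrite ?enorm_ge0//; apply: le_trans mp _; apply: le_trans h _.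
by rewrite {1}(polar_angleE p) {1}(polar_angleE q); exact: polar_dist_polar_point.
Qed.

Lemma cartesian_inj p q : closed_disk p -> closed_disk q -> cartesian p = cartesian q -> p = q.
Proof.
move=> p1 q1 E; apply/eqP; apply: contraT => pq.
have h : 0 < enorm (p - q).
  rewrite lt_neqAle enorm_ge0 andbT eq_sym; apply/eqP => /enorm_eq0 /eqP.
  by rewrite subr_eq0 (negPf pq).
have [d d0 H] := cartesian_modulus h; have := H p q p1 q1 (lexx _).
by rewrite E subrr enorm0 leNgt d0.
Qed.

Lemma cartesian_embedding : C1_isometric_embedding cartesian.
Proof.
have inj : {in (open_disk : set 'rV[R]_2) &, injective cartesian}.
  by move=> p q; rewrite !inE => /open_closed_disk p1 /open_closed_disk q1; exact: cartesian_inj.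
split => //.
- by move=> p /cartesian_diff[].
- rewrite (continuous_open_subspace _ open_open_disk) => p; rewrite inE => p1.
  rewrite /continuous_at; apply/(@cvg_ballP _ _ _ (nbhs p) (nbhs_filter p)) => e e0.
  suff : \forall q \near p, forall i j, `|Jcart p i j - Jcart q i j| < e.
    have : \forall q \near p, open_disk q by apply: open_nbhs_nbhs; split => //; exact: open_open_disk.
    apply: filterS2 => q q1 h; split => // i j.
    by rewrite (cartesian_diff p1).2 (cartesian_diff q1).2; exact: h.
  apply: (@filter_forall _ _ _ (nbhs p) (nbhs_filter p)) => i; apply: (@filter_forall _ _ _ (nbhs p) (nbhs_filter p)) => j.
  by apply/nbhs_enorm; have [r r0 h] := Jcart_near i j p1 e0; exists r.
- by move=> p p1; rewrite (cartesian_diff p1).2; exact: Jcart_metric.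
apply/subspace_continuousP => y [p p1 <-].
apply/(cvg_enorm (within_filter _ _)) => e e0.
have [d d0 H] := cartesian_modulus e0.
apply/nbhs_enorm; exists d => // z hz [q q1 qz]; rewrite -{}qz in hz *.
rewrite /from_subspace !pinvKV ?inE// ltNge; apply: contraTN hz => h; rewrite -leNgt.
by apply: H => //; exact: open_closed_disk.
Qed.

End Cartesian.

(** * Hölder regularity *)

Section HolderAux.
Context {R : realType}.

(** Write [a = a^(1-b) a^b] and bound each factor by a different estimate. *)
Lemma powR_interp (a e t b : R) : 0 < b < 1 -> 0 <= a -> a <= e -> a <= t -> a <= e `^ (1 - b) * t `^ b.
Proof.
move=> b01 a0 ae at_.
have -> : a = a `^ (1 - b) * a `^ b.
  by rewrite -powRD ?subrK ?powRr1// oner_eq0.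
have e0 := le_trans a0 ae; have t0 := le_trans a0 at_.
by apply: ler_pM; rewrite ?powR_ge0//; apply: ge0_ler_powR; rewrite ?nnegrE//; lra.
Qed.

(** With [B = 2^m lip_bound m.+1] the budget is [B^-m], and [m (1 - b) >= 1] makes [B^(-m (1 - b))]
    at most [1 / B]. *)
Lemma budget_powR (b : R) m : 0 < b < 1 -> 1 <= m%:R * (1 - b) -> budget m `^ (1 - b) * (2 * lip_bound m.+1) <= 2 * 2^-1 ^+ m.
Proof.
move=> b01 mb; have L1 := lip_bound_ge1 (R := R) m.+1.
have m2 : 1 <= 2 ^+ m :> R by rewrite exprn_ege1//; lra.
rewrite /budget; set B := 2 ^+ m * lip_bound m.+1; have B1 : 1 <= B by rewrite -[1]mulr1 ler_pM.
have B0 : 0 < B by lra.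
have X0 : 0 < B ^+ m by rewrite exprn_gt0.
have h : B <= (B ^+ m) `^ (1 - b).
  by rewrite -powR_mulrn ?(ltW B0)// -powRrM -[leLHS]powRr1 ?(ltW B0)// ler_powR.
have E : (B ^+ m)^-1 `^ (1 - b) * (B ^+ m) `^ (1 - b) = 1.
  by rewrite -powRM ?invr_ge0 ?(ltW X0)// mulVf ?gt_eqF// powR1.
have Y0 : 0 < (B ^+ m) `^ (1 - b) by rewrite powR_gt0.
have -> : (B ^+ m)^-1 `^ (1 - b) = ((B ^+ m) `^ (1 - b))^-1 by apply: (mulIf (lt0r_neq0 Y0)); rewrite E mulVf ?gt_eqF.
rewrite mulrC ler_pdivrMr// exprVn mulrAC ler_pdivlMr ?exprn_gt0//.
rewrite -mulrA ler_pM2l// mulrC; exact: h.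
Qed.

Lemma le_self_powR (D b : R) : 0 < b < 1 -> 0 <= D -> D <= 2 -> D <= 2 * D `^ b.
Proof.
move=> b01 D0 D2; have [D1|D1] := leP D 1.
  have [->|Dn] := eqVneq D 0; first by rewrite mulr_ge0// powR_ge0.
  apply: le_trans (_ : D `^ b <= _); last by rewrite ler_peMl ?powR_ge0//; lra.
  by rewrite -{1}[D]powRr1// ger_powR//; lra.
apply: le_trans D2 _; rewrite -{1}[2]mulr1 ler_pM2l//.
by rewrite -[1](powRr0 D) ler_powR//; lra.
Qed.

End HolderAux.

(** * Lipschitz bounds of the maps and Hölder regularity of the limit *)

Section Holder.
Context {R : realType}.
Variable Z : nat -> (R -> R -> 'rV[R]_3) * R.
Hypotheses (Zst : forall m, stage_ok m (Z m)) (Znext : forall m, next m (Z m) (Z m.+1)).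
Let F m := (Z m).1.

(** [first_form_upper] at the coordinate vectors; [conformal_le] gives [16 / tau^2], increased to
    [36 / tau^2] to absorb the slack. *)
Lemma vd_bound m (x y : R) : 0 < x <= 1 ->
  enorm (vdx (F m) x y) <= 6 / tau ^+ m.+1 /\ enorm (vdy (F m) x y) <= 6 / tau ^+ m.+1 * x.
Proof.
move=> /andP[x0 x1]; have [fi _ _ _] := Zst m; rewrite -/(F m) in fi.
set k := (m %/ 3)%N in fi *; set i := (m %% 3)%N in fi.
have i3 : (i <= 3)%N by rewrite ltnW// ltn_mod.
have xI : stage_domain (3 * k + i) x by rewrite /stage_domain/= x0/=; exact: le_lt_trans (outer_radius_gt1 _).
have d := stage_domain_near_disk_succ xI; have [w0 w1 _] := slack_bounds d; have d1 := near_disk_le (leqnSn _) d.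
have m4 := conformal_ge4 (near_disk_le (leqnSn k) d1).
have t0 := @tauX_gt0 R m.+1.
have mb : conformal k.+1 x + 3 * slack k x <= (6 / tau ^+ m.+1) ^+ 2.
  have := conformal_le d1; have tm : (tau ^+ m.+1) ^+ 2 <= (tau ^+ k.+1) ^+ 2 :> R.
    by rewrite ler_sqr ?nnegrE ?(ltW (tauX_gt0 _))// tauX_anti// ltnS /k leq_div.
  have h16 : 16 / (tau ^+ k.+1) ^+ 2 <= 16 / (tau ^+ m.+1) ^+ 2 :> R.
    have p1 := exprn_gt0 2 (@tauX_gt0 R k.+1); have p2 := exprn_gt0 2 t0.
    by rewrite ler_pM2l// lef_pV2 ?posrE.
  rewrite expr_div_n (_ : 6 ^+ 2 / (tau ^+ m.+1) ^+ 2 = 36 / (tau ^+ m.+1) ^+ 2); last by congr (_ / _); ring.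
  move: h16 w1; rewrite /increment; move: ((tau ^+ m.+1) ^+ 2)^-1 (_ / (tau ^+ k.+1) ^+ 2) => a b h16 w1 hm; lra.
have c0 : 0 <= 6 / tau ^+ m.+1 :> R by rewrite divr_ge0// ltW.
split.
  rewrite -ler_sqr ?nnegrE ?enorm_ge0// enorm_sqr; apply: le_trans mb.
  have := first_form_upper i3 fi y 1 0 xI; rewrite /first_form expr1n expr0n /=.
  rewrite -[dot _ _]/(coef_E (F m) x y); move: (coef_E _ _ _) (coef_F _ _ _) (coef_G _ _ _) (conformal _ _ + _) => p q r s; lra.
have cx0 : 0 <= 6 / tau ^+ m.+1 * x by rewrite mulr_ge0// ltW.
rewrite -ler_sqr ?nnegrE ?enorm_ge0// enorm_sqr exprMn.
apply: le_trans (ler_wpM2r (sqr_ge0 x) mb).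
have := first_form_upper i3 fi y 0 1 xI; rewrite /first_form expr1n expr0n /=.
rewrite -[dot _ _]/(coef_G (F m) x y); move: (coef_G _ _ _) (coef_F _ _ _) (coef_E _ _ _) (conformal _ _ + _) (x ^+ 2) => p q r s t; lra.
Qed.

Lemma F_stage_domain m (x : R) : 0 < x -> x <= 1 -> stage_domain (3 * (m %/ 3) + m %% 3) x.
Proof. by move=> x0 x1; rewrite /stage_domain/= x0/=; exact: le_lt_trans (outer_radius_gt1 _). Qed.

Lemma F_radial m (x x' y : R) : 0 < x -> x <= 1 -> 0 < x' -> x' <= 1 ->
  enorm (F m x' y - F m x y) <= 12 / tau ^+ m.+1 * `|x' - x|.
Proof.
move=> x0 x1 x'0 x'1; have [[sf _ _ _ _] _ _ _] := Zst m.
have -> : 12 / tau ^+ m.+1 * `|x' - x| = 2 * (6 / tau ^+ m.+1 * `|x' - x|).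
  by move: (_ ^+ m.+1)^-1 => a; ring.
have seg z : Num.min x x' <= z <= Num.max x x' -> 0 < z <= 1.
  rewrite ge_min le_max => /andP[h1 h2]; apply/andP; split.
    by case/orP: h1 => h1; exact: lt_le_trans h1.
  by case/orP: h2 => h2; exact: le_trans h2 _.
apply: enorm3_le => j.
have [|z zr E] := @mean_value R (fun x => F m x y 0 j) (fun x => vdx (F m) x y 0 j) x x'.
  move=> z /seg/andP[z0 z1]; rewrite vdx_coord; exact: smooth_dxP y (sf j) (F_stage_domain m z0 z1).
rewrite rV3B E normrM ler_wpM2r//; apply: le_trans (enorm_coord _ _) _.
by have [] := vd_bound m y (seg z zr).
Qed.

Lemma F_angular m (x y y' : R) : 0 < x -> x <= 1 ->
  enorm (F m x y' - F m x y) <= 12 / tau ^+ m.+1 * (x * `|y' - y|).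
Proof.
move=> x0 x1; have [[sf _ _ _ _] _ _ _] := Zst m.
have -> : 12 / tau ^+ m.+1 * (x * `|y' - y|) = 2 * (6 / tau ^+ m.+1 * x * `|y' - y|).
  by move: (_ ^+ m.+1)^-1 => a; ring.
have xr : 0 < x <= 1 by rewrite x0.
apply: enorm3_le => j.
have [|z zr E] := @mean_value R (fun y => F m x y 0 j) (fun y => vdy (F m) x y 0 j) y y'.
  move=> z _; rewrite vdy_coord; exact: smooth_dyP z (sf j) (F_stage_domain m x0 x1).
rewrite rV3B E normrM ler_wpM2r//; apply: le_trans (enorm_coord _ _) _.
by have [] := vd_bound m z xr.
Qed.

Lemma F_zero m (x y : R) : x <= 0 -> F m x y = f0 x y.
Proof.
move=> x0; have [[_ _ _ h _] _ _ _] := Zst m; apply: h; apply: le_trans x0 _.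
by rewrite ltW// core_radius_gt0.
Qed.

Lemma f0_norm (x y : R) : 0 <= x -> enorm (f0 x y) = 2 * x.
Proof.
move=> x0; rewrite /enorm dot3E !mxE /= mulr0 addr0.
have -> : 2 * (x * cos y) * (2 * (x * cos y)) + 2 * (x * sin y) * (2 * (x * sin y)) = (2 * x) ^+ 2 * (cos y ^+ 2 + sin y ^+ 2) by ring.
by rewrite cos2Dsin2 mulr1 sqrtr_sqr ger0_norm// mulr_ge0.
Qed.

Lemma f0_0 y : f0 0 y = 0 :> 'rV[R]_3.
Proof. by apply: enorm_eq0; rewrite f0_norm// mulr0. Qed.

Lemma F_center m (x y : R) : 0 < x -> x <= 1 -> enorm (F m x y) <= lip_bound m * x.
Proof.
move=> x0 x1; have t1 := @tauX_le1 R m.+1; have t0 := @tauX_gt0 R m.+1.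
have k1 : 1 <= (tau ^+ m.+1)^-1 :> R by rewrite invf_ge1.
have [[_ _ _ h _] _ _ _] := Zst m.
set s := core_radius _ in h; have s0 : 0 < s by exact: core_radius_gt0.
have [xs|xs] := leP x s.
  rewrite /F h// f0_norm ?(ltW x0)// ler_wpM2r ?(ltW x0)// /lip_bound.
  by move: (_ ^+ m.+1)^-1 k1 => a k1; lra.
have s1 : s <= 1 by exact: le_trans (ltW xs) x1.
have := F_radial m y s0 s1 x0 x1; rewrite ger0_norm ?subr_ge0 ?(ltW xs)// => hr.
have -> : F m x y = (F m x y - F m s y) + F m s y by rewrite subrK.
have fs : enorm (F m s y) <= 2 * s by rewrite /F h ?lexx// f0_norm ?(ltW s0).
apply: le_trans (enormD _ _) _; apply: le_trans (lerD hr fs) _; rewrite /lip_bound; move: (_ ^+ m.+1)^-1 k1 => a k1.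
have : 12 * a * (x - s) <= 12 * a * x by rewrite ler_wpM2l//; lra.
have : x <= a * x by rewrite ler_peMl// ltW.
lra.
Qed.

(** Path made of an arc at the smaller radius and of a radial segment. Taking the smaller radius
    bounds the arc by 8 times the distance, whence [9 = 8 + 1]. *)
Lemma F_lip m (x y x' y' : R) : 0 <= x <= 1 -> 0 <= x' <= 1 ->
  enorm (F m x y - F m x' y') <= lip_bound m * enorm (polar_point x y - polar_point x' y').
Proof.
have pol0 y0 : polar_point 0 y0 = 0 :> 'rV[R]_2 by apply: enorm_eq0; rewrite enorm_polar_point normr0.
wlog xx : x y x' y' / x <= x'.
  move=> H xr xr'; case: (leP x x') => xx; first exact: H.
  by rewrite enorm_distC [enorm (polar_point _ _ - _)]enorm_distC; apply: H => //; exact: ltW.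
move=> /andP[x0 x1] /andP[x'0 x'1].
have L0 : 0 <= lip_bound m :> R by apply: le_trans (lip_bound_ge1 _).
move: x0; rewrite le_eqVlt => /predU1P[x0|x0].
  rewrite -x0 pol0 sub0r enormN enorm_polar_point ger0_norm// F_zero// f0_0 sub0r enormN.
  move: x'0; rewrite le_eqVlt => /predU1P[<-|x'p]; last exact: F_center.
  by rewrite F_zero// f0_0 enorm0 mulr0.
have x'p : 0 < x' by exact: lt_le_trans xx.
have [k hk] := angle_near y y'.
have [[_ pf _ _ _] _ _ _] := Zst m.
have -> : F m x' y' = F m x' (y' + k%:~R * (2 * pi)) by rewrite /F (per_int k x' y' pf).
have pE : polar_point x' y' = polar_point x' (y' + k%:~R * (2 * pi)).
  by apply/polar_eqE; have [a b] := @polar_eq_shift R x' y' k; split.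
rewrite pE; move: (y' + _) hk => z hk; set D := enorm (polar_point _ _ - _).
have d1 : `|x - x'| <= D by apply: polar_point_dist_radius; exact: ltW.
have d2 : x * `|y - z| <= 8 * D by apply: polar_point_dist_angle => //; exact: ltW.
have a1 := F_radial m z x'p x'1 x0 x1; have a2 := F_angular m z y x0 x1.
have -> : F m x y - F m x' z = (F m x y - F m x z) + (F m x z - F m x' z) by rewrite addrA subrK.
apply: le_trans (enormD _ _) _.
apply: le_trans (lerD a2 a1) _; rewrite -mulrDr /lip_bound.
have c0 : 0 <= (tau ^+ m.+1)^-1 :> R by rewrite invr_ge0 ltW// tauX_gt0.
apply: le_trans (_ : 12 / tau ^+ m.+1 * (9 * D) <= _).
  by rewrite ler_wpM2l ?mulr_ge0//; lra.
have D0 : 0 <= D by exact: enorm_ge0.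
rewrite mulrA ler_wpM2r//; move: (_ ^+ m.+1)^-1 c0 => a c0; lra.
Qed.

(** From the index [M] on, the C^0 and the Lipschitz bounds of a step interpolate to a summable
    Hölder bound; the map of index [M] is Lipschitz. *)
Lemma limit_map_holder (b : R) : 0 < b < 1 -> exists2 K : R, 0 < K & forall x y x' y', 0 <= x <= 1 -> 0 <= x' <= 1 ->
  enorm (limit_map Z x y - limit_map Z x' y') <= K * enorm (polar_point x y - polar_point x' y') `^ b.
Proof.
move=> b01; pose M := Num.bound (1 - b)^-1.
have b1 : 0 < 1 - b by lra.
have Mb m : (M <= m)%N -> 1 <= m%:R * (1 - b).
  move=> Mm; rewrite -ler_pdivrMr// mul1r; apply: le_trans (ltW (archi_boundP _)) _; first by rewrite invr_ge0 ltW.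
  by rewrite ler_nat.
have L0 m : 0 <= lip_bound m :> R by apply: le_trans (lip_bound_ge1 _).
exists (2 * lip_bound M + 4); first by rewrite ltr_wpDl// mulr_ge0.
move=> x y x' y' xr xr'; set D := enorm (polar_point x y - polar_point x' y').
have D0 : 0 <= D by exact: enorm_ge0.
have x1 : x <= 1 by case/andP: xr. have x'1 : x' <= 1 by case/andP: xr'.
have D2 : D <= 2.
  apply: le_trans (enormB _ _) _; rewrite !enorm_polar_point !ger0_norm; [lra|by case/andP: xr'|by case/andP: xr].
pose P := D `^ b; have P0 : 0 <= P by exact: powR_ge0.
have DP : D <= 2 * P by exact: le_self_powR.
have inc m : (M <= m)%N -> enorm (F m.+1 x y - F m x y - (F m.+1 x' y' - F m x' y')) <= 2 * 2^-1 ^+ m * P.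
  move=> Mm; set e := enorm _; have e0 : 0 <= e by exact: enorm_ge0.
  have [_ _ de _] := Zst m; have [_ _ h _] := Znext m.
  have he : e <= budget m.
    apply: le_trans de; rewrite [leRHS]splitr; apply: le_trans (enormB _ _) _.
    by apply: lerD; exact: h.
  have hL : e <= 2 * lip_bound m.+1 * D.
    have -> : e = enorm ((F m.+1 x y - F m.+1 x' y') - (F m x y - F m x' y')).
      by rewrite /e; congr enorm; move: (F _ _ _) (F _ _ _) (F _ _ _) (F _ _ _) => p q r s; apply/rowP => j; rewrite !mxE; ring.
    apply: le_trans (enormB _ _) _; rewrite mulr2n !mulrDl mul1r.
    apply: lerD; first exact: F_lip.
    apply: le_trans (F_lip _ _ _ xr xr') _; rewrite ler_wpM2r//.
    rewrite /lip_bound ler_pM2l// lef_pV2 ?posrE ?tauX_gt0//; exact/ltW/tauX_S.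
  apply: le_trans (powR_interp b01 e0 he hL) _.
  have L1 := lip_bound_ge1 (R := R) m.+1.
  have -> : (2 * lip_bound m.+1 * D) `^ b = (2 * lip_bound m.+1) `^ b * P by rewrite powRM// mulr_ge0.
  rewrite mulrA ler_wpM2r//.
  apply: le_trans (budget_powR b01 (Mb m Mm)); rewrite ler_wpM2l ?powR_ge0//.
  apply: ler1_powR; lra.
(* The Hölder increments [2 * 2^-m], summed from [M] on, contribute at most [4 - 4 * 2^-(n + M)]. *)
have ind n : enorm (F (n + M)%N x y - F (n + M)%N x' y') <= (2 * lip_bound M + 4 - 4 * 2^-1 ^+ (n + M)) * P.
  elim: n => [|n IH].
    rewrite add0n; apply: le_trans (F_lip _ _ _ xr xr') _; rewrite -/D.
    apply: le_trans (ler_wpM2l (L0 M) DP) _; rewrite mulrA ler_wpM2r// mulrC -addrA lerDl subr_ge0.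
    by rewrite ler_piMr// exprn_ile1 ?invr_ge0//; lra.
  have -> : F (n.+1 + M)%N x y - F (n.+1 + M)%N x' y' = (F (n + M)%N x y - F (n + M)%N x' y') +
     (F (n + M).+1 x y - F (n + M)%N x y - (F (n + M).+1 x' y' - F (n + M)%N x' y')).
    by rewrite addSn; move: (F _ _ _) (F _ _ _) (F _ _ _) (F _ _ _) => p q r s; apply/rowP => j; rewrite !mxE; ring.
  apply: le_trans (enormD _ _) _; apply: le_trans (lerD IH (inc _ (leq_addl _ _))) _.
  by rewrite -mulrDl ler_wpM2r// addSn exprS; lra.
have KP : 2 * lip_bound M + 4 >= 0 :> R by rewrite addr_ge0// mulr_ge0.
apply: (vlim_bound (u := fun n => F n x y - F n x' y') (e := fun n => (Z n).2 + (Z n).2) (m := M)).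
- rewrite -[X in _ --> X]addr0; apply: cvgD; exact: (cvg_d Zst Znext).
- move=> n _; have -> : limit_map Z x y - limit_map Z x' y' - (F n x y - F n x' y') = (limit_map Z x y - F n x y) - (limit_map Z x' y' - F n x' y').
    by move: (limit_map _ _ _) (limit_map _ _ _) (F _ _ _) (F _ _ _) => p q r s; apply/rowP => j; rewrite !mxE; ring.
  by apply: le_trans (enormB _ _) _; apply: lerD; exact: (limit_map_F Zst Znext).
move=> n Mn; rewrite -(subnK Mn); apply: le_trans (ind _) _; rewrite ler_wpM2r//.
by rewrite gerBl mulr_ge0// exprn_ge0// invr_ge0.
Qed.

End Holder.

(** * Limit set and Hausdorff dimension *)

Section Circle.
Context {R : realType}.
Variable f : 'rV[R]_2 -> 'rV[R]_3.
Hypothesis hol : forall b : R, 0 < b < 1 -> exists2 K : R, 0 < K & forall p q, closed_disk p -> closed_disk q ->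
  enorm (f p - f q) <= K * enorm (p - q) `^ b.

Definition boundary (t : R) : 'rV[R]_3 := f (polar_point 1 (2 * pi * t)).

Lemma polar_point1_disk (y : R) : closed_disk (polar_point 1 y).
Proof. by rewrite /closed_disk/= enorm_polar_point normr1. Qed.

Lemma polar_point1_dist (a b : R) : enorm (polar_point 1 a - polar_point 1 b) <= 2 * `|a - b|.
Proof.
rewrite -ler_sqr ?nnegrE ?enorm_ge0 ?mulr_ge0// polar_point_dist subrr expr0n add0r !mulr1 exprMn real_normK ?num_real//.
have := cos_ge (a - b); have := sqr_ge0 (a - b); lra.
Qed.

Lemma boundary_holder (b : R) : 0 < b < 1 -> exists2 K : R, 0 < K & forall s t : R,
  enorm (boundary s - boundary t) <= K * `|s - t| `^ b.
Proof.
move=> b01; have [K K0 h] := hol b01.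
exists (K * (4 * pi) `^ b); first by rewrite mulr_gt0// powR_gt0// mulr_gt0// pi_gt0.
move=> s t; apply: le_trans (h _ _ (polar_point1_disk _) (polar_point1_disk _)) _.
rewrite -[leRHS]mulrA ler_pM2l// -powRM ?mulr_ge0 ?pi_ge0//.
apply: ge0_ler_powR; rewrite ?nnegrE ?enorm_ge0 ?mulr_ge0 ?pi_ge0//; first by case/andP: b01 => /ltW.
by apply: le_trans (polar_point1_dist _ _) _; rewrite -mulrBr normrM ger0_norm ?mulr_ge0 ?pi_ge0// mulrA; lra.
Qed.

Lemma half01 : 0 < (1 / 2 : R) < 1. Proof. by lra. Qed.

Lemma near_powR (K e : R) : 0 < K -> 0 < e -> exists2 d : R, 0 < d & forall u : R, 0 <= u -> u < d -> K * u `^ (1 / 2) < e.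
Proof.
move=> K0 e0; have eK : 0 < e / K by rewrite divr_gt0.
exists ((e / K) ^+ 2); first by rewrite exprn_gt0.
move=> u u0 h; rewrite mulrC -ltr_pdivlMr// div1r powR12_sqrt//.
by rewrite -ltr_sqr ?nnegrE ?sqrtr_ge0 ?(ltW eK)// sqr_sqrtr.
Qed.

Lemma boundary_continuous : continuous boundary.
Proof.
move=> t; have [K K0 h] := boundary_holder half01.
apply/(cvg_enorm (nbhs_filter t)) => e e0; have [d d0 hd] := near_powR K0 e0.
exists d => //= s /= hs; apply: le_lt_trans (h _ _) _; exact: hd.
Qed.

Lemma boundary1 : boundary 0 = boundary 1.
Proof.
congr f; apply: rV2P; rewrite !mxE/= mulr0 mulr1 ?cos0 ?sin0 mulr_natl ?cos2pi ?sin2pi//.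
Qed.

Lemma boundary_surj (p : 'rV[R]_2) : enorm p = 1 -> exists2 t : R, 0 <= t <= 1 & p = polar_point 1 (2 * pi * t).
Proof.
move=> p1; have [y Ep] := polar_point_surj p; have [k hk] := angle_reduce y.
have pi2 : 0 < 2 * pi :> R by rewrite mulr_gt0// pi_gt0.
exists ((y + k%:~R * (2 * pi)) / (2 * pi)).
  by case/andP: hk => h1 h2; rewrite divr_ge0 ?(ltW pi2)//= ler_pdivrMr// mul1r.
rewrite mulrC divfK ?gt_eqF// Ep p1; have [pc ps] := @per_cossin R.
by apply: rV2P; rewrite !mxE/= (per_int k 1 y pc, per_int k 1 y ps).
Qed.

Lemma compact_enorm (r : R) : compact [set p : 'rV[R]_2 | enorm p <= r].
Proof.
apply: bounded_closed_compact.
  exists r; split; first exact: num_real.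
  move=> x rx p hp; apply: le_trans (norm_le_enorm p) (le_trans hp (ltW rx)).
move=> p hp; rewrite /= leNgt; apply/negP => h.
have hr : 0 < enorm p - r by rewrite subr_gt0.
have [q [/= q1 q2]] : [set p : 'rV[R]_2 | enorm p <= r] `&` [set q | enorm (p - q) < enorm p - r] !=set0.
  by apply: hp; apply/nbhs_enorm; exists (enorm p - r).
by have := enormD (p - q) q; rewrite subrK; lra.
Qed.

(** The radii [1 - 1 / (n + 2)] are those of the radial sequences that will reach the points of the
    circle. *)
Lemma leave_compact (K : set 'rV[R]_2) : compact K -> K `<=` open_disk ->
  \forall n \near \oo, forall p, K p -> enorm p < 1 - n.+2%:R^-1.
Proof.
move=> /compact_near_coveringP cK Kd.
apply: (cK nat \oo (fun n p => enorm p < 1 - n.+2%:R^-1) _) => p /Kd; rewrite /open_disk/= => p1.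
pose d : R := (1 - enorm p) / 2; have d0 : 0 < d by rewrite divr_gt0 ?subr_gt0.
have hn : \forall n \near \oo, (n.+1%:R^-1 : R) < d.
  have /cvgrPdist_lt/(_ d d0) := @cvg_harmonic R.
  by apply: filterS => n; rewrite sub0r normrN ger0_norm ?invr_ge0.
exists ([set q | enorm (p - q) < d], [set n : nat | (n.+1%:R^-1 : R) < d]) => /=.
  by split => //; apply/nbhs_enorm; exists d.
move=> [q n] /= [hq hn'].
have h2 : (n.+2%:R^-1 : R) <= n.+1%:R^-1 by rewrite lef_pV2 ?posrE// ler_nat.
have := enormD (q - p) p; rewrite subrK enorm_distC => h3.
have num (a b c u v : R) : a <= b + c -> b < (1 - c) / 2 -> v <= u -> u < (1 - c) / 2 -> a < 1 - v by lra.
exact: num h3 hq h2 hn'.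
Qed.

(* Only the Hölder exponent 1/2 is used: the points of the sequence are replaced
   by their radial projections to the unit circle. *)
Lemma limit_setE : limit_set f = boundary @` `[0, 1].
Proof.
have [K K0 h] := hol half01.
apply/seteqP; split => y.
  move=> [p [p1 pK py]].
  have cG : compact (boundary @` `[0, 1]).
    apply: continuous_compact; last exact: segment_compact.
    by apply: continuous_subspaceT; exact: boundary_continuous.
  apply: (compact_closed (@norm_hausdorff _ _) cG) => B /nbhs_enorm[e e0 he].
  have e2 : 0 < e / 2 by rewrite divr_gt0.
  have [d d0 hd] := near_powR K0 e2.
  (* Leaving this closed disk forces [p n] to come within [d] of the circle, hence [f (p n)] close
     to the image of its radial projection. *)
  have H1 := pK _ (@compact_enorm (1 - Num.min d 1)).
  have H2 : [set p : 'rV[R]_2 | enorm p <= 1 - Num.min d 1] `<=` open_disk.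
    move=> q /=; rewrite /open_disk/= => hq; apply: le_lt_trans hq _.
    by rewrite ltrBlDr ltrDl lt_min d0 ltr01.
  have /(cvg_enorm _)/(_ _ e2) H3 := py.
  have [n [/= n1 n2]] := filter_ex (filterI (H1 H2) H3).
  have nd : 1 - enorm (p n) < d.
    have : Num.min d 1 <= d by rewrite ge_min lexx.
    move/negP: n1; rewrite -ltNge; lra.
  have [z Ep] := polar_point_surj (p n).
  have hz : enorm (polar_point 1 z) = 1 by rewrite enorm_polar_point normr1.
  have [t t01 Et] := boundary_surj hz.
  exists (boundary t); split; first by exists t; rewrite //= in_itv.
  apply: he; rewrite /boundary -Et.
  have hp : enorm (f (p n) - f (polar_point 1 z)) < e / 2.
    apply: le_lt_trans (h _ _ (ltW (p1 n)) (polar_point1_disk z)) _; apply: hd; first exact: enorm_ge0.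
    suff -> : enorm (p n - polar_point 1 z) = 1 - enorm (p n) by [].
    rewrite {1}Ep; apply/eqP; rewrite -(eqrXn2 (n := 2)) ?enorm_ge0// ?subr_ge0 ?(ltW (p1 n))//.
    by rewrite polar_point_dist subrr cos0 subrr mulr0 addr0; apply/eqP; ring.
  by have := enormD (y - f (p n)) (f (p n) - f (polar_point 1 z)); rewrite addrA subrK; lra.
move=> [t _ <-].
have nE n : 0 <= 1 - (n.+2%:R^-1 : R) by rewrite subr_ge0 invf_le1// ler1n.
have nE' n : enorm (polar_point (1 - (n.+2%:R^-1 : R)) (2 * pi * t)) = 1 - n.+2%:R^-1 by rewrite enorm_polar_point ger0_norm.
exists (fun n => polar_point (1 - n.+2%:R^-1) (2 * pi * t)); split.
- by move=> n; rewrite /open_disk/= nE' ltrBlDr ltrDl invr_gt0.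
- move=> Q cQ Qd; apply: filterS (leave_compact cQ Qd) => n H /H.
  by rewrite nE' ltxx.
- apply/(cvg_enorm _) => e e0; have [d d0 hd] := near_powR K0 e0.
  have /cvgrPdist_lt/(_ d d0) := @cvg_harmonic R.
  apply: filterS => n; rewrite sub0r normrN ger0_norm ?invr_ge0// => hn.
  have hp : closed_disk (polar_point (1 - (n.+2%:R^-1 : R)) (2 * pi * t)).
    by rewrite /closed_disk/= nE' gerBl invr_ge0.
  apply: le_lt_trans (h _ _ (polar_point1_disk _) hp) _; apply: hd; first exact: enorm_ge0.
  apply: le_lt_trans hn; apply: le_trans (_ : n.+2%:R^-1 <= _).
    rewrite -ler_sqr ?nnegrE ?enorm_ge0 ?invr_ge0// polar_point_dist subrr cos0 subrr mulr0 addr0 subKr//.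
  by rewrite /harmonic lef_pV2 ?posrE// ler_nat.
Qed.

Lemma limit_set_curve : closed_curve (limit_set f).
Proof.
exists boundary; split; [|exact: boundary1|exact: limit_setE].
by apply: continuous_subspaceT; exact: boundary_continuous.
Qed.

End Circle.

(** * Hausdorff dimension of a curve that is Hölder for all exponents below 1 *)

Section HausdorffAux.
Context {R : realType}.
Implicit Types A : set 'rV[R]_3.

Lemma diameter_ge0 A : (0 <= diameter A)%E.
Proof. by apply: ereal_sup_ubound; left. Qed.

Lemma diameter_le A (d : R) : 0 <= d -> (forall x y, A x -> A y -> enorm (x - y) <= d) -> (diameter A <= d%:E)%E.
Proof.
move=> d0 h; apply: ge_ereal_sup => _ [->|[x Ax [y Ay <-]]]; first by rewrite lee_fin.
by rewrite lee_fin h.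
Qed.

Lemma diameter_ub A x y : A x -> A y -> ((enorm (x - y))%:E <= diameter A)%E.
Proof. by move=> Ax Ay; apply: ereal_sup_ubound; right; exists x => //; exists y. Qed.

Lemma diameter0 : diameter (set0 : set 'rV[R]_3) = 0%E.
Proof.
by apply/eqP; rewrite eq_le diameter_ge0 andbT; apply: diameter_le.
Qed.

Lemma premeasure_ge0 s d A : (0 <= hausdorff_premeasure s d A)%E.
Proof.
apply: le_ereal_inf_tmp => _ [U [_ _] <-]; apply: nneseries_ge0 => n _ _; exact: poweR_ge0.
Qed.

(** A finite cover is padded with empty sets, whose diameter is 0. *)
Lemma premeasure_finite s d (e : R) A (U : nat -> set 'rV[R]_3) n : 0 < s -> 0 <= d -> d <= e -> 0 <= e ->
  A `<=` \bigcup_i U i -> (forall i, (i < n)%N -> (diameter (U i) <= d%:E)%E) -> (forall i, (n <= i)%N -> U i = set0) ->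
  (hausdorff_premeasure s e A <= (n%:R * d `^ s)%:E)%E.
Proof.
move=> s0 d0 de e0 AU Ud U0.
have Ui i : (diameter (U i) <= d%:E)%E.
  by have [/Ud//|/U0 ->] := ltnP i n; rewrite diameter0 lee_fin.
apply: le_trans (_ : _ <= \sum_(0 <= i <oo) poweR (diameter (U i)) s)%E _.
  apply: ereal_inf_lbound; exists U => //; split=> // i; apply: le_trans (Ui i) _; by rewrite lee_fin.
rewrite (@nneseries_split _ _ 0 n)/=; last by move=> k _; exact: poweR_ge0.
rewrite add0n [X in (_ + X)%E]eseries0 ?adde0; last first.
  by move=> k nk _; rewrite U0// diameter0 poweR0r// gt_eqF.
apply: le_trans (_ : _ <= \sum_(0 <= i < n) (d `^ s)%:E)%E _.
  apply: lee_sum => i _; rewrite -poweR_EFin; apply: gt0_ler_poweR; rewrite ?(ltW s0)// in_itv/= leey andbT ?diameter_ge0//.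
by rewrite sumEFin sumr_const_nat subn0 lee_fin mulr_natl.
Qed.

Lemma inv_powR_small (c y : R) : 0 < c -> 0 < y -> exists n, n.+1%:R `^ (- c) <= y.
Proof.
move=> c0 y0; pose z : R := (y^-1) `^ c^-1; exists (Num.bound z).
have z0 : 0 <= z by exact: powR_ge0.
have hz : z <= (Num.bound z).+1%:R.
  by apply: ltW; apply: lt_trans (archi_boundP z0) _; rewrite ltr_nat.
rewrite powRN -[leRHS]invrK lef_pV2 ?posrE ?invr_gt0 ?powR_gt0//.
have -> : y^-1 = z `^ c by rewrite /z -powRrM mulVf ?gt_eqF// powRr1// invr_ge0 ltW.
by apply: ge0_ler_powR; rewrite ?nnegrE// ltW.
Qed.

Variable c : R -> 'rV[R]_3.
Hypothesis ch : forall b : R, 0 < b < 1 -> exists2 K : R, 0 < K & forall s t : R, enorm (c s - c t) <= K * `|s - t| `^ b.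
Let G := c @` `[0, 1].

Lemma arc_cover n : G `<=` \bigcup_i (if (i < n.+1)%N then c @` `[i%:R / n.+1%:R, i.+1%:R / n.+1%:R] else set0).
Proof.
move=> _ [t ht <-]; move: ht => /=; rewrite ?in_itv/= => /andP[t0 t1].
have n0 : 0 < n.+1%:R :> R by rewrite ltr0n.
(* The minimum with [n] puts [t = 1] in the last arc. *)
pose i := minn (Num.truncn (t * n.+1%:R)) n.
have tn : 0 <= t * n.+1%:R by rewrite mulr_ge0.
have /andP[h1 h2] := truncn_itv tn.
exists i => //; have -> : (i < n.+1)%N by rewrite ltnS geq_minr.
exists t => //=; rewrite in_itv/= ler_pdivrMr// ler_pdivlMr//; apply/andP; split.
  by apply: le_trans h1; rewrite ler_nat geq_minl.
rewrite /i /minn; case: ifP => _; first exact: ltW.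
by rewrite -[leRHS]mul1r ler_wpM2r// ltW.
Qed.

(** The exponent [b] is taken between [1 / s] and 1, so that [b s > 1]: the cover by [n + 1] arcs of
    diameter at most [K (n + 1)^-b] has [s]-sum at most [K^s (n + 1)^(1 - b s)]. *)
Lemma hausdorff_measure_gt1 s : 1 < s -> hausdorff_measure s G = 0%E.
Proof.
move=> s1; have s0 : 0 < s by lra.
apply/eqP; rewrite eq_le; apply/andP; split; last first.
  apply: le_trans (premeasure_ge0 s 1 G) _; apply: ereal_sup_ubound; exists 1 => //=.
apply: ge_ereal_sup => _ [d /= d0 <-].
apply/lee_addgt0Pr => e e0; rewrite add0e.
pose b : R := (1 + s^-1) / 2.
have sV : 0 < s^-1 < 1 by rewrite invr_gt0 s0 invf_lt1.
have b01 : 0 < b < 1 by rewrite /b; lra.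
have bs : b * s = (s + 1) / 2 by rewrite /b; field; rewrite gt_eqF.
have [K K0 h] := ch b01.
have [n1 h1] := @inv_powR_small b (d / K) (proj1 (andP b01)) (divr_gt0 d0 K0).
have sb : 0 < (s - 1) / 2 by lra.
have [n2 h2] := @inv_powR_small _ (e / K `^ s) sb (divr_gt0 e0 (powR_gt0 s K0)).
pose n := maxn n1 n2.
have mono (a : R) m : 0 < a -> (m <= n)%N -> n.+1%:R `^ (- a) <= m.+1%:R `^ (- a).
  move=> a0 mn; rewrite !powRN lef_pV2 ?posrE ?powR_gt0//.
  by apply: ge0_ler_powR; rewrite ?nnegrE ?(ltW a0)// ler_nat.
pose D : R := K * n.+1%:R `^ (- b).
have D0 : 0 <= D by rewrite mulr_ge0 ?powR_ge0 ?ltW.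
have Dd : D <= d.
  rewrite /D mulrC -ler_pdivlMr//; apply: le_trans h1; apply: mono; last exact: leq_maxl.
  by case/andP: b01.
have n0 : 0 < n.+1%:R :> R by rewrite ltr0n.
apply: le_trans (@premeasure_finite s D d G _ n.+1 s0 D0 Dd (ltW d0) (@arc_cover n) _ _) _.
- move=> i ->; apply: diameter_le => // _ _ [x hx <-] [y hy <-]; move: hx hy => /=; rewrite ?in_itv/= => hx hy.
  apply: le_trans (h _ _) _; rewrite /D ler_pM2l//.
  have -> : n.+1%:R `^ (- b) = n.+1%:R^-1 `^ b by rewrite -powR_inv1 ?(ltW n0)// -powRrM mulN1r.
  apply: ge0_ler_powR; rewrite ?nnegrE ?invr_ge0 ?(ltW n0)//; first by case/andP: b01 => /ltW.
  have E : i.+1%:R / n.+1%:R = i%:R / n.+1%:R + n.+1%:R^-1 :> R by rewrite -natr1 mulrDl mul1r.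
  rewrite E in hx hy; move: hx hy; move: (i%:R / n.+1%:R : R) (n.+1%:R^-1 : R) => u v.
  by rewrite ler_norml => /andP[? ?] /andP[? ?]; apply/andP; split; lra.
- by move=> i; rewrite leqNgt => /negbTE ->.
rewrite lee_fin /D powRM ?powR_ge0 ?(ltW K0)// -powRrM mulNr bs mulrCA -ler_pdivlMl ?powR_gt0//.
rewrite [leRHS]mulrC; apply: le_trans h2; apply: le_trans (mono _ _ sb (leq_maxr n1 n2)).
rewrite -{1}[n.+1%:R]powRr1 ?(ltW n0)// -powRD; last by rewrite (gt_eqF n0) implybT.
by rewrite (_ : 1 + - ((s + 1) / 2) = - ((s - 1) / 2))//; field.
Qed.

Lemma continuous_c : continuous c.
Proof.
move=> t; have [K K0 h] := ch (half01 (R := R)).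
apply/(cvg_enorm (nbhs_filter t)) => e e0; have [d d0 hd] := near_powR K0 e0.
exists d => //= s /= hs; apply: le_lt_trans (h _ _) _; exact: hd.
Qed.

(* A coordinate of the curve takes all values between two of its values, so that
   the projections of a cover have total length at least their difference. *)
Lemma projection_cover (U : nat -> set 'rV[R]_3) j (a b : R) : 0 <= a <= 1 -> 0 <= b <= 1 -> c a 0 j < c b 0 j ->
  G `<=` \bigcup_i U i -> (forall i, (diameter (U i) <= 1)%E) ->
  ((c b 0 j - c a 0 j)%:E <= \sum_(0 <= i <oo) 2%:E * diameter (U i))%E.
Proof.
move=> a01 b01 ab GU Ud.
pose d i : R := fine (diameter (U i)).
have dE i : diameter (U i) = (d i)%:E.
  by rewrite /d fineK// ge0_fin_numE ?diameter_ge0//; apply: le_lt_trans (Ud i) _; rewrite ltry.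
have d0 i : 0 <= d i by rewrite -lee_fin -dE diameter_ge0.
pose z i : R := xget 0 (U i) 0 j.
pose V : nat -> set R := fun i => [set x | z i - d i <= x <= z i + d i].
have VE i : V i = `[z i - d i, z i + d i]%classic by apply/seteqP; split=> x; rewrite /V/= in_itv.
have VU i x : U i x -> V i (x 0 j).
  move=> Ux; rewrite /V /=.
  have Uz : U i (xget 0 (U i)) by apply: xgetPex; exists x.
  have := diameter_ub Ux Uz; rewrite dE lee_fin; move: (enorm_coord (x - xget 0 (U i)) j).
  rewrite !mxE -/(z i) => h1 h2; have := le_trans h1 h2; rewrite ler_norml => /andP[? ?].
  by apply/andP; split; lra.
have cover : `[c a 0 j, c b 0 j] `<=` \bigcup_i V i.
  move=> v /=; rewrite in_itv/= => /andP[v1 v2].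
  have cj : continuous (fun t => c t 0 j).
    by move=> t; apply: (@continuous_comp _ _ _ c (fun M : 'rV[R]_3 => M 0 j)); [exact: continuous_c|exact: coord_continuous].
  have [t [t01 Et]] : exists t, 0 <= t <= 1 /\ c t 0 j = v.
    have [le|/ltW le] := leP a b.
      have [||t + <-] := @IVT R (fun t => c t 0 j) a b v le.
      - exact: continuous_subspaceT.
      - by rewrite ge_min v1 le_max v2 orbT.
      rewrite in_itv/= => /andP[? ?]; exists t; split=> //.
      by move: a01 b01 => /andP[? ?] /andP[? ?]; apply/andP; split; lra.
    have [||t + <-] := @IVT R (fun t => c t 0 j) b a v le.
    - exact: continuous_subspaceT.
    - by rewrite ge_min v1 le_max v2 !orbT.
    rewrite in_itv/= => /andP[? ?]; exists t; split=> //.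
    by move: a01 b01 => /andP[? ?] /andP[? ?]; apply/andP; split; lra.
  have [|i _ hi] := GU (c t); first by exists t => //=; rewrite ?in_itv.
  by exists i => //; rewrite -Et; exact: VU.
have L (u v : R) : u <= v -> lebesgue_measure (`[u, v]%classic : set R) = (v - u)%:E.
  rewrite le_eqVlt lebesgue_measure_itv/= lte_fin => /predU1P[->|->]; last by rewrite EFinB.
  by rewrite ltxx subrr.
have mV i : measurable (V i) by rewrite VE; exact: measurable_itv.
have h := @measure_sigma_subadditive _ R _ lebesgue_measure _ V mV (measurable_itv _) cover.
rewrite -(L _ _ (ltW ab)).
apply: le_trans h _; apply: lee_nneseries => [i _ _|i _]; first exact: measure_ge0.
have zd : z i - d i <= z i + d i by have := d0 i; lra.
apply: (@le_trans _ _ (z i + d i - (z i - d i))%:E).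
  rewrite le_eqVlt; apply/orP; left; apply/eqP; rewrite VE; exact: L.
by rewrite dE -EFinM lee_fin; lra.
Qed.

(** For [s < 1] and diameters at most 1, [d <= d^s]. A cover of small [s]-sum would thus have a
    total diameter too small for [projection_cover], applied to a coordinate along which the curve
    is not constant. *)
Lemma hausdorff_measure_lt1 s a b : 0 < s -> 0 <= a <= 1 -> 0 <= b <= 1 -> c a <> c b -> hausdorff_measure s G = 0%E -> 1 <= s.
Proof.
move=> s0 a01 b01 cab m0; have [//|s1] := leP 1 s; exfalso.
have [j [a' [b' [ha hb hj]]]] : exists j a' b', [/\ 0 <= a' <= 1, 0 <= b' <= 1 & c a' 0 j < c b' 0 j].
  have : exists j, c a 0 j != c b 0 j.
    apply/existsP; apply: contra_notT cab; rewrite negb_exists => /forallP h.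
    by apply/rowP => j; have /negbNE/eqP := h j.
  move=> [j]; rewrite neq_lt => /orP[h|h]; [by exists j, a, b|by exists j, b, a].
pose e : R := (c b' 0 j - c a' 0 j) / 2; have e0 : 0 < e by rewrite divr_gt0 ?subr_gt0.
have : (hausdorff_premeasure s 1 G <= hausdorff_measure s G)%E by apply: ereal_sup_ubound; exists 1 => //=.
rewrite m0 => p0.
have /ereal_inf_lt[_ [U [GU Ud] <-]] : (hausdorff_premeasure s 1 G < e%:E)%E by apply: le_lt_trans p0 _; rewrite lte_fin.
apply/negP; rewrite -leNgt.
have E : (c b' 0 j - c a' 0 j)%:E = (2%:E * e%:E)%E by rewrite -EFinM /e mulrC divfK.
have := projection_cover ha hb hj GU Ud; rewrite E nneseriesZl; last by move=> i _; exact: diameter_ge0.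
rewrite lee_pmul2l// ?lte_fin// => h; apply: le_trans h _.
apply: lee_nneseries => [i _ _|i _]; first exact: diameter_ge0.
have := Ud i; have := diameter_ge0 (U i); case: (diameter (U i)) => [x| |]//=; rewrite ?poweR_EFin ?lee_fin.
move=> x0 x1; have [->|xn] := eqVneq x 0; first by rewrite powR0 ?gt_eqF.
by rewrite -[leLHS]powRr1// ger_powR ?(ltW s1)// x1 andbT lt_neqAle eq_sym xn.
Qed.

Lemma hausdorff_dim1 a b : 0 <= a <= 1 -> 0 <= b <= 1 -> c a <> c b -> hausdorff_dim G = 1%:E.
Proof.
move=> a01 b01 cab; apply/eqP; rewrite eq_le; apply/andP; split.
  apply/lee_addgt0Pr => e e0; apply: ereal_inf_lbound; exists (1 + e); last by rewrite EFinD.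
  by split; [lra|apply: hausdorff_measure_gt1; rewrite ltrDl].
apply: le_ereal_inf_tmp => _ [s [s0 h] <-]; rewrite lee_fin; exact: hausdorff_measure_lt1 a01 b01 cab h.
Qed.

End HausdorffAux.

Section LimitSet.
Context {R : realType}.
Variable f : 'rV[R]_2 -> 'rV[R]_3.
Hypothesis hol : forall b : R, 0 < b < 1 -> exists2 K : R, 0 < K & forall p q, closed_disk p -> closed_disk q ->
  enorm (f p - f q) <= K * enorm (p - q) `^ b.
Hypothesis finj : forall p q, closed_disk p -> closed_disk q -> f p = f q -> p = q.

(** The curve is not constant, since the boundary points of parameters 0 and [1 / 2] are antipodal
    and have distinct images. *)
Lemma limit_set_dim1 : hausdorff_dim (limit_set f) = 1%:E.
Proof.
rewrite (limit_setE hol); apply: (hausdorff_dim1 (boundary_holder hol) (a := 0) (b := 1 / 2)); [lra|lra|].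
move=> /(finj (polar_point1_disk _) (polar_point1_disk _)) /rowP/(_ 0); rewrite !mxE/= mulr0 cos0.
have -> : 2 * pi * (1 / 2) = pi :> R by rewrite mulrC mulrA div1r mulVf ?mul1r.
by rewrite cospi; lra.
Qed.

End LimitSet.

(** * The corrugation process on the annulus *)

Section StripCalculus.
Context {R : realType} {V : normedModType R} {T : finType}.
Variables (rho0 : R) (I : set R) (e : T -> V).
Hypotheses (rho1 : rho0 < 1) (oI : open I) (SI : forall x, rho0 <= x <= 1 -> I x).
Implicit Types (G : T -> R -> R -> R) (p : 'rV[R]_2).

(* Treats at once the maps with values in R, R^3 and the symmetric matrices. *)
Definition expand G p : V := \sum_j G j (p 0 0) (p 0 1) *: e j.

Lemma cvg_sumr (U : Type) (F : set_system U) (FF : Filter F) (r : seq T) (f : T -> U -> V) (l : T -> V) :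
  (forall j, f j x @[x --> F] --> l j) -> \sum_(j <- r) f j x @[x --> F] --> \sum_(j <- r) l j.
Proof.
move=> h; elim: r => [|j r IH]; first by rewrite big_nil; under eq_fun do rewrite big_nil; exact: cvg_cst.
by rewrite big_cons; under eq_fun do rewrite big_cons; exact: cvgD.
Qed.

Lemma expand_continuous G : (forall j, smooth I (G j)) -> {within strip rho0, continuous (expand G)}.
Proof.
move=> sG; apply/subspace_continuousP => p sp; apply: cvg_within_filter.
apply: cvg_sumr => j; apply: cvgZr_tmp.
apply: (@cvg_comp _ _ _ (fun q : 'rV[R]_2 => (q 0 0, q 0 1)) (fun z : R * R => G j z.1 z.2) _ (nbhs (p 0 0, p 0 1))).
  by apply: (@cvg_pair _ _ _ (nbhs p) (nbhs (p 0 0)) (nbhs (p 0 1)) _ _ _ (fun q : 'rV[R]_2 => q 0 0) (fun q : 'rV[R]_2 => q 0 1)); exact: coord_continuous.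
exact: (smooth_jcont (sG j) (SI sp)).
Qed.

Definition partials (i : 'I_2) (g : R -> R -> R) := if i == 0 then dx g else dy g.

Lemma smooth_partials i (g : R -> R -> R) : smooth I g -> smooth I (partials i g).
Proof. by rewrite /partials => sigma; case: ifP => _; [exact: smooth_dx|exact: smooth_dy]. Qed.

Lemma is_derive_cvg (u : R -> R) (x d : R) : is_derive x (1 : R) u d ->
  h^-1 * (u (x + h) - u x) @[h --> 0^'] --> d.
Proof.
move=> [ex <-]; have := ex; rewrite /derivable => /cvg_ex[l hl]; rewrite /derive (cvg_lim _ hl)//.
by apply: cvg_trans hl; apply: near_eq_cvg; near=> h; rewrite /= [_%:A]mulr1 [h + x]addrC.
Unshelve. all: by end_near.
Qed.

(** On the boundary the increments have a constrained sign. As the strip has positive width,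
    arbitrarily small ones exist, which gives the uniqueness of the limit defining [partial]. *)
Lemma strip_proper i p : strip rho0 p ->
  ProperFilter (within [set h : R | strip rho0 (p + h *: delta_mx 0 i)] (0 : R)^').
Proof.
move=> /andP[p0 p1]; apply: Build_ProperFilter => P.
move: P; rewrite /within/= => -[d /= d0 hd].
have [h [h0 hd' hs]] : exists h : R, [/\ h != 0, `|h| < d & strip rho0 (p + h *: delta_mx 0 i)].
  have E (h : R) : (p + h *: delta_mx 0 i) 0 0 = p 0 0 + h * (0 == i)%:R by rewrite !mxE.
  pose s : R := Num.min (d / 2) ((1 - rho0) / 2).
  have s0 : 0 < s by rewrite lt_min !divr_gt0 ?subr_gt0.
  have s1 : s <= d / 2 by rewrite ge_min lexx.
  have s2 : s <= (1 - rho0) / 2 by rewrite ge_min lexx orbT.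
  have b : 0 <= ((0 == i)%:R : R) <= 1 by case: (0 == i); rewrite ?ler01 lexx.
  have sb : 0 <= s * (0 == i)%:R <= s by apply/andP; split; [rewrite mulr_ge0 ?(ltW s0)|rewrite ler_piMr ?(ltW s0)//]; lra.
  have [hp|hp] := leP (p 0 0) ((1 + rho0) / 2).
    exists s; split; [by rewrite gt_eqF|by rewrite gtr0_norm//; lra|].
    by rewrite /strip/= E; apply/andP; split; lra.
  exists (- s); split; [by rewrite oppr_eq0 gt_eqF|by rewrite normrN gtr0_norm//; lra|].
  by rewrite /strip/= E mulNr; apply/andP; split; lra.
by apply: (hd h _ h0 hs); rewrite /ball_/= sub0r normrN.
Qed.

(** The coefficients are smooth on a neighbourhood of the strip, so that the restricted difference
    quotients converge as the unrestricted ones do. *)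
Lemma expand_quotient G i p : (forall j, smooth I (G j)) -> strip rho0 p ->
  partial_quotient rho0 (expand G) i p --> expand (fun j => partials i (G j)) p.
Proof.
move=> sG sp; apply: cvg_within_filter.
have -> : (fun h : R => h^-1 *: (expand G (p + h *: delta_mx 0 i) - expand G p)) =
    fun h => \sum_j (h^-1 * (G j ((p + h *: delta_mx 0 i) 0 0) ((p + h *: delta_mx 0 i) 0 1) - G j (p 0 0) (p 0 1))) *: e j.
  apply/funext => h; rewrite /expand -sumrB scaler_sumr; apply: eq_bigr => j _.
  by rewrite -scalerBl scalerA.
apply: cvg_sumr => j; apply: cvgZr_tmp; rewrite /partials.
have E a b (h : R) : (p + h *: delta_mx 0 a) 0 b = p 0 b + h * (b == a)%:R by rewrite !mxE eqxx.
case: ifP => [/eqP -> | i1].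
  under eq_fun do rewrite !E eqxx/= mulr1 mulr0 addr0.
  exact: (is_derive_cvg (smooth_dxP (p 0 1) (sG j) (SI sp))).
have -> : i = 1 by apply/val_inj; case: i i1 {E} => [[|[|]]].
under eq_fun do rewrite !E eqxx/= mulr1 mulr0 addr0.
exact: (is_derive_cvg (smooth_dyP (p 0 1) (sG j) (SI sp))).
Qed.

Lemma partial_expand G i p : (forall j, smooth I (G j)) -> strip rho0 p ->
  partial rho0 (expand G) i p = expand (fun j => partials i (G j)) p.
Proof.
move=> sG sp; have PF := strip_proper i sp.
have := @expand_quotient G i p sG sp; rewrite /partial /partial_quotient => h.
apply: cvg_lim; [exact: norm_hausdorff|exact: h].
Qed.

End StripCalculus.

(** * Smoothness on the annulus *)

Section StripExtension.
Context {R : realType} {V : normedModType R}.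
Variable rho0 : R.
Implicit Types f g : 'rV[R]_2 -> V.

Lemma partial_quotient_ext f g i p : (forall q, strip rho0 q -> f q = g q) -> strip rho0 p ->
  partial_quotient rho0 f i p `=>` partial_quotient rho0 g i p.
Proof.
move=> fg sp; apply: near_eq_cvg; rewrite near_withinE; apply: nearW => h /= sh.
by rewrite !fg.
Qed.

Lemma partial_ext f g i p : (forall q, strip rho0 q -> f q = g q) -> strip rho0 p ->
  partial rho0 f i p = partial rho0 g i p.
Proof.
move=> fg sp; rewrite /partial; congr lim; apply/seteqP; split.
  by apply: partial_quotient_ext => // q /fg.
exact: partial_quotient_ext.
Qed.

Lemma within_ext f g : (forall q, strip rho0 q -> f q = g q) ->
  {within strip rho0, continuous f} -> {within strip rho0, continuous g}.
Proof.
move=> fg fc; apply/subspace_continuousP => x sx.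
have h : f @ within (strip rho0) (nbhs x) --> g x by rewrite -(fg x sx); exact: ((subspace_continuousP _ _).1 fc x sx).
apply: cvg_trans h; apply: near_eq_cvg; rewrite near_withinE; apply: nearW => y sy; by rewrite fg.
Qed.

(** The formulas for partial derivatives hold on the strip only, whereas [Ck_strip] speaks of
    functions on the plane. *)
Lemma Ck_strip_ext k f g : (forall q, strip rho0 q -> f q = g q) -> Ck_strip rho0 k f -> Ck_strip rho0 k g.
Proof.
elim: k f g => [|k IH] f g fg [fc fk].
  by split=> //; exact: within_ext fc.
split=> [|i]; first exact: within_ext fc.
 have [h1 h2] := fk i; split.
  move=> p sp; have [l hl] := (cvg_ex _).1 (h1 p sp); apply/cvg_ex; exists l.
  by apply: cvg_trans hl; apply: partial_quotient_ext => // q /fg.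
by apply: IH h2 => p sp; exact: partial_ext.
Qed.

Lemma strip_period p : strip rho0 p -> strip rho0 (p + (2 * pi) *: delta_mx 0 1).
Proof. by rewrite /strip/= !mxE/= mulr0 addr0. Qed.

Lemma smooth_on_annulus_ext f g : (forall q, strip rho0 q -> f q = g q) ->
  smooth_on_annulus rho0 f -> smooth_on_annulus rho0 g.
Proof.
move=> fg [pf sf]; split; last by move=> k; exact: Ck_strip_ext (sf k).
by move=> p sp; rewrite -!fg ?pf//; exact: strip_period.
Qed.

(** The partial derivatives of an expansion are again expansions, which drives the induction on the
    order. *)
Lemma smooth_expand (T : finType) (I : set R) (e : T -> V) (G : T -> R -> R -> R) : rho0 < 1 -> open I ->
  (forall x, rho0 <= x <= 1 -> I x) -> (forall j, smooth I (G j)) -> (forall j, per (G j)) ->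
  smooth_on_annulus rho0 (expand e G).
Proof.
move=> rho1 oI SI sG pG; split.
  move=> p sp; apply: eq_bigr => j _; rewrite -[in RHS](pG j) !mxE/= mulr0 addr0 mulr1//.
move=> k; elim: k G sG {pG} => [|k IH] G sG.
all: have gc : {within strip rho0, continuous (expand e G)} by exact: (@expand_continuous R V T rho0 I e SI G sG).
- by split.
split=> // i; split.
  by move=> p sp; apply/cvg_ex; exists (expand e (fun j => partials i (G j)) p); exact: (@expand_quotient R V T rho0 I e SI G i p sG sp).
apply: (@Ck_strip_ext k (expand e (fun j => partials i (G j)))).
  by move=> q sq; rewrite (partial_expand e rho1 SI).
by apply: IH => j; exact: smooth_partials.
Qed.

End StripExtension.

(** * The maps of the construction viewed on the annulus *)

Section Lift.
Context {R : realType}.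
Implicit Types (f : R -> R -> 'rV[R]_3) (p v w : 'rV[R]_2).

Definition annulus_map f p := f (p 0 0) (p 0 1).
(** With this inner radius, the annulus avoids the transition zones of all cutoffs, which end before
    [2 core_radius k.+2 <= 1 / 50]. *)
Definition rho_half : R := 1 / 2.

Lemma strip_stage_domain m (x : R) : rho_half <= x <= 1 -> stage_domain m x.
Proof. by rewrite /rho_half /stage_domain/= => h; have := @outer_radius_gt1 R m; lra. Qed.

Lemma annulus_map_expand f : annulus_map f = expand (fun j => delta_mx 0 j : 'rV[R]_3) (fun j x y => f x y 0 j).
Proof. by apply/funext => p; rewrite /expand/= [LHS]matrix_sum_delta big_ord1. Qed.

Lemma smooth_lift m f : vsmooth (stage_domain m) f -> per f -> smooth_on_annulus rho_half (annulus_map f).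
Proof.
move=> sf pf; rewrite annulus_map_expand; apply: (smooth_expand _ _ (@open_stage_domain R m) (@strip_stage_domain m)) => //.
  by rewrite /rho_half; lra.
by move=> j x y; rewrite pf.
Qed.

Lemma jac_lift m f p i : vsmooth (stage_domain m) f -> strip rho_half p ->
  row i (jac rho_half (annulus_map f) p) = if i == 0 then vdx f (p 0 0) (p 0 1) else vdy f (p 0 0) (p 0 1).
Proof.
move=> sf sp; rewrite rowK annulus_map_expand (partial_expand _ _ (@strip_stage_domain m))//; last by rewrite /rho_half; lra.
rewrite /partials; case: ifP => _; by rewrite [RHS]matrix_sum_delta big_ord1; apply: eq_bigr => j _; rewrite mxE.
Qed.

Lemma df_lift m f p v : vsmooth (stage_domain m) f -> strip rho_half p ->
  df rho_half (annulus_map f) p v = v 0 0 *: vdx f (p 0 0) (p 0 1) + v 0 1 *: vdy f (p 0 0) (p 0 1).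
Proof.
move=> sf sp; rewrite /df mulmx_sum_row big_ord_recl big_ord1 !(jac_lift _ sf sp)//=.
by congr (_ *: _ + _ *: _); congr (v 0 _); exact/val_inj.
Qed.

Lemma pullback_lift m f p i k : vsmooth (stage_domain m) f -> strip rho_half p ->
  let r (i : 'I_2) := if i == 0 then vdx f (p 0 0) (p 0 1) else vdy f (p 0 0) (p 0 1) in
  pullback rho_half (annulus_map f) p i k = dot (r i) (r k).
Proof.
move=> sf sp r; rewrite /r -!(jac_lift _ sf sp) /pullback mxE; by apply: eq_bigr => j _; rewrite !mxE.
Qed.

(** Cramer's rule for the Gram matrix: each coordinate of a vector of the kernel is killed by the
    Gram determinant. *)
Lemma immersion_lift m f : vsmooth (stage_domain m) f -> (forall x y, stage_domain m x -> 0 < gram f x y) ->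
  immersion rho_half (annulus_map f).
Proof.
move=> sf g0 p sp v; rewrite (df_lift _ sf sp); have := g0 _ (p 0 1) (strip_stage_domain m sp); rewrite /gram.
move: (vdx f _ _) (vdy f _ _) => X Y g E.
have [u0 w0] : v 0 0 = 0 /\ v 0 1 = 0; last by apply: rV2P; rewrite !mxE.
have eX : dot (v 0 0 *: X + v 0 1 *: Y) X = 0 by rewrite E -[0](scale0r X) dotZl mul0r.
have eY : dot (v 0 0 *: X + v 0 1 *: Y) Y = 0 by rewrite E -[0](scale0r Y) dotZl mul0r.
move: eX eY g; rewrite !dotDl !dotZl (dotC Y X); move: (v 0 0) (v 0 1) (dot X X) (dot X Y) (dot Y Y) => a b E' F G e1 e2 g.
have ha : a * (E' * G - F ^+ 2) = 0.
  by rewrite (_ : _ * _ = G * (a * E' + b * F) - F * (a * F + b * G)); [rewrite e1 e2 !mulr0 subr0|ring].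
have hb : b * (E' * G - F ^+ 2) = 0.
  by rewrite (_ : _ * _ = E' * (a * F + b * G) - F * (a * E' + b * F)); [rewrite e1 e2 !mulr0 subr0|ring].
by split; [move/eqP: ha|move/eqP: hb]; rewrite mulf_eq0 (gt_eqF g) orbF => /eqP.
Qed.

End Lift.

(** * The phases as linear forms and their dual basis *)

Section Forms.
Context {R : realType}.
Implicit Types (a b : R) (S : 'M[R]_2).

Definition linear_form a b (v : 'rV[R]_2) : R := a * v 0 0 + b * v 0 1.

Lemma linear_form_is_scalar a b : scalar (linear_form a b).
Proof. by move=> k u v; rewrite /linear_form !mxE /=; ring. Qed.

HB.instance Definition _ a b := GRing.isLinear.Build R 'rV[R]_2 R *%R (linear_form a b) (linear_form_is_scalar a b).

Definition forms (i : 'I_3) : {scalar 'rV[R]_2} := linear_form (form_rho i) (form_phi i).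

Lemma form_squareE i (j k : 'I_2) : form_square (forms i) j k =
  (if j == 0 then form_rho i else form_phi i) * (if k == 0 then form_rho i else form_phi i).
Proof.
have E (l : 'I_2) : forms i (delta_mx 0 l) = if l == 0 then form_rho i else form_phi i.
  rewrite /forms/= /linear_form !mxE eqxx/=.
  by case: l => [[|[|]]]//= _; rewrite ?mulr0 ?mulr1 ?addr0 ?add0r.
by rewrite mxE !E.
Qed.

Lemma form_squares_nth (i : 'I_3) : (form_squares forms)`_i = form_square (forms i).
Proof. by rewrite -tnth_nth tnth_mktuple. Qed.

Lemma dual_form_big j (r : seq 'I_3) (k A B C : 'I_3 -> R) :
  dual_form j (\sum_(i <- r) k i * A i) (\sum_(i <- r) k i * B i) (\sum_(i <- r) k i * C i) =
  \sum_(i <- r) k i * dual_form j (A i) (B i) (C i).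
Proof.
elim: r => [|i r IH]; last by rewrite !big_cons dual_formD dual_formZ IH.
by rewrite !big_nil; case: j => [|[|j]] /=; ring.
Qed.

Lemma dual_form_sum_forms j (k : 'I_3 -> R) : let S := \sum_i k i *: (form_squares forms)`_i in
  dual_form (j : 'I_3) (S 0 0) (S 0 1) (S 1 1) = k j.
Proof.
move=> S; have E (a b : 'I_2) : S a b = \sum_i k i * ((if a == 0 then form_rho i else form_phi i) * (if b == 0 then form_rho i else form_phi i)).
  by rewrite /S summxE; apply: eq_bigr => i _; rewrite mxE form_squares_nth form_squareE.
rewrite !E dual_form_big (bigD1 j)//= -!expr2 dual_form_form// eqxx mulr1 big1 ?addr0// => i ij.
by rewrite -!expr2 dual_form_form// (_ : (nat_of_ord i == j) = false) ?mulr0//; exact/negbTE.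
Qed.

(** The dual forms read off the coefficients of a combination of the squares. *)
Lemma free_forms : free (form_squares forms).
Proof.
apply/freeP => k k0 i; rewrite -(dual_form_sum_forms i k) k0 !mxE.
by case: i => [[|[|[|]]]]//= _; rewrite ?mul0r ?mulr0 ?addr0 ?subr0 ?mulr0.
Qed.

Lemma dual_form_decomposition (E F G : R) :
  [/\ E = dual_form 0 E F G * (form_rho 0 * form_rho 0) + (dual_form 1 E F G * (form_rho 1 * form_rho 1) + dual_form 2 E F G * (form_rho 2 * form_rho 2)),
      F = dual_form 0 E F G * (form_rho 0 * form_phi 0) + (dual_form 1 E F G * (form_rho 1 * form_phi 1) + dual_form 2 E F G * (form_rho 2 * form_phi 2)),
      F = dual_form 0 E F G * (form_phi 0 * form_rho 0) + (dual_form 1 E F G * (form_phi 1 * form_rho 1) + dual_form 2 E F G * (form_phi 2 * form_rho 2)) &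
      G = dual_form 0 E F G * (form_phi 0 * form_phi 0) + (dual_form 1 E F G * (form_phi 1 * form_phi 1) + dual_form 2 E F G * (form_phi 2 * form_phi 2))].
Proof. by rewrite /dual_form /form_rho /form_phi; move: (pi : R) (@pi_neq0 R) => p p0; split; field. Qed.

Lemma symmetric_decomposition S : S^T = S ->
  S = \sum_i dual_form (i : 'I_3) (S 0 0) (S 0 1) (S 1 1) *: (form_squares forms)`_i.
Proof.
move=> sym; have S10 : S 1 0 = S 0 1 by rewrite -[in RHS]sym mxE.
have [hE hF hF' hG] := dual_form_decomposition (S 0 0) (S 0 1) (S 1 1).
apply/matrixP => a b.
have -> : (\sum_i dual_form (i : 'I_3) (S 0 0) (S 0 1) (S 1 1) *: (form_squares forms)`_i) a b =
  \sum_(i < 3) dual_form i (S 0 0) (S 0 1) (S 1 1) * ((if a == 0 then form_rho i else form_phi i) * (if b == 0 then form_rho i else form_phi i)).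
  by rewrite summxE; apply: eq_bigr => i _; rewrite mxE form_squares_nth form_squareE.
rewrite !big_ord_recl big_ord0 addr0.
have i01 (i : 'I_2) : i = 0 \/ i = 1 by case: i => [[|[|]]]//= ?; [left|right]; exact/val_inj.
case: (i01 a) => ->; case: (i01 b) => ->; rewrite ?S10; [exact: hE|exact: hF|exact: hF'|exact: hG].
Qed.

Lemma coord_forms (i : 'I_3) S : S^T = S -> coord (form_squares forms) i S = dual_form i (S 0 0) (S 0 1) (S 1 1).
Proof.
move=> sym; rewrite {1}(symmetric_decomposition sym).
exact: (coord_sum_free (fun i : 'I_3 => dual_form i (S 0 0) (S 0 1) (S 1 1)) i free_forms).
Qed.

Lemma symmetric_basis_forms : symmetric_basis (form_squares forms).
Proof.
split=> [|S]; first exact: free_forms.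
split=> [|/symmetric_decomposition ->].
  move/coord_span => ->; rewrite linear_sum; apply: eq_bigr => i _.
  rewrite form_squares_nth linearZ; congr (_ *: _); apply/matrixP => a b.
  by rewrite /= mxE !form_squareE mulrC.
by apply: memv_suml => i _; apply: memvZ; apply: memv_span; rewrite mem_nth// size_tuple.
Qed.

End Forms.

(** * The explicit map is given by the corrugation process *)

Section CorrugationProcess.
Context {R : realType}.
Implicit Types (f : R -> R -> 'rV[R]_3) (eta psi : R -> R -> R) (p v w : 'rV[R]_2).

Lemma osc_cos a s : osc 0 0 a s = cos (a * cos (2 * pi * s)) :> R.
Proof. by rewrite /osc expr0 mul1r addr0. Qed.

Lemma osc_sin a s : osc 0 (- (pi / 2)) a s = sin (a * cos (2 * pi * s)) :> R.
Proof. by rewrite /osc expr0 mul1r -cosBpihalf. Qed.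

(** Integral of one coordinate of the loop minus a constant [c]: with [c = 0] and [T = 1] it
    computes the average, and with [c] the average it computes the displacement. *)
Lemma loop_primitive (r t m a c T : R) :
  oriented_integral 0 T (fun s => r * (cos (a * cos (2 * pi * s)) * t + sin (a * cos (2 * pi * s)) * m) - c) =
  r * (osc_integral 0 0 a T * t + osc_integral 0 (- (pi / 2)) a T * m) - T * c.
Proof.
pose G x := r * (osc_integral 0 0 a x * t + osc_integral 0 (- (pi / 2)) a x * m) - x * c.
have E : (fun s => r * (cos (a * cos (2 * pi * s)) * t + sin (a * cos (2 * pi * s)) * m) - c) =
    fun s => r * (osc 0 0 a s * t + osc 0 (- (pi / 2)) a s * m) - c.
  by apply/funext => s; rewrite osc_cos osc_sin.
rewrite E; pose g s := r * (osc 0 0 a s * t + osc 0 (- (pi / 2)) a s * m) - c.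
have cg : continuous g.
  move=> s; have c1 := @continuous_osc R 0 0 a s; have c2 := @continuous_osc R 0 (- (pi / 2)) a s.
  apply: cvgB; last exact: cvg_cst.
  apply: cvgM; first exact: cvg_cst.
  by apply: cvgD; apply: cvgM => //; exact: cvg_cst.
have dG x : is_derive x (1 : R) G (g x).
  have d1 := osc_integral_dx 0 0 a x; have d2 := osc_integral_dx 0 (- (pi / 2)) a x.
  have e1 := is_derive_mul d1 (is_derive_cst t x (1 : R)).
  have e2 := is_derive_mul d2 (is_derive_cst m x (1 : R)).
  have e3 := is_derive_mul (is_derive_cst r x (1 : R)) (is_deriveD e1 e2).
  have e4 := is_derive_mul (is_derive_id x (1 : R)) (is_derive_cst c x (1 : R)).
  by apply: (is_derive_congr _ _ (is_deriveB e3 e4)) => //=; rewrite /g; ring.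
by rewrite -/g (oriented_integral_FTC 0 T cg dG) /G !osc_integral0; ring.
Qed.

Section Frame.
Variables (m N : nat) (f : R -> R -> 'rV[R]_3) (eta psi : R -> R -> R) (a b : R) (e : 'rV[R]_2 -> R).
Hypothesis ok : step_ok (stage_domain m) f eta psi a b.
Variable p : 'rV[R]_2.
Hypotheses (sp : strip rho_half p) (ep : e p = eta (p 0 0) (p 0 1)) (ps : psi (p 0 0) (p 0 1) = 1).
Let x := p 0 0.
Let y := p 0 1.
Let pI : stage_domain m x. Proof. exact: strip_stage_domain. Qed.
Let sf : vsmooth (stage_domain m) f. Proof. by case: ok => -[]. Qed.
Let ab : 0 < a ^+ 2 + b ^+ 2. Proof. by case: ok => _ [[]]. Qed.

Definition dirv : 'rV[R]_2 := \row_i (if i == 0 then a else b).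
Definition dirw : 'rV[R]_2 := \row_i (if i == 0 then - b else a).
Definition diru : 'rV[R]_2 := (a ^+ 2 + b ^+ 2)^-1 *: (dirv + sS f a b x y *: dirw).

Lemma df_dirv : df rho_half (annulus_map f) p dirv = sV f a b x y.
Proof. by rewrite (df_lift _ sf sp) !mxE. Qed.

Lemma df_dirw : df rho_half (annulus_map f) p dirw = sW f a b x y.
Proof. by rewrite (df_lift _ sf sp) !mxE. Qed.

Lemma df_diru : df rho_half (annulus_map f) p diru = sU f a b x y.
Proof. by rewrite /df -scalemxAl mulmxDl -scalemxAl -/(df _ _ p dirv) -/(df _ _ p dirw) df_dirv df_dirw. Qed.

(** [V] and [(a^2 + b^2) U] differ by a multiple of [W], hence define the same unit normal. *)
Lemma cross_VW : cross (sV f a b x y) (sW f a b x y) = (a ^+ 2 + b ^+ 2) *: cross (sU f a b x y) (sW f a b x y).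
Proof.
have c0 := lt0r_neq0 ab; have : sV f a b x y = (a ^+ 2 + b ^+ 2) *: sU f a b x y - sS f a b x y *: sW f a b x y.
  by rewrite /sU scalerA divff// scale1r addrK.
move: (sV _ _ _ _ _) (sU _ _ _ _ _) (sW _ _ _ _ _) (sS _ _ _ _ _) (a ^+ 2 + b ^+ 2) => V U W s c ->.
have [e0 e1 e2] := cross3E U W; have [h0 h1 h2] := cross3E (c *: U - s *: W) W.
have E k : (c *: U - s *: W) 0 k = c * U 0 k - s * W 0 k by rewrite !mxE.
by apply: rV3P; rewrite rV3Z ?(h0, h1, h2) ?(e0, e1, e2) !E; ring.
Qed.

Lemma frame_nE : frame_n rho_half (annulus_map f) dirv dirw p = sn f a b x y.
Proof.
rewrite /frame_n df_dirv df_dirw cross_VW /normalize /sn enormZ gtr0_norm//.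
have -> : enorm (cross (sU f a b x y) (sW f a b x y)) = enorm (sU f a b x y) * enorm (sW f a b x y).
  by rewrite /enorm dot_cross (sUW ok y pI) expr0n subr0 sqrtrM// dot_ge0.
by rewrite scalerA invfM mulrAC mulVf ?mul1r// gt_eqF.
Qed.

Lemma cross_cross (W U : 'rV[R]_3) : cross W (cross U W) = dot W W *: U - dot W U *: W.
Proof.
have [e0 e1 e2] := cross3E U W; have [h0 h1 h2] := cross3E W (cross U W).
have E k : (dot W W *: U - dot W U *: W) 0 k = dot W W * U 0 k - dot W U * W 0 k by rewrite !mxE.
by apply: rV3P; rewrite E ?(h0, h1, h2) ?(e0, e1, e2) !dot3E; ring.
Qed.

(** By the double cross product, and as [U] is orthogonal to [W], the vector [t] is the unit vector
    along [U]. *)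
Lemma frame_tE : frame_t rho_half (annulus_map f) dirv dirw p = st f a b x y.
Proof.
rewrite /frame_t frame_nE /frame_w df_dirw /normalize /sn /st.
have W0 := sW_gt0 ok y pI; have UW := sUW ok y pI; have U0 := senorm_gt0 ok y pI.
have Z (k l : R) (u v : 'rV[R]_3) : cross (k *: u) (l *: v) = (k * l) *: cross u v.
  have [e0 e1 e2] := cross3E u v; have [h0 h1 h2] := cross3E (k *: u) (l *: v).
  by apply: rV3P; rewrite rV3Z ?h0 ?h1 ?h2 ?e0 ?e1 ?e2 !rV3Z; ring.
rewrite Z cross_cross dotC UW scale0r subr0 scalerA -enorm_sqr; congr (_ *: _).
have : 0 < enorm (sW f a b x y) by rewrite sqrtr_gt0.
by move: (enorm _) U0 (enorm _) => n n0 k k0; field; rewrite !gt_eqF.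
Qed.

Lemma radiusE : radius rho_half (annulus_map f) e diru p = sr f eta a b x y.
Proof. by rewrite /radius df_diru enorm_sqr ep. Qed.

Lemma amplitudeE : amplitude rho_half (annulus_map f) e diru p = sal f eta a b x y.
Proof. by rewrite /amplitude radiusE df_diru. Qed.

(** Where the cutoff is 1, the integral of the loop minus its average is [osc_excursion] at the
    phase, along both [t] and [n]. *)
Lemma corrug_integral : corrug f eta psi a b N x y = f x y + N%:R^-1 *:
  vector_integral 0 (N%:R * (linear_form a b p + 0)) (fun s => loop rho_half (annulus_map f) e dirv dirw diru p s
    - loop_average rho_half (annulus_map f) e dirv dirw diru p).
Proof.
rewrite /corrug; congr (_ + _ *: _); apply/rowP => j.
have L s : loop rho_half (annulus_map f) e dirv dirw diru p s 0 j =
    sr f eta a b x y * (cos (sal f eta a b x y * cos (2 * pi * s)) * st f a b x y 0 j +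
    sin (sal f eta a b x y * cos (2 * pi * s)) * sn f a b x y 0 j).
  by rewrite /loop amplitudeE radiusE frame_tE frame_nE rV3Z rV3D !rV3Z.
have A : loop_average rho_half (annulus_map f) e dirv dirw diru p 0 j =
    sr f eta a b x y * (osc_integral 0 0 (sal f eta a b x y) 1 * st f a b x y 0 j +
      osc_integral 0 (- (pi / 2)) (sal f eta a b x y) 1 * sn f a b x y 0 j).
  rewrite mxE (_ : (fun s => _) = fun s => sr f eta a b x y * (cos (sal f eta a b x y * cos (2 * pi * s)) * st f a b x y 0 j +
    sin (sal f eta a b x y * cos (2 * pi * s)) * sn f a b x y 0 j) - 0).
    by rewrite loop_primitive mulr0 subr0.
  by apply/funext => s; rewrite L subr0.
have -> : linear_form a b p + 0 = a * x + b * y by rewrite addr0.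
rewrite [RHS]mxE (_ : (fun s => _) = fun s => sr f eta a b x y * (cos (sal f eta a b x y * cos (2 * pi * s)) * st f a b x y 0 j +
    sin (sal f eta a b x y * cos (2 * pi * s)) * sn f a b x y 0 j) - loop_average rho_half (annulus_map f) e dirv dirw diru p 0 j); last first.
  by apply/funext => s; rewrite -L; move: (loop _ _ _ _ _ _ _ s) (loop_average _ _ _ _ _ _ _) => u v; rewrite !mxE.
rewrite loop_primitive A {A L} rV3D !rV3Z /sA /sB ?rV3Z /osc_excursion /sphase (_ : psi x y = 1)// !mul1r.
by move: (osc_integral _ _ _ _) (osc_integral _ _ _ _) (osc_integral _ _ _ _) (osc_integral _ _ _ _) => k1 k2 k3 k4; ring.
Qed.

End Frame.
End CorrugationProcess.

(** * The metrics of the stages in polar coordinates *)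

Section PolarMetric.
Context {R : realType}.
Implicit Types (p v : 'rV[R]_2) (S : 'M[R]_2).

Definition polar_form (x : R) : 'M[R]_2 := delta_mx 0 0 + x ^+ 2 *: delta_mx 1 1.

Definition stage_metric k p : 'M[R]_2 := conformal k (p 0 0) *: polar_form (p 0 0).

Lemma polar_form_entries (x : R) : [/\ polar_form x 0 0 = 1, polar_form x 0 1 = 0, polar_form x 1 0 = 0 &
  polar_form x 1 1 = x ^+ 2].
Proof. by split; rewrite !mxE/= ?mulr0 ?addr0 ?add0r ?mulr1. Qed.

Lemma stage_metric_entries k p : [/\ stage_metric k p 0 0 = conformal k (p 0 0), stage_metric k p 0 1 = 0, stage_metric k p 1 0 = 0 &
  stage_metric k p 1 1 = conformal k (p 0 0) * p 0 0 ^+ 2].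
Proof.
have [e1 e2 e3 e4] := polar_form_entries (p 0 0); rewrite /stage_metric; move: (polar_form _) e1 e2 e3 e4 => P e1 e2 e3 e4.
by split; rewrite mxE ?e1 ?e2 ?e3 ?e4 ?mulr1 ?mulr0.
Qed.

Lemma sym2P S : S 0 1 = S 1 0 -> S^T = S.
Proof.
move=> h; apply/matrixP => i j; rewrite mxE.
have i01 (l : 'I_2) : l = 0 \/ l = 1 by case: l => [[|[|]]]//= ?; [left|right]; exact/val_inj.
by case: (i01 i) => ->; case: (i01 j) => ->.
Qed.

Lemma posdef_diag S : 0 < S 0 0 -> 0 < S 1 1 -> S 0 1 = 0 -> S 1 0 = 0 -> posdef S.
Proof.
move=> s0 s1 h01 h10; split; first by apply: sym2P; rewrite h01 h10.
move=> v v0; have E : (v *m S *m v^T) 0 0 = S 0 0 * v 0 0 ^+ 2 + S 1 1 * v 0 1 ^+ 2.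
  have l1 : lift ord0 ord0 = 1 :> 'I_2 by exact/val_inj.
  rewrite !mxE !big_ord_recl !big_ord0 !mxE !big_ord_recl !big_ord0 l1 h01 h10; ring.
have q0 : 0 <= S 0 0 * v 0 0 ^+ 2 by rewrite mulr_ge0 ?sqr_ge0 ?(ltW s0).
have q1 : 0 <= S 1 1 * v 0 1 ^+ 2 by rewrite mulr_ge0 ?sqr_ge0 ?(ltW s1).
rewrite E lt_neqAle (addr_ge0 q0 q1) andbT eq_sym.
apply: contra v0; rewrite paddr_eq0//.
rewrite !mulf_eq0 (gt_eqF s0) (gt_eqF s1) /= !orbb => /andP[/eqP h1 /eqP h2].
by apply/eqP; apply: rV2P; rewrite mxE.
Qed.

Lemma smooth_stage_metric k : smooth_on_annulus rho_half (stage_metric k).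
Proof.
pose G (i : 'I_2) x (y : R) : R := if i == 0 then conformal k x else conformal k x * x ^+ 2.
apply: (@smooth_on_annulus_ext _ _ _ (expand (fun i : 'I_2 => delta_mx i i : 'M[R]_2) G)).
  move=> p _; rewrite /expand big_ord_recl big_ord1 /G/= /stage_metric /polar_form scalerDr scalerA.
  by congr (_ + _ *: _); congr delta_mx; exact/val_inj.
have sm : smooth (stage_domain k) (fun x (_ : R) => conformal k x) by apply: smooth_conformal; lia.
apply: (smooth_expand _ _ (@open_stage_domain R k) (@strip_stage_domain R k)); rewrite ?/rho_half; first by lra.
- move=> i; rewrite /G; case: (i == 0) => //.
  by apply: smoothM => //; apply: smoothX; exact: smooth_fst.
- by move=> i x y; rewrite /G.
Qed.

Lemma strip_gt0 p : strip rho_half p -> 0 < p 0 0 <= 1.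
Proof. by rewrite /strip/= /rho_half => /andP[h ->]; rewrite andbT; lra. Qed.

Lemma posdef_stage_metric k p : strip rho_half p -> posdef (stage_metric k p).
Proof.
move=> /strip_gt0/andP[p0 p1]; have [e1 e2 e3 e4] := stage_metric_entries k p.
have m0 : 0 < conformal k (p 0 0) by have := conformal_ge4 (near_disk_unit k p0 p1); lra.
by apply: posdef_diag; rewrite ?e1 ?e2 ?e3 ?e4// mulr_gt0// exprn_gt0.
Qed.

Lemma posdef_stage_metric_increment k p : strip rho_half p -> posdef (stage_metric k.+1 p - stage_metric k p).
Proof.
move=> /strip_gt0/andP[p0 p1].
have [e1 e2 e3 e4] := stage_metric_entries k p; have [h1 h2 h3 h4] := stage_metric_entries k.+1 p.
have d0 : 0 < increment k (p 0 0) by exact: increment_gt0 (near_disk_unit _ p0 p1).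
move: (stage_metric _ _) (stage_metric _ _) e1 e2 e3 e4 h1 h2 h3 h4 => P Q e1 e2 e3 e4 h1 h2 h3 h4.
apply: posdef_diag; rewrite !mxE ?e1 ?e2 ?e3 ?e4 ?h1 ?h2 ?h3 ?h4 ?subrr//.
by rewrite -mulrBl mulr_gt0// exprn_gt0.
Qed.

Definition polar_jacobian (x y : R) : 'M[R]_2 :=
  \matrix_(i, j) (if i == 0 then if j == 0 then cos y else sin y else if j == 0 then - (x * sin y) else x * cos y).

Lemma eq_le_norm (a b : R) : a = b -> `|a| <= `|b|.
Proof. by move=> ->. Qed.

(** Second-order estimates of the cosine and of the sine, the latter as a shifted cosine. For
    displacements below 1, [A] bounds the coefficient of the quadratic error in each coordinate. *)
Lemma jacobian_polar p : jacobian polar p = polar_jacobian (p 0 0) (p 0 1).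
Proof.
apply: (proj2 (diff_of_estimate _)) => e e0.
pose A : R := `|p 0 0| + 2; have A0 : 0 < A by rewrite ltr_wpDl.
exists (Num.min 1 (e / (3 * A))); first by rewrite lt_min ltr01 divr_gt0// mulr_gt0.
move=> q; rewrite enorm_distC lt_min => /andP[D1 DA]; set D := enorm (q - p) in D1 DA *.
have D0 : 0 <= D by exact: enorm_ge0.
have hx : `|q 0 0 - p 0 0| <= D by have := enorm_coord (q - p) 0; rewrite !mxE.
have hy : `|q 0 1 - p 0 1| <= D by have := enorm_coord (q - p) 1; rewrite !mxE.
have est (c c' x x' y t : R) : `|c' - c - t * y| <= t ^+ 2 -> `|y| <= 1 -> `|x' - x| <= D -> `|t| <= D -> `|x| + 2 <= A ->
    `|x' * c' - x * c - ((x' - x) * c + x * (t * y))| <= A * D ^+ 2.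
  move=> h1 h2 h3 h4 h5.
  have -> : x' * c' - x * c - ((x' - x) * c + x * (t * y)) = x' * (c' - c - t * y) + (x' - x) * (t * y) by ring.
  apply: le_trans (ler_normD _ _) _; rewrite !normrM.
  have x'b : `|x'| <= `|x| + D by rewrite -[x'](subrK x) addrC; apply: le_trans (ler_normD _ _) _; rewrite lerD2l.
  have t2 : t ^+ 2 <= D ^+ 2 by rewrite -(real_normK (num_real t)) ler_sqr ?nnegrE.
  have hA : `|x'| * `|c' - c - t * y| <= (`|x| + D) * D ^+ 2.
    by apply: ler_pM => //; exact: le_trans t2.
  have hB : `|x' - x| * (`|t| * `|y|) <= D * (D * 1).
    by apply: ler_pM; rewrite ?mulr_ge0//; exact: ler_pM.
  apply: le_trans (lerD hA hB) _.
  rewrite mulr1 -expr2 -[X in _ + X]mul1r -mulrDl ler_wpM2r ?sqr_ge0//; lra.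
have hp : `|p 0 0| + 2 <= A by [].
have cE : cos (q 0 1) = cos (p 0 1 + (q 0 1 - p 0 1)) by congr cos; ring.
have sE : sin (q 0 1) = sin (p 0 1 + (q 0 1 - p 0 1)) by congr sin; ring.
have := cos_taylor2 (p 0 1) (q 0 1 - p 0 1); rewrite -cE cosDpihalf => T1.
have := cos_taylor2 (p 0 1 - pi / 2) (q 0 1 - p 0 1); rewrite subrK [_ - pi / 2 + _]addrAC !cosBpihalf -sE => T2.
have s1 : `|- sin (p 0 1)| <= 1 by rewrite normrN; exact: sin_max.
have c1 : `|cos (p 0 1)| <= 1 by exact: cos_max.
have E1 := est _ _ _ _ _ _ T1 s1 hx hy hp; have E2 := est _ _ _ _ _ _ T2 c1 hx hy hp.
apply: le_trans (_ : 3 * (A * D ^+ 2) <= _).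
  apply: enorm_le_coord; first by rewrite mulr_ge0 ?sqr_ge0// ltW.
  have l1 : lift ord0 ord0 = 1 :> 'I_2 by exact/val_inj.
  move=> j; have [->|->] : j = 0 \/ j = 1 by case: j => [[|[|]]]//= ?; [left|right]; exact/val_inj.
    by apply: le_trans E1; rewrite !mxE !big_ord_recl !big_ord0 !mxE l1 /=; apply/eq_le_norm; ring.
  by apply: le_trans E2; rewrite !mxE !big_ord_recl !big_ord0 !mxE l1 /=; apply/eq_le_norm; ring.
rewrite expr2 !mulrA ler_wpM2r// mulrC -ler_pdivlMr// ?mulr_gt0//; exact: ltW.
Qed.

Lemma hyperbolic_polarE p : hyperbolic_polar p = (4 / (1 - p 0 0 ^+ 2) ^+ 2) *: polar_form (p 0 0).
Proof.
rewrite /hyperbolic_polar jacobian_polar /hyperbolic_metric.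
have -> : dot (polar p) (polar p) = p 0 0 ^+ 2.
  by rewrite -enorm_sqr (enorm_polar_point (p 0 0) (p 0 1)) real_normK ?num_real.
rewrite mul_mx_scalar -scalemxAl; congr (_ *: _).
have l1 : lift ord0 ord0 = 1 :> 'I_2 by exact/val_inj.
have cs := cos2Dsin2 (p 0 1); move: (p 0 0) (p 0 1) cs => x y cs.
have i01 (l : 'I_2) : l = 0 \/ l = 1 by case: l => [[|[|]]]//= ?; [left|right]; exact/val_inj.
have [e1 e2 e3 e4] := polar_form_entries x; apply/matrixP => i j.
case: (i01 i) => ->; case: (i01 j) => ->; rewrite ?e1 ?e2 ?e3 ?e4 !mxE !big_ord_recl !big_ord0 !mxE /=.
- by rewrite addr0 -!expr2.
- by ring.
- by ring.
- by rewrite -[RHS]mulr1 -cs; ring.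
Qed.

Lemma cvg_stage_metric p : strip rho_half p -> p 0 0 < 1 -> stage_metric k p @[k --> \oo] --> hyperbolic_polar p.
Proof.
move=> /strip_gt0/andP[p0 _] p1; rewrite hyperbolic_polarE; apply: cvgZr_tmp; apply: cvg_conformal.
by rewrite p0.
Qed.

End PolarMetric.

(** * The sequence is a 3-corrugated process *)

Section Process.
Context {R : realType}.
Variable Z : nat -> (R -> R -> 'rV[R]_3) * R.
Hypotheses (Zst : forall m, stage_ok m (Z m)) (Znext : forall m, next m (Z m) (Z m.+1)).

(** The stages of the process are numbered from 1, those of the construction from 0. *)
Definition process k i : 'rV[R]_2 -> 'rV[R]_3 := annulus_map (Z (3 * k.-1 + i)).1.

Lemma stage_cutoff_strip k x y : rho_half <= x <= 1 -> stage_cutoff k x y = 1 :> R.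
Proof.
rewrite /rho_half => xr; rewrite /stage_cutoff cutoff1// ler_pdivlMr ?core_radius_gt0//; have := @core_radius_le R k.+2; lra.
Qed.

Lemma process_divn k i : (i < 3)%N -> ((3 * k + i) %/ 3 = k)%N /\ ((3 * k + i) %% 3 = i)%N.
Proof.
by move=> i3; rewrite mulnC divnMDl// modnMDl divn_small// modn_small// addn0.
Qed.

Lemma process_eta k (i : 'I_3) (f : R -> R -> 'rV[R]_3) (p : 'rV[R]_2) : stage_inv k i f -> strip rho_half p ->
  coord (form_squares forms) i (stage_metric k.+1 p - pullback rho_half (annulus_map f) p) = deficit k f i (p 0 0) (p 0 1).
Proof.
move=> [sf _ _ _ _] sp.
have pE := @pullback_lift R _ f p _ _ sf sp.
have [e1 e2 e3 e4] := stage_metric_entries k.+1 p.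
have h00 := pE 0 0; have h01 := pE 0 1; have h10 := pE 1 0; have h11 := pE 1 1.
move: (pullback _ _ _) h00 h01 h10 h11 => Q /= h00 h01 h10 h11.
have E a b : (stage_metric k.+1 p - Q) a b = stage_metric k.+1 p a b - Q a b by rewrite !mxE.
rewrite coord_forms; last by apply: sym2P; rewrite !E e2 e3 h01 h10 dotC.
by rewrite !E e1 e2 e4 h00 h01 h11 sub0r.
Qed.

Lemma det_mx2 (M : 'M[R]_2) : \det M = M 0 0 * M 1 1 - M 0 1 * M 1 0.
Proof.
have i1 : lift ord0 ord0 = 1 :> 'I_2 by exact/val_inj.
rewrite (expand_det_row _ 0) !big_ord_recl big_ord0 addr0 /cofactor !det_mx11 !mxE /= i1.
rewrite (_ : lift 1 0 = 0 :> 'I_2) ?addn0 ?expr0 ?mul1r; last exact/val_inj.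
by rewrite expr1 mulN1r mulrN.
Qed.

Lemma det_col_mx (v w : 'rV[R]_2) : \det (col_mx v w : 'M[R]_2) = v 0 0 * w 0 1 - v 0 1 * w 0 0.
Proof.
have e (i j : 'I_2) : (col_mx v w : 'M[R]_2) i j = if i == 0 then v 0 j else w 0 j.
  by have [->|->] : i = lshift 1 (0 : 'I_1) \/ i = rshift 1 (0 : 'I_1);
    [case: i => [[|[|]]]//= ?; [left|right]; exact/val_inj|exact: (col_mxEu v w 0 j)|exact: (col_mxEd v w 0 j)].
by rewrite det_mx2 !e.
Qed.

Lemma process_step k (i : 'I_3) : (0 < k)%N -> exists N,
  is_corrugation rho_half (process k i)
    (fun p => coord (form_squares forms) i (stage_metric k p - pullback rho_half (process k i) p))
    (forms i) 0 N (process k i.+1).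
Proof.
case: k => // k _; rewrite /process /=; have i3 := ltn_ord i; have [dE mE] := process_divn k i3.
have [fi _ _ _] := Zst (3 * k + i); rewrite dE mE in fi.
have [[N N0 FE] _ _ _] := Znext (3 * k + i); rewrite dE mE -addnS in FE.
have ok := inv_step_ok i3 fi; have eE p := process_eta fi (p := p).
have [sf pf _ _ _] := fi; set f := (Z (3 * k + i)%N).1 in fi sf pf FE ok eE *.
have ab : 0 < form_rho i ^+ 2 + form_phi i ^+ 2 :> R by exact: forms_gt0.
exists N; split; [split|split| |exact: N0|].
- exact: smooth_lift sf pf.
- by apply: (immersion_lift sf) => x y; exact: gram_gt0.
- have sD : smooth (stage_domain (3 * k + i)) (deficit k f i) by apply: smooth_deficit => //; lia.
  (* On the strip [eta] is the deficit; a scalar function is an expansion over a basis with one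
     element. *)
  apply: (@smooth_on_annulus_ext _ _ _ (expand (fun _ : 'I_1 => 1 : R^o) (fun _ => deficit k f i))).
    by move=> p sp; rewrite /expand big_ord1 eE// [LHS]mulr1.
  apply: (smooth_expand _ _ (@open_stage_domain R _) (@strip_stage_domain R _)); first by rewrite /rho_half; lra.
  - by move=> _; exact: sD.
  - by move=> _; exact: per_deficit.
- by move=> p sp; rewrite eE//; apply: (deficit_gt0 i3 fi); exact: strip_stage_domain.
- have [z hz] := @forms_int R i; rewrite /forms/= /linear_form !mxE/= mulr0 mulr0 add0r mulr1 hz; exact: intr_int.
exists (dirv (form_rho i) (form_phi i)), (dirw (form_rho i) (form_phi i)); split.
- by rewrite det_col_mx !mxE/= mulrN opprK -!expr2.
- by rewrite /forms/= /linear_form !mxE/= -!expr2.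
- by rewrite /forms/= /linear_form !mxE/=; ring.
move=> p sp; exists (diru f (form_rho i) (form_phi i) p); split.
- exists (enorm (sU f (form_rho i) (form_phi i) (p 0 0) (p 0 1))).
  rewrite (df_diru ok sp) (frame_tE ok sp) /st scalerA divff ?scale1r// gt_eqF//.
  by apply: (senorm_gt0 ok); exact: strip_stage_domain.
- rewrite /diru /forms linearZ linearD linearZ /= /linear_form !mxE/=.
  by rewrite (_ : form_rho i * - form_phi i + form_phi i * form_rho i = 0); [rewrite mulr0 addr0 -!expr2 mulVf// gt_eqF|ring].
have H := @corrug_integral R _ N f _ _ (form_rho i) (form_phi i)
  (fun p => coord (form_squares forms) i (stage_metric k.+1 p - pullback rho_half (annulus_map f) p))
  ok p sp (eE p sp) (stage_cutoff_strip k (p 0 1) sp).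
rewrite -[LHS]/((Z (3 * k + i.+1)).1 (p 0 0) (p 0 1)) FE; exact: H.
Qed.

End Process.

(** * Initial metric, uniform convergence and margins of the limit *)

Section Assembly.
Context {R : realType}.
Variable Z : nat -> (R -> R -> 'rV[R]_3) * R.
Hypotheses (Z0 : (Z 0%N).1 = f0) (Zst : forall m, stage_ok m (Z m)) (Znext : forall m, next m (Z m) (Z m.+1)).

Lemma first_form_f0 (x y : R) : [/\ coef_E f0 x y = 4, coef_F f0 x y = 0 & coef_G f0 x y = 4 * x ^+ 2].
Proof.
have [ex ey] := vd_f0 x y; have cs := cos2Dsin2 y; split.
- by rewrite /coef_E ex dot3E !mxE /= -[RHS]mulr1 -[X in _ = _ * X]cs; ring.
- by rewrite /coef_F ex ey dot3E !mxE /=; ring.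
- by rewrite /coef_G ey dot3E !mxE /= -[RHS]mulr1 -[X in _ = _ * X]cs; ring.
Qed.

Lemma stage_metric0_pullback (p : 'rV[R]_2) : strip rho_half p -> stage_metric 0 p = pullback rho_half (process Z 1 0) p.
Proof.
move=> sp; rewrite /process /= Z0; have [sf _ _ _ _] := @inv0 R.
have pE := @pullback_lift R _ f0 p _ _ sf sp; have [e1 e2 e3 e4] := stage_metric_entries 0 p.
have [hE hF hG] := first_form_f0 (p 0 0) (p 0 1).
have h00 := pE 0 0; have h01 := pE 0 1; have h10 := pE 1 0; have h11 := pE 1 1.
move: (pullback _ _ _) (stage_metric _ _) h00 h01 h10 h11 e1 e2 e3 e4 => Q P /= h00 h01 h10 h11 e1 e2 e3 e4.
have i01 (l : 'I_2) : l = 0 \/ l = 1 by case: l => [[|[|]]]//= ?; [left|right]; exact/val_inj.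
apply/matrixP => i j; case: (i01 i) => ->; case: (i01 j) => ->.
- by rewrite e1 h00 conformal0 -hE.
- by rewrite e2 h01 -hF.
- by rewrite e3 h10 dotC -hF.
- by rewrite e4 h11 conformal0 -hG.
Qed.

Lemma process_three_corrugated : three_corrugated_process rho_half (process Z).
Proof.
(* The frequencies are chosen for all pairs of indices at once; the condition is void at [k = 0]. *)
have H (ki : nat * 'I_3) : exists N, (0 < ki.1)%N ->
    is_corrugation rho_half (process Z ki.1 ki.2)
    (fun p => coord (form_squares forms) ki.2 (stage_metric ki.1 p - pullback rho_half (process Z ki.1 ki.2) p))
    (forms ki.2) 0 N (process Z ki.1 ki.2.+1).
  case: ki => k i /=; case: k => [|k]; first by exists 0%N.
  by have [N hN] := process_step Zst Znext i (ltn0Sn k); exists N.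
have [N HN] := choice H.
exists stage_metric, forms, (fun=> 0), (fun k i => N (k, i)); split.
- split; [exact: smooth_stage_metric|exact: posdef_stage_metric|exact: stage_metric0_pullback|exact: posdef_stage_metric_increment|exact: cvg_stage_metric].
- exact: symmetric_basis_forms.
- by case=> // k _; rewrite /process /= addn0 mulnS addnC.
- by move=> k i k0; exact: (HN (k, i) k0).
Qed.

Lemma process_uniform (finf : 'rV[R]_2 -> 'rV[R]_3) : (forall x y, 0 <= x -> finf (polar_point x y) = limit_map Z x y) ->
  {uniform strip rho_half, (fun k => process Z k.+1 0) @ \oo --> finf \o polar}.
Proof.
move=> fE P /uniform_nbhs[E [entE EP]].
move: entE; rewrite -entourage_ballE => -[e /= e0 he].
have cd := cvg_d Zst Znext.
have /cvgrPdist_lt/(_ e e0)[n _ hn] := cd.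
exists n => // k /= nk; apply: EP => p sp; apply: he => /=.
have /andP[x0 x1] := strip_gt0 sp.
rewrite -ball_normE /=; apply: le_lt_trans (norm_le_enorm _) _.
have -> : finf (polar p) = limit_map Z (p 0 0) (p 0 1) by rewrite -(fE _ _ (ltW x0)).
rewrite /process /annulus_map /=; apply: le_lt_trans (limit_map_F Zst Znext _ _ x1) _.
have := hn (3 * k + 0)%N; rewrite /= sub0r normrN => h.
by apply: le_lt_trans (ler_norm _) (h _); rewrite addn0; apply: leq_trans nk _; rewrite leq_pmull.
Qed.

(** All later moves amount to at most [d] at each of the two points, which leaves [2 d] of the
    margin [4 d] of the map of index [m]. *)
Lemma limit_map_margin m : exists2 d : R, 0 < d & forall x y x' y' : R, 0 <= x <= 1 -> 0 <= x' <= 1 ->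
  m.+1%:R^-1 <= polar_dist x y x' y' -> d <= enorm (limit_map Z x y - limit_map Z x' y').
Proof.
have [_ z0 _ hm] := Zst m; exists (Z m).2 => // x y x' y' hx hx' h.
have := hm _ _ _ _ hx hx' h; have /andP[_ x1] := hx; have /andP[_ x1'] := hx'.
have := limit_map_F Zst Znext m y x1; have := limit_map_F Zst Znext m y' x1'.
move: (limit_map Z x y) (limit_map Z x' y') ((Z m).1 x y) ((Z m).1 x' y') => A B a b h1 h2 h3.
have := enormD (a - A) (A - B); have := enormD (a - A + (A - B)) (B - b).
have -> : a - A + (A - B) + (B - b) = a - b by apply/rowP => j; rewrite !mxE; ring.
by rewrite (enorm_distC a A); lra.
Qed.

End Assembly.

Theorem proposition3 (R : realType) :
  exists finf : 'rV[R]_2 -> 'rV[R]_3,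
    [/\ forall beta : R, 0 < beta < 1 -> holder_on closed_disk finf beta,
        C1_isometric_embedding finf,
        closed_curve (limit_set finf) /\
          hausdorff_dim (limit_set finf) = 1%:E &
        exists2 rho0 : R, 0 < rho0 < 1 & three_corrugated rho0 finf].
Proof.
have [Z [Z0 Zst Znext]] := @sequence_exists R.
have [pF pX pY] := per_lim Zst.
have F0 y : limit_map Z 0 y = 0.
  by rewrite (limit_map_origin Zst)//; apply/rowP => j; rewrite !mxE !mul0r mulr0 if_same if_same.
have Fdiff := limit_map_diff Zst Znext; have XYc := XY_cont Zst Znext; have met := metric_lim Zst Znext.
have orig := near_origin Z0 Zst Znext; have marg := limit_map_margin Zst Znext.
pose finf := cartesian (limit_map Z).
have hol (b : R) : 0 < b < 1 -> exists2 K : R, 0 < K & forall p q, closed_disk p -> closed_disk q ->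
    enorm (finf p - finf q) <= K * enorm (p - q) `^ b.
  move=> b01; have [K K0 h] := limit_map_holder Zst Znext b01; exists K => // p q p1 q1.
  have := h (enorm p) (polar_angle p) (enorm q) (polar_angle q); rewrite !enorm_ge0 /= -!polar_angleE; apply; [exact: p1|exact: q1].
have inj p q : closed_disk p -> closed_disk q -> finf p = finf q -> p = q by exact: cartesian_inj.
exists finf; split.
- by move=> b b01; have [K _ h] := hol b b01; exists K.
- exact: cartesian_embedding pF pX pY F0 Fdiff XYc met orig marg.
- by split; [exact: limit_set_curve|exact: limit_set_dim1].
exists rho_half; first by rewrite /rho_half; lra.
exists (process Z); split; first exact: process_three_corrugated.
by apply: process_uniform => // x y x0; exact: cartesian_polar_point.
Qed.
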